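(* Let $\varphi_2$ be the multi-valued Schwarz map on $Z=\mathbb{C}-\{0,1\}$ for $(a,b,c)=(\frac1{12},\frac5{12},1)$ described in the context, and let $\mathbb{H}_2\subset\mathbb{H}$ be its image. The inverse of $\varphi_2$ is given by $$\mathbb{H}_2\ni\tau\mapsto z=\frac{1}{j(\tau)}\in\mathbb{C}-\{0,1\},$$ that is, for $z\in Z$ and $\tau\in\mathbb{H}_2$, $\tau$ is one of the values of $\varphi_2$ at $z$ if and only if $z=1/j(\tau)$. Here the $j$-invariant is defined by $$j(\tau)=\frac{4}{27}\,\frac{(\lambda(\tau)^2-\lambda(\tau)+1)^3}{\lambda(\tau)^2(1-\lambda(\tau))^2}=\frac1{54}\,\frac{\bigl(\vartheta_{00}(\tau)^8+\vartheta_{01}(\tau)^8+\vartheta_{10}(\tau)^8\bigr)^3}{\vartheta_{00}(\tau)^8\,\vartheta_{01}(\tau)^8\,\vartheta_{10}(\tau)^8}.$$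
   Context: $i=\sqrt{-1}$, $\omega=\frac{-1+\sqrt3\, i}{2}$, $\mathbb{H}$ is the upper half-plane, $B(\cdot,\cdot)$ is the beta function. Theta constants: for $p,q\in\{0,1\}$ and $\tau\in\mathbb{H}$, $\vartheta_{pq}(\tau)=\sum_{n\in\mathbb{Z}}\exp\bigl(\pi i(n+\frac p2)^2\tau+2\pi i(n+\frac p2)\frac q2\bigr)$. Lambda function: $\lambda(\tau)=\vartheta_{10}(\tau)^4/\vartheta_{00}(\tau)^4$. Jacobi's identity $\vartheta_{00}^4=\vartheta_{01}^4+\vartheta_{10}^4$ holds. Hypergeometric series: $F(a,b,c;z)=\sum_{n\ge0}\frac{(a,n)(b,n)}{(c,n)(1,n)}z^n$ for $|z|<1$, with $(a,n)=a(a+1)\cdots(a+n-1)$. Schwarz's map $\varphi_2$: it is the multi-valued map obtained by analytic continuation along all paths in $Z=\mathbb{C}-\{0,1\}$ of $$z\mapsto i\cdot\frac{B(\frac1{12},\frac5{12})}{2\pi}\cdot\frac{F(\frac1{12},\frac5{12},\frac12;1-z)}{F(\frac1{12},\frac5{12},1;z)}-i,$$ initially defined on $\{z\in\mathbb{C}: |z|<1,\ |1-z|<1\}$. Its image is $\mathbb{H}_2=\mathbb{H}-\{g\cdot i,\ g\cdot(-\omega^2)\mid g\in\mathrm{SL}_2(\mathbb{Z})\}$, with $\mathrm{SL}_2(\mathbb{Z})$ acting by linear fractional transformations. *)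

(* Defs.v *)
From Stdlib Require Import Reals ZArith.
From Coquelicot Require Import Coquelicot.

Open Scope C_scope.

Definition Cexp (z : C) : C :=
  (exp (Re z) * cos (Im z), exp (Re z) * sin (Im z))%R.

(* [Series] returns an arbitrary real on a divergent series; all the series
   below converge where they are used. *)
Definition CSeries (u : nat -> C) : C :=
  (Series (fun n => Re (u n)), Series (fun n => Im (u n))).

Definition CSeriesZ (u : Z -> C) : C :=
  CSeries (fun n => u (Z.of_nat n)) + CSeries (fun n => u (- Z.of_nat (S n))%Z).

Fixpoint pochhammer (a : R) (n : nat) : R :=
  match n with
  | O => 1%R
  | S m => (pochhammer a m * (a + INR m))%R
  end.

Definition hypergeom (a b c : R) (z : C) : C :=
  CSeries (fun n =>
    RtoC (pochhammer a n * pochhammer b n / (pochhammer c n * pochhammer 1 n))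
    * z ^ n).

(* Euler's integral is improper at both ends when p, q < 1. *)
Definition beta (p q : R) : R :=
  RInt_gen (fun t : R => Rpower t (p - 1) * Rpower (1 - t) (q - 1))%R
    (at_right 0%R) (at_left 1%R).

Definition upper_half_plane (tau : C) : Prop := (0 < Im tau)%R.

Definition theta (p q : nat) (tau : C) : C :=
  CSeriesZ (fun n : Z =>
    let m := RtoC (IZR n + INR p / 2) in
    Cexp (RtoC PI * Ci * m ^ 2 * tau
          + 2 * RtoC PI * Ci * m * RtoC (INR q / 2))).

Definition lambda (tau : C) : C := theta 1 0 tau ^ 4 / theta 0 0 tau ^ 4.

Definition j_inv (tau : C) : C :=
  4 / 27 * ((lambda tau ^ 2 - lambda tau + 1) ^ 3
            / (lambda tau ^ 2 * (1 - lambda tau) ^ 2)).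

Definition j_theta (tau : C) : C :=
  1 / 54 * ((theta 0 0 tau ^ 8 + theta 0 1 tau ^ 8 + theta 1 0 tau ^ 8) ^ 3
            / (theta 0 0 tau ^ 8 * theta 0 1 tau ^ 8 * theta 1 0 tau ^ 8)).

Definition analytic_at (f : C -> C) (z0 : C) : Prop :=
  exists (u : nat -> C) (r : R), (0 < r)%R /\
    forall z : C, (Cmod (z - z0) < r)%R ->
      @is_pseries C_AbsRing C_NormedModule u (z - z0) (f z).

Definition unit_interval (t : R) : Prop := (0 <= t <= 1)%R.

Definition path_in (D : C -> Prop) (gamma : R -> C) : Prop :=
  continuous_on unit_interval gamma /\
  forall t : R, unit_interval t -> D (gamma t).

(* The function element at time t is (F t, disc of centre gamma t and radius
   r t); the values of F t outside of that disc are irrelevant. *)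
Definition continuation_along (gamma : R -> C) (F : R -> C -> C) (r : R -> R)
    : Prop :=
  forall t : R, unit_interval t ->
    (0 < r t)%R /\
    (forall w : C, (Cmod (w - gamma t) < r t)%R -> analytic_at (F t) w) /\
    exists delta : R, (0 < delta)%R /\
      forall s : R, unit_interval s -> (Rabs (s - t) < delta)%R ->
        (Cmod (gamma s - gamma t) < r t)%R /\
        locally (gamma s) (fun w : C => F s w = F t w).

(* [w] is one of the values at [z] of the multi-valued map obtained from
   [f], given on [U], by analytic continuation along all paths in [D]. *)
Definition continuation_value (D U : C -> Prop) (f : C -> C) (z w : C) : Prop :=
  exists (gamma : R -> C) (F : R -> C -> C) (r : R -> R),
    path_in D gamma /\ U (gamma 0%R) /\ gamma 1%R = z /\
    continuation_along gamma F r /\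
    locally (gamma 0%R) (fun x : C => F 0%R x = f x) /\
    F 1%R z = w.

Definition Zdom (z : C) : Prop := z <> 0 /\ z <> 1.

Definition lens (z : C) : Prop := (Cmod z < 1)%R /\ (Cmod (1 - z) < 1)%R.

Definition schwarz2_init (z : C) : C :=
  Ci * RtoC (beta (1 / 12) (5 / 12) / (2 * PI))
     * (hypergeom (1 / 12) (5 / 12) (1 / 2) (1 - z)
        / hypergeom (1 / 12) (5 / 12) 1 z)
  - Ci.

(* [schwarz2 z tau]: [tau] is one of the values of the multi-valued map at [z]. *)
Definition schwarz2 (z tau : C) : Prop :=
  continuation_value Zdom lens schwarz2_init z tau.

Definition omega : C := (-1 + RtoC (sqrt 3) * Ci) / 2.

Definition moebius (a b c d : Z) (tau : C) : C :=
  (RtoC (IZR a) * tau + RtoC (IZR b)) / (RtoC (IZR c) * tau + RtoC (IZR d)).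

Definition H2 (tau : C) : Prop :=
  upper_half_plane tau /\
  forall a b c d : Z, (a * d - b * c = 1)%Z ->
    tau <> moebius a b c d Ci /\ tau <> moebius a b c d (- omega ^ 2).

(* Main.v *)
Require Import Defs.
From Stdlib Require Import Reals ZArith Lra Lia Psatz Classical ClassicalEpsilon.
From Stdlib Require Cantor.
From Coquelicot Require Import Coquelicot.

(* On the imaginary axis the theorem is an identity between real functions: the pull-back of the
   hypergeometric equation along [z = 1/j], written in terms of [x = lambda], expresses both series
   through the complete elliptic integrals [K(x)] and [K(1 - x)], the beta factor comes from the
   logarithmic growth at the cusp, and [K(1 - lambda(it)) / K(lambda(it)) = t] because Landen's
   transformation matches the doubling formulas of the theta constants. Hence the initial branch
   sends [1/j(it)] to [it] for [t > 1].

   By the identity theorem the initial branch is a local section of [1/j] on the whole lens. The map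
   [j] is invariant under [SL_2(Z)] and, by reduction to a compact set, evenly covers a neighbourhood
   of each value other than [0] and [1]; so analytic continuation along any path in [Z] keeps being a
   section of [1/j]. Conversely the points of the upper half-plane with [j = 0] or [j = 1] are
   countably many, so that every [tau] in [H_2] is joined to [2i] by an arc avoiding them, and the
   local inverses of [1/j] along that arc form an analytic continuation ending at [tau]. The points
   with [j = 0, 1] are exactly the orbits of [-omega^2] and [i]: [lambda] separates orbits near
   its cusp, and this is carried along rays by the covering property of [lambda]. *)

Open Scope C_scope.

(** Seen from $x=\lambda$, the map $1/j$ has a critical point at $x=1/2$ with value $1$. The series
    in $1-z$ therefore pulls back to the solution symmetric under $x\mapsto1-x$, a multiple of
    $K(x)+K(1-x)$, while the series in $z$ pulls back to $K(x)$. On $\tau=it$ their quotient is a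
    multiple of $1+t$, and the term $-i$ of the Schwarz map removes the $1$. The constants are read
    off for $t\to\infty$: a quotient invariant under $t\mapsto2t$ with a limit at infinity is
    constant. The half-plane is studied through $\lambda$ before $j$, because $\lambda$ has no
    critical point and begins with $16q$ in the nome $q=e^{\pi i\tau}$. Both
    $\lambda(-1/\tau)=1-\lambda(\tau)$ and $\lambda'\ne0$ come from the real function $K(1-x)/K(x)$,
    which is injective on $(0,1)$ and inverse to $t\mapsto\lambda(it)$; the identity theorem carries
    them from the imaginary axis to the half-plane. The radius of a covering disc must serve
    infinitely many preimages at once, whence the reduction to a compact box. *)

Definition near (z : C) (P : C -> Prop) : Prop :=
  exists d : R, (0 < d)%R /\ forall w : C, (Cmod (w - z) < d)%R -> P w.

Lemma near_and (z : C) (P Q : C -> Prop) :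
  near z P -> near z Q -> near z (fun w => P w /\ Q w).
Proof.
  intros (d1 & h1 & H1) (d2 & h2 & H2).
  exists (Rmin d1 d2); split; [now apply Rmin_pos|].
  intros w Hw; split; [apply H1 | apply H2];
  (eapply Rlt_le_trans; [apply Hw|]); [apply Rmin_l | apply Rmin_r].
Qed.

Lemma near_imp (z : C) (P Q : C -> Prop) :
  (forall w, P w -> Q w) -> near z P -> near z Q.
Proof. intros H (d & h & H1); exists d; split; auto. Qed.

Lemma near_self (z : C) (P : C -> Prop) : near z P -> P z.
Proof.
  intros (d & h & H); apply H.
  replace (z - z) with (RtoC 0) by ring. now rewrite Cmod_0.
Qed.

Lemma near_all (z : C) (P : C -> Prop) : (forall w, P w) -> near z P.
Proof. intros H; exists 1%R; split; [lra | auto]. Qed.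

Lemma near_disc (z0 z : C) (r : R) :
  (Cmod (z - z0) < r)%R -> near z (fun w => Cmod (w - z0) < r)%R.
Proof.
  intros H; exists (r - Cmod (z - z0))%R; split; [lra|].
  intros w Hw. replace (w - z0) with ((w - z) + (z - z0)) by ring.
  eapply Rle_lt_trans; [apply Cmod_triangle | lra].
Qed.

Lemma near_near (z : C) (P : C -> Prop) : near z P -> near z (fun w => near w P).
Proof.
  intros (d & h & H); exists d; split; auto.
  intros w Hw. apply (near_imp _ (fun w' => Cmod (w' - z) < d)%R); auto.
  now apply near_disc.
Qed.

Lemma im_le_Cmod (z : C) : (Rabs (Im z) <= Cmod z)%R.
Proof.
  destruct z as [x y]; unfold Cmod; simpl.
  rewrite <- sqrt_Rsqr_abs. apply sqrt_le_1_alt. unfold Rsqr; nra.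
Qed.

Lemma Cmod_le_comp (z : C) : (Cmod z <= Rabs (Re z) + Rabs (Im z))%R.
Proof.
  destruct z as [x y]; unfold Cmod; simpl.
  rewrite <- (sqrt_Rsqr (Rabs x + Rabs y)).
  - apply sqrt_le_1_alt. unfold Rsqr.
    generalize (Rabs_pos x) (Rabs_pos y) (Rsqr_abs x) (Rsqr_abs y); unfold Rsqr; nra.
  - generalize (Rabs_pos x) (Rabs_pos y); lra.
Qed.

(** The basic neighbourhoods behind [locally] on [C] are squares, those of [near] are discs; each
    contains a smaller one of the other kind. *)
Lemma near_locally (z : C) (P : C -> Prop) : near z P <-> locally z P.
Proof.
  split.
  - intros (d & h & H). exists (mkposreal (d / 2) ltac:(lra)).
    intros w [Hx Hy]. apply H.
    unfold ball in Hx, Hy; simpl in Hx, Hy; unfold AbsRing_ball, abs, minus, plus, opp in Hx, Hy; simpl in Hx, Hy.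
    eapply Rle_lt_trans; [apply Cmod_le_comp|]. destruct w, z; simpl in *.
    unfold Rminus in *. lra.
  - intros [d H]. exists (pos d); split; [apply cond_pos|].
    intros w Hw. apply H. split;
    unfold ball; simpl; unfold AbsRing_ball, abs, minus, plus, opp; simpl;
    (eapply Rle_lt_trans; [|apply Hw]).
    + generalize (re_le_Cmod (w - z)); destruct w, z; simpl; auto.
    + generalize (im_le_Cmod (w - z)); destruct w, z; simpl; auto.
Qed.

(** * Continuity and complex differentiation *)

Definition ccont (f : C -> C) (z : C) : Prop :=
  forall eps : R, (0 < eps)%R -> near z (fun w => Cmod (f w - f z) < eps)%R.

Lemma ccont_near_pred (f : C -> C) (z : C) (P : C -> Prop) :
  ccont f z -> near (f z) P -> near z (fun w => P (f w)).
Proof.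
  intros Hf (d & h & H). apply (near_imp _ (fun w => Cmod (f w - f z) < d)%R); auto.
Qed.

Lemma ccont_const (c z : C) : ccont (fun _ => c) z.
Proof.
  intros eps He; apply near_all; intros _.
  replace (c - c) with (RtoC 0) by ring. now rewrite Cmod_0.
Qed.

Lemma ccont_id (z : C) : ccont (fun w => w) z.
Proof. intros eps He; exists eps; split; auto. Qed.

Lemma ccont_plus (f g : C -> C) (z : C) :
  ccont f z -> ccont g z -> ccont (fun w => f w + g w) z.
Proof.
  intros Hf Hg eps He.
  generalize (near_and _ _ _ (Hf (eps/2)%R ltac:(lra)) (Hg (eps/2)%R ltac:(lra))).
  apply near_imp; intros w [H1 H2].
  replace (f w + g w - (f z + g z)) with ((f w - f z) + (g w - g z)) by ring.
  eapply Rle_lt_trans; [apply Cmod_triangle | lra].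
Qed.

Lemma ccont_mult (f g : C -> C) (z : C) :
  ccont f z -> ccont g z -> ccont (fun w => f w * g w) z.
Proof.
  intros Hf Hg eps He.
  generalize (Cmod_ge_0 (f z)) (Cmod_ge_0 (g z)); intros Pf Pg.
  set (m := (Cmod (f z) + Cmod (g z) + 2)%R).
  set (e := Rmin 1 (eps / (2 * m))).
  assert (Hm : (0 < m)%R) by (unfold m; lra).
  assert (Hem : (0 < eps / (2 * m))%R) by (apply Rdiv_lt_0_compat; lra).
  assert (Hep : (0 < e)%R) by (apply Rmin_pos; lra).
  generalize (near_and _ _ _ (Hf e Hep) (Hg e Hep)).
  apply near_imp; intros w [H1 H2].
  replace (f w * g w - f z * g z)
    with ((f w - f z) * (g w - g z) + ((f w - f z) * g z + f z * (g w - g z))) by ring.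
  assert (He1 : (e <= 1)%R) by apply Rmin_l.
  assert (He2 : (e <= eps / (2 * m))%R) by apply Rmin_r.
  assert (Hmul : (e * m <= eps / 2)%R).
  { replace (eps / 2)%R with (eps / (2 * m) * m)%R by (field; lra).
    apply Rmult_le_compat_r; lra. }
  eapply Rle_lt_trans; [apply Cmod_triangle |].
  eapply Rle_lt_trans; [apply Rplus_le_compat_l, Cmod_triangle |].
  rewrite !Cmod_mult.
  generalize (Cmod_ge_0 (f w - f z)) (Cmod_ge_0 (g w - g z)); intros.
  assert (Cmod (f w - f z) * Cmod (g w - g z) <= e * 1)%R by (apply Rmult_le_compat; lra).
  assert (Cmod (f w - f z) * Cmod (g z) <= e * Cmod (g z))%R by (apply Rmult_le_compat_r; lra).
  assert (Cmod (f z) * Cmod (g w - g z) <= Cmod (f z) * e)%R by (apply Rmult_le_compat_l; lra).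
  unfold m in *. nra.
Qed.

Lemma ccont_comp (f g : C -> C) (z : C) :
  ccont f z -> ccont g (f z) -> ccont (fun w => g (f w)) z.
Proof.
  intros Hf Hg eps He.
  apply (ccont_near_pred f z (fun v => Cmod (g v - g (f z)) < eps)%R); auto.
Qed.

Lemma ccont_ext (f g : C -> C) (z : C) :
  near z (fun w => f w = g w) -> ccont f z -> ccont g z.
Proof.
  intros H Hf eps He. generalize (near_and _ _ _ H (Hf eps He)).
  apply near_imp; intros w [<- H2]. now rewrite <- (near_self _ _ H).
Qed.

Lemma ccont_neq0 (f : C -> C) (z c : C) :
  ccont f z -> f z <> c -> near z (fun w => f w <> c).
Proof.
  intros Hf Hz.
  assert (0 < Cmod (f z - c))%R by (apply Cmod_gt_0; intro E; apply Hz, Ceq_minus, E).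
  generalize (Hf _ H). apply near_imp; intros w Hw E. subst c.
  apply (Rlt_irrefl (Cmod (f z - f w))).
  replace (f z - f w) with (- (f w - f z)) at 1 by ring. now rewrite Cmod_opp.
Qed.

Lemma ccont_inv (f : C -> C) (z : C) :
  ccont f z -> f z <> 0 -> ccont (fun w => / f w) z.
Proof.
  intros Hf Hz.
  assert (Hi : ccont Cinv (f z)).
  { set (a := f z) in *. intros eps He.
    assert (Ha : (0 < Cmod a)%R) by now apply Cmod_gt_0.
    set (e := Rmin (Cmod a / 2) (eps * (Cmod a * Cmod a) / 2)).
    assert (Hep : (0 < e)%R) by (apply Rmin_pos; [lra|apply Rdiv_lt_0_compat; [|lra]; repeat apply Rmult_lt_0_compat; lra]).
    exists e; split; auto. intros w Hw.
    assert (He1 : (e <= Cmod a / 2)%R) by apply Rmin_l.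
    assert (He2 : (e <= eps * (Cmod a * Cmod a) / 2)%R) by apply Rmin_r.
    assert (Hw2 : (Cmod a / 2 < Cmod w)%R).
    { assert (Cmod a <= Cmod w + Cmod (w - a))%R; [|lra].
      replace a with (w + - (w - a)) at 1 by ring.
      eapply Rle_trans; [apply Cmod_triangle|]. rewrite Cmod_opp. lra. }
    assert (Hw0 : w <> 0) by (intro; subst w; rewrite Cmod_0 in Hw2; lra).
    replace (/ w - / a) with (- (w - a) / (w * a)) by (field; auto).
    rewrite Cmod_div by now apply Cmult_neq_0.
    rewrite Cmod_opp, Cmod_mult.
    apply Rmult_lt_reg_r with (Cmod w * Cmod a)%R; [apply Rmult_lt_0_compat; lra|].
    unfold Rdiv; rewrite Rmult_assoc, Rinv_l, Rmult_1_r.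
    2: apply Rgt_not_eq, Rmult_lt_0_compat; lra.
    apply Rlt_le_trans with (1 := Hw). eapply Rle_trans; [apply He2|].
    apply Rle_trans with (eps * (Cmod a / 2 * Cmod a))%R; [nra|].
    apply Rmult_le_compat_l; [lra|]. apply Rmult_le_compat_r; lra. }
  now apply (ccont_comp f Cinv).
Qed.

(* Carathéodory's form of complex differentiability makes the product and chain
   rules algebraic identities between continuous factors. *)
Definition cder (f : C -> C) (z l : C) : Prop :=
  exists phi : C -> C, ccont phi z /\ phi z = l /\
    forall w, f w - f z = phi w * (w - z).

Lemma cder_cont (f : C -> C) (z l : C) : cder f z l -> ccont f z.
Proof.
  intros (p & Hp & _ & H).
  apply (ccont_ext (fun w => f z + p w * (w + - z))).
  - apply near_all; intros w. change (w + - z) with (w - z). rewrite <- H. ring.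
  - repeat first [apply ccont_plus | apply ccont_mult | apply ccont_const | apply ccont_id | assumption].
Qed.

Lemma cder_const (c z : C) : cder (fun _ => c) z 0.
Proof. exists (fun _ => 0); split; [apply ccont_const|split; auto]. intros; ring. Qed.

Lemma cder_id (z : C) : cder (fun w => w) z 1.
Proof. exists (fun _ => 1); split; [apply ccont_const|split; auto]. intros; ring. Qed.

Lemma cder_plus (f g : C -> C) (z l m : C) :
  cder f z l -> cder g z m -> cder (fun w => f w + g w) z (l + m).
Proof.
  intros (p & Hp & <- & H) (q & Hq & <- & K).
  exists (fun w => p w + q w); split; [now apply ccont_plus|split; auto].
  intros w. transitivity ((f w - f z) + (g w - g z)); [ring|]. rewrite H, K; ring.
Qed.

Lemma cder_mult (f g : C -> C) (z l m : C) :
  cder f z l -> cder g z m -> cder (fun w => f w * g w) z (l * g z + f z * m).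
Proof.
  intros Hf Hg. generalize (cder_cont _ _ _ Hf); intros Cf.
  destruct Hf as (p & Hp & <- & H), Hg as (q & Hq & <- & K).
  exists (fun w => p w * g z + f w * q w); split; [|split; auto].
  - repeat first [apply ccont_plus | apply ccont_mult | apply ccont_const | assumption].
  - intros w. transitivity ((f w - f z) * g z + f w * (g w - g z)); [ring|]. rewrite H, K; ring.
Qed.

Lemma cder_comp (f g : C -> C) (z l m : C) :
  cder f z l -> cder g (f z) m -> cder (fun w => g (f w)) z (m * l).
Proof.
  intros Hf Hg. generalize (cder_cont _ _ _ Hf); intros Cf.
  destruct Hf as (p & Hp & <- & H), Hg as (q & Hq & <- & K).
  exists (fun w => q (f w) * p w); split; [|split; auto].
  - apply ccont_mult; auto. now apply ccont_comp.
  - intros w. rewrite K, H; ring.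
Qed.

Lemma cder_inv (f : C -> C) (z l : C) :
  cder f z l -> near z (fun w => f w <> 0) -> cder (fun w => / f w) z (- l / (f z * f z)).
Proof.
  intros Hf Hn. generalize (cder_cont _ _ _ Hf); intros Cf.
  destruct Hf as (p & Hp & <- & H).
  generalize (near_self _ _ Hn); intros Hz.
  (* The factor must satisfy its equation at every [w]. Where [f w = 0] it is the plain difference
     quotient; elsewhere it is an expression whose continuity at [z] is visible. *)
  set (D := fun w => if Ceq_dec (f w) 0 then (/ f w - / f z) / (w - z) else - p w * (/ f w * / f z)).
  exists D; split; [|split].
  - apply (ccont_ext (fun w => (Copp (RtoC 1)) * p w * (/ f w * / f z))).
    + revert Hn; apply near_imp; intros w Hw; unfold D.
      destruct (Ceq_dec (f w) 0); [tauto|]. ring.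
    + repeat first [apply ccont_mult | apply ccont_const | assumption]. now apply ccont_inv.
  - unfold D; destruct (Ceq_dec (f z) 0); [tauto|]. field; auto.
  - intros w; unfold D. destruct (Ceq_dec (f w) 0) as [E|E].
    + destruct (Ceq_dec w z) as [->|Hw]; [tauto|].
      unfold Cdiv; rewrite <- Cmult_assoc, Cinv_l, Cmult_1_r; auto.
      intro K; apply Hw, Ceq_minus, K.
    + transitivity (- (f w - f z) * (/ f w * / f z)); [field; auto|]. rewrite H; ring.
Qed.

Lemma cder_ext (f g : C -> C) (z l : C) :
  near z (fun w => f w = g w) -> cder f z l -> cder g z l.
Proof.
  intros Hn (p & Hp & <- & H).
  exists (fun w => if Ceq_dec w z then p z else (g w - g z) / (w - z)).
  split; [|split].
  - apply (ccont_ext p); auto. revert Hn.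
    intros (d & h & Hn). exists d; split; auto. intros w Hw.
    destruct (Ceq_dec w z) as [->|Hz]; auto.
    rewrite <- (Hn w Hw), <- (Hn z), H.
    field. intro; apply Hz; now apply Ceq_minus.
    replace (z - z) with (RtoC 0) by ring; now rewrite Cmod_0.
  - destruct (Ceq_dec z z); tauto.
  - intros w; destruct (Ceq_dec w z) as [->|Hz]; [ring|].
    field. intro; apply Hz; now apply Ceq_minus.
Qed.

Lemma cder_eq (f : C -> C) (z l m : C) : cder f z l -> l = m -> cder f z m.
Proof. now intros H <-. Qed.

(** Two Carathéodory factors coincide away from [z]; if they differed at [z], continuity would make
    them differ at the nearby point [z + d / 2] as well. *)
Lemma cder_unique (f : C -> C) (z l m : C) : cder f z l -> cder f z m -> l = m.
Proof.
  intros (p & Hp & <- & H) (q & Hq & <- & K).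
  destruct (Ceq_dec (p z) (q z)) as [|Hne]; auto. exfalso.
  assert (Hd : ccont (fun w => p w + (Copp (RtoC 1)) * q w) z)
    by (repeat first [apply ccont_plus | apply ccont_mult | apply ccont_const | assumption]).
  destruct (ccont_neq0 _ _ 0 Hd) as (d & h & Hw).
  { intro E; apply Hne, Ceq_minus. rewrite <- E; ring. }
  assert (Hz : z + RtoC (d/2) - z = RtoC (d/2)) by ring.
  apply (Hw (z + RtoC (d / 2))).
  - rewrite Hz, Cmod_R, Rabs_pos_eq; lra.
  - generalize (H (z + RtoC (d / 2))) (K (z + RtoC (d / 2))); rewrite Hz; intros -> E.

    transitivity ((p (z + RtoC (d / 2)) * RtoC (d/2) - q (z + RtoC (d / 2)) * RtoC (d/2)) / RtoC (d/2)).
    + field. intro E2; apply RtoC_inj in E2; lra.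
    + rewrite E. field. intro E2; apply RtoC_inj in E2; lra.
Qed.

Lemma cder_opp (f : C -> C) (z l : C) : cder f z l -> cder (fun w => - f w) z (- l).
Proof.
  intros H. eapply cder_eq; [apply (cder_ext (fun w => (Copp (RtoC 1)) * f w))|].
  - apply near_all; intros; ring.
  - apply cder_mult; [apply cder_const | apply H].
  - cbv beta; ring.
Qed.

Lemma cder_minus (f g : C -> C) (z l m : C) :
  cder f z l -> cder g z m -> cder (fun w => f w - g w) z (l - m).
Proof. intros; apply cder_plus; auto. now apply cder_opp. Qed.

Lemma cder_div (f g : C -> C) (z l m : C) :
  cder f z l -> cder g z m -> g z <> 0 ->
  cder (fun w => f w / g w) z ((l * g z - f z * m) / (g z * g z)).
Proof.
  intros Hf Hg Hz. eapply cder_eq.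
  - apply cder_mult; [apply Hf|]. apply cder_inv; [apply Hg|].
    apply ccont_neq0; auto. now apply cder_cont in Hg.
  - cbv beta. field; auto.
Qed.

Lemma cder_pow (f : C -> C) (z l : C) (n : nat) :
  cder f z l -> cder (fun w => f w ^ n) z (RtoC (INR n) * f z ^ (pred n) * l).
Proof.
  intros H; induction n as [|n IH].
  - eapply cder_eq; [apply (cder_const 1)|]. simpl; ring.
  - eapply cder_eq; [apply (cder_mult f (fun w => f w ^ n)); [apply H | apply IH]|].
    cbv beta. rewrite S_INR, RtoC_plus. destruct n; simpl; ring.
Qed.

(** * Differentiable curves and the mean value inequality *)

Definition rder (p : R -> C) (t : R) (v : C) : Prop :=
  is_derive (fun u => Re (p u)) t (Re v) /\ is_derive (fun u => Im (p u)) t (Im v).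

(** The second factor vanishes at [t], so no derivative of [a] enters and continuity of [a] is
    enough. This is what transports a Carathéodory factor along a curve. *)
Lemma is_derive_cara (a b : R -> R) (t l : R) :
  continuous a t -> is_derive b t l ->
  is_derive (fun u => a u * (b u - b t))%R t (a t * l)%R.
Proof.
  intros Ha Hb. apply is_derive_Reals in Hb. apply is_derive_Reals.
  apply continuity_pt_filterlim in Ha.
  intros eps He.
  assert (H : limit1_in (fun h => a (t + h)%R * ((b (t + h) - b t) / h))%R (fun h => h <> 0%R) (a t * l)%R 0%R).
  { apply limit_mul.
    - intros e Hep. destruct (Ha e Hep) as (d & Hd & H). exists d; split; auto.
      intros h [Hh1 Hh2]. destruct (Req_dec h 0) as [->|N]; [tauto|].
      apply H. split.
      + split; [exact I|]. intro E; apply N; lra.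
      + simpl in *; unfold Rdist in *. replace (t + h - t)%R with (h - 0)%R by ring; auto.
    - intros e Hep. destruct (Hb e Hep) as (d & H). exists d; split; [apply cond_pos|].
      intros h [Hh1 Hh2]. simpl in *; unfold Rdist in *. apply H; auto. now rewrite Rminus_0_r in Hh2. }
  destruct (H eps He) as (d & Hd & K).
  exists (mkposreal d Hd). intros h Hh Hhd.
  specialize (K h). simpl in K, Hhd; unfold Rdist in K.
  replace ((a (t + h) * (b (t + h) - b t) - a t * (b t - b t)) / h)%R
    with (a (t + h) * ((b (t + h) - b t) / h))%R by (field; auto).
  apply K. split; auto. now rewrite Rminus_0_r.
Qed.

Lemma continuous_R_eps (a : R -> R) (t : R) :
  (forall eps : R, (0 < eps)%R -> exists d : R, (0 < d)%R /\
    forall u, (Rabs (u - t) < d)%R -> (Rabs (a u - a t) < eps)%R) -> continuous a t.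
Proof.
  intros H. apply continuity_pt_filterlim. intros e He.
  destruct (H e He) as (d & Hd & K). exists d; split; auto.
  intros u [_ Hu]. simpl in *; unfold Rdist in *; auto.
Qed.

Lemma continuous_R_eps_inv (a : R -> R) (t : R) :
  continuous a t -> forall eps : R, (0 < eps)%R -> exists d : R, (0 < d)%R /\
    forall u, (Rabs (u - t) < d)%R -> (Rabs (a u - a t) < eps)%R.
Proof.
  intros Ha e He. apply continuity_pt_filterlim in Ha.
  destruct (Ha e He) as (d & Hd & K). exists d; split; auto.
  intros u Hu. destruct (Req_dec u t) as [->|N].
  - now rewrite Rminus_diag, Rabs_R0.
  - apply K. split; [split; [exact I|auto]|]. exact Hu.
Qed.

Definition pcont (p : R -> C) (t : R) : Prop :=
  forall eps : R, (0 < eps)%R -> exists d : R, (0 < d)%R /\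
    forall u, (Rabs (u - t) < d)%R -> (Cmod (p u - p t) < eps)%R.

Lemma pcont_comps (p : R -> C) (t : R) :
  pcont p t <-> continuous (fun u => Re (p u)) t /\ continuous (fun u => Im (p u)) t.
Proof.
  split.
  - intros H; split; apply continuous_R_eps; intros e He; destruct (H e He) as (d & Hd & K);
    exists d; split; auto; intros u Hu; (eapply Rle_lt_trans; [|apply (K u Hu)]).
    + change (Re (p u) - Re (p t))%R with (Re (p u - p t)). apply re_le_Cmod.
    + change (Im (p u) - Im (p t))%R with (Im (p u - p t)). apply im_le_Cmod.
  - intros [H1 H2] e He.
    destruct (continuous_R_eps_inv _ _ H1 (e/2)%R ltac:(lra)) as (d1 & Hd1 & K1).
    destruct (continuous_R_eps_inv _ _ H2 (e/2)%R ltac:(lra)) as (d2 & Hd2 & K2).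
    exists (Rmin d1 d2); split; [now apply Rmin_pos|].
    intros u Hu. eapply Rle_lt_trans; [apply Cmod_le_comp|].
    specialize (K1 u (Rlt_le_trans _ _ _ Hu (Rmin_l _ _))).
    specialize (K2 u (Rlt_le_trans _ _ _ Hu (Rmin_r _ _))).
    change (Re (p u - p t)) with (Re (p u) - Re (p t))%R.
    change (Im (p u - p t)) with (Im (p u) - Im (p t))%R. lra.
Qed.

Lemma pcont_comp (f : C -> C) (p : R -> C) (t : R) :
  pcont p t -> ccont f (p t) -> pcont (fun u => f (p u)) t.
Proof.
  intros Hp Hf e He. destruct (Hf e He) as (d & Hd & K).
  destruct (Hp d Hd) as (d' & Hd' & K'). exists d'; split; auto.
Qed.

Lemma rder_cont (p : R -> C) (t : R) (v : C) : rder p t v -> pcont p t.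
Proof.
  intros [H1 H2]; apply pcont_comps; split; apply (ex_derive_continuous (K := R_AbsRing) (V := R_NormedModule)); eexists; eassumption.
Qed.

(** From $f(p(u))=f(p(t))+q(p(u))\,(p(u)-p(t))$, each component is a constant plus products covered
    by [is_derive_cara]. *)
Lemma cder_curve (f : C -> C) (p : R -> C) (t : R) (l v : C) :
  cder f (p t) l -> rder p t v -> rder (fun u => f (p u)) t (l * v).
Proof.
  intros (q & Hq & <- & H) Hv.
  assert (Hqp : pcont (fun u => q (p u)) t) by (apply pcont_comp; auto; now apply (rder_cont p t v)).
  apply pcont_comps in Hqp. destruct Hqp as [Q1 Q2], Hv as [V1 V2].
  assert (E : forall u, f (p u) = f (p t) + q (p u) * (p u - p t)) by (intros u; rewrite <- H; ring).
  split.
  - apply (is_derive_ext (fun u => Re (f (p t)) + (Re (q (p u)) * (Re (p u) - Re (p t)) - Im (q (p u)) * (Im (p u) - Im (p t))))%R).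
    { intros u; rewrite (E u) . unfold Re, Im; destruct (q (p u)), (p u), (p t), (f (p t)); simpl; ring. }
    replace (Re (q (p t) * v)) with (0 + (Re (q (p t)) * Re v - Im (q (p t)) * Im v))%R
      by (destruct (q (p t)), v; simpl; ring).
    apply (is_derive_plus (K := R_AbsRing) (V := R_NormedModule)); [apply @is_derive_const|].
    apply (is_derive_minus (K := R_AbsRing) (V := R_NormedModule));
    [apply (is_derive_cara (fun u => Re (q (p u))) (fun u => Re (p u))) | apply (is_derive_cara (fun u => Im (q (p u))) (fun u => Im (p u)))]; auto.
  - apply (is_derive_ext (fun u => Im (f (p t)) + (Re (q (p u)) * (Im (p u) - Im (p t)) + Im (q (p u)) * (Re (p u) - Re (p t))))%R).
    { intros u; rewrite (E u) . unfold Re, Im; destruct (q (p u)), (p u), (p t), (f (p t)); simpl; ring. }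
    replace (Im (q (p t) * v)) with (0 + (Re (q (p t)) * Im v + Im (q (p t)) * Re v))%R
      by (destruct (q (p t)), v; simpl; ring).
    apply (is_derive_plus (K := R_AbsRing) (V := R_NormedModule)); [apply @is_derive_const|].
    apply (is_derive_plus (K := R_AbsRing) (V := R_NormedModule));
    [apply (is_derive_cara (fun u => Re (q (p u))) (fun u => Im (p u))) | apply (is_derive_cara (fun u => Im (q (p u))) (fun u => Re (p u)))]; auto.
Qed.

Lemma rder_line (z v : C) (t : R) : rder (fun u => z + RtoC u * v) t v.
Proof.
  split; destruct z, v; simpl; auto_derive; auto; ring.
Qed.

(* The real function [t -> Re (conj D * (p t - t v))] with [D = p 1 - p 0 - v]
   turns this into the real mean value theorem. *)
Lemma curve_mean_value (p p' : R -> C) (v : C) (e : R) :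
  (forall t : R, (0 <= t <= 1)%R -> rder p t (p' t)) ->
  (forall t : R, (0 <= t <= 1)%R -> Cmod (p' t - v) <= e)%R ->
  (Cmod (p 1%R - p 0%R - v) <= e)%R.
Proof.
  intros Hp He. set (D := p 1%R - p 0%R - v).
  set (h := fun t => (Re D * (Re (p t) - t * Re v) + Im D * (Im (p t) - t * Im v))%R).
  set (h' := fun t => (Re D * (Re (p' t) - Re v) + Im D * (Im (p' t) - Im v))%R).
  assert (Hh : forall t, (0 <= t <= 1)%R -> is_derive h t (h' t)).
  { intros t Ht. destruct (Hp t Ht) as [G1 G2]. unfold h, h'.
    apply (is_derive_plus (K := R_AbsRing) (V := R_NormedModule));
    [apply (is_derive_scal (fun t => Re (p t) - t * Re v)%R) | apply (is_derive_scal (fun t => Im (p t) - t * Im v)%R)];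
    (apply (is_derive_minus (K := R_AbsRing) (V := R_NormedModule)); [assumption|]);
    auto_derive; auto; ring. }
  destruct (MVT_gen h 0 1 h') as (c & Hc & E).
  { intros x Hx. rewrite Rmin_left, Rmax_right in Hx by lra. apply Hh; lra. }
  { intros x Hx. rewrite Rmin_left, Rmax_right in Hx by lra.
    apply continuity_pt_filterlim. apply (ex_derive_continuous (K := R_AbsRing) (V := R_NormedModule)).
    eexists; apply Hh; lra. }
  rewrite Rmin_left, Rmax_right in Hc by lra.
  assert (E1 : (h 1 - h 0 = Cmod D * Cmod D)%R).
  { unfold h. replace (Cmod D * Cmod D)%R with (Re D * Re D + Im D * Im D)%R.
    - unfold D. destruct (p 1%R), (p 0%R), v; simpl; ring.
    - unfold Cmod. rewrite sqrt_sqrt; [destruct D; simpl; ring|]. nra. }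
  assert (E2 : (h' c <= Cmod D * e)%R).
  { unfold h'.
    replace (Re D * (Re (p' c) - Re v) + Im D * (Im (p' c) - Im v))%R with (Re (Cconj D * (p' c - v)))
      by (destruct D, (p' c), v; simpl; ring).
    eapply Rle_trans; [apply Rle_abs|]. eapply Rle_trans; [apply re_le_Cmod|].
    rewrite Cmod_mult, Cmod_conj. apply Rmult_le_compat_l; [apply Cmod_ge_0|]. now apply He. }
  rewrite E1 in E. destruct (Cmod_ge_0 D) as [Hq|Hz].
  - apply Rmult_le_reg_l with (Cmod D); auto. nra.
  - rewrite <- Hz. eapply Rle_trans; [apply Cmod_ge_0|]. apply (He 0%R). lra.
Qed.

(** When [f'] stays close to [l] on a segment, [f] differs from the linear map of slope [l] by a
    small Lipschitz error. This estimate drives the iteration in [local_inverse]. *)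
Lemma mean_value_ineq (f f' : C -> C) (z w l : C) (e : R) :
  (forall t : R, (0 <= t <= 1)%R -> cder f (z + RtoC t * (w - z)) (f' (z + RtoC t * (w - z)))) ->
  (forall t : R, (0 <= t <= 1)%R -> Cmod (f' (z + RtoC t * (w - z))%C - l) <= e)%R ->
  (Cmod (f w - f z - l * (w - z)) <= e * Cmod (w - z))%R.
Proof.
  intros Hf He.
  replace w with (z + RtoC 1 * (w - z)) at 1 by ring. replace z with (z + RtoC 0 * (w - z)) at 3 by ring.
  apply (curve_mean_value (fun t => f (z + RtoC t * (w - z))) (fun t => f' (z + RtoC t * (w - z)) * (w - z))).
  - intros t Ht. apply (cder_curve f (fun t => z + RtoC t * (w - z))); [now apply Hf | apply rder_line].
  - intros t Ht.
    replace (f' (z + RtoC t * (w - z)) * (w - z) - l * (w - z)) with ((f' (z + RtoC t * (w - z)) - l) * (w - z)) by ring.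
    rewrite Cmod_mult. apply Rmult_le_compat_r; [apply Cmod_ge_0 | now apply He].
Qed.

(** * Cauchy's integral and power series *)

Definition circ (r t : R) : C := (r * cos t, r * sin t)%R.

Lemma Cmod_circ (r t : R) : (0 <= r)%R -> Cmod (circ r t) = r.
Proof.
  intros Hr. unfold Cmod, circ; simpl.
  replace (r * cos t * (r * cos t * 1) + r * sin t * (r * sin t * 1))%R
    with (r * r * (Rsqr (sin t) + Rsqr (cos t)))%R by (unfold Rsqr; ring).
  rewrite sin2_cos2, Rmult_1_r. now apply sqrt_square.
Qed.

Lemma rder_circ (r t : R) : rder (circ r) t (Ci * circ r t).
Proof. split; unfold circ; simpl; auto_derive; auto; ring. Qed.

Lemma pcont_circ (r t : R) : pcont (circ r) t.
Proof. eapply rder_cont, rder_circ. Qed.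

Definition CI (h : R -> C) : C :=
  (RInt (fun t => Re (h t)) 0 (2 * PI), RInt (fun t => Im (h t)) 0 (2 * PI))%R.

Definition pcontinuous (h : R -> C) : Prop := forall t, pcont h t.

Lemma ex_RInt_Re (h : R -> C) (a b : R) : pcontinuous h -> ex_RInt (fun t => Re (h t)) a b.
Proof.
  intros H. apply (ex_RInt_continuous (V := R_CompleteNormedModule)). intros t _. apply (proj1 (pcont_comps _ _) (H t)).
Qed.

Lemma ex_RInt_Im (h : R -> C) (a b : R) : pcontinuous h -> ex_RInt (fun t => Im (h t)) a b.
Proof.
  intros H. apply (ex_RInt_continuous (V := R_CompleteNormedModule)). intros t _. apply (proj1 (pcont_comps _ _) (H t)).
Qed.

Lemma CI_ext (h k : R -> C) : (forall t, h t = k t) -> CI h = CI k.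
Proof. intros E. unfold CI. f_equal; apply RInt_ext; intros t _; now rewrite E. Qed.

Lemma CI_plus (h k : R -> C) : pcontinuous h -> pcontinuous k ->
  CI (fun t => h t + k t) = CI h + CI k.
Proof.
  intros Hh Hk. unfold CI, Cplus; simpl. f_equal.
  - rewrite <- (RInt_plus (V := R_CompleteNormedModule) (fun t => Re (h t)) (fun t => Re (k t))); auto using ex_RInt_Re.
  - rewrite <- (RInt_plus (V := R_CompleteNormedModule) (fun t => Im (h t)) (fun t => Im (k t))); auto using ex_RInt_Im.
Qed.

Lemma CI_scal (c : C) (h : R -> C) : pcontinuous h -> CI (fun t => c * h t) = c * CI h.
Proof.
  intros Hh. destruct c as [x y]. unfold CI, Cmult; simpl. f_equal.
  - rewrite <- !(RInt_scal (V := R_CompleteNormedModule)) by auto using ex_RInt_Re, ex_RInt_Im.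
    apply (RInt_minus (V := R_CompleteNormedModule)
      (fun t => scal x (Re (h t))) (fun t => scal y (Im (h t))));
    apply (ex_RInt_scal (V := R_NormedModule)); auto using ex_RInt_Re, ex_RInt_Im.
  - rewrite <- !(RInt_scal (V := R_CompleteNormedModule)) by auto using ex_RInt_Re, ex_RInt_Im.
    apply (RInt_plus (V := R_CompleteNormedModule)
      (fun t => scal x (Im (h t))) (fun t => scal y (Re (h t))));
    apply (ex_RInt_scal (V := R_NormedModule)); auto using ex_RInt_Re, ex_RInt_Im.
Qed.

Lemma CI_const (c : C) : CI (fun _ => c) = RtoC (2 * PI) * c.
Proof.
  unfold CI. rewrite !RInt_const. destruct c; unfold Cmult, scal; simpl; unfold mult; simpl.
  f_equal; ring.
Qed.

(** The constant is [4 * PI] instead of [2 * PI] because real and imaginary parts are bounded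
    separately; only the proportionality to [M] matters later. *)
Lemma CI_bound (h : R -> C) (M : R) : pcontinuous h ->
  (forall t, 0 <= t <= 2 * PI -> Cmod (h t) <= M)%R ->
  (Cmod (CI h) <= 4 * PI * M)%R.
Proof.
  intros Hc HM. assert (P := PI_RGT_0).
  eapply Rle_trans; [apply Cmod_le_comp|]. unfold CI; simpl.
  assert (B : forall g : R -> R, ex_RInt g 0 (2*PI)%R -> (forall t, 0 <= t <= 2 * PI -> Rabs (g t) <= M)%R ->
    (Rabs (RInt g 0 (2*PI)%R) <= 2 * PI * M)%R).
  { intros g Hg Hb. eapply Rle_trans; [apply (abs_RInt_le_const g 0 (2*PI) M)|]; auto; try lra. }
  assert (B1 := B _ (ex_RInt_Re h 0 (2*PI) Hc) (fun t Ht => Rle_trans _ _ _ (re_le_Cmod _) (HM t Ht))).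
  assert (B2 := B _ (ex_RInt_Im h 0 (2*PI) Hc) (fun t Ht => Rle_trans _ _ _ (im_le_Cmod _) (HM t Ht))).
  lra.
Qed.

Lemma CI_derive (P P' : R -> C) :
  (forall t, rder P t (P' t)) -> pcontinuous P' -> P (2 * PI)%R = P 0%R -> CI P' = 0.
Proof.
  intros Hd Hc E. unfold CI. unfold RtoC. f_equal.
  - replace 0%R with (minus (Re (P (2*PI)%R)) (Re (P 0%R))) at 2.
    + apply is_RInt_unique, (is_RInt_derive (V := R_CompleteNormedModule) (fun t => Re (P t)) (fun t => Re (P' t))).
      * intros; apply Hd.
      * intros t _. apply (proj1 (proj1 (pcont_comps _ _) (Hc t))).
    + rewrite E. apply Rminus_diag.
  - replace 0%R with (minus (Im (P (2*PI)%R)) (Im (P 0%R))) at 2.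
    + apply is_RInt_unique, (is_RInt_derive (V := R_CompleteNormedModule) (fun t => Im (P t)) (fun t => Im (P' t))).
      * intros; apply Hd.
      * intros t _. apply (proj2 (proj1 (pcont_comps _ _) (Hc t))).
    + rewrite E. apply Rminus_diag.
Qed.

Lemma pcont_const (c : C) (t : R) : pcont (fun _ => c) t.
Proof. apply pcont_comps; split; apply continuous_const. Qed.

Lemma pcont_plus (p q : R -> C) (t : R) : pcont p t -> pcont q t -> pcont (fun u => p u + q u) t.
Proof.
  intros Hp Hq. apply pcont_comps in Hp; apply pcont_comps in Hq. apply pcont_comps; split.
  - apply (continuous_plus (V := R_NormedModule)); tauto.
  - apply (continuous_plus (V := R_NormedModule)); tauto.
Qed.

Lemma pcont_mult (p q : R -> C) (t : R) : pcont p t -> pcont q t -> pcont (fun u => p u * q u) t.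
Proof.
  intros Hp Hq. apply pcont_comps in Hp; apply pcont_comps in Hq. apply pcont_comps; split.
  - apply (continuous_minus (V := R_NormedModule)); apply (continuous_mult (K := R_AbsRing)); tauto.
  - apply (continuous_plus (V := R_NormedModule)); apply (continuous_mult (K := R_AbsRing)); tauto.
Qed.

Lemma pcont_inv (p : R -> C) (t : R) : pcont p t -> p t <> 0 -> pcont (fun u => / p u) t.
Proof.
  intros Hp Hz. apply (pcont_comp Cinv p); auto.
  apply (ccont_inv (fun x => x)); auto. apply ccont_id.
Qed.

Section Cauchy.

Variables (f f' : C -> C) (R0 r : R) (w : C).
Hypothesis Hr : (0 < r < R0)%R.
Hypothesis Hw : (Cmod w < r)%R.
Hypothesis Hf : forall z, (Cmod z < R0)%R -> cder f z (f' z).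
Hypothesis Hc : forall z, (Cmod z < R0)%R -> ccont f' z.

Lemma circ_neq t : circ r t - w <> 0.
Proof.
  intro E. assert (circ r t = w) by (apply Ceq_minus, E).
  generalize (Cmod_circ r t ltac:(lra)). rewrite H. lra.
Qed.

(** Contraction of the circle to [w]. The integral of [dens s] turns out to be independent of [s];
    at [s = 1] it is Cauchy's integral and at [s = 0] it is [f w] times the integral of the
    kernel. *)
Definition homot (s t : R) : C := w + RtoC s * (circ r t - w).

(** Since [circ r t - w] is shorter than $2r$, moving [s] by less than $(R_0-r)/(2r)$ moves the
    point by less than $R_0-r$. Parameters slightly outside of $[0,1]$ are included because the
    integral is differentiated at the ends too. *)
Lemma homot_in (s s' t : R) : (0 <= s <= 1)%R -> (Rabs (s' - s) < (R0 - r) / (2 * r))%R ->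
  (Cmod (homot s' t) < R0)%R.
Proof.
  intros Hs Hd.
  assert (A : (Cmod (circ r t - w) < 2 * r)%R).
  { eapply Rle_lt_trans; [apply (Cmod_triangle (circ r t) (- w))|]. rewrite Cmod_opp, Cmod_circ; lra. }
  assert (B : (Cmod (homot s t) <= r)%R).
  { unfold homot. replace (w + RtoC s * (circ r t - w)) with (RtoC (1 - s) * w + RtoC s * circ r t)
      by (rewrite RtoC_minus; ring).
    eapply Rle_trans; [apply Cmod_triangle|]. rewrite !Cmod_mult, !Cmod_R, Cmod_circ, !Rabs_pos_eq by lra. nra. }
  replace (homot s' t) with (homot s t + RtoC (s' - s) * (circ r t - w))
    by (unfold homot; rewrite RtoC_minus; ring).
  eapply Rle_lt_trans; [apply Cmod_triangle|]. rewrite Cmod_mult, Cmod_R.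
  assert (Rabs (s' - s) * Cmod (circ r t - w) < (R0 - r) / (2 * r) * (2 * r))%R.
  { apply Rmult_le_0_lt_compat; auto using Rabs_pos, Cmod_ge_0. }
  replace ((R0 - r) / (2 * r) * (2 * r))%R with (R0 - r)%R in H by (field; lra). lra.
Qed.

(** Cauchy's kernel in the angular parameter: with $\zeta=re^{it}$, $d\zeta/(\zeta-w)$ is $i$ times
    [kern t] $dt$. *)
Definition kern (t : R) : C := circ r t / (circ r t - w).

Lemma pcont_kern t : pcont kern t.
Proof.
  apply pcont_mult; [apply pcont_circ|]. apply pcont_inv; [|apply circ_neq].
  apply (pcont_plus (circ r) (fun _ => - w)); [apply pcont_circ | apply pcont_const].
Qed.

Lemma pcont_homot s t : pcont (homot s) t.
Proof.
  apply (pcont_plus (fun _ => w)); [apply pcont_const|].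
  apply (pcont_mult (fun _ => RtoC s)); [apply pcont_const|].
  apply (pcont_plus (circ r) (fun _ => - w)); [apply pcont_circ | apply pcont_const].
Qed.

Definition dens (s t : R) : C := f (homot s t) * kern t.

Lemma homot_dens_cont s : (0 <= s <= 1)%R -> forall s', (Rabs (s' - s) < (R0 - r) / (2 * r))%R ->
  pcontinuous (dens s').
Proof.
  intros Hs s' Hs' t. apply pcont_mult; [|apply pcont_kern].
  apply pcont_comp; [apply pcont_homot|]. eapply cder_cont, Hf. now apply homot_in with s.
Qed.

(** The factor [circ r t - w] produced by the chain rule cancels the denominator of the kernel. *)
Lemma dens_deriv s t : (Cmod (homot s t) < R0)%R ->
  rder (fun s => dens s t) s (f' (homot s t) * circ r t).
Proof.
  intros H. replace (f' (homot s t) * circ r t) with ((f' (homot s t) * kern t) * (circ r t - w)).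
  2:{ unfold kern. field. apply circ_neq. }
  apply (cder_curve (fun z => f z * kern t) (fun s => homot s t)).
  - eapply cder_eq; [apply cder_mult; [now apply Hf | apply cder_const]|]. cbv beta. ring.
  - apply rder_line.
Qed.

Lemma homot_2d s t (e : R) : (0 < e)%R ->
  exists d : R, (0 < d)%R /\ forall s' t' : R, (Rabs (s' - s) < d)%R -> (Rabs (t' - t) < d)%R ->
    (Cmod (homot s' t' - homot s t) < e)%R.
Proof.
  intros He. destruct (pcont_circ r t (Rmin 1 (e / (2 * (Rabs s + 1)))) ) as (d1 & Hd1 & H1).
  { apply Rmin_pos; [lra|]. apply Rdiv_lt_0_compat; [lra|]. generalize (Rabs_pos s); lra. }
  set (m := (Cmod (circ r t - w) + 1)%R). assert (Hm : (0 < m)%R) by (unfold m; generalize (Cmod_ge_0 (circ r t - w)); lra).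
  exists (Rmin d1 (e / (2 * m))). split; [apply Rmin_pos; auto; apply Rdiv_lt_0_compat; lra|].
  intros s' t' Hs Ht.
  assert (Hs' := Rlt_le_trans _ _ _ Hs (Rmin_r _ _)). assert (Ht' := Rlt_le_trans _ _ _ Ht (Rmin_l _ _)).
  specialize (H1 t' Ht').
  replace (homot s' t' - homot s t)
    with (RtoC (s' - s) * (circ r t' - w) + RtoC s * (circ r t' - circ r t))
    by (unfold homot; rewrite RtoC_minus; ring).
  eapply Rle_lt_trans; [apply Cmod_triangle|]. rewrite !Cmod_mult, !Cmod_R.
  assert (A : (Cmod (circ r t' - w) <= m)%R).
  { replace (circ r t' - w) with ((circ r t' - circ r t) + (circ r t - w)) by ring.
    eapply Rle_trans; [apply Cmod_triangle|]. unfold m. generalize (Rmin_l 1 (e / (2 * (Rabs s + 1)))); lra. }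
  assert (B : (Cmod (circ r t' - circ r t) < e / (2 * (Rabs s + 1)))%R)
    by (eapply Rlt_le_trans; [apply H1 | apply Rmin_r]).
  assert (P := Rabs_pos s).
  assert (Rabs (s' - s) * Cmod (circ r t' - w) <= e / (2 * m) * m)%R
    by (apply Rmult_le_compat; auto using Rabs_pos, Cmod_ge_0; lra).
  replace (e / (2 * m) * m)%R with (e / 2)%R in H by (field; lra).
  assert (C : ((Rabs s + 1) * Cmod (circ r t' - circ r t) < (Rabs s + 1) * (e / (2 * (Rabs s + 1))))%R)
    by (apply Rmult_lt_compat_l; lra).
  replace ((Rabs s + 1) * (e / (2 * (Rabs s + 1))))%R with (e / 2)%R in C by (field; lra).
  generalize (Cmod_ge_0 (circ r t' - circ r t)). nra.
Qed.

Lemma deriv_2d s t : (Cmod (homot s t) < R0)%R ->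
  continuity_2d_pt (fun s t => Re (f' (homot s t) * circ r t)) s t.
Proof.
  intros H eps.
  set (M := (Cmod (f' (homot s t)) + r + 1)%R).
  assert (HM : (0 < M)%R) by (unfold M; generalize (Cmod_ge_0 (f' (homot s t))); lra).
  set (e := Rmin 1 (eps / (2 * M))).
  assert (He : (0 < e)%R) by (apply Rmin_pos; [lra|]; apply Rdiv_lt_0_compat; [apply cond_pos|lra]).
  destruct (Hc _ H e He) as (d1 & Hd1 & K1).
  destruct (homot_2d s t d1 Hd1) as (d2 & Hd2 & K2).
  destruct (pcont_circ r t e He) as (d3 & Hd3 & K3).
  exists (mkposreal (Rmin d2 d3) (Rmin_pos _ _ Hd2 Hd3)). simpl. intros s' t' Hs Ht.
  assert (A := K1 _ (K2 s' t' (Rlt_le_trans _ _ _ Hs (Rmin_l _ _)) (Rlt_le_trans _ _ _ Ht (Rmin_l _ _)))).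
  assert (B := K3 _ (Rlt_le_trans _ _ _ Ht (Rmin_r _ _))).
  set (a := f' (homot s t)) in *. set (a' := f' (homot s' t')) in *.
  apply Rle_lt_trans with (Cmod (a' * circ r t' - a * circ r t)).
  { exact (re_le_Cmod (a' * circ r t' - a * circ r t)). }
  replace (a' * circ r t' - a * circ r t) with ((a' - a) * circ r t' + a * (circ r t' - circ r t)) by ring.
  eapply Rle_lt_trans; [apply Cmod_triangle|]. rewrite !Cmod_mult, Cmod_circ by lra.
  assert (C : (e * M <= eps / 2)%R).
  { apply Rle_trans with (eps / (2 * M) * M)%R; [apply Rmult_le_compat_r; [lra|apply Rmin_r]|].
    right; field; lra. }
  assert (P := Cmod_ge_0 a). assert (Q := cond_pos eps). unfold M in C; fold a in C. nra.
Qed.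

(** Differentiating under the integral in [s] gives the integral of [f' (homot s t) * circ r t]. For
    $s\ne0$ this integrand is the [t]-derivative of $-\frac is f(\mathrm{homot}\,s\,t)$, which takes
    the same value at $0$ and $2\pi$. The mean value theorem may also return the end $s=0$, which
    needs its own primitive. *)
Lemma Re_dens_const : RInt (fun t => Re (dens 1 t)) 0 (2 * PI) = RInt (fun t => Re (dens 0 t)) 0 (2 * PI).
Proof.
  assert (Hd : (0 < (R0 - r) / (2 * r))%R) by (apply Rdiv_lt_0_compat; lra).
  set (D := fun s t => Re (f' (homot s t) * circ r t)).
  assert (HD : forall s : R, (0 <= s <= 1)%R ->
    is_derive (fun s => RInt (fun t => Re (dens s t)) 0 (2 * PI)) s (RInt (D s) 0 (2 * PI))).
  { intros s Hs.
    assert (Hloc : forall s', (Rabs (s' - s) < (R0 - r) / (2 * r))%R -> forall t, is_derive (fun s => Re (dens s t)) s' (D s' t)).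
    { intros s' Hs' t. apply dens_deriv. now apply homot_in with s. }
    replace (RInt (D s) 0 (2 * PI)) with (RInt (fun t => Derive (fun u => Re (dens u t)) s) 0 (2 * PI)).
    2:{ apply RInt_ext; intros t _. apply is_derive_unique, Hloc. now rewrite Rminus_diag, Rabs_R0. }
    apply (is_derive_RInt_param (fun s t => Re (dens s t))).
    - exists (mkposreal _ Hd). intros s' Hs' t _. eexists. apply Hloc. apply Hs'.
    - intros t _. apply continuity_2d_pt_ext_loc with (f := D).
      + exists (mkposreal _ Hd). intros s' t' Hs' _. symmetry. apply is_derive_unique, Hloc, Hs'.
      + apply deriv_2d. apply homot_in with s; auto. now rewrite Rminus_diag, Rabs_R0.
    - exists (mkposreal _ Hd). intros s' Hs'. apply ex_RInt_Re. now apply homot_dens_cont with s. }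
  destruct (MVT_gen (fun s => RInt (fun t => Re (dens s t)) 0 (2 * PI)) 0 1 (fun s => RInt (D s) 0 (2 * PI)))
    as (c & Hcc & E).
  { intros x Hx. rewrite Rmin_left, Rmax_right in Hx by lra. apply HD; lra. }
  { intros x Hx. rewrite Rmin_left, Rmax_right in Hx by lra.
    apply continuity_pt_filterlim. apply (ex_derive_continuous (K := R_AbsRing) (V := R_NormedModule)
      (fun s => RInt (fun t => Re (dens s t)) 0 (2 * PI))).
    eexists; apply HD; lra. }
  rewrite Rmin_left, Rmax_right in Hcc by lra.
  apply Rminus_diag_uniq. rewrite E.
  destruct (Req_dec c 0) as [->|Nc].
  - (* at [s = 0] the integrand is a constant times the derivative of [circ]. *)
    assert (Z : CI (fun t => f' w * circ r t) = 0).
    { apply (CI_derive (fun t => (- Ci * f' w) * circ r t)).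
      - intros t. replace (f' w * circ r t) with ((- Ci * f' w) * (Ci * circ r t)).
        2:{ transitivity (- (Ci * Ci) * (f' w * circ r t)); [ring|]. replace (Ci * Ci) with (Copp 1); [ring|].
            unfold Ci, Cmult, Copp, RtoC; simpl; f_equal; ring. }
        apply (cder_curve (fun z => (- Ci * f' w) * z)); [|apply rder_circ].
        eapply cder_eq; [apply (cder_mult (fun _ => _) (fun x => x)); [apply cder_const | apply cder_id]|]. cbv beta; ring.
      - intros t. apply pcont_mult; [apply pcont_const|apply pcont_circ].
      - unfold circ. rewrite cos_2PI, sin_2PI, cos_0, sin_0. reflexivity. }
    apply (f_equal Re) in Z. change (RInt (fun t => Re (f' w * circ r t)) 0 (2 * PI) = 0%R) in Z.
    replace (RInt (D 0%R) 0 (2 * PI)) with 0%R; [ring|]. etransitivity; [symmetry; exact Z|].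
    apply RInt_ext. intros t _. unfold D, homot. replace (w + RtoC 0 * (circ r t - w)) with w by ring. reflexivity.
  - assert (Hin : forall t, (Cmod (homot c t) < R0)%R).
    { intros t; apply homot_in with c; auto. now rewrite Rminus_diag, Rabs_R0. }
    assert (Hrc : RtoC c <> 0) by (intro X; apply RtoC_inj in X; auto).
    assert (Z : CI (fun t => f' (homot c t) * circ r t) = 0).
    { apply (CI_derive (fun t => (- Ci / RtoC c) * f (homot c t))).
      - intros t. replace (f' (homot c t) * circ r t) with ((- Ci / RtoC c * f' (homot c t)) * (RtoC c * (Ci * circ r t))).
        2:{ transitivity (- (Ci * Ci) * (f' (homot c t) * circ r t)); [field; auto|]. replace (Ci * Ci) with (Copp 1); [ring|].
            unfold Ci, Cmult, Copp, RtoC; simpl; f_equal; ring. }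
        apply (cder_curve (fun z => (- Ci / RtoC c) * f z) (homot c)).
        + eapply cder_eq; [apply cder_mult; [apply cder_const | apply Hf, Hin]|]. cbv beta; ring.
        + apply (cder_curve (fun z => w + RtoC c * (z - w)) (circ r)); [|apply rder_circ].
          eapply cder_eq; [apply cder_plus; [apply cder_const|]; apply (cder_mult (fun _ => RtoC c)); [apply cder_const|]; apply cder_minus; [apply cder_id | apply cder_const]|]. ring.
      - intros t. apply pcont_mult; [|apply pcont_circ]. apply pcont_comp; [apply pcont_homot|apply Hc, Hin].
      - unfold homot, circ. rewrite cos_2PI, sin_2PI, cos_0, sin_0. reflexivity. }
    apply (f_equal Re) in Z. change (RInt (D c) 0 (2 * PI) = 0%R) in Z.
    rewrite Z; ring.
Qed.

End Cauchy.

(** * Complex series and the power series expansion *)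

Fixpoint csum (u : nat -> C) (n : nat) : C :=
  match n with O => 0 | S m => csum u m + u m end.

Definition cseries (u : nat -> C) (l : C) : Prop :=
  forall eps : R, (0 < eps)%R -> exists N : nat, forall n : nat, (N <= n)%nat ->
    (Cmod (csum u n - l) < eps)%R.

Lemma csum_S (u : nat -> C) (n : nat) : csum u (S n) = csum u n + u n.
Proof. reflexivity. Qed.

Lemma csum_ext (u v : nat -> C) (n : nat) :
  (forall k, (k < n)%nat -> u k = v k) -> csum u n = csum v n.
Proof.
  induction n as [|n IH]; simpl; auto. intros H. rewrite IH, H; auto.
Qed.

Lemma csum_plus (u v : nat -> C) (n : nat) :
  csum (fun k => u k + v k) n = csum u n + csum v n.
Proof. induction n as [|n IH]; simpl; [ring|]. rewrite IH; ring. Qed.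

Lemma csum_scal (c : C) (u : nat -> C) (n : nat) :
  csum (fun k => c * u k) n = c * csum u n.
Proof. induction n as [|n IH]; simpl; [ring|]. rewrite IH; ring. Qed.

Lemma csum_sum_n (u : nat -> C) (n : nat) : @sum_n C_AbelianMonoid u n = csum u (S n).
Proof.
  induction n as [|n IH].
  - rewrite sum_O. simpl; ring.
  - rewrite sum_Sn, IH. reflexivity.
Qed.

Lemma pow_n_Cpow (x : C) (k : nat) : @pow_n C_Ring x k = x ^ k.
Proof. induction k as [|k IH]; [reflexivity|]. simpl. rewrite IH. reflexivity. Qed.

Lemma is_pseries_cseries (a : nat -> C) (x l : C) :
  @is_pseries C_AbsRing C_NormedModule a x l <-> cseries (fun k => a k * x ^ k) l.
Proof.
  assert (E : forall n, @sum_n C_AbelianMonoid (fun k => @scal C_AbsRing C_NormedModule (@pow_n C_Ring x k) (a k)) n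
    = csum (fun k => a k * x ^ k) (S n)).
  { intros n. rewrite csum_sum_n. apply csum_ext. intros k _. rewrite pow_n_Cpow.
    change (x ^ k * a k = a k * x ^ k). ring. }
  split.
  - intros H eps He.
    assert (L : locally l (fun w : C => Cmod (w - l) < eps)%R).
    { apply near_locally. exists eps; split; auto. }
    destruct (H _ L) as [N HN]. exists (S N). intros n Hn. destruct n as [|n]; [lia|].
    rewrite <- E. apply HN. lia.
  - intros H P HP. apply near_locally in HP. destruct HP as (d & Hd & HP).
    destruct (H d Hd) as [N HN]. exists N. intros n Hn. apply HP.
    eapply Rle_lt_trans; [|apply (HN (S n)); lia]. right. f_equal. f_equal. apply E.
Qed.

Lemma cseries_unique (u : nat -> C) (l m : C) : cseries u l -> cseries u m -> l = m.
Proof.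
  intros Hl Hm. apply Ceq_minus. apply Cmod_eq_0.
  destruct (Cmod_ge_0 (l - m)) as [Hp|]; auto. exfalso.
  destruct (Hl (Cmod (l - m) / 2)%R ltac:(lra)) as [N1 H1].
  destruct (Hm (Cmod (l - m) / 2)%R ltac:(lra)) as [N2 H2].
  specialize (H1 (N1 + N2)%nat ltac:(lia)). specialize (H2 (N1 + N2)%nat ltac:(lia)).
  assert (Cmod (l - m) <= Cmod (csum u (N1 + N2) - m) + Cmod (csum u (N1 + N2) - l))%R; [|lra].
  replace (l - m) with ((csum u (N1 + N2) - m) + - (csum u (N1 + N2) - l)) by ring.
  eapply Rle_trans; [apply Cmod_triangle|]. rewrite Cmod_opp. lra.
Qed.

Lemma cauchy_turn (f f' : C -> C) (R0 r : R) (w : C) :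
  (0 < r < R0)%R -> (Cmod w < r)%R ->
  (forall z, (Cmod z < R0)%R -> cder f z (f' z)) ->
  (forall z, (Cmod z < R0)%R -> ccont f' z) ->
  CI (fun t => f (circ r t) * kern r w t) = f w * CI (kern r w).
Proof.
  intros Hr Hw Hf Hc.
  assert (Hk : pcontinuous (kern r w)) by (intros t; apply (pcont_kern R0); auto).
  rewrite <- CI_scal by auto.
  assert (A : forall g g' : C -> C, (forall z, (Cmod z < R0)%R -> cder g z (g' z)) ->
    (forall z, (Cmod z < R0)%R -> ccont g' z) ->
    RInt (fun t => Re (g (circ r t) * kern r w t)) 0 (2 * PI) = RInt (fun t => Re (g w * kern r w t)) 0 (2 * PI)).
  { intros g g' Hg Hg'. generalize (Re_dens_const g g' R0 r w Hr Hw Hg Hg'). unfold dens, homot.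
    intros E. etransitivity; [|etransitivity; [exact E|]]; apply RInt_ext; intros t _; f_equal; f_equal; f_equal; ring. }
  unfold CI. f_equal.
  - now apply (A f f').
  (* The imaginary part of a complex number is the real part of its product with $-i$, so the first
     half applies to $-if$. *)
  - assert (B := A (fun z => (- Ci) * f z) (fun z => (- Ci) * f' z)).
    etransitivity; [|etransitivity; [apply B|]].
    + apply RInt_ext; intros t _. unfold Ci; destruct (f (circ r t)), (kern r w t); simpl; ring.
    + intros z Hz. eapply cder_eq; [apply cder_mult; [apply cder_const | apply Hf, Hz]|]. cbv beta; ring.
    + intros z Hz. apply ccont_mult; [apply ccont_const | auto].
    + apply RInt_ext; intros t _. unfold Ci; destruct (f w), (kern r w t); simpl; ring.
Qed.

Lemma circ_neq0 (r t : R) : (0 < r)%R -> circ r t <> 0.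
Proof. intros Hr E. generalize (Cmod_circ r t ltac:(lra)). rewrite E, Cmod_0. lra. Qed.

Lemma pcont_pow (p : R -> C) (t : R) (n : nat) : pcont p t -> pcont (fun u => p u ^ n) t.
Proof.
  intros H; induction n as [|n IH]; [apply (pcont_const 1) | now apply (pcont_mult p (fun u => p u ^ n))].
Qed.

(** The finite geometric expansion
    $\frac{\zeta}{\zeta-w}=\sum_{k<n}(w/\zeta)^k+(w/\zeta)^n\frac{\zeta}{\zeta-w}$ on the circle,
    integrated against [F]. The remainder is kept exact so that it can be estimated. *)
Lemma CI_geom (F : R -> C) (r : R) (w : C) (n : nat) :
  (0 < r)%R -> (Cmod w < r)%R -> pcontinuous F ->
  CI (fun t => F t * kern r w t) =
  csum (fun k => CI (fun t => F t / circ r t ^ k) * w ^ k) n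
  + CI (fun t => F t * (w / circ r t) ^ n * kern r w t).
Proof.
  intros Hr Hw HF.
  assert (Hk : pcontinuous (kern r w)) by (intros t; apply (pcont_kern (r + 1)); auto; lra).
  assert (Hi : pcontinuous (fun t => / circ r t)) by (intros t; apply pcont_inv; [apply pcont_circ | now apply circ_neq0]).
  induction n as [|n IH].
  - simpl. rewrite Cplus_0_l. apply CI_ext; intros t. ring.
  - rewrite IH. simpl csum. rewrite <- Cplus_assoc. f_equal.
    rewrite Cmult_comm, <- CI_scal, <- CI_plus.
    + apply CI_ext; intros t. unfold kern.
      assert (circ r t <> 0) by now apply circ_neq0.
      assert (circ r t - w <> 0) by (apply (circ_neq (r+1)); auto; lra).
      assert (E : (w / circ r t) ^ n = w ^ n / circ r t ^ n).
      { unfold Cdiv. rewrite Cpow_mult_l, Cpow_inv; auto. }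
      simpl. rewrite E. field. repeat split; auto. now apply Cpow_nz.
    + intros t. apply pcont_mult; [apply pcont_const|]. apply pcont_mult; [apply HF|].
      apply pcont_inv; [apply pcont_pow, pcont_circ | apply Cpow_nz; now apply circ_neq0].
    + intros t. apply pcont_mult; [|apply Hk]. apply pcont_mult; [apply HF|].
      apply (pcont_pow (fun u => w / circ r u)). apply pcont_mult; [apply pcont_const | apply Hi].
    + intros t. apply pcont_mult; [apply HF|].
      apply pcont_inv; [apply pcont_pow, pcont_circ | apply Cpow_nz; now apply circ_neq0].
Qed.

Lemma Cpow_le_1_limit (q : R) : (0 <= q < 1)%R -> forall eps : R, (0 < eps)%R ->
  exists N, forall n, (N <= n)%nat -> (q ^ n < eps)%R.
Proof.
  intros Hq eps He. destruct (pow_lt_1_zero q) with (y := eps) as [N HN]; auto.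
  { rewrite Rabs_pos_eq; lra. }
  exists N; intros n Hn. eapply Rle_lt_trans; [apply Rle_abs|]. now apply HN.
Qed.

Lemma CI_geom_series (F : R -> C) (r M : R) (w : C) :
  (0 < r)%R -> (Cmod w < r)%R -> pcontinuous F -> (forall t, 0 <= t <= 2 * PI -> Cmod (F t) <= M)%R ->
  cseries (fun k => CI (fun t => F t / circ r t ^ k) * w ^ k) (CI (fun t => F t * kern r w t)).
Proof.
  intros Hr Hw HF HM eps He.
  assert (HM0 : (0 <= M)%R) by (eapply Rle_trans; [apply Cmod_ge_0 | apply (HM 0%R); generalize PI_RGT_0; lra]).
  assert (Hw0 := Cmod_ge_0 w). assert (Pp := PI_RGT_0).
  set (B := (4 * PI * (M * (r / (r - Cmod w))) + 1)%R).
  assert (HB : (0 <= M * (r / (r - Cmod w)))%R).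
  { apply Rmult_le_pos; auto. apply Rlt_le, Rdiv_lt_0_compat; lra. }
  assert (HB1 : (0 < B)%R) by (unfold B; nra).
  assert (Hq : (0 <= Cmod w / r < 1)%R).
  { split; [apply Rmult_le_pos; auto; apply Rlt_le, Rinv_0_lt_compat; auto|].
    apply Rmult_lt_reg_r with r; auto. unfold Rdiv; rewrite Rmult_assoc, Rinv_l; lra. }
  destruct (Cpow_le_1_limit (Cmod w / r) Hq (eps / B)%R) as [N HN]; [now apply Rdiv_lt_0_compat|].
  exists N. intros n Hn. specialize (HN n Hn).
  rewrite (CI_geom F r w n) by auto.
  match goal with |- (Cmod (?a - (?a + ?b)) < _)%R => replace (a - (a + b)) with (- b) by ring end.
  rewrite Cmod_opp.
  assert (Hk : pcontinuous (kern r w)) by (intros t; apply (pcont_kern (r + 1)); auto; lra).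
  eapply Rle_lt_trans; [apply CI_bound with (M := (M * (Cmod w / r) ^ n * (r / (r - Cmod w)))%R)|].
  - intros t. apply pcont_mult; [|apply Hk]. apply pcont_mult; [apply HF|].
    apply (pcont_pow (fun u => w / circ r u)). apply pcont_mult; [apply pcont_const|].
    apply pcont_inv; [apply pcont_circ | now apply circ_neq0].
  - intros t Ht. assert (C0 : circ r t <> 0) by now apply circ_neq0.
    assert (C1 : circ r t - w <> 0) by (apply (circ_neq (r+1)); auto; lra).
    assert (C2 : (r - Cmod w <= Cmod (circ r t - w))%R).
    { assert (Cmod (circ r t) <= Cmod (circ r t - w) + Cmod w)%R.
      { replace (circ r t) with ((circ r t - w) + w) at 1 by ring. apply Cmod_triangle. }
      rewrite Cmod_circ in H; lra. }
    rewrite !Cmod_mult. unfold kern. rewrite Cmod_pow, !Cmod_div, Cmod_circ by (auto; lra).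
    apply Rmult_le_compat.
    + apply Rmult_le_pos; [apply Cmod_ge_0 | apply pow_le; tauto].
    + apply Rlt_le, Rdiv_lt_0_compat; lra.
    + apply Rmult_le_compat_r; [apply pow_le; tauto | now apply HM].
    + apply Rmult_le_compat_l; [lra|]. apply Rinv_le_contravar; lra.
  - assert (Hp : (0 <= (Cmod w / r) ^ n)%R) by (apply pow_le; tauto).
    apply Rle_lt_trans with ((Cmod w / r) ^ n * B)%R; [unfold B; nra|].
    apply Rlt_le_trans with (eps / B * B)%R; [apply Rmult_lt_compat_r; auto|].
    right; field; lra.
Qed.

(** With $\zeta=re^{it}$, the function $\zeta^{-(k+1)}$ is the derivative in $t$ of
    $\frac{i}{k+1}\zeta^{-(k+1)}$. *)
Lemma CI_circ_pow (r : R) (k : nat) : (0 < r)%R -> CI (fun t => 1 / circ r t ^ S k) = 0.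
Proof.
  intros Hr. assert (HS : RtoC (INR (S k)) <> 0).
  { intro E; apply RtoC_inj in E. generalize (lt_0_INR (S k) ltac:(lia)); lra. }
  apply (CI_derive (fun t => (Ci / RtoC (INR (S k))) * / circ r t ^ S k)).
  - intros t. assert (Hz : circ r t <> 0) by now apply circ_neq0.
    replace (1 / circ r t ^ S k)
      with ((Ci / RtoC (INR (S k))) * (- (RtoC (INR (S k)) * circ r t ^ k * 1) / (circ r t ^ S k * circ r t ^ S k)) * (Ci * circ r t)).
    + apply (cder_curve (fun z => (Ci / RtoC (INR (S k))) * / z ^ S k)); [|apply rder_circ].
      eapply cder_eq; [apply (cder_mult (fun _ => _)); [apply cder_const|]; apply cder_inv; [apply (cder_pow (fun z => z)); apply cder_id|]|].
      * apply (ccont_neq0 (fun z => z ^ S k)); [|now apply Cpow_nz].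
        eapply cder_cont. apply (cder_pow (fun z => z)); apply cder_id.
      * cbv beta. simpl pred. ring.
    + transitivity (- (Ci * Ci) / circ r t ^ S k).
      * simpl. field. repeat split; auto. now apply Cpow_nz.
      * replace (Ci * Ci) with (Copp 1); [f_equal; ring|].
        unfold Ci, Cmult, Copp, RtoC; simpl; f_equal; ring.
  - intros t. apply pcont_mult; [apply pcont_const|].
    apply pcont_inv; [apply pcont_pow, pcont_circ | apply Cpow_nz; now apply circ_neq0].
  - unfold circ. rewrite cos_2PI, sin_2PI, cos_0, sin_0. reflexivity.
Qed.

(** The expansion of the kernel for [F] constantly $1$: only the term $k=0$ survives integration. *)
Lemma CI_kern (r : R) (w : C) : (0 < r)%R -> (Cmod w < r)%R -> CI (kern r w) = RtoC (2 * PI).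
Proof.
  intros Hr Hw.
  assert (H : cseries (fun k => CI (fun t => 1 / circ r t ^ k) * w ^ k) (CI (fun t => 1 * kern r w t))).
  { apply (CI_geom_series (fun _ => 1) r 1); auto.
    - intros t; apply pcont_const.
    - intros t _. rewrite Cmod_1; lra. }
  transitivity (CI (fun t => 1 * kern r w t)); [apply CI_ext; intros; ring|].
  apply (cseries_unique _ _ _ H). intros eps He. exists 1%nat. intros n Hn.
  replace (csum _ n) with (RtoC (2 * PI)).
  { replace (RtoC (2 * PI) - RtoC (2 * PI)) with (RtoC 0) by ring. now rewrite Cmod_0. }
  induction n as [|n IH]; [lia|]. simpl csum. destruct n as [|n].
  - simpl. transitivity (0 + CI (fun _ => 1) * 1).
    + rewrite CI_const; ring.
    + f_equal. f_equal. apply CI_ext. intros t. field.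
  - rewrite <- IH by lia. rewrite (CI_circ_pow r n Hr). ring.
Qed.

(** Cauchy's formula on the circle of radius $R_0/2$ and the geometric expansion of its kernel give
    the coefficients $\frac1{2\pi}\int_0^{2\pi}f(z_0+\zeta)\,\zeta^{-k}\,dt$. The lemma links
    differentiability with the predicate [analytic_at] of the continuation. *)
Theorem cauchy_power_series (f f' : C -> C) (z0 : C) (R0 : R) :
  (0 < R0)%R ->
  (forall z, (Cmod (z - z0) < R0)%R -> cder f z (f' z)) ->
  (forall z, (Cmod (z - z0) < R0)%R -> ccont f' z) ->
  analytic_at f z0.
Proof.
  intros HR Hf Hc. set (r := (R0 / 2)%R).
  set (g := fun z => f (z0 + z)). set (g' := fun z => f' (z0 + z)).
  assert (Hs : forall z, ccont (fun z => z0 + z) z).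
  { intros z. apply ccont_plus; [apply ccont_const | apply ccont_id]. }
  assert (Hg : forall z, (Cmod z < R0)%R -> cder g z (g' z)).
  { intros z Hz. unfold g, g'. eapply cder_eq.
    - apply (cder_comp (fun z => z0 + z) f).
      + apply cder_plus; [apply cder_const | apply cder_id].
      + apply Hf. now replace (z0 + z - z0) with z by ring.
    - ring. }
  assert (Hg' : forall z, (Cmod z < R0)%R -> ccont g' z).
  { intros z Hz. apply (ccont_comp (fun z => z0 + z) f'); auto. apply Hc. now replace (z0 + z - z0) with z by ring. }
  assert (HF : pcontinuous (fun t => g (circ r t))).
  { intros t. apply pcont_comp; [apply pcont_circ|]. eapply cder_cont, Hg. rewrite Cmod_circ; unfold r; lra. }
  assert (HM : exists M, forall t, (0 <= t <= 2 * PI)%R -> (Cmod (g (circ r t)) <= M)%R).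
  { destruct (continuity_ab_maj (fun t => Cmod (g (circ r t))) 0 (2 * PI)) as (m & Hm & _).
    - generalize PI_RGT_0; lra.
    - intros t _. apply continuity_pt_filterlim, continuous_R_eps. intros e He.
      destruct (HF t e He) as (d & Hd & K). exists d; split; auto. intros u Hu.
      eapply Rle_lt_trans; [|apply (K u Hu)].
      apply Rabs_le_between. assert (A := Cmod_triangle (g (circ r u) - g (circ r t)) (g (circ r t))).
      assert (B := Cmod_triangle (g (circ r t) - g (circ r u)) (g (circ r u))).
      replace (g (circ r u) - g (circ r t) + g (circ r t)) with (g (circ r u)) in A by ring.
      replace (g (circ r t) - g (circ r u) + g (circ r u)) with (g (circ r t)) in B by ring.
      replace (g (circ r t) - g (circ r u)) with (- (g (circ r u) - g (circ r t))) in B by ring.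
      rewrite Cmod_opp in B. lra.
    - eexists; intros t Ht. apply Hm, Ht. }
  destruct HM as [M HM].
  exists (fun k => CI (fun t => g (circ r t) / circ r t ^ k) / RtoC (2 * PI)), r.
  split; [unfold r; lra|]. intros z Hz. apply is_pseries_cseries.
  set (w := z - z0) in *.
  assert (Pp := PI_RGT_0).
  assert (HP : RtoC (2 * PI) <> 0) by (intro E; apply RtoC_inj in E; lra).
  assert (S := CI_geom_series (fun t => g (circ r t)) r M w ltac:(unfold r; lra) Hz HF HM).
  cbv beta in S; rewrite (cauchy_turn g g' R0 r w) in S by (auto; unfold r; lra).
  rewrite CI_kern in S by (auto; unfold r; lra).
  intros eps He. destruct (S (2 * PI * eps)%R) as [N HN]; [apply Rmult_lt_0_compat; lra|].
  exists N; intros n Hn. specialize (HN n Hn).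
  rewrite (csum_ext _ (fun k => / RtoC (2 * PI) * (CI (fun t => g (circ r t) / circ r t ^ k) * w ^ k))).
  2:{ intros k _. field. auto. }
  rewrite csum_scal.
  replace (f z) with (g w) by (unfold g, w; f_equal; ring).
  match goal with |- (Cmod (/ ?p * ?s - ?x) < _)%R => replace (/ p * s - x) with ((s - x * p) / p) by (field; auto) end.
  rewrite Cmod_div by auto. rewrite Cmod_R, Rabs_pos_eq by lra.
  apply Rmult_lt_reg_r with (2 * PI)%R; [lra|].
  unfold Rdiv; rewrite Rmult_assoc, Rinv_l by lra. lra.
Qed.

Lemma csum_Re (u : nat -> C) (n : nat) : Re (csum u (S n)) = sum_n (fun k => Re (u k)) n.
Proof.
  induction n as [|n IH].
  - rewrite sum_O. simpl csum. now rewrite Cplus_0_l.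
  - rewrite sum_Sn, <- IH. reflexivity.
Qed.

Lemma csum_Im (u : nat -> C) (n : nat) : Im (csum u (S n)) = sum_n (fun k => Im (u k)) n.
Proof.
  induction n as [|n IH].
  - rewrite sum_O. simpl csum. now rewrite Cplus_0_l.
  - rewrite sum_Sn, <- IH. reflexivity.
Qed.

Lemma is_series_eps (a : nat -> R) (l : R) :
  is_series a l <-> forall eps : R, (0 < eps)%R -> exists N, forall n, (N <= n)%nat ->
    (Rabs (sum_n a n - l) < eps)%R.
Proof.
  split.
  - intros H eps He. destruct (proj2 (is_lim_seq_spec (sum_n a) (Finite l)) H (mkposreal eps He)) as [N HN].
    exists N. exact HN.
  - intros H. apply (is_lim_seq_spec (sum_n a) (Finite l)). intros eps.
    destruct (H eps (cond_pos eps)) as [N HN]. exists N. exact HN.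
Qed.

Lemma cseries_comps (u : nat -> C) (l : C) :
  cseries u l <-> is_series (fun n => Re (u n)) (Re l) /\ is_series (fun n => Im (u n)) (Im l).
Proof.
  split.
  - intros H. split; apply is_series_eps; intros eps He; destruct (H eps He) as [N HN];
    exists N; intros n Hn; (eapply Rle_lt_trans; [|apply (HN (S n)); lia]).
    + rewrite <- csum_Re. exact (re_le_Cmod (csum u (S n) - l)).
    + rewrite <- csum_Im. exact (im_le_Cmod (csum u (S n) - l)).
  - intros [H1 H2] eps He.
    destruct (proj1 (is_series_eps _ _) H1 (eps/2)%R ltac:(lra)) as [N1 K1].
    destruct (proj1 (is_series_eps _ _) H2 (eps/2)%R ltac:(lra)) as [N2 K2].
    exists (S (N1 + N2)). intros n Hn. destruct n as [|n]; [lia|].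
    eapply Rle_lt_trans; [apply Cmod_le_comp|].
    specialize (K1 n ltac:(lia)). specialize (K2 n ltac:(lia)).
    change (Re (csum u (S n) - l)) with (Re (csum u (S n)) - Re l)%R.
    change (Im (csum u (S n) - l)) with (Im (csum u (S n)) - Im l)%R.
    rewrite csum_Re, csum_Im. lra.
Qed.

Lemma CSeries_unique (u : nat -> C) (l : C) : cseries u l -> CSeries u = l.
Proof.
  intros H. apply cseries_comps in H. destruct H as [H1 H2].
  unfold CSeries. rewrite (is_series_unique _ _ H1), (is_series_unique _ _ H2).
  now destruct l.
Qed.

Definition csummable (u : nat -> C) : Prop := ex_series (fun n => Cmod (u n)).

Lemma ex_series_le_R (a b : nat -> R) : (forall n, (0 <= a n <= b n)%R) -> ex_series b -> ex_series a.
Proof.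
  intros H Hb. apply (ex_series_le (K := R_AbsRing) (V := R_CompleteNormedModule)) with b; auto.
  intros n. change (norm (a n)) with (Rabs (a n)). rewrite Rabs_pos_eq; apply H.
Qed.

Lemma csummable_cseries (u : nat -> C) : csummable u -> cseries u (CSeries u).
Proof.
  intros H. apply cseries_comps. split; apply Series_correct; apply ex_series_Rabs;
  (eapply ex_series_le_R; [|exact H]); intros n; split; auto using Rabs_pos, re_le_Cmod, im_le_Cmod.
Qed.

Lemma csummable_le (u : nat -> C) (b : nat -> R) :
  (forall n, (Cmod (u n) <= b n)%R) -> ex_series b -> csummable u.
Proof. intros H Hb. apply (ex_series_le_R _ b); auto. intros n; split; auto using Cmod_ge_0. Qed.

Lemma CSeries_ext (u v : nat -> C) : (forall n, u n = v n) -> CSeries u = CSeries v.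
Proof. intros H. unfold CSeries. f_equal; apply Series_ext; intros n; now rewrite H. Qed.

Lemma cseries_ext (u v : nat -> C) (l : C) : (forall n, u n = v n) -> cseries u l -> cseries v l.
Proof.
  intros E H eps He. destruct (H eps He) as [N HN]. exists N; intros n Hn.
  rewrite <- (csum_ext u v); auto.
Qed.

Lemma cseries_plus (u v : nat -> C) (l m : C) :
  cseries u l -> cseries v m -> cseries (fun n => u n + v n) (l + m).
Proof.
  intros Hu Hv eps He.
  destruct (Hu (eps/2)%R ltac:(lra)) as [N1 K1]. destruct (Hv (eps/2)%R ltac:(lra)) as [N2 K2].
  exists (N1 + N2)%nat. intros n Hn. rewrite csum_plus.
  replace (csum u n + csum v n - (l + m)) with ((csum u n - l) + (csum v n - m)) by ring.
  eapply Rle_lt_trans; [apply Cmod_triangle|].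
  specialize (K1 n ltac:(lia)). specialize (K2 n ltac:(lia)). lra.
Qed.

Lemma cseries_scal (c : C) (u : nat -> C) (l : C) :
  cseries u l -> cseries (fun n => c * u n) (c * l).
Proof.
  intros Hu eps He. assert (Pc := Cmod_ge_0 c).
  destruct (Hu (eps / (Cmod c + 1))%R) as [N K]; [apply Rdiv_lt_0_compat; lra|].
  exists N. intros n Hn. rewrite csum_scal.
  replace (c * csum u n - c * l) with (c * (csum u n - l)) by ring.
  rewrite Cmod_mult. specialize (K n Hn).
  apply Rle_lt_trans with ((Cmod c + 1) * Cmod (csum u n - l))%R.
  - apply Rmult_le_compat_r; [apply Cmod_ge_0 | lra].
  - replace eps with ((Cmod c + 1) * (eps / (Cmod c + 1)))%R by (field; lra).
    apply Rmult_lt_compat_l; lra.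
Qed.

Lemma csum_Cmod (u : nat -> C) (n : nat) :
  (Cmod (csum u (S n)) <= sum_n (fun k => Cmod (u k)) n)%R.
Proof.
  induction n as [|n IH].
  - rewrite sum_O. simpl. rewrite Cplus_0_l. lra.
  - rewrite sum_Sn. eapply Rle_trans; [apply (Cmod_triangle (csum u (S n)) (u (S n)))|].
    unfold plus; simpl plus. simpl in *. lra.
Qed.

Lemma sum_n_le_Series (a : nat -> R) (n : nat) :
  (forall k, 0 <= a k)%R -> ex_series a -> (sum_n a n <= Series a)%R.
Proof.
  intros Ha He. apply (is_lim_seq_incr_compare (sum_n a)).
  - apply Series_correct, He.
  - intros k. rewrite sum_Sn. unfold plus; simpl. generalize (Ha (S k)); lra.
Qed.

Lemma cseries_Cmod_le (u : nat -> C) (l : C) (b : nat -> R) :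
  cseries u l -> (forall n, (Cmod (u n) <= b n)%R) -> ex_series b ->
  (Cmod l <= Series b)%R.
Proof.
  intros Hu Hb He. apply le_epsilon. intros eps Heps.
  destruct (Hu eps Heps) as [N HN]. specialize (HN (S N) ltac:(lia)).
  replace l with (csum u (S N) + - (csum u (S N) - l)) by ring.
  eapply Rle_trans; [apply Cmod_triangle|]. rewrite Cmod_opp.
  assert (A := csum_Cmod u N).
  assert (B : (sum_n (fun k => Cmod (u k)) N <= sum_n b N)%R) by (apply sum_n_m_le; auto).
  assert (D : (sum_n b N <= Series b)%R).
  { apply sum_n_le_Series; auto. intros k. eapply Rle_trans; [apply Cmod_ge_0|apply Hb]. }
  lra.
Qed.

(** * Termwise differentiation of series with gaps *)

Lemma cder_local (f phi : C -> C) (z l : C) :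
  ccont phi z -> phi z = l -> near z (fun w => f w - f z = phi w * (w - z)) -> cder f z l.
Proof.
  intros Hp <- Hn. apply (cder_ext (fun w => f z + phi w * (w - z))).
  - revert Hn; apply near_imp; intros w Hw. rewrite <- Hw; ring.
  - exists phi. split; auto. split; auto. intros w. ring.
Qed.

(* [gsum w q k] is [(w^k - q^k) / (w - q)]. *)
Fixpoint gsum (w q : C) (k : nat) : C :=
  match k with O => 0 | S m => w * gsum w q m + q ^ m end.

Lemma gsum_mult (w q : C) (k : nat) : w ^ k - q ^ k = gsum w q k * (w - q).
Proof.
  induction k as [|k IH]; simpl; [ring|].
  transitivity (w * (w ^ k - q ^ k) + q ^ k * (w - q)); [ring|]. rewrite IH; ring.
Qed.

Lemma gsum_diag (q : C) (k : nat) : gsum q q k = RtoC (INR k) * q ^ pred k.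
Proof.
  induction k as [|k IH]; [simpl; ring|]. simpl gsum. rewrite IH, S_INR, RtoC_plus.
  destruct k; simpl; ring.
Qed.

(** [gsum] is a sum of [k] monomials of degree $k-1$. Multiplication by [rho] restores the exponent
    [k] and avoids a predecessor at $k=0$. *)
Lemma gsum_bound (w q : C) (rho : R) (k : nat) : (0 <= rho)%R ->
  (Cmod w <= rho)%R -> (Cmod q <= rho)%R -> (Cmod (gsum w q k) * rho <= INR k * rho ^ k)%R.
Proof.
  intros Hr Hw Hq. induction k as [|k IH]; [simpl; rewrite Cmod_0; lra|].
  rewrite S_INR. simpl gsum. simpl pow.
  apply Rle_trans with ((Cmod w * Cmod (gsum w q k) + Cmod q ^ k) * rho)%R.
  - apply Rmult_le_compat_r; auto. rewrite <- Cmod_mult, <- Cmod_pow. apply Cmod_triangle.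
  - assert (P := Cmod_ge_0 w). assert (Q := Cmod_ge_0 (gsum w q k)).
    assert (Cmod q ^ k <= rho ^ k)%R by (apply pow_incr; split; auto using Cmod_ge_0).
    assert (Cmod w * (Cmod (gsum w q k) * rho) <= rho * (INR k * rho ^ k))%R
      by (apply Rmult_le_compat; auto; apply Rmult_le_pos; auto).
    nra.
Qed.

(** The second-order counterpart, multiplied by $\rho^2$ for the same reason. It makes the
    difference quotients of a series continuous as soon as the terms with weight $k^2\rho^k$ are
    summable. *)
Lemma gsum_diff (w q : C) (rho : R) (k : nat) : (0 <= rho)%R ->
  (Cmod w <= rho)%R -> (Cmod q <= rho)%R ->
  (Cmod (gsum w q k - gsum q q k) * (rho * rho) <= Cmod (w - q) * (INR k * INR k * rho ^ k))%R.
Proof.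
  intros Hr Hw Hq. induction k as [|k IH].
  - simpl. replace (0 - 0) with (RtoC 0) by ring. rewrite Cmod_0. lra.
  - rewrite S_INR. simpl gsum. simpl pow.
    replace (w * gsum w q k + q ^ k - (q * gsum q q k + q ^ k))
      with (w * (gsum w q k - gsum q q k) + (w - q) * gsum q q k) by ring.
    apply Rle_trans with ((Cmod w * Cmod (gsum w q k - gsum q q k) + Cmod (w - q) * Cmod (gsum q q k)) * (rho * rho))%R.
    + apply Rmult_le_compat_r; [nra|]. rewrite <- !Cmod_mult. apply Cmod_triangle.
    + assert (B := gsum_bound q q rho k Hr Hq Hq).
      assert (P := Cmod_ge_0 (w - q)). assert (Q := Cmod_ge_0 (gsum w q k - gsum q q k)).
      assert (Pk := pos_INR k). assert (Pr : (0 <= rho ^ k)%R) by now apply pow_le.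
      assert (A : (Cmod w * (Cmod (gsum w q k - gsum q q k) * (rho * rho)) <= rho * (Cmod (w - q) * (INR k * INR k * rho ^ k)))%R).
      { apply Rmult_le_compat; auto using Cmod_ge_0. apply Rmult_le_pos; nra. }
      assert (A2 : (Cmod (w - q) * rho * (Cmod (gsum q q k) * rho) <= Cmod (w - q) * rho * (INR k * rho ^ k))%R).
      { apply Rmult_le_compat_l; nra. }
      assert (0 <= Cmod (w - q) * rho * rho ^ k)%R by (repeat apply Rmult_le_pos; auto).
      assert (0 <= Cmod (w - q) * rho * rho ^ k * INR k)%R by (repeat apply Rmult_le_pos; auto).
      lra.
Qed.

(** This is $kx^{k-1}\le1+x+\dots+x^{k-1}$ cleared of denominators. It absorbs the factor $k$ of a
    derivative into a slightly larger radius. *)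
Lemma pow_geom_bound (x : R) (k : nat) : (0 <= x < 1)%R -> (INR k * x ^ pred k * (1 - x) <= 1)%R.
Proof.
  intros Hx.
  assert (H : forall k, (INR k * x ^ pred k * (1 - x) <= 1 - x ^ k)%R).
  { induction k0 as [|m IH]; [simpl; lra|]. rewrite S_INR. simpl pred. simpl pow.
    destruct m as [|m]; [simpl; lra|]. simpl pred in IH. simpl pow in *.
    assert (P : (0 <= x ^ m)%R) by (apply pow_le; lra). assert (Q := pos_INR (S m)).
    assert (R1 : (x * (INR (S m) * x ^ m * (1 - x)) <= x * (1 - x * x ^ m))%R) by (apply Rmult_le_compat_l; lra).
    assert (P1 : (x ^ m <= 1)%R) by (rewrite <- (pow1 m); apply pow_incr; lra).
    assert (0 <= (1 - x) * (1 - x * x ^ m))%R by (apply Rmult_le_pos; nra).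
    lra. }
  generalize (H k). assert (0 <= x ^ k)%R by (apply pow_le; lra). lra.
Qed.

Section GapSeries.

Variables (a : nat -> C) (e : nat -> nat) (R0 : R).

(** The exponent function [e] treats power series and theta series alike, without zero coefficients
    being inserted between the squares. *)
Definition gap_summable (a : nat -> C) (e : nat -> nat) (R0 : R) : Prop :=
  forall rho : R, (0 <= rho < R0)%R -> ex_series (fun n => Cmod (a n) * rho ^ e n)%R.

(** At the radius [r'] halfway between [rho] and [R0] the series converges, and the geometric factor
    $(\rho/r')^{k-1}$ compensates the new factor $k$. *)
Lemma gap_summable_derive :
  gap_summable a e R0 -> gap_summable (fun n => a n * RtoC (INR (e n))) (fun n => pred (e n)) R0.
Proof.
  intros H rho Hr. set (r' := ((rho + R0) / 2)%R).
  assert (Hr' : (rho < r' < R0)%R) by (unfold r'; lra).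
  apply ex_series_le_R with (b := fun n => (/ ((1 - rho / r') * r') * (Cmod (a n) * r' ^ e n))%R).
  2:{ apply (ex_series_scal (K := R_AbsRing) (V := R_NormedModule)). apply H; lra. }
  intros n. assert (P := Cmod_ge_0 (a n)). assert (Q := pos_INR (e n)).
  assert (Pr : (0 <= rho ^ pred (e n))%R) by (apply pow_le; lra).
  rewrite Cmod_mult, Cmod_R, (Rabs_pos_eq (INR (e n))) by auto.
  split; [repeat apply Rmult_le_pos; auto|].
  assert (Hx : (0 <= rho / r' < 1)%R).
  { split; [apply Rmult_le_pos; [lra|]; apply Rlt_le, Rinv_0_lt_compat; lra|].
    apply Rmult_lt_reg_r with r'; [lra|]. unfold Rdiv; rewrite Rmult_assoc, Rinv_l; lra. }
  assert (B := pow_geom_bound (rho / r') (e n) Hx).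
  assert (Hd : (0 < (1 - rho / r') * r')%R) by (apply Rmult_lt_0_compat; lra).
  apply Rmult_le_reg_l with ((1 - rho / r') * r')%R; auto.
  rewrite <- Rmult_assoc with (r2 := (/ ((1 - rho / r') * r'))%R), Rinv_r, Rmult_1_l by lra.
  destruct (e n) as [|k] eqn:Ek.
  - simpl INR. replace ((1 - rho / r') * r' * (Cmod (a n) * 0 * rho ^ pred 0))%R with 0%R by ring.
    apply Rmult_le_pos; auto.
  - simpl pred in *.
    assert (E : (rho ^ k = (rho / r') ^ k * r' ^ k)%R).
    { rewrite <- Rpow_mult_distr. f_equal. field; lra. }
    rewrite E. simpl pow.
    assert (Pk : (0 <= r' * r' ^ k)%R) by (apply Rmult_le_pos; [lra | apply pow_le; lra]).
    replace ((1 - rho / r') * r' * (Cmod (a n) * INR (S k) * ((rho / r') ^ k * r' ^ k)))%R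
      with (INR (S k) * (rho / r') ^ k * (1 - rho / r') * (Cmod (a n) * (r' * r' ^ k)))%R by ring.
    rewrite <- (Rmult_1_l (Cmod (a n) * (r' * r' ^ k))) at 2.
    apply Rmult_le_compat_r; auto. now apply Rmult_le_pos.
Qed.

Lemma gap_csummable (q : C) : gap_summable a e R0 -> (Cmod q < R0)%R ->
  csummable (fun n => a n * q ^ e n).
Proof.
  intros H Hq. eapply csummable_le; [|apply (H (Cmod q)); split; auto using Cmod_ge_0].
  intros n. rewrite Cmod_mult, Cmod_pow. apply Rle_refl.
Qed.

End GapSeries.

Lemma ex_series_le_scal (c : R) (a b : nat -> R) :
  (forall n, (0 <= a n <= c * b n)%R) -> ex_series b -> ex_series a.
Proof.
  intros H Hb. apply ex_series_le_R with (fun n => c * b n)%R; auto.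
  apply (ex_series_scal (K := R_AbsRing) (V := R_NormedModule)), Hb.
Qed.

(** The Carathéodory factor is the series of divided differences [a n * gsum w q (e n)]. At [w = q]
    it is the derived series, and [gsum_diff] gives its continuity there. *)
Lemma gap_series_cder (a : nat -> C) (e : nat -> nat) (R0 : R) (q : C) :
  gap_summable a e R0 -> (Cmod q < R0)%R ->
  cder (fun q => CSeries (fun n => a n * q ^ e n)) q
    (CSeries (fun n => a n * RtoC (INR (e n)) * q ^ pred (e n))).
Proof.
  intros H Hq.
  assert (H1 := gap_summable_derive a e R0 H).
  assert (H2 := gap_summable_derive _ _ R0 H1). cbv beta in H2.
  assert (Q0 := Cmod_ge_0 q).
  set (rho := ((Cmod q + R0) / 2)%R). assert (Hr : (Cmod q < rho < R0)%R) by (unfold rho; lra).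
  (* By $e^2=e+e(e-1)$ the quadratic weight is covered by the first and second derived series. *)
  assert (S2 : ex_series (fun n => Cmod (a n) * (INR (e n) * INR (e n) * rho ^ e n))%R).
  { generalize (H1 rho ltac:(lra)) (H2 rho ltac:(lra)); intros K1 K2.
    apply ex_series_le_R with (b := fun n => (rho * (Cmod (a n * RtoC (INR (e n))) * rho ^ pred (e n)) +
      rho * rho * (Cmod (a n * RtoC (INR (e n)) * RtoC (INR (pred (e n)))) * rho ^ pred (pred (e n))))%R).
    2:{ apply (ex_series_plus (K := R_AbsRing) (V := R_NormedModule) (fun n => rho * (Cmod (a n * RtoC (INR (e n))) * rho ^ pred (e n)))%R);
        apply (ex_series_scal (K := R_AbsRing) (V := R_NormedModule)); auto. }
    intros n. assert (P := Cmod_ge_0 (a n)). assert (Qn := pos_INR (e n)). assert (Qn' := pos_INR (pred (e n))).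
    rewrite !Cmod_mult, !Cmod_R, !Rabs_pos_eq by auto.
    assert (Pp : forall k, (0 <= rho ^ k)%R) by (intros; apply pow_le; lra).
    split; [repeat apply Rmult_le_pos; auto|].
    destruct (e n) as [|[|k]]; simpl pred; simpl pow; rewrite ?S_INR; simpl INR.
    - nra.
    - right; ring.
    - right. ring. }
  assert (Hq1 : forall w, (Cmod w <= rho)%R -> csummable (fun n => a n * gsum w q (e n))).
  { intros w Hw.
    apply csummable_le with (fun n => (/ rho * (rho * (Cmod (a n * RtoC (INR (e n))) * rho ^ pred (e n))))%R).
    2:{ apply (ex_series_scal (K := R_AbsRing) (V := R_NormedModule)). apply (ex_series_scal (K := R_AbsRing) (V := R_NormedModule)).
        apply (H1 rho ltac:(lra)). }
    intros n. rewrite !Cmod_mult, Cmod_R, Rabs_pos_eq by auto using pos_INR.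
    apply Rmult_le_reg_r with rho; [lra|].
    assert (B := gsum_bound w q rho (e n) ltac:(lra) Hw ltac:(lra)).
    rewrite Rmult_assoc. apply Rle_trans with (Cmod (a n) * (INR (e n) * rho ^ e n))%R.
    - apply Rmult_le_compat_l; auto using Cmod_ge_0.
    - right. destruct (e n); simpl pred; simpl pow; [simpl; ring | field; lra]. }
  assert (Hq2 : Cmod q <= rho) by lra.
  apply cder_local with (fun w => CSeries (fun n => a n * gsum w q (e n))).
  - intros eps He.
    set (B := (Series (fun n => Cmod (a n) * (INR (e n) * INR (e n) * rho ^ e n)) / (rho * rho) + 1)%R).
    assert (HB : (0 < B)%R).
    { unfold B. apply Rplus_le_lt_0_compat; [|lra]. apply Rmult_le_pos.
      - rewrite <- (Rmult_0_l 0). apply Rle_trans with (Series (fun _ => 0)%R).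
        + right. symmetry. rewrite Rmult_0_l. apply is_series_unique. apply is_series_eps. intros x Hx; exists O; intros n _.
          replace (sum_n (fun _ : nat => 0%R) n) with 0%R; [now rewrite Rminus_diag, Rabs_R0|].
          induction n; [now rewrite sum_O | rewrite sum_Sn, <- IHn; symmetry; apply Rplus_0_l].
        + apply Series_le; auto. intros n; split; [lra|]. repeat apply Rmult_le_pos; auto using Cmod_ge_0, pos_INR. apply pow_le; lra.
      - apply Rlt_le, Rinv_0_lt_compat; nra. }
    exists (Rmin (rho - Cmod q) (eps / B)). split; [apply Rmin_pos; [lra | now apply Rdiv_lt_0_compat]|].
    intros w Hw. assert (Hw1 := Rlt_le_trans _ _ _ Hw (Rmin_l _ _)). assert (Hw2 := Rlt_le_trans _ _ _ Hw (Rmin_r _ _)).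
    assert (Hwr : (Cmod w <= rho)%R).
    { replace w with ((w - q) + q) by ring. eapply Rle_trans; [apply Cmod_triangle|lra]. }
    assert (D : cseries (fun n => a n * gsum w q (e n) + (- (1)) * (a n * gsum q q (e n)))
       (CSeries (fun n => a n * gsum w q (e n)) + (- (1)) * CSeries (fun n => a n * gsum q q (e n)))).
    { apply cseries_plus; [|apply cseries_scal]; apply csummable_cseries; auto. }
    match goal with |- (Cmod ?x < _)%R => replace x with (CSeries (fun n => a n * gsum w q (e n)) + (- (1)) * CSeries (fun n => a n * gsum q q (e n))) by ring end.
    eapply Rle_lt_trans; [apply (cseries_Cmod_le _ _ (fun n => (Cmod (w - q) / (rho * rho)) * (Cmod (a n) * (INR (e n) * INR (e n) * rho ^ e n)))%R D)|].
    + intros n. replace (a n * gsum w q (e n) + (- (1)) * (a n * gsum q q (e n))) with (a n * (gsum w q (e n) - gsum q q (e n))) by ring.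
      rewrite Cmod_mult. apply Rmult_le_reg_r with (rho * rho)%R; [nra|].
      assert (G := gsum_diff w q rho (e n) ltac:(lra) Hwr Hq2).
      rewrite Rmult_assoc.
      apply Rle_trans with (Cmod (a n) * (Cmod (w - q) * (INR (e n) * INR (e n) * rho ^ e n)))%R.
      * apply Rmult_le_compat_l; auto using Cmod_ge_0.
      * right. field. lra.
    + apply (ex_series_scal (K := R_AbsRing) (V := R_NormedModule)), S2.
    + rewrite Series_scal_l.
      apply Rle_lt_trans with (Cmod (w - q) * B)%R.
      * unfold B. assert (P := Cmod_ge_0 (w - q)). unfold Rdiv. nra.
      * apply Rlt_le_trans with (eps / B * B)%R; [apply Rmult_lt_compat_r; auto|]. right; field; lra.
  - apply CSeries_ext. intros n. rewrite gsum_diag. ring.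
  - exists (rho - Cmod q)%R; split; [lra|]. intros w Hw.
    assert (Hwr : (Cmod w <= rho)%R).
    { replace w with ((w - q) + q) by ring. eapply Rle_trans; [apply Cmod_triangle|lra]. }
    rewrite Cmult_comm. apply cseries_unique with (fun n => (w - q) * (a n * gsum w q (e n))).
    2:{ apply cseries_scal, csummable_cseries; auto. }
    apply cseries_ext with (fun n => a n * w ^ e n + (- (1)) * (a n * q ^ e n)).
    { intros n. transitivity (a n * (w ^ e n - q ^ e n)); [ring|]. rewrite gsum_mult. ring. }
    replace (CSeries (fun n => a n * w ^ e n) - CSeries (fun n => a n * q ^ e n))
      with (CSeries (fun n => a n * w ^ e n) + (- (1)) * CSeries (fun n => a n * q ^ e n)) by ring.
    apply cseries_plus; [|apply cseries_scal]; apply csummable_cseries; apply (gap_csummable a e R0); auto; lra.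
Qed.

(** * Holomorphic functions and the identity theorem *)

(** The derivative is required to be continuous because Cauchy's formula is proved by
    differentiation under the integral sign. *)
Definition holo (f : C -> C) (z : C) : Prop :=
  exists f' : C -> C, near z (fun w => cder f w (f' w) /\ ccont f' w).

Lemma holo_cder (f : C -> C) (z : C) : holo f z -> exists l, cder f z l.
Proof. intros (f' & H). apply near_self in H. eexists; apply H. Qed.

Lemma holo_ccont (f : C -> C) (z : C) : holo f z -> ccont f z.
Proof. intros H. destruct (holo_cder f z H) as [l Hl]. now apply cder_cont in Hl. Qed.

Lemma holo_ext (f g : C -> C) (z : C) :
  near z (fun w => f w = g w) -> holo f z -> holo g z.
Proof.
  intros H (f' & Hf). exists f'. generalize (near_and _ _ _ (near_near _ _ H) Hf).
  apply near_imp. intros w (Hw & H1 & H2). split; auto. now apply (cder_ext f).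
Qed.

Lemma holo_const (c z : C) : holo (fun _ => c) z.
Proof.
  exists (fun _ => 0). apply near_all; intros w; split; [apply cder_const | apply ccont_const].
Qed.

Lemma holo_id (z : C) : holo (fun w => w) z.
Proof.
  exists (fun _ => 1). apply near_all; intros w; split; [apply cder_id | apply ccont_const].
Qed.

Lemma holo_plus (f g : C -> C) (z : C) : holo f z -> holo g z -> holo (fun w => f w + g w) z.
Proof.
  intros (f' & Hf) (g' & Hg). exists (fun w => f' w + g' w).
  generalize (near_and _ _ _ Hf Hg). apply near_imp. intros w ((H1 & H2) & H3 & H4).
  split; [now apply cder_plus | now apply ccont_plus].
Qed.

Lemma holo_mult (f g : C -> C) (z : C) : holo f z -> holo g z -> holo (fun w => f w * g w) z.
Proof.
  intros (f' & Hf) (g' & Hg). exists (fun w => f' w * g w + f w * g' w).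
  generalize (near_and _ _ _ Hf Hg). apply near_imp. intros w ((H1 & H2) & H3 & H4).
  split; [now apply cder_mult|].
  apply ccont_plus; apply ccont_mult; auto; eapply cder_cont; eassumption.
Qed.

Lemma holo_comp (f g : C -> C) (z : C) : holo f z -> holo g (f z) -> holo (fun w => g (f w)) z.
Proof.
  intros Hf0 (g' & Hg). assert (Cf := holo_ccont _ _ Hf0). destruct Hf0 as (f' & Hf).
  exists (fun w => g' (f w) * f' w).
  generalize (near_and _ _ _ Hf (ccont_near_pred _ _ _ Cf Hg)). apply near_imp. intros w ((H1 & H2) & H3 & H4).
  split; [now apply cder_comp|].
  apply ccont_mult; auto. apply ccont_comp; auto. eapply cder_cont; eassumption.
Qed.

Lemma holo_Cinv (z : C) : z <> 0 -> holo Cinv z.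
Proof.
  intros Hz. exists (fun w => - (1) / (w * w)).
  assert (H := ccont_neq0 _ z 0 (ccont_id z) Hz). apply near_near in H. revert H.
  apply near_imp. intros w Hw. assert (Hw0 := near_self _ _ Hw). cbv beta in Hw0.
  split; [apply (cder_inv (fun w => w)); [apply cder_id | auto]|].
  apply ccont_mult; [apply ccont_const|].
  apply (ccont_inv (fun w => w * w)); [apply ccont_mult; apply ccont_id|]. now apply Cmult_neq_0.
Qed.

Lemma holo_inv (f : C -> C) (z : C) : holo f z -> f z <> 0 -> holo (fun w => / f w) z.
Proof. intros Hf Hz. apply (holo_comp f Cinv); auto. now apply holo_Cinv. Qed.

Lemma holo_opp (f : C -> C) (z : C) : holo f z -> holo (fun w => - f w) z.
Proof.
  intros H. apply (holo_ext (fun w => (- (1)) * f w)).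
  - apply near_all; intros; ring.
  - apply holo_mult; auto. apply holo_const.
Qed.

Lemma holo_minus (f g : C -> C) (z : C) : holo f z -> holo g z -> holo (fun w => f w - g w) z.
Proof. intros; apply holo_plus; auto. now apply holo_opp. Qed.

Lemma holo_div (f g : C -> C) (z : C) :
  holo f z -> holo g z -> g z <> 0 -> holo (fun w => f w / g w) z.
Proof. intros; apply holo_mult; auto. now apply holo_inv. Qed.

Lemma holo_pow (f : C -> C) (z : C) (n : nat) : holo f z -> holo (fun w => f w ^ n) z.
Proof.
  intros H. induction n as [|n IH]; [apply (holo_const 1) | now apply (holo_mult f (fun w => f w ^ n))].
Qed.

Lemma holo_analytic (f : C -> C) (z : C) : holo f z -> analytic_at f z.
Proof.
  intros (f' & d & Hd & H). apply (cauchy_power_series f f' z d Hd); intros w Hw; now apply H.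
Qed.

Lemma gap_series_holo (a : nat -> C) (e : nat -> nat) (R0 : R) (q : C) :
  gap_summable a e R0 -> (Cmod q < R0)%R -> holo (fun q => CSeries (fun n => a n * q ^ e n)) q.
Proof.
  intros H Hq. exists (fun q => CSeries (fun n => a n * RtoC (INR (e n)) * q ^ pred (e n))).
  generalize (near_disc 0 q R0). intros K.
  replace (q - 0) with q in K by ring. specialize (K Hq). revert K. apply near_imp.
  intros w Hw. replace (w - 0) with w in Hw by ring. split.
  - now apply (gap_series_cder a e R0).
  - eapply cder_cont. apply (gap_series_cder (fun n => a n * RtoC (INR (e n))) (fun n => pred (e n)) R0); auto.
    now apply gap_summable_derive.
Qed.

(** Abel's lemma: convergence at [r'] bounds the terms there, so that at a smaller [rho] they are
    dominated by a geometric sequence. *)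
Lemma pseries_gap_summable (u : nat -> C) (r : R) :
  (forall x, (Cmod x < r)%R -> exists l, cseries (fun k => u k * x ^ k) l) ->
  gap_summable u (fun n => n) r.
Proof.
  intros H rho Hr. set (r' := ((rho + r) / 2)%R). assert (Hr' : (rho < r' < r)%R) by (unfold r'; lra).
  destruct (H (RtoC r')) as [l Hl].
  { rewrite Cmod_R, Rabs_pos_eq; lra. }
  assert (B : exists M, forall n, (Cmod (u n) * r' ^ n <= M)%R).
  { destruct (Hl 1%R ltac:(lra)) as [N HN].
    assert (G : forall n, (N <= n)%nat -> (Cmod (u n) * r' ^ n <= 2)%R).
    { intros n Hn. assert (A1 := HN n Hn). assert (A2 := HN (S n) ltac:(lia)). simpl csum in A2.
      replace (Cmod (u n) * r' ^ n)%R with (Cmod (u n * RtoC r' ^ n)).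
      2:{ rewrite Cmod_mult, Cmod_pow, Cmod_R, Rabs_pos_eq; auto; lra. }
      set (c := csum (fun k : nat => u k * RtoC r' ^ k) n) in *.
      replace (u n * RtoC r' ^ n) with ((c + u n * RtoC r' ^ n - l) + - (c - l)) by ring.
      eapply Rle_trans; [apply Cmod_triangle|]. rewrite Cmod_opp. lra. }
    assert (F : forall K, exists M, (2 <= M)%R /\ forall n, (n < K)%nat -> (Cmod (u n) * r' ^ n <= M)%R).
    { induction K as [|K (M & HM & IH)]; [exists 2%R; split; [lra|intros; lia]|].
      exists (Rmax M (Cmod (u K) * r' ^ K)). split; [eapply Rle_trans; [apply HM | apply Rmax_l]|].
      intros n Hn. destruct (Nat.eq_dec n K) as [->|]; [apply Rmax_r|].
      eapply Rle_trans; [apply IH; lia | apply Rmax_l]. }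
    destruct (F N) as (M & HM & HF). exists M. intros n. destruct (le_lt_dec N n); auto.
    eapply Rle_trans; [now apply G | lra]. }
  destruct B as [M HM].
  assert (Hx : (0 <= rho / r' < 1)%R).
  { split; [apply Rmult_le_pos; [lra|]; apply Rlt_le, Rinv_0_lt_compat; lra|].
    apply Rmult_lt_reg_r with r'; [lra|]. unfold Rdiv; rewrite Rmult_assoc, Rinv_l; lra. }
  apply ex_series_le_scal with M (fun n => (rho / r') ^ n)%R.
  - intros n. assert (P : (0 <= rho ^ n)%R) by (apply pow_le; lra). split.
    + apply Rmult_le_pos; auto using Cmod_ge_0.
    + replace (rho ^ n)%R with (r' ^ n * (rho / r') ^ n)%R.
      2:{ rewrite <- Rpow_mult_distr. f_equal. field; lra. }
      rewrite <- Rmult_assoc. apply Rmult_le_compat_r; auto. apply pow_le; lra.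
  - apply ex_series_geom. rewrite Rabs_pos_eq; lra.
Qed.

Lemma analytic_gap (f : C -> C) (z0 : C) : analytic_at f z0 ->
  exists u r, (0 < r)%R /\ gap_summable u (fun n => n) r /\
    forall z, (Cmod (z - z0) < r)%R -> f z = CSeries (fun n => u n * (z - z0) ^ n).
Proof.
  intros (u & r & Hr & H). exists u, r. split; auto. split.
  - apply pseries_gap_summable. intros x Hx. exists (f (z0 + x)).
    apply is_pseries_cseries. replace x with (z0 + x - z0) at 1 by ring. apply H.
    now replace (z0 + x - z0) with x by ring.
  - intros z Hz. symmetry. apply CSeries_unique. now apply is_pseries_cseries, H.
Qed.

Lemma cder_shift (g : C -> C) (z0 z l : C) : cder g (z - z0) l -> cder (fun z => g (z - z0)) z l.
Proof.
  intros H. eapply cder_eq; [apply (cder_comp (fun z => z - z0) g); [|apply H]|].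
  - apply cder_minus; [apply cder_id | apply cder_const].
  - ring.
Qed.

Lemma holo_shift (g : C -> C) (z0 z : C) : holo g (z - z0) -> holo (fun z => g (z - z0)) z.
Proof.
  intros H. apply (holo_comp (fun z => z - z0) g); auto.
  apply holo_minus; [apply holo_id | apply holo_const].
Qed.

Lemma analytic_holo (f : C -> C) (z : C) : analytic_at f z -> holo f z.
Proof.
  intros H. destruct (analytic_gap f z H) as (u & r & Hr & Hu & E).
  apply (holo_ext (fun w => CSeries (fun n => u n * (w - z) ^ n))).
  - exists r; split; auto. intros w Hw; symmetry; auto.
  - apply (holo_shift (fun q => CSeries (fun n => u n * q ^ n))).
    apply (gap_series_holo u (fun n => n) r); auto.
    replace (z - z) with (RtoC 0) by ring. now rewrite Cmod_0.
Qed.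

(** A total function obtained by choice; its value means something only where a derivative
    exists. *)
Definition Cderiv (f : C -> C) (z : C) : C := epsilon (inhabits (RtoC 0)) (cder f z).

Lemma Cderiv_correct (f : C -> C) (z : C) : holo f z -> cder f z (Cderiv f z).
Proof. intros H. unfold Cderiv. apply epsilon_spec. now apply holo_cder. Qed.

(** Near [z] the derivative is the derived power series, which can be differentiated again. *)
Lemma holo_Cderiv (f : C -> C) (z : C) : holo f z -> holo (Cderiv f) z.
Proof.
  intros H. destruct (analytic_gap f z (holo_analytic f z H)) as (u & r & Hr & Hu & E).
  apply (holo_ext (fun w => CSeries (fun n => u n * RtoC (INR n) * (w - z) ^ pred n))).
  - exists r; split; auto. intros w Hw.
    assert (L : cder f w (CSeries (fun n => u n * RtoC (INR n) * (w - z) ^ pred n))).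
    { apply (cder_ext (fun w => CSeries (fun n => u n * (w - z) ^ n))).
      - apply near_disc in Hw. revert Hw; apply near_imp; intros; symmetry; auto.
      - apply (cder_shift (fun q => CSeries (fun n => u n * q ^ n))).
        now apply (gap_series_cder u (fun n => n) r). }
    apply (cder_unique f w); auto. apply Cderiv_correct.
    apply (holo_ext (fun w => CSeries (fun n => u n * (w - z) ^ n))).
    + apply near_disc in Hw. revert Hw; apply near_imp; intros; symmetry; auto.
    + apply (holo_shift (fun q => CSeries (fun n => u n * q ^ n))).
      now apply (gap_series_holo u (fun n => n) r).
  - apply (holo_shift (fun q => CSeries (fun n => u n * RtoC (INR n) * q ^ pred n))).
    apply (gap_series_holo (fun n => u n * RtoC (INR n)) pred r).
    + now apply gap_summable_derive.
    + replace (z - z) with (RtoC 0) by ring. now rewrite Cmod_0.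
Qed.

Lemma csum_shift (u : nat -> C) (k n : nat) :
  (forall j, (j < k)%nat -> u j = 0) -> csum u (k + n) = csum (fun j => u (k + j)%nat) n.
Proof.
  intros H. induction n as [|n IH].
  - rewrite Nat.add_0_r. induction k as [|k IHk]; auto. simpl. rewrite IHk, H; auto. simpl; ring.
  - rewrite Nat.add_succ_r. simpl. now rewrite IH.
Qed.

Lemma gap_summable_tail (u : nat -> C) (r : R) (k : nat) : (0 < r)%R ->
  gap_summable u (fun n => n) r -> gap_summable (fun n => u (k + n)%nat) (fun n => n) r.
Proof.
  intros Hr0 H. apply pseries_gap_summable. intros x Hx.
  destruct (Ceq_dec x 0) as [->|Nx].
  - exists (u k). intros eps He. exists 1%nat. intros n Hn.
    replace (csum _ n) with (u k). { replace (u k - u k) with (RtoC 0) by ring. now rewrite Cmod_0. }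
    induction n as [|n IH]; [lia|]. destruct n; simpl in *.
    + rewrite Nat.add_0_r. ring.
    + rewrite <- IH by lia. ring.
  - assert (S := gap_csummable u (fun n => n) r x H Hx).
    assert (S' : csummable (fun n => u (k + n)%nat * x ^ n)).
    { apply csummable_le with (fun n => (/ Cmod (x ^ k) * Cmod (u (k + n)%nat * x ^ (k + n)))%R).
      - intros n. rewrite Cpow_add_r, !Cmod_mult. right.
        assert (0 < Cmod (x ^ k))%R by now apply Cmod_gt_0, Cpow_nz. field. lra.
      - apply (ex_series_scal (K := R_AbsRing) (V := R_NormedModule)).
        apply (ex_series_incr_n (K := R_AbsRing) (V := R_NormedModule) (fun n => Cmod (u n * x ^ n)) k). exact S. }
    eexists. apply csummable_cseries, S'.
Qed.

(** If $u_k$ is the first nonzero Taylor coefficient, then $h(w)=(w-z_0)^kg(w-z_0)$ with $g(0)=u_k$,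
    so $h$ has no zero close to $z_0$ other than possibly $z_0$. Accumulating zeros therefore
    annihilate all coefficients by strong induction. *)
Lemma holo_zeros (h : C -> C) (z0 : C) : holo h z0 ->
  (forall d : R, (0 < d)%R -> exists w, w <> z0 /\ (Cmod (w - z0) < d)%R /\ h w = 0) ->
  near z0 (fun w => h w = 0).
Proof.
  intros Hh Hz. destruct (analytic_gap h z0 (holo_analytic h z0 Hh)) as (u & r & Hr & Hu & E).
  assert (Hk : forall k, (forall j, (j < k)%nat -> u j = 0) -> u k = 0).
  { intros k Hj. set (g := fun q => CSeries (fun n => u (k + n)%nat * q ^ n)).
    assert (Hg : holo g 0).
    { apply (gap_series_holo _ (fun n => n) r); [now apply gap_summable_tail|]. now rewrite Cmod_0. }
    assert (Hg0 : g 0 = u k).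
    { apply CSeries_unique. intros eps He. exists 1%nat. intros n Hn.
      replace (csum _ n) with (u k). { replace (u k - u k) with (RtoC 0) by ring. now rewrite Cmod_0. }
      induction n as [|n IH]; [lia|]. destruct n; simpl in *.
      + rewrite Nat.add_0_r. ring.
      + rewrite <- IH by lia. ring. }
    destruct (Ceq_dec (u k) 0) as [|N]; auto. exfalso.
    rewrite <- Hg0 in N. destruct (ccont_neq0 g 0 0 (holo_ccont _ _ Hg) N) as (d & Hd & Kd).
    destruct (Hz (Rmin d r) (Rmin_pos _ _ Hd Hr)) as (w & Hw1 & Hw2 & Hw3).
    assert (A1 := Rlt_le_trans _ _ _ Hw2 (Rmin_l _ _)). assert (A2 := Rlt_le_trans _ _ _ Hw2 (Rmin_r _ _)).
    apply (Kd (w - z0)); [now replace (w - z0 - 0) with (w - z0) by ring|].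
    assert (Nw : w - z0 <> 0) by (intro X; apply Hw1, Ceq_minus, X).
    assert (Eh : h w = (w - z0) ^ k * g (w - z0)).
    { rewrite E by auto. apply CSeries_unique.
      assert (S : cseries (fun n => u (k + n)%nat * (w - z0) ^ n) (g (w - z0))).
      { apply csummable_cseries. apply (gap_csummable _ (fun n => n) r); auto. now apply gap_summable_tail. }
      apply (cseries_scal ((w - z0) ^ k)) in S. intros eps He. destruct (S eps He) as [N' HN].
      exists (k + N')%nat. intros n Hn. replace n with (k + (n - k))%nat by lia.
      rewrite csum_shift by (intros j Hjk; rewrite Hj by auto; ring).
      rewrite (csum_ext _ (fun n => (w - z0) ^ k * (u (k + n)%nat * (w - z0) ^ n))).
      - apply HN. lia.
      - intros j _. rewrite Cpow_add_r. ring. }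
    rewrite Hw3 in Eh. destruct (Ceq_dec (g (w - z0)) 0); auto.
    exfalso. apply (Cmult_neq_0 ((w - z0) ^ k) (g (w - z0))); auto. now apply Cpow_nz. }
  assert (Hall : forall k, u k = 0).
  { intros k. induction k as [k IH] using lt_wf_ind. apply Hk. auto. }
  exists r; split; auto. intros w Hw. rewrite E by auto. apply CSeries_unique.
  intros eps He. exists O. intros n _. replace (csum _ n) with (RtoC 0).
  - replace (0 - 0) with (RtoC 0) by ring. now rewrite Cmod_0.
  - induction n as [|n IH]; auto. simpl. rewrite <- IH, Hall. ring.
Qed.

(** * Induction along the unit interval and the identity theorem *)

Lemma real_induction (P : R -> Prop) : P 0%R ->
  (forall t, (0 < t <= 1)%R -> (forall s, (0 <= s < t)%R -> P s) -> P t) ->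
  (forall t, (0 <= t < 1)%R -> P t -> exists d, (0 < d)%R /\ forall s, (t <= s < t + d)%R -> (s <= 1)%R -> P s) ->
  forall t, (0 <= t <= 1)%R -> P t.
Proof.
  intros H0 Hlim Hopen.
  (* The supremum of the parameters up to which [P] holds satisfies [P] by the limit clause, and
     then equals $1$ by the clause of propagation to the right. *)
  set (E := fun t => (0 <= t <= 1)%R /\ forall s, (0 <= s <= t)%R -> P s).
  assert (E0 : E 0%R). { split; [lra|]. intros s Hs. now replace s with 0%R by lra. }
  destruct (completeness E) as [m [Hub Hlub]].
  { exists 1%R. intros x [Hx _]. lra. }
  { now exists 0%R. }
  assert (Hm : (0 <= m <= 1)%R). { split; [now apply Hub|]. apply Hlub. intros x [Hx _]; lra. }
  assert (Hbelow : forall s, (0 <= s < m)%R -> P s).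
  { intros s Hs. apply NNPP. intros Hn. assert (m <= s)%R; [|lra].
    apply Hlub. intros x [Hx1 Hx2]. destruct (Rle_lt_dec x s); auto. exfalso. apply Hn, Hx2; lra. }
  assert (Hpm : P m).
  { destruct (Req_dec m 0) as [->|N]; auto. apply Hlim; auto. lra. }
  assert (Em : m = 1%R).
  { destruct (Req_dec m 1) as [|N]; auto. exfalso.
    destruct (Hopen m ltac:(lra) Hpm) as (d & Hd & K).
    set (x := Rmin 1 (m + d / 2)).
    assert (H0' : (x <= m)%R).
    { apply Hub. split.
      - unfold x. split; [apply Rmin_glb; lra | apply Rmin_l].
      - intros s Hs. destruct (Rlt_le_dec s m); [apply Hbelow; lra|].
        apply K; [|unfold x in Hs; generalize (Rmin_l 1 (m + d/2)); lra].
        unfold x in Hs; generalize (Rmin_r 1 (m + d/2)); lra. }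
    unfold x in H0'. revert H0'. unfold Rmin. destruct (Rle_dec 1 (m + d / 2)); lra. }
  intros t Ht. destruct (Req_dec t 1) as [->|]; [now rewrite <- Em|]. apply Hbelow; lra.
Qed.

(** For properties that pass between any two parameters close to a common [t], in both directions.
    Covering neighbourhoods transfer properties along a path in exactly this way. *)
Lemma uniform_induction (P : R -> Prop) : P 0%R ->
  (forall t, (0 <= t <= 1)%R -> exists d, (0 < d)%R /\
     forall s s', (0 <= s <= 1)%R -> (0 <= s' <= 1)%R -> (Rabs (s - t) < d)%R -> (Rabs (s' - t) < d)%R -> P s -> P s') ->
  forall t, (0 <= t <= 1)%R -> P t.
Proof.
  intros H0 H. apply real_induction; auto.
  - intros t Ht Hs. destruct (H t ltac:(lra)) as (d & Hd & K).
    set (s := Rmax 0 (t - d / 2)).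
    assert (A : (0 <= s < t)%R). { unfold s. split; [apply Rmax_l|]. apply Rmax_lub_lt; lra. }
    apply (K s); try lra; auto.
    + apply Rabs_def1; [lra|]. generalize (Rmax_r 0 (t - d/2)); unfold s; lra.
    + now rewrite Rminus_diag, Rabs_R0.
  - intros t Ht Pt. destruct (H t ltac:(lra)) as (d & Hd & K). exists d; split; auto.
    intros s Hs Hs1. apply (K t); auto; try lra.
    + now rewrite Rminus_diag, Rabs_R0.
    + apply Rabs_def1; lra.
Qed.

Definition convex (U : C -> Prop) : Prop :=
  forall a b t, U a -> U b -> (0 <= t <= 1)%R -> U (a + RtoC t * (b - a)).

(** Induction along the segment from [a] to [b]: at a limit parameter the earlier points of the
    segment are accumulating zeros, so [holo_zeros] applies. *)
Lemma identity_theorem (U : C -> Prop) (h : C -> C) (a b : C) :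
  convex U -> (forall z, U z -> holo h z) -> U a -> U b ->
  near a (fun w => h w = 0) -> near b (fun w => h w = 0).
Proof.
  intros HU Hh Ha Hb Hn. destruct (Ceq_dec a b) as [<-|Nab]; auto.
  set (p := fun t : R => a + RtoC t * (b - a)).
  assert (Hba : b - a <> 0) by (intro X; apply Nab; symmetry; apply Ceq_minus, X).
  assert (Hm : (0 < Cmod (b - a))%R) by now apply Cmod_gt_0.
  assert (Hp : forall s t, (Cmod (p s - p t) = Rabs (s - t) * Cmod (b - a))%R).
  { intros s t. replace (p s - p t) with (RtoC (s - t) * (b - a)) by (unfold p; rewrite RtoC_minus; ring).
    now rewrite Cmod_mult, Cmod_R. }
  cut (forall t, (0 <= t <= 1)%R -> near (p t) (fun w => h w = 0)).
  { intros H. specialize (H 1%R ltac:(lra)). unfold p in H. now replace (a + RtoC 1 * (b - a)) with b in H by ring. }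
  apply real_induction.
  - unfold p. now replace (a + RtoC 0 * (b - a)) with a by ring.
  - intros t Ht Hs. apply holo_zeros.
    + apply Hh, HU; auto; lra.
    (* The point with this parameter precedes [p t] on the segment and is at distance at most $d/2$
       from it. *)
    + intros d Hd. set (s := Rmax 0 (t - d / (2 * Cmod (b - a)))).
      assert (Hdp : (0 < d / (2 * Cmod (b - a)))%R) by (apply Rdiv_lt_0_compat; lra).
      assert (A : (0 <= s < t)%R). { unfold s. split; [apply Rmax_l|]. apply Rmax_lub_lt; lra. }
      exists (p s). repeat split.
      * intro X. assert (Y := Hp s t). rewrite X in Y. replace (p t - p t) with (RtoC 0) in Y by ring.
        rewrite Cmod_0 in Y. assert (0 < Rabs (s - t))%R by (apply Rabs_pos_lt; lra). nra.
      * rewrite Hp. rewrite Rabs_left by lra.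
        apply Rle_lt_trans with (d / (2 * Cmod (b - a)) * Cmod (b - a))%R.
        -- apply Rmult_le_compat_r; [lra|]. generalize (Rmax_r 0 (t - d / (2 * Cmod (b - a)))); unfold s; lra.
        -- replace (d / (2 * Cmod (b - a)) * Cmod (b - a))%R with (d / 2)%R by (field; lra). lra.
      * apply near_self with (P := fun w => h w = 0). now apply Hs.
  - intros t Ht Hnt. apply near_near in Hnt. destruct Hnt as (d & Hd & K).
    exists (d / Cmod (b - a))%R. split; [now apply Rdiv_lt_0_compat|].
    intros s Hs _. apply K. rewrite Hp.
    apply Rlt_le_trans with (d / Cmod (b - a) * Cmod (b - a))%R.
    + apply Rmult_lt_compat_r; auto. apply Rabs_def1; lra.
    + right; field; lra.
Qed.

Lemma identity_theorem_eq (U : C -> Prop) (f g : C -> C) (a b : C) :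
  convex U -> (forall z, U z -> holo f z) -> (forall z, U z -> holo g z) -> U a -> U b ->
  near a (fun w => f w = g w) -> near b (fun w => f w = g w).
Proof.
  intros HU Hf Hg Ha Hb Hn.
  apply (near_imp b (fun w => f w - g w = 0)); [intros w Hw; now apply Ceq_minus|].
  apply (identity_theorem U (fun w => f w - g w) a); auto.
  - intros z Hz. apply holo_minus; auto.
  - revert Hn; apply near_imp; intros w ->. ring.
Qed.

Lemma convex_disc (z0 : C) (r : R) : convex (fun w => Cmod (w - z0) < r)%R.
Proof.
  intros a b t Ha Hb Ht.
  replace (a + RtoC t * (b - a) - z0) with (RtoC (1 - t) * (a - z0) + RtoC t * (b - z0)) by (rewrite RtoC_minus; ring).
  eapply Rle_lt_trans; [apply Cmod_triangle|]. rewrite !Cmod_mult, !Cmod_R, !Rabs_pos_eq by lra.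
  destruct (Req_dec t 1) as [->|]; [lra|].
  assert ((1 - t) * Cmod (a - z0) < (1 - t) * r)%R by (apply Rmult_lt_compat_l; lra).
  assert (t * Cmod (b - z0) <= t * r)%R by (apply Rmult_le_compat_l; lra). lra.
Qed.

Lemma cder_eps (f : C -> C) (z l : C) :
  (forall eps : R, (0 < eps)%R -> near z (fun w => Cmod (f w - f z - l * (w - z)) <= eps * Cmod (w - z))%R) ->
  cder f z l.
Proof.
  intros H. exists (fun w => if Ceq_dec w z then l else (f w - f z) / (w - z)).
  split; [|split].
  - intros eps He. destruct (H (eps / 2)%R ltac:(lra)) as (d & Hd & K). exists d; split; auto.
    intros w Hw. destruct (Ceq_dec z z) as [_|]; [|tauto].
    destruct (Ceq_dec w z) as [->|N].
    + replace (l - l) with (RtoC 0) by ring. now rewrite Cmod_0.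
    + assert (N' : w - z <> 0) by (intro X; apply N, Ceq_minus, X).
      assert (P : (0 < Cmod (w - z))%R) by now apply Cmod_gt_0.
      replace ((f w - f z) / (w - z) - l) with ((f w - f z - l * (w - z)) / (w - z)) by (field; auto).
      rewrite Cmod_div by auto. specialize (K w Hw).
      apply Rle_lt_trans with (eps / 2)%R; [|lra].
      apply Rmult_le_reg_r with (Cmod (w - z)); auto.
      unfold Rdiv at 1; rewrite Rmult_assoc, Rinv_l; lra.
  - destruct (Ceq_dec z z); tauto.
  - intros w. destruct (Ceq_dec w z) as [->|N]; [ring|]. field. intro X; apply N, Ceq_minus, X.
Qed.

(** * The complex exponential *)

Lemma Cexp_plus (z w : C) : Cexp (z + w) = Cexp z * Cexp w.
Proof.
  unfold Cexp. destruct z as [x y], w as [u v]; unfold Cmult; simpl.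
  rewrite exp_plus, cos_plus, sin_plus. f_equal; ring.
Qed.

Lemma Cexp_0 : Cexp 0 = 1.
Proof. unfold Cexp, RtoC; simpl. rewrite exp_0, cos_0, sin_0. f_equal; ring. Qed.

Lemma Cmod_Cexp (z : C) : Cmod (Cexp z) = exp (Re z).
Proof.
  destruct z as [x y]. unfold Cexp, Cmod; simpl.
  replace (exp x * cos y * (exp x * cos y * 1) + exp x * sin y * (exp x * sin y * 1))%R
    with (exp x * exp x * (Rsqr (sin y) + Rsqr (cos y)))%R by (unfold Rsqr; ring).
  rewrite sin2_cos2, Rmult_1_r. apply sqrt_square, Rlt_le, exp_pos.
Qed.

Lemma Cexp_neq0 (z : C) : Cexp z <> 0.
Proof. intros E. generalize (exp_pos (Re z)). rewrite <- Cmod_Cexp, E, Cmod_0. lra. Qed.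

Lemma ccont_Re (g : R -> R) (z : C) : continuous g (Re z) -> ccont (fun w => RtoC (g (Re w))) z.
Proof.
  intros H eps He. destruct (continuous_R_eps_inv g (Re z) H eps He) as (d & Hd & K).
  exists d; split; auto. intros w Hw. rewrite <- RtoC_minus, Cmod_R. apply K.
  eapply Rle_lt_trans; [|apply Hw]. exact (re_le_Cmod (w - z)).
Qed.

Lemma ccont_Im (g : R -> R) (z : C) : continuous g (Im z) -> ccont (fun w => RtoC (g (Im w))) z.
Proof.
  intros H eps He. destruct (continuous_R_eps_inv g (Im z) H eps He) as (d & Hd & K).
  exists d; split; auto. intros w Hw. rewrite <- RtoC_minus, Cmod_R. apply K.
  eapply Rle_lt_trans; [|apply Hw]. exact (im_le_Cmod (w - z)).
Qed.

Lemma ccont_Cexp (z : C) : ccont Cexp z.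
Proof.
  apply (ccont_ext (fun w => RtoC (exp (Re w)) * (RtoC (cos (Im w)) + Ci * RtoC (sin (Im w))))).
  { apply near_all; intros w. unfold Cexp, Ci, Cmult, Cplus, RtoC; simpl. f_equal; ring. }
  apply ccont_mult; [apply ccont_Re | apply ccont_plus; [apply ccont_Im | apply ccont_mult; [apply ccont_const | apply ccont_Im]]];
  apply (ex_derive_continuous (K := R_AbsRing) (V := R_NormedModule)); auto_derive; auto.
Qed.

Lemma rder_Cexp_line (h : C) (t : R) : rder (fun t => Cexp (RtoC t * h)) t (h * Cexp (RtoC t * h)).
Proof.
  destruct h as [x y].
  assert (E : forall u, Cexp (RtoC u * (x, y)) = (exp (u * x) * cos (u * y), exp (u * x) * sin (u * y))%R).
  { intros u. unfold Cexp; simpl. replace (u * x - 0 * y)%R with (u * x)%R by ring.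
    now replace (u * y + 0 * x)%R with (u * y)%R by ring. }
  rewrite E. split; (eapply is_derive_ext; [intros u; rewrite E; reflexivity|]); simpl; auto_derive; auto; ring.
Qed.

(** The functional equation reduces the claim to an estimate of $e^h-1-h$, which is the mean value
    inequality for $t\mapsto e^{th}$ together with continuity at $0$. *)
Lemma cder_Cexp (z : C) : cder Cexp z (Cexp z).
Proof.
  apply cder_eps. intros eps He.
  assert (Hz := exp_pos (Re z)).
  destruct (ccont_Cexp 0 (eps / exp (Re z))%R) as (d & Hd & K); [now apply Rdiv_lt_0_compat|].
  exists d; split; auto. intros w Hw. set (h := w - z) in *.
  assert (E : Cexp w = Cexp z * Cexp h) by (rewrite <- Cexp_plus; f_equal; unfold h; ring).
  replace (Cexp w - Cexp z - Cexp z * h) with (Cexp z * (Cexp h - 1 - h)) by (rewrite E; ring).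
  rewrite Cmod_mult, Cmod_Cexp.
  assert (B : (Cmod (Cexp h - 1 - h) <= eps / exp (Re z) * Cmod h)%R).
  { rewrite <- Cexp_0. rewrite <- (Cmult_0_l h) at 1. rewrite <- (Cmult_1_l h) at 1.
    apply (curve_mean_value (fun t => Cexp (RtoC t * h)) (fun t => h * Cexp (RtoC t * h))).
    - intros t Ht. apply rder_Cexp_line.
    - intros t Ht. replace (h * Cexp (RtoC t * h) - h) with ((Cexp (RtoC t * h) - Cexp 0) * h) by (rewrite Cexp_0; ring).
      rewrite Cmod_mult. apply Rmult_le_compat_r; [apply Cmod_ge_0|]. apply Rlt_le, K.
      replace (RtoC t * h - 0) with (RtoC t * h) by ring. rewrite Cmod_mult, Cmod_R, Rabs_pos_eq by lra.
      assert (P := Cmod_ge_0 h). nra. }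
  apply Rle_trans with (exp (Re z) * (eps / exp (Re z) * Cmod h))%R; [apply Rmult_le_compat_l; lra|].
  right; field; lra.
Qed.

Lemma holo_Cexp (z : C) : holo Cexp z.
Proof.
  exists Cexp. apply near_all; intros w; split; [apply cder_Cexp | apply ccont_Cexp].
Qed.

(* Newton's iteration with frozen slope [a] is a contraction of a small disc. *)
Lemma local_inverse (f : C -> C) (z0 a : C) (eps : R) :
  (0 < eps)%R -> holo f z0 -> cder f z0 a -> a <> 0 ->
  exists eta delta : R, exists G : C -> C, (0 < eta <= eps)%R /\ (0 < delta)%R /\
    (forall z z', (Cmod (z - z0) < eta)%R -> (Cmod (z' - z0) < eta)%R -> f z = f z' -> z = z') /\
    (forall w, (Cmod (w - f z0) < delta)%R ->
       (Cmod (G w - z0) < eta)%R /\ f (G w) = w /\ holo G w).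
Proof.
  intros Heps (f' & Hf) Ha Na.
  assert (Hder0 := near_self _ _ Hf). destruct Hder0 as [Hd0 Hc0].
  assert (Ea : f' z0 = a) by (eapply cder_unique; eassumption).
  assert (Pa : (0 < Cmod a)%R) by now apply Cmod_gt_0.
  (* A deviation of $f'$ from $a$ below $|a|/2$ yields a contraction of ratio $1/2$ and the
     expansion bound [Hexp], and keeps $f'$ away from $0$. *)
  destruct (near_and _ _ _ Hf (Hc0 (Cmod a / 2)%R ltac:(lra))) as (d & Hd & K). rewrite Ea in K.
  set (eta := Rmin d eps). assert (Heta : (0 < eta)%R) by now apply Rmin_pos.
  assert (Hed : (eta <= d)%R) by apply Rmin_l.
  assert (Hlip : forall z z', (Cmod (z - z0) < eta)%R -> (Cmod (z' - z0) < eta)%R ->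
    (Cmod (f z - f z' - a * (z - z')) <= Cmod a / 2 * Cmod (z - z'))%R).
  { intros z z' Hz Hz'.
    assert (Hseg : forall t, (0 <= t <= 1)%R -> (Cmod (z' + RtoC t * (z - z') - z0) < d)%R).
    { intros t Ht. eapply Rlt_le_trans; [|apply Hed]. now apply (convex_disc z0 eta z' z t). }
    apply (mean_value_ineq f f').
    - intros t Ht. now apply K, Hseg.
    - intros t Ht. apply Rlt_le. now apply K, Hseg. }
  assert (Hexp : forall z z', (Cmod (z - z0) < eta)%R -> (Cmod (z' - z0) < eta)%R ->
    (Cmod a / 2 * Cmod (z - z') <= Cmod (f z - f z'))%R).
  { intros z z' Hz Hz'. assert (L := Hlip z z' Hz Hz').
    assert (T : (Cmod (a * (z - z')) <= Cmod (f z - f z') + Cmod (f z - f z' - a * (z - z')))%R).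
    { replace (a * (z - z')) with ((f z - f z') + - (f z - f z' - a * (z - z'))) at 1 by ring.
      eapply Rle_trans; [apply Cmod_triangle|]. rewrite Cmod_opp. lra. }
    rewrite Cmod_mult in T. lra. }
  assert (Hinj : forall z z', (Cmod (z - z0) < eta)%R -> (Cmod (z' - z0) < eta)%R -> f z = f z' -> z = z').
  { intros z z' Hz Hz' E. assert (L := Hexp z z' Hz Hz'). rewrite E in L.
    replace (f z' - f z') with (RtoC 0) in L by ring. rewrite Cmod_0 in L.
    apply Ceq_minus, Cmod_eq_0. assert (P := Cmod_ge_0 (z - z')). nra. }
  (* With this radius the first Newton step is shorter than $\eta/4$; the steps halve, so the
     iteration stays within $\eta/2$ of [z0]. *)
  set (delta := (Cmod a * eta / 4)%R). assert (Hdelta : (0 < delta)%R) by (unfold delta; nra).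
  assert (Hsurj : forall w, (Cmod (w - f z0) < delta)%R -> exists z, (Cmod (z - z0) < eta)%R /\ f z = w).
  { intros w Hw.
    set (N := fun z => z - (f z - w) / a).
    set (x := fix x n := match n with O => z0 | S m => N (x m) end).
    set (k := (Cmod (w - f z0) / Cmod a)%R).
    assert (Hk : (0 <= k < eta / 4)%R).
    { unfold k; split; [apply Rmult_le_pos; [apply Cmod_ge_0 | now apply Rlt_le, Rinv_0_lt_compat]|].
      apply Rmult_lt_reg_r with (Cmod a); auto. unfold Rdiv at 1; rewrite Rmult_assoc, Rinv_l by lra. unfold delta in Hw; lra. }
    assert (Hkp : forall m, (0 <= k * (1 / 2) ^ m)%R) by (intros; apply Rmult_le_pos; [lra | apply pow_le; lra]).
    assert (Hx : forall n, (Cmod (x (S n) - x n) <= k * (1 / 2) ^ n)%R /\ (Cmod (x (S n) - z0) <= 2 * k * (1 - (1 / 2) ^ S n))%R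
      /\ (Cmod (x n - z0) <= 2 * k * (1 - (1 / 2) ^ n))%R).
    { induction n as [|n (IH1 & IH2 & IH3)].
      - assert (E : x 1%nat - x 0%nat = (w - f z0) / a) by (simpl; unfold N; field; auto).
        assert (E' : (Cmod (x 1%nat - z0) = k)%R) by (change z0 with (x 0%nat) at 1; rewrite E, Cmod_div; auto).
        repeat split.
        + rewrite E, Cmod_div by auto. simpl. unfold k. lra.
        + rewrite E'. simpl. lra.
        + simpl. replace (z0 - z0) with (RtoC 0) by ring. rewrite Cmod_0. lra.
      - assert (B1 : (Cmod (x n - z0) < eta)%R) by (generalize (Hkp n); lra).
        assert (B2 : (Cmod (x (S n) - z0) < eta)%R) by (generalize (Hkp (S n)); lra).
        assert (C1 : (Cmod (x (S (S n)) - x (S n)) <= k * (1 / 2) ^ S n)%R).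
        { change (x (S (S n))) with (N (x (S n))). change (x (S n)) with (N (x n)) at 2.
          replace (N (x (S n)) - N (x n)) with (- (f (x (S n)) - f (x n) - a * (x (S n) - x n)) / a)
            by (unfold N; field; auto).
          rewrite Cmod_div, Cmod_opp by auto.
          apply Rmult_le_reg_r with (Cmod a); auto. unfold Rdiv at 1; rewrite Rmult_assoc, Rinv_l by lra.
          rewrite Rmult_1_r. eapply Rle_trans; [apply Hlip; auto|]. rewrite <- tech_pow_Rmult.
          assert (Cmod a * Cmod (x (S n) - x n) <= Cmod a * (k * (1 / 2) ^ n))%R by (apply Rmult_le_compat_l; lra). lra. }
        repeat split; auto.
        replace (x (S (S n)) - z0) with ((x (S (S n)) - x (S n)) + (x (S n) - z0)) by ring.
        eapply Rle_trans; [apply Cmod_triangle|]. rewrite <- (tech_pow_Rmult (1 / 2) (S n)). lra. }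
    assert (Sm : csummable (fun n => x (S n) - x n)).
    { apply csummable_le with (fun n => (k * (1 / 2) ^ n)%R); [intros n; apply Hx|].
      apply (ex_series_scal (K := R_AbsRing) (V := R_NormedModule)), ex_series_geom. rewrite Rabs_pos_eq; lra. }
    set (l := CSeries (fun n => x (S n) - x n)).
    assert (Hl : cseries (fun n => x (S n) - x n) l) by now apply csummable_cseries.
    assert (Htel : forall n, csum (fun n => x (S n) - x n) n = x n - z0).
    { induction n as [|n IH]; [simpl; ring|].
      change (csum (fun n => x (S n) - x n) n + (x (S n) - x n) = x (S n) - z0). rewrite IH. ring. }
    set (z := z0 + l).
    assert (Hlim : forall e, (0 < e)%R -> exists M, forall n, (M <= n)%nat -> (Cmod (x n - z) < e)%R).
    { intros e He. destruct (Hl e He) as [M HM]. exists M. intros n Hn. specialize (HM n Hn).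
      rewrite Htel in HM. unfold z. now replace (x n - (z0 + l)) with (x n - z0 - l) by ring. }
    assert (Hz : (Cmod (z - z0) <= eta / 2)%R).
    { apply le_epsilon. intros e He. destruct (Hlim e He) as [M HM]. specialize (HM M (le_n M)).
      destruct (Hx M) as (_ & _ & H3).
      replace (z - z0) with ((x M - z0) + - (x M - z)) by ring.
      eapply Rle_trans; [apply Cmod_triangle|]. rewrite Cmod_opp.
      generalize (Hkp M); lra. }
    exists z. split; [lra|].
    apply Ceq_minus, Cmod_eq_0. apply Rle_antisym; [|apply Cmod_ge_0].
    apply le_epsilon. intros e He.
    destruct (Hlim (e / (3 * Cmod a))%R) as [M HM]; [apply Rdiv_lt_0_compat; lra|].
    assert (H1 := HM M (le_n M)). assert (H2 := HM (S M) ltac:(lia)).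
    assert (Bx : (Cmod (x M - z0) < eta)%R).
    { destruct (Hx M) as (_ & _ & H3). generalize (Hkp M); lra. }
    assert (L := Hlip (x M) z Bx ltac:(lra)).
    (* [f z - w = (f z - f x_M - a (z - x_M)) + a (z - x_(M+1))] *)
    replace (f z - w) with (- (f (x M) - f z - a * (x M - z)) + - (a * (x (S M) - z)))
      by (simpl; unfold N; field; auto).
    eapply Rle_trans; [apply Cmod_triangle|]. rewrite !Cmod_opp, Cmod_mult.
    assert (G1 : (Cmod a * Cmod (x (S M) - z) < e / 3)%R).
    { apply Rlt_le_trans with (Cmod a * (e / (3 * Cmod a)))%R; [now apply Rmult_lt_compat_l|]. right; field; lra. }
    assert (G2 : (Cmod a * Cmod (x M - z) < e / 3)%R).
    { apply Rlt_le_trans with (Cmod a * (e / (3 * Cmod a)))%R; [now apply Rmult_lt_compat_l|]. right; field; lra. }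
    lra. }
  set (G := fun w => epsilon (inhabits z0) (fun z => (Cmod (z - z0) < eta)%R /\ f z = w)).
  assert (HG : forall w, (Cmod (w - f z0) < delta)%R -> (Cmod (G w - z0) < eta)%R /\ f (G w) = w).
  { intros w Hw. unfold G. apply epsilon_spec. now apply Hsurj. }
  exists eta, delta, G. split; [split; auto; apply Rmin_r|]. split; auto. split; auto.
  assert (HGc : forall w, (Cmod (w - f z0) < delta)%R -> ccont G w).
  { intros w Hw e He. destruct (near_disc (f z0) w delta Hw) as (d' & Hd' & K').
    exists (Rmin d' (Cmod a / 2 * e)). split; [apply Rmin_pos; auto; nra|].
    intros v Hv. assert (V1 := Rlt_le_trans _ _ _ Hv (Rmin_l _ _)). assert (V2 := Rlt_le_trans _ _ _ Hv (Rmin_r _ _)).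
    destruct (HG w Hw) as [W1 W2]. destruct (HG v (K' v V1)) as [W3 W4].
    assert (L := Hexp (G v) (G w) W3 W1). rewrite W2, W4 in L.
    apply Rmult_lt_reg_l with (Cmod a / 2)%R; lra. }
  assert (Hf'0 : forall z, (Cmod (z - z0) < eta)%R -> f' z <> 0).
  { intros z Hz E. destruct (K z ltac:(lra)) as [_ Kz]. rewrite E in Kz.
    replace (0 - a) with (- a) in Kz by ring. rewrite Cmod_opp in Kz. lra. }
  (* The Carathéodory factor of the inverse is the reciprocal of that of [f], composed with [G]. *)
  assert (HGd : forall w, (Cmod (w - f z0) < delta)%R -> cder G w (/ f' (G w))).
  { intros w Hw. destruct (HG w Hw) as [W1 W2].
    destruct (K (G w) ltac:(lra)) as [[(q & Q1 & Q2 & Q3) _] _].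
    apply cder_local with (fun v => / q (G v)).
    - apply ccont_inv; [|now rewrite Q2; apply Hf'0]. apply ccont_comp; auto.
    - now rewrite Q2.
    - assert (Nq : near w (fun v => q (G v) <> 0)).
      { apply ccont_neq0; [apply ccont_comp; auto|]. rewrite Q2. now apply Hf'0. }
      generalize (near_and _ _ _ Nq (near_disc (f z0) w delta Hw)). apply near_imp.
      intros v [V1 V2]. destruct (HG v V2) as [V3 V4].
      assert (E := Q3 (G v)). rewrite W2, V4 in E. rewrite E. field. auto. }
  intros w Hw. destruct (HG w Hw) as [W1 W2]. repeat split; auto.
  exists (fun v => / f' (G v)). generalize (near_disc (f z0) w delta Hw). apply near_imp.
  intros v Hv. destruct (HG v Hv) as [V1 V2]. split; auto.
  apply ccont_inv; [|now apply Hf'0]. apply ccont_comp; auto. now apply K; lra.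
Qed.

(** By continuity both [F] and [G] stay near the common value, where [f] is injective because its
    derivative does not vanish. *)
Lemma section_unique (f F G : C -> C) (w0 a : C) :
  holo f (F w0) -> cder f (F w0) a -> a <> 0 -> ccont F w0 -> ccont G w0 -> F w0 = G w0 ->
  near w0 (fun w => f (F w) = f (G w)) -> near w0 (fun w => F w = G w).
Proof.
  intros Hf Ha Na HF HG E Hn.
  destruct (local_inverse f (F w0) a 1 Rlt_0_1 Hf Ha Na) as (eta & delta & _ & [He _] & _ & Hinj & _).
  assert (H1 := HF eta He). assert (H2 := HG eta He). rewrite <- E in H2.
  generalize (near_and _ _ _ Hn (near_and _ _ _ H1 H2)). apply near_imp.
  intros w (A1 & A2 & A3). auto.
Qed.

(** * Series over the integers and theta constants *)

(** Pairing $n$ with $-(n+1)$ meets every integer exactly once and turns a two-sided series into an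
    ordinary one. *)
Definition pairz (u : Z -> C) (n : nat) : C := u (Z.of_nat n) + u (- Z.of_nat (S n))%Z.

Definition pairzR (u : Z -> R) (n : nat) : R := (u (Z.of_nat n) + u (- Z.of_nat (S n))%Z)%R.

Definition zsummable (u : Z -> C) : Prop := ex_series (pairzR (fun n => Cmod (u n))).

Lemma zsummable_le (u : Z -> C) (b : Z -> R) :
  (forall n, (Cmod (u n) <= b n)%R) -> ex_series (pairzR b) -> zsummable u.
Proof.
  intros H. apply ex_series_le_R. intros n. unfold pairzR.
  generalize (H (Z.of_nat n)) (H (- Z.of_nat (S n))%Z) (Cmod_ge_0 (u (Z.of_nat n))) (Cmod_ge_0 (u (- Z.of_nat (S n))%Z)). lra.
Qed.

Lemma zsummable_pos (u : Z -> C) : zsummable u -> csummable (fun n => u (Z.of_nat n)).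
Proof.
  intros H. eapply csummable_le; [|exact H]. intros n. unfold pairzR.
  generalize (Cmod_ge_0 (u (- Z.of_nat (S n))%Z)). lra.
Qed.

Lemma zsummable_neg (u : Z -> C) : zsummable u -> csummable (fun n => u (- Z.of_nat (S n))%Z).
Proof.
  intros H. eapply csummable_le; [|exact H]. intros n. unfold pairzR.
  generalize (Cmod_ge_0 (u (Z.of_nat n))). lra.
Qed.

Lemma zsummable_pairz (u : Z -> C) : zsummable u -> csummable (pairz u).
Proof. intros H. eapply csummable_le; [|exact H]. intros n. apply Cmod_triangle. Qed.

Lemma CSeriesZ_cseries (u : Z -> C) : zsummable u -> cseries (pairz u) (CSeriesZ u).
Proof.
  intros H. apply cseries_plus; apply csummable_cseries; [now apply zsummable_pos | now apply zsummable_neg].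
Qed.

Lemma CSeriesZ_pairz (u : Z -> C) : zsummable u -> CSeriesZ u = CSeries (pairz u).
Proof. intros H. symmetry. now apply CSeries_unique, CSeriesZ_cseries. Qed.

Lemma CSeriesZ_unique (u : Z -> C) (l : C) : zsummable u -> cseries (pairz u) l -> CSeriesZ u = l.
Proof. intros H Hl. eapply cseries_unique; [now apply CSeriesZ_cseries | exact Hl]. Qed.

Lemma CSeriesZ_ext (u v : Z -> C) : (forall n, u n = v n) -> CSeriesZ u = CSeriesZ v.
Proof. intros H. unfold CSeriesZ. f_equal; apply CSeries_ext; auto. Qed.

Lemma zsummable_ext (u v : Z -> C) : (forall n, u n = v n) -> zsummable u -> zsummable v.
Proof.
  intros E H. apply (zsummable_le v (fun n => Cmod (u n))); auto. intros n; rewrite E; lra.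
Qed.

Lemma zsummable_scal (c : C) (u : Z -> C) : zsummable u -> zsummable (fun n => c * u n).
Proof.
  intros H. apply (zsummable_le _ (fun n => Cmod c * Cmod (u n))%R).
  - intros n. rewrite Cmod_mult. lra.
  - apply ex_series_le_scal with (Cmod c) (pairzR (fun n => Cmod (u n))); auto.
    intros n. unfold pairzR. assert (P := Cmod_ge_0 c).
    assert (P1 := Cmod_ge_0 (u (Z.of_nat n))). assert (P2 := Cmod_ge_0 (u (- Z.of_nat (S n))%Z)). nra.
Qed.

Lemma CSeriesZ_scal (c : C) (u : Z -> C) : zsummable u -> CSeriesZ (fun n => c * u n) = c * CSeriesZ u.
Proof.
  intros H. apply CSeriesZ_unique; [now apply zsummable_scal|].
  apply cseries_ext with (fun n => c * pairz u n); [intros; unfold pairz; ring|].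
  now apply cseries_scal, CSeriesZ_cseries.
Qed.

(** The substitution $n\mapsto-n-1$ exchanges the two halves of [CSeriesZ]. It reduces negative
    shifts to positive ones and yields the vanishing in [gth_1_true]. *)
Lemma CSeriesZ_reflect (u : Z -> C) : CSeriesZ (fun n => u (- n - 1)%Z) = CSeriesZ u.
Proof.
  unfold CSeriesZ. rewrite Cplus_comm. f_equal; apply CSeries_ext; intros n; f_equal; lia.
Qed.

Lemma csummable_vanish (u : nat -> C) : csummable u -> forall eps : R, (0 < eps)%R ->
  exists N, forall n, (N <= n)%nat -> (Cmod (u n) < eps)%R.
Proof.
  intros H eps He. destruct (csummable_cseries u H (eps / 2)%R ltac:(lra)) as [N HN].
  exists N. intros n Hn. assert (A := HN n Hn). assert (B := HN (S n) ltac:(lia)). simpl in B.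
  replace (u n) with ((csum u n + u n - CSeries u) + - (csum u n - CSeries u)) by ring.
  eapply Rle_lt_trans; [apply Cmod_triangle|]. rewrite Cmod_opp. lra.
Qed.

Lemma csummable_shift (u : nat -> C) : csummable u -> csummable (fun n => u (S n)).
Proof. intros H. now apply (ex_series_incr_1 (K := R_AbsRing) (V := R_NormedModule) (fun n => Cmod (u n))). Qed.

Lemma csummable_unshift (u : nat -> C) : csummable (fun n => u (S n)) -> csummable u.
Proof. intros H. now apply (ex_series_incr_1 (K := R_AbsRing) (V := R_NormedModule) (fun n => Cmod (u n))). Qed.

Lemma zsummable_intro (u : Z -> C) :
  csummable (fun n => u (Z.of_nat n)) -> csummable (fun n => u (- Z.of_nat (S n))%Z) -> zsummable u.
Proof. intros H1 H2. apply (ex_series_plus (K := R_AbsRing) (V := R_NormedModule) _ _ H1 H2). Qed.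

Lemma csummable_ext (u v : nat -> C) : (forall n, u n = v n) -> csummable u -> csummable v.
Proof. intros E H. apply (csummable_le v (fun n => Cmod (u n))); auto. intros n; rewrite E; lra. Qed.

Lemma zsummable_succ (u : Z -> C) : zsummable u -> zsummable (fun n => u (n + 1)%Z).
Proof.
  intros H. apply zsummable_intro.
  - apply csummable_ext with (fun n => u (Z.of_nat (S n))); [intros; f_equal; lia|].
    apply (csummable_shift (fun n => u (Z.of_nat n))). now apply zsummable_pos.
  - apply csummable_unshift. apply csummable_ext with (fun n => u (- Z.of_nat (S n))%Z); [intros; f_equal; lia|].
    now apply zsummable_neg.
Qed.

Lemma zsummable_reflect (u : Z -> C) : zsummable u -> zsummable (fun n => u (- n - 1)%Z).
Proof.
  intros H. apply zsummable_intro.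
  - apply csummable_ext with (fun n => u (- Z.of_nat (S n))%Z); [intros; f_equal; lia|]. now apply zsummable_neg.
  - apply csummable_ext with (fun n => u (Z.of_nat n)); [intros; f_equal; lia|]. now apply zsummable_pos.
Qed.

(** The partial sums of the shifted series differ from the original ones by the boundary terms
    $u(n)-u(-n)$, which tend to $0$. *)
Lemma CSeriesZ_succ (u : Z -> C) : zsummable u -> CSeriesZ (fun n => u (n + 1)%Z) = CSeriesZ u.
Proof.
  intros H. apply CSeriesZ_unique; [now apply zsummable_succ|].
  assert (E : forall n, csum (pairz (fun n => u (n + 1)%Z)) n = csum (pairz u) n + (u (Z.of_nat n) + - u (- Z.of_nat n)%Z)).
  { induction n as [|n IH].
    - simpl. ring.
    - simpl csum. rewrite IH. unfold pairz.
      replace (Z.of_nat n + 1)%Z with (Z.of_nat (S n)) by lia.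
      replace (- Z.of_nat (S n) + 1)%Z with (- Z.of_nat n)%Z by lia. ring. }
  intros eps He. destruct (CSeriesZ_cseries u H (eps/3)%R ltac:(lra)) as [N1 K1].
  destruct (csummable_vanish _ (zsummable_pos u H) (eps/3)%R ltac:(lra)) as [N2 K2].
  destruct (csummable_vanish _ (zsummable_neg u H) (eps/3)%R ltac:(lra)) as [N3 K3].
  exists (S (N1 + N2 + N3)). intros n Hn. rewrite E.
  specialize (K1 n ltac:(lia)). specialize (K2 n ltac:(lia)).
  destruct n as [|n]; [lia|]. specialize (K3 n ltac:(lia)).
  replace (csum (pairz u) (S n) + (u (Z.of_nat (S n)) + - u (- Z.of_nat (S n))%Z) - CSeriesZ u)
    with ((csum (pairz u) (S n) - CSeriesZ u) + (u (Z.of_nat (S n)) + - u (- Z.of_nat (S n))%Z)) by ring.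
  eapply Rle_lt_trans; [apply Cmod_triangle|].
  assert (T := Cmod_triangle (u (Z.of_nat (S n))) (- u (- Z.of_nat (S n))%Z)). rewrite Cmod_opp in T. lra.
Qed.

Lemma CSeriesZ_shift (u : Z -> C) (k : Z) : zsummable u ->
  zsummable (fun n => u (n + k)%Z) /\ CSeriesZ (fun n => u (n + k)%Z) = CSeriesZ u.
Proof.
  assert (P : forall m : nat, forall u, zsummable u ->
    zsummable (fun n => u (n + Z.of_nat m)%Z) /\ CSeriesZ (fun n => u (n + Z.of_nat m)%Z) = CSeriesZ u).
  { clear u. induction m as [|m IH]; intros u H.
    - split; [apply (zsummable_ext u); auto; intros; f_equal; lia | apply CSeriesZ_ext; intros; f_equal; lia].
    - destruct (IH u H) as [S1 E1]. split.
      + apply zsummable_ext with (fun n => u (n + 1 + Z.of_nat m)%Z); [intros; f_equal; lia|].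
        apply (zsummable_succ (fun n => u (n + Z.of_nat m)%Z) S1).
      + rewrite <- E1, <- (CSeriesZ_succ _ S1). apply CSeriesZ_ext; intros; f_equal; lia. }
  intros H. destruct (Z_le_dec 0 k) as [L|L].
  - replace k with (Z.of_nat (Z.to_nat k)) by lia. now apply P.
  - (* a negative shift is a positive shift of the reflected sequence *)
    destruct (P (Z.to_nat (- k)) (fun n => u (- n - 1)%Z) (zsummable_reflect u H)) as [S1 E1].
    split.
    + apply zsummable_reflect in S1. revert S1. apply zsummable_ext. intros n. f_equal. lia.
    + rewrite <- (CSeriesZ_reflect u), <- E1, <- (CSeriesZ_reflect (fun n => u (n + k)%Z)).
      apply CSeriesZ_ext. intros n; f_equal; lia.
Qed.

(** The first $n$ pairs of the even and of the odd subseries together are the first $2n$ pairs of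
    [u]. *)
Lemma CSeriesZ_even_odd (u : Z -> C) : zsummable u ->
  zsummable (fun n => u (2 * n)%Z) -> zsummable (fun n => u (2 * n + 1)%Z) ->
  CSeriesZ u = CSeriesZ (fun n => u (2 * n)%Z) + CSeriesZ (fun n => u (2 * n + 1)%Z).
Proof.
  intros H He Ho.
  assert (S := cseries_plus _ _ _ _ (CSeriesZ_cseries _ He) (CSeriesZ_cseries _ Ho)).
  apply cseries_unique with (2 := S).
  intros eps Heps. destruct (CSeriesZ_cseries u H eps Heps) as [N HN].
  exists N. intros n Hn.
  replace (csum _ n) with (csum (pairz u) (2 * n)); [apply HN; lia|].
  clear Hn. induction n as [|n IH]; auto.
  replace (2 * Datatypes.S n)%nat with (Datatypes.S (Datatypes.S (2 * n))) by lia. rewrite !csum_S, <- IH.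
  unfold pairz.
  replace (2 * Z.of_nat n)%Z with (Z.of_nat (2 * n)) by lia.
  replace (Z.of_nat (2 * n) + 1)%Z with (Z.of_nat (Datatypes.S (2 * n))) by lia.
  replace (2 * - Z.of_nat (Datatypes.S n))%Z with (- Z.of_nat (Datatypes.S (Datatypes.S (2 * n))))%Z by lia.
  replace (- Z.of_nat (Datatypes.S (Datatypes.S (2 * n))) + 1)%Z with (- Z.of_nat (Datatypes.S (2 * n)))%Z by lia.
  ring.
Qed.

Fixpoint rsum (a : nat -> R) (n : nat) : R :=
  match n with O => 0%R | S m => (rsum a m + a m)%R end.

Lemma rsum_sum_n (a : nat -> R) (n : nat) : rsum a (S n) = sum_n a n.
Proof.
  induction n as [|n IH]; [rewrite sum_O; simpl; ring|]. rewrite sum_Sn, <- IH. reflexivity.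
Qed.

Lemma rsum_le_Series (a : nat -> R) (n : nat) :
  (forall k, 0 <= a k)%R -> ex_series a -> (rsum a n <= Series a)%R.
Proof.
  intros Ha He. apply Rle_trans with (rsum a (S n)); [simpl; generalize (Ha n); lra|].
  rewrite rsum_sum_n. now apply sum_n_le_Series.
Qed.

Lemma cseries_tail (u : nat -> C) (l : C) (c : R) (a : nat -> R) (N : nat) :
  cseries u l -> (0 <= c)%R -> (forall n, (0 <= a n)%R) -> (forall n, (Cmod (u n) <= c * a n)%R) -> ex_series a ->
  (Cmod (l - csum u N) <= c * (Series a - rsum a N))%R.
Proof.
  intros Hu Hc Ha Hb He.
  assert (H : forall m, (Cmod (csum u (N + m) - csum u N) <= c * (rsum a (N + m) - rsum a N))%R).
  { induction m as [|m IH].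
    - rewrite Nat.add_0_r. replace (csum u N - csum u N) with (RtoC 0) by ring. rewrite Cmod_0. lra.
    - rewrite Nat.add_succ_r. simpl.
      replace (csum u (N + m) + u (N + m)%nat - csum u N) with ((csum u (N + m) - csum u N) + u (N + m)%nat) by ring.
      eapply Rle_trans; [apply Cmod_triangle|]. specialize (Hb (N + m)%nat). lra. }
  apply le_epsilon. intros eps Heps. destruct (Hu eps Heps) as [M HM].
  specialize (HM (N + M)%nat ltac:(lia)). specialize (H M).
  replace (l - csum u N) with (- (csum u (N + M) - l) + (csum u (N + M) - csum u N)) by ring.
  eapply Rle_trans; [apply Cmod_triangle|]. rewrite Cmod_opp.
  assert (B : (rsum a (N + M) <= Series a)%R) by now apply rsum_le_Series.
  assert (c * (rsum a (N + M) - rsum a N) <= c * (Series a - rsum a N))%R by (apply Rmult_le_compat_l; lra). lra.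
Qed.

Lemma rsum_Series_lim (a : nat -> R) : ex_series a -> forall eps : R, (0 < eps)%R ->
  exists N, forall n, (N <= n)%nat -> (Rabs (Series a - rsum a n) < eps)%R.
Proof.
  intros H eps He. apply Series_correct in H.
  destruct (proj1 (is_series_eps _ _) H eps He) as [N HN]. exists (S N). intros n Hn.
  destruct n as [|n]; [lia|]. rewrite rsum_sum_n, Rabs_minus_sym. apply HN. lia.
Qed.

Lemma csum_cseries_exchange (w : nat -> nat -> C) (N : nat) :
  (forall n, csummable (w n)) ->
  cseries (fun k => csum (fun n => w n k) N) (csum (fun n => CSeries (w n)) N).
Proof.
  intros H. induction N as [|N IH].
  - intros eps He. exists O. intros n _. replace (csum _ n) with (RtoC 0).
    + simpl. replace (0 - 0) with (RtoC 0) by ring. now rewrite Cmod_0.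
    + induction n as [|n IH]; auto. simpl in *. rewrite <- IH. ring.
  - simpl. apply cseries_plus; auto. now apply csummable_cseries.
Qed.

(** Once the first $n$ rows are subtracted, the $k$-th column sum is at most $b_k$ times the tail of
    $\sum a$; summation over $k$ leaves that tail times $\sum b$, which tends to $0$. *)
Lemma fubini_nat (w : nat -> nat -> C) (a b : nat -> R) :
  (forall n, 0 <= a n)%R -> (forall n, 0 <= b n)%R -> ex_series a -> ex_series b ->
  (forall n k, (Cmod (w n k) <= a n * b k)%R) ->
  cseries (fun n => CSeries (w n)) (CSeries (fun k => CSeries (fun n => w n k))).
Proof.
  intros Ha Hb Sa Sb Hw.
  assert (Hrow : forall n, csummable (w n)).
  { intros n. apply csummable_le with (fun k => a n * b k)%R; auto.
    apply (ex_series_scal (K := R_AbsRing) (V := R_NormedModule)), Sb. }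
  assert (Hcol : forall k, cseries (fun n => w n k) (CSeries (fun n => w n k))).
  { intros k. apply csummable_cseries, csummable_le with (fun n => b k * a n)%R.
    - intros n. rewrite Rmult_comm. apply Hw.
    - apply (ex_series_scal (K := R_AbsRing) (V := R_NormedModule)), Sa. }
  assert (HT : csummable (fun k => CSeries (fun n => w n k))).
  { apply csummable_le with (fun k => Series a * b k)%R.
    - intros k. assert (A := cseries_tail _ _ (b k) a 0 (Hcol k) (Hb k) Ha ltac:(intros n; rewrite Rmult_comm; apply Hw) Sa).
      simpl in A. replace (CSeries (fun n => w n k) - 0) with (CSeries (fun n => w n k)) in A by ring.
      rewrite Rminus_0_r in A. lra.
    - apply (ex_series_scal (K := R_AbsRing) (V := R_NormedModule)), Sb. }
  intros eps He. assert (PB : (0 <= Series b)%R) by (apply (rsum_le_Series b 0); auto).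
  destruct (rsum_Series_lim a Sa (eps / (Series b + 1))%R) as [N HN]; [apply Rdiv_lt_0_compat; lra|].
  exists N. intros n Hn. specialize (HN n Hn).
  assert (D : cseries (fun k => CSeries (fun n => w n k) + (- (1)) * csum (fun n => w n k) n)
    (CSeries (fun k => CSeries (fun n => w n k)) + (- (1)) * csum (fun n => CSeries (w n)) n)).
  { apply cseries_plus; [now apply csummable_cseries|]. apply cseries_scal. now apply csum_cseries_exchange. }
  set (T := CSeries (fun k => CSeries (fun n => w n k))) in *.
  replace (csum (fun n => CSeries (w n)) n - T) with (- (T + (- (1)) * csum (fun n => CSeries (w n)) n)) by ring.
  rewrite Cmod_opp.
  assert (Ra : (0 <= Series a - rsum a n)%R) by (generalize (rsum_le_Series a n Ha Sa); lra).
  rewrite Rabs_pos_eq in HN by auto.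
  eapply Rle_lt_trans; [apply (cseries_Cmod_le _ _ (fun k => (Series a - rsum a n) * b k)%R D)|].
  - intros k. replace (CSeries (fun n => w n k) + (- (1)) * csum (fun n => w n k) n)
      with (CSeries (fun n => w n k) - csum (fun n => w n k) n) by ring.
    rewrite Rmult_comm. apply (cseries_tail _ _ (b k) a n (Hcol k)); auto.
    intros m; rewrite Rmult_comm; apply Hw.
  - apply (ex_series_scal (K := R_AbsRing) (V := R_NormedModule)), Sb.
  - rewrite Series_scal_l.
    apply Rle_lt_trans with ((Series a - rsum a n) * (Series b + 1))%R; [apply Rmult_le_compat_l; lra|].
    apply Rlt_le_trans with (eps / (Series b + 1) * (Series b + 1))%R; [apply Rmult_lt_compat_r; lra|].
    right; field; lra.
Qed.

Lemma CSeries_plus (u v : nat -> C) : csummable u -> csummable v ->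
  CSeries (fun n => u n + v n) = CSeries u + CSeries v.
Proof. intros Hu Hv. apply CSeries_unique, cseries_plus; now apply csummable_cseries. Qed.

Section FubiniZ.

Variables (v : Z -> Z -> C) (A B : Z -> R).
Hypothesis HA : forall n, (0 <= A n)%R.
Hypothesis HB : forall n, (0 <= B n)%R.
Hypothesis SA : ex_series (pairzR A).
Hypothesis SB : ex_series (pairzR B).
Hypothesis Hv : forall n k, (Cmod (v n k) <= A n * B k)%R.

Lemma ex_series_pairzR_scal (c : R) (D : Z -> R) : ex_series (pairzR D) -> ex_series (pairzR (fun n => c * D n)%R).
Proof.
  intros H. apply (ex_series_ext (fun n => c * pairzR D n)%R); [intros; unfold pairzR; apply Rmult_plus_distr_l|].
  now apply (ex_series_scal (K := R_AbsRing) (V := R_NormedModule)).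
Qed.

Lemma fubini_row n : zsummable (v n).
Proof. apply zsummable_le with (fun k => A n * B k)%R; auto. now apply ex_series_pairzR_scal. Qed.

Lemma fubini_col k : zsummable (fun n => v n k).
Proof.
  apply zsummable_le with (fun n => B k * A n)%R; [intros n; rewrite Rmult_comm; auto|].
  now apply ex_series_pairzR_scal.
Qed.

Lemma CSeriesZ_bound (u : Z -> C) (c : R) (D : Z -> R) : (forall n, (Cmod (u n) <= c * D n)%R) ->
  ex_series (pairzR D) -> (Cmod (CSeriesZ u) <= c * Series (pairzR D))%R.
Proof.
  intros H S. rewrite <- Series_scal_l. apply cseries_Cmod_le with (pairz u).
  - apply CSeriesZ_cseries, zsummable_le with (1 := H). now apply ex_series_pairzR_scal.
  - intros n. unfold pairz, pairzR. eapply Rle_trans; [apply Cmod_triangle|].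
    generalize (H (Z.of_nat n)) (H (- Z.of_nat (Datatypes.S n))%Z). lra.
  - now apply (ex_series_scal (K := R_AbsRing) (V := R_NormedModule)).
Qed.

Lemma fubini_rows_summable : zsummable (fun n => CSeriesZ (v n)).
Proof.
  apply zsummable_le with (fun n => Series (pairzR B) * A n)%R; [|now apply ex_series_pairzR_scal].
  intros n. rewrite Rmult_comm. apply CSeriesZ_bound; auto.
Qed.

Lemma fubini_cols_summable : zsummable (fun k => CSeriesZ (fun n => v n k)).
Proof.
  apply zsummable_le with (fun n => Series (pairzR A) * B n)%R; [|now apply ex_series_pairzR_scal].
  intros n. rewrite Rmult_comm. apply CSeriesZ_bound; auto. intros m; rewrite Rmult_comm; auto.
Qed.

(** Pairing in both indices gives a four-term array [w] over the natural numbers, to which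
    [fubini_nat] applies. *)
Lemma fubini_Z : CSeriesZ (fun n => CSeriesZ (v n)) = CSeriesZ (fun k => CSeriesZ (fun n => v n k)).
Proof.
  set (w := fun n k => pairz (v (Z.of_nat n)) k + pairz (v (- Z.of_nat (S n))%Z) k).
  apply CSeriesZ_unique; [apply fubini_rows_summable|].
  rewrite (CSeriesZ_pairz _ fubini_cols_summable).
  apply cseries_ext with (fun n => CSeries (w n)).
  { intros n. unfold w, pairz at 3. rewrite CSeries_plus by apply zsummable_pairz, fubini_row.
    now rewrite !CSeriesZ_pairz by apply fubini_row. }
  rewrite (CSeries_ext (pairz (fun k => CSeriesZ (fun n => v n k))) (fun k => CSeries (fun n => w n k))).
  - apply fubini_nat with (pairzR A) (pairzR B); auto.
    + intros n; unfold pairzR; apply Rplus_le_le_0_compat; auto.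
    + intros n; unfold pairzR; apply Rplus_le_le_0_compat; auto.
    + intros n k. unfold w, pairz, pairzR.
      eapply Rle_trans; [apply Cmod_triangle|].
      eapply Rle_trans; [apply Rplus_le_compat; apply Cmod_triangle|].
      generalize (Hv (Z.of_nat n) (Z.of_nat k)) (Hv (Z.of_nat n) (- Z.of_nat (S k))%Z)
        (Hv (- Z.of_nat (S n))%Z (Z.of_nat k)) (Hv (- Z.of_nat (S n))%Z (- Z.of_nat (S k))%Z). lra.
  - intros k. unfold pairz at 1. rewrite !CSeriesZ_pairz by apply fubini_col.
    rewrite <- CSeries_plus by apply zsummable_pairz, fubini_col.
    apply CSeries_ext. intros n. unfold w, pairz. ring.
Qed.

End FubiniZ.

(** * Theta series with characteristics and their product formula *)

Definition chi (s : bool) (n : Z) : C := if s then (if Z.even n then 1 else - (1)) else 1.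

Lemma chi_add (s : bool) (n m : Z) : chi s (n + m) = chi s n * chi s m.
Proof.
  destruct s; simpl; [|ring]. rewrite Z.even_add. destruct (Z.even n), (Z.even m); simpl; ring.
Qed.

Lemma chi_xorb (s s' : bool) (n : Z) : chi (xorb s s') n = chi s n * chi s' n.
Proof. destruct s, s'; simpl; try ring. destruct (Z.even n); ring. Qed.

Lemma chi_double (s : bool) (n : Z) : chi s (2 * n) = 1.
Proof. destruct s; auto. unfold chi. now rewrite Z.even_mul. Qed.

Lemma chi_sqr (s : bool) (n : Z) : chi s n * chi s n = 1.
Proof. destruct s; simpl; [destruct (Z.even n)|]; ring. Qed.

Lemma Cmod_chi (s : bool) (n : Z) : Cmod (chi s n) = 1%R.
Proof. destruct s; simpl; [destruct (Z.even n)|]; rewrite ?Cmod_opp; apply Cmod_1. Qed.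

(* [qexp tau x] is [q ^ x] for [q = exp (pi i tau)]. *)
Definition qexp (tau : C) (x : R) : C := Cexp (RtoC PI * Ci * RtoC x * tau).

Lemma qexp_plus (tau : C) (x y : R) : qexp tau (x + y) = qexp tau x * qexp tau y.
Proof. unfold qexp. rewrite <- Cexp_plus. f_equal. rewrite RtoC_plus. ring. Qed.

Lemma qexp_double (tau : C) (x : R) : qexp tau (2 * x) = qexp (2 * tau) x.
Proof. unfold qexp. f_equal. rewrite RtoC_mult. ring. Qed.

Lemma Cmod_qexp (tau : C) (x : R) : Cmod (qexp tau x) = exp (- (PI * Im tau) * x).
Proof. unfold qexp. rewrite Cmod_Cexp. f_equal. destruct tau; simpl. ring. Qed.

Lemma exp_INR_mult (x : R) (k : nat) : exp (INR k * x) = (exp x ^ k)%R.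
Proof.
  induction k as [|k IH]; [simpl; rewrite Rmult_0_l; apply exp_0|].
  rewrite S_INR. replace ((INR k + 1) * x)%R with (x + INR k * x)%R by ring.
  rewrite exp_plus, IH. reflexivity.
Qed.

Lemma exp_le_compat (x y : R) : (x <= y)%R -> (exp x <= exp y)%R.
Proof. intros [H| ->]; [left; now apply exp_increasing | right; auto]. Qed.

(** From $(x+h)^2\ge x^2/2-h^2$ and $x^2\ge k$ for an integer $x$ of absolute value at least $k$,
    the terms are dominated by a geometric sequence of ratio $e^{-c/2}$. *)
Lemma gauss_summable (c h : R) : (0 < c)%R ->
  ex_series (pairzR (fun n => exp (- c * ((IZR n + h) * (IZR n + h))))).
Proof.
  intros Hc.
  assert (B : forall (k : nat) (x : R), (INR k <= Rabs x)%R ->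
    (exp (- c * ((x + h) * (x + h))) <= exp (c * (h * h)) * exp (- (c / 2)) ^ k)%R).
  { intros k x Hx. rewrite <- exp_INR_mult, <- exp_plus. apply exp_le_compat.
    assert (K : (INR k <= x * x)%R).
    { destruct k as [|k]; [simpl; nra|].
      assert (1 <= INR (S k))%R by (rewrite S_INR; generalize (pos_INR k); lra).
      replace (x * x)%R with (Rabs x * Rabs x)%R by (rewrite <- Rabs_mult; apply Rabs_pos_eq; nra).
      assert (Rabs x * 1 <= Rabs x * Rabs x)%R by (apply Rmult_le_compat_l; lra). lra. }
    assert (Q : (x * x / 2 - h * h <= (x + h) * (x + h))%R).
    { assert (0 <= (x + 2 * h) * (x + 2 * h))%R by apply Rle_0_sqr. lra. }
    assert (c * (x * x / 2 - h * h) <= c * ((x + h) * (x + h)))%R by (apply Rmult_le_compat_l; lra).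
    assert (c * INR k <= c * (x * x))%R by (apply Rmult_le_compat_l; lra). lra. }
  apply ex_series_le_scal with (2 * exp (c * (h * h)))%R (fun k => exp (- (c / 2)) ^ k)%R.
  - intros k. unfold pairzR. split; [left; apply Rplus_lt_0_compat; apply exp_pos|].
    assert (B1 := B k (IZR (Z.of_nat k))). assert (B2 := B k (IZR (- Z.of_nat (S k)))).
    rewrite opp_IZR, Rabs_Ropp in B2. rewrite <- opp_IZR in B2.
    rewrite <- !INR_IZR_INZ in *. rewrite !Rabs_pos_eq in B1, B2 by auto using pos_INR.
    specialize (B1 (Rle_refl _)). rewrite S_INR in B2.
    assert (E : (IZR (- Z.of_nat (S k)) = - (INR k + 1))%R) by (rewrite opp_IZR, <- INR_IZR_INZ, S_INR; auto).
    rewrite E in *. specialize (B2 ltac:(lra)). lra.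
  - apply ex_series_geom. rewrite Rabs_pos_eq by (left; apply exp_pos).
    rewrite <- exp_0. apply exp_increasing. lra.
Qed.

(** The first characteristic is an arbitrary integer because the product formula raises [p] to
    [p + 1]. The sign $(-1)^n$ agrees with the phase of [theta p q] in the three cases with $pq=0$
    that are compared with it. *)
Definition gterm (p : Z) (s : bool) (tau : C) (n : Z) : C :=
  chi s n * qexp tau ((IZR n + IZR p / 2) * (IZR n + IZR p / 2)).

Definition gth (p : Z) (s : bool) (tau : C) : C := CSeriesZ (gterm p s tau).

Lemma gterm_summable (p : Z) (s : bool) (tau : C) : upper_half_plane tau -> zsummable (gterm p s tau).
Proof.
  intros H. apply zsummable_le with (2 := gauss_summable (PI * Im tau) (IZR p / 2) ltac:(apply Rmult_lt_0_compat; [apply PI_RGT_0 | apply H])).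
  intros n. unfold gterm. rewrite Cmod_mult, Cmod_chi, Cmod_qexp. lra.
Qed.

Lemma gth_add2 (p : Z) (s : bool) (tau : C) : upper_half_plane tau ->
  gth (p + 2) s tau = chi s 1 * gth p s tau.
Proof.
  intros H. unfold gth. rewrite <- (CSeriesZ_succ _ (gterm_summable p s tau H)).
  rewrite <- CSeriesZ_scal by apply zsummable_succ, gterm_summable, H.
  apply CSeriesZ_ext. intros n. unfold gterm. rewrite chi_add.
  rewrite !plus_IZR.
  replace ((IZR n + (IZR p + 2) / 2) * (IZR n + (IZR p + 2) / 2))%R
    with ((IZR n + 1 + IZR p / 2) * (IZR n + 1 + IZR p / 2))%R by field.
  transitivity ((chi s 1 * chi s 1) * chi s n * qexp tau ((IZR n + 1 + IZR p / 2) * (IZR n + 1 + IZR p / 2))).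
  - rewrite chi_sqr. ring.
  - ring.
Qed.

Lemma uhp_double (tau : C) : upper_half_plane tau -> upper_half_plane (2 * tau).
Proof. unfold upper_half_plane. destruct tau; simpl. lra. Qed.

Lemma gth_shifted (p l : Z) (s : bool) (tau c : C) : upper_half_plane tau ->
  CSeriesZ (fun n => c * (chi s n * qexp tau ((IZR (n + l) + IZR p / 2) * (IZR (n + l) + IZR p / 2))))
  = c * chi s l * gth p s tau.
Proof.
  intros H. destruct (CSeriesZ_shift (gterm p s tau) l (gterm_summable p s tau H)) as [S E].
  unfold gth. rewrite <- E, <- CSeriesZ_scal by auto.
  apply CSeriesZ_ext. intros n. unfold gterm. rewrite chi_add.
  transitivity (c * (chi s l * chi s l) * chi s n * qexp tau ((IZR (n + l) + IZR p / 2) * (IZR (n + l) + IZR p / 2))).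
  - rewrite chi_sqr. ring.
  - ring.
Qed.

(* With [m = n + k] the exponent [(n+h)^2 + (m+h)^2] becomes
   [2 (n + h + k/2)^2 + k^2/2]; the two parities of [k] give the two products. *)
Theorem gth_mult (p : Z) (s1 s2 : bool) (tau : C) : upper_half_plane tau ->
  let s := xorb s1 s2 in
  gth p s1 tau * gth p s2 tau =
  gth 0 s (2 * tau) * gth p s (2 * tau) + chi s2 1 * gth 1 s (2 * tau) * gth (p + 1) s (2 * tau).
Proof.
  intros H s. assert (H2 := uhp_double tau H).
  set (h := (IZR p / 2)%R).
  set (v := fun n k : Z => gterm p s1 tau n * gterm p s2 tau (n + k)).
  (* A third of the decay rate suffices for a majorant in product form:
     $3(x^2+(x+y)^2)-x^2-y^2=\frac15((5x+3y)^2+y^2)\ge0$. *)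
  set (c := (PI * Im tau / 3)%R).
  assert (Hc : (0 < c)%R).
  { unfold c. assert (0 < PI * Im tau)%R by (apply Rmult_lt_0_compat; [apply PI_RGT_0 | apply H]). lra. }
  set (A := fun n => exp (- c * ((IZR n + h) * (IZR n + h)))).
  set (B := fun n => exp (- c * ((IZR n + 0) * (IZR n + 0)))).
  assert (SA : ex_series (pairzR A)) by now apply gauss_summable.
  assert (SB : ex_series (pairzR B)) by now apply gauss_summable.
  assert (PA : forall n, (0 <= A n)%R) by (intros; left; apply exp_pos).
  assert (PB : forall n, (0 <= B n)%R) by (intros; left; apply exp_pos).
  assert (Hv : forall n k, (Cmod (v n k) <= A n * B k)%R).
  { intros n k. unfold v, gterm, A, B. rewrite !Cmod_mult, !Cmod_chi, !Cmod_qexp, !Rmult_1_l, <- !exp_plus.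
    apply exp_le_compat. rewrite plus_IZR. fold h.
    set (x := (IZR n + h)%R). replace (IZR n + IZR k + h)%R with (x + IZR k)%R by (unfold x; ring).
    set (y := IZR k). replace (PI * Im tau)%R with (3 * c)%R by (unfold c; field).
    assert (Q : (0 <= 3 * (x * x + (x + y) * (x + y)) - x * x - y * y)%R).
    { generalize (Rle_0_sqr (5 * x + 3 * y)) (Rle_0_sqr y). unfold Rsqr. lra. }
    assert (0 <= c * (3 * (x * x + (x + y) * (x + y)) - x * x - y * y))%R by (apply Rmult_le_pos; lra). lra. }
  assert (E1 : gth p s1 tau * gth p s2 tau = CSeriesZ (fun n => CSeriesZ (v n))).
  { rewrite Cmult_comm. unfold gth at 2. rewrite <- CSeriesZ_scal by now apply gterm_summable.
    apply CSeriesZ_ext. intros n. unfold v.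
    destruct (CSeriesZ_shift (gterm p s2 tau) n (gterm_summable p s2 tau H)) as [S E].
    rewrite CSeriesZ_scal.
    - rewrite Cmult_comm. f_equal. unfold gth. rewrite <- E. apply CSeriesZ_ext. intros k; f_equal; lia.
    - revert S. apply zsummable_ext. intros k; f_equal; lia. }
  rewrite E1, (fubini_Z v A B) by auto.
  assert (SW := fubini_cols_summable v A B SA SB Hv).
  set (W := fun k => CSeriesZ (fun n => v n k)) in *.
  assert (We : forall l, W (2 * l)%Z = gth p s (2 * tau) * gterm 0 s (2 * tau) l).
  { intros l. unfold W.
    rewrite (CSeriesZ_ext _ (fun n => qexp (2 * tau) (IZR l * IZR l) *
       (chi s n * qexp (2 * tau) ((IZR (n + l) + IZR p / 2) * (IZR (n + l) + IZR p / 2))))).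
    - rewrite gth_shifted by auto. unfold gterm.
      replace ((IZR l + 0 / 2) * (IZR l + 0 / 2))%R with (IZR l * IZR l)%R by field. ring.
    - intros n. unfold v, gterm, s. rewrite chi_xorb, chi_add, chi_double. fold h.
      transitivity (chi s1 n * chi s2 n * (qexp tau ((IZR n + h) * (IZR n + h)) * qexp tau ((IZR (n + 2 * l) + h) * (IZR (n + 2 * l) + h)))); [ring|].
      transitivity (chi s1 n * chi s2 n * (qexp (2 * tau) (IZR l * IZR l) * qexp (2 * tau) ((IZR (n + l) + h) * (IZR (n + l) + h)))); [|ring].
      f_equal. rewrite <- !qexp_plus, <- qexp_double. f_equal. rewrite !plus_IZR, mult_IZR. ring. }
  assert (Wo : forall l, W (2 * l + 1)%Z = (chi s2 1 * gth (p + 1) s (2 * tau)) * gterm 1 s (2 * tau) l).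
  { intros l. unfold W.
    rewrite (CSeriesZ_ext _ (fun n => (chi s2 1 * qexp (2 * tau) ((IZR l + 1 / 2) * (IZR l + 1 / 2))) *
       (chi s n * qexp (2 * tau) ((IZR (n + l) + IZR (p + 1) / 2) * (IZR (n + l) + IZR (p + 1) / 2))))).
    - rewrite gth_shifted by auto. unfold gterm. ring.
    - intros n. unfold v, gterm, s. rewrite chi_xorb, !chi_add, chi_double. fold h.
      transitivity (chi s1 n * chi s2 n * chi s2 1 * (qexp tau ((IZR n + h) * (IZR n + h)) * qexp tau ((IZR (n + (2 * l + 1)) + h) * (IZR (n + (2 * l + 1)) + h)))); [ring|].
      transitivity (chi s1 n * chi s2 n * chi s2 1 * (qexp (2 * tau) ((IZR l + 1 / 2) * (IZR l + 1 / 2)) * qexp (2 * tau) ((IZR (n + l) + IZR (p + 1) / 2) * (IZR (n + l) + IZR (p + 1) / 2)))); [|ring].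
      f_equal. rewrite <- !qexp_plus, <- qexp_double. f_equal. unfold h. rewrite !plus_IZR, mult_IZR. field. }
  rewrite CSeriesZ_even_odd; auto.
  - rewrite (CSeriesZ_ext _ _ We), (CSeriesZ_ext _ _ Wo).
    rewrite !CSeriesZ_scal by now apply gterm_summable. unfold gth. ring.
  - apply (zsummable_ext _ _ (fun l => eq_sym (We l))). apply zsummable_scal. now apply gterm_summable.
  - apply (zsummable_ext _ _ (fun l => eq_sym (Wo l))). apply zsummable_scal. now apply gterm_summable.
Qed.

(** The reflection $n\mapsto-n-1$ fixes $(n+\frac12)^2$ and changes the sign $(-1)^n$, so the sum
    equals its negative. *)
Lemma gth_1_true (tau : C) : upper_half_plane tau -> gth 1 true tau = 0.
Proof.
  intros H. assert (E : gth 1 true tau = (- (1)) * gth 1 true tau).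
  { unfold gth at 1. rewrite <- CSeriesZ_reflect. unfold gth. rewrite <- CSeriesZ_scal by now apply gterm_summable.
    apply CSeriesZ_ext. intros n. unfold gterm.
    replace (chi true (- n - 1)) with (- chi true n).
    - rewrite minus_IZR, opp_IZR.
      replace ((- IZR n - 1 + 1 / 2) * (- IZR n - 1 + 1 / 2))%R with ((IZR n + 1 / 2) * (IZR n + 1 / 2))%R by field. ring.
    - simpl. rewrite Z.even_sub, Z.even_opp. simpl. destruct (Z.even n); simpl; ring. }
  assert (D : RtoC 2 * gth 1 true tau = 0).
  { replace (RtoC 2 * gth 1 true tau) with (gth 1 true tau - (- (1)) * gth 1 true tau) by ring. rewrite <- E. ring. }
  destruct (Ceq_dec (gth 1 true tau) 0) as [|N]; auto. exfalso. revert D. apply Cmult_neq_0; auto.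
  intro X; apply RtoC_inj in X; lra.
Qed.

Lemma Cexp_PI_Ci : Cexp (RtoC PI * Ci) = - (1).
Proof.
  unfold Cexp; simpl.
  replace (PI * 0 - 0 * 1)%R with 0%R by ring. replace (PI * 1 + 0 * 0)%R with PI by ring.
  rewrite exp_0, cos_PI, sin_PI. unfold Copp, RtoC; simpl. f_equal; ring.
Qed.

Lemma Cexp_chi (n : Z) : Cexp (RtoC (IZR n) * (RtoC PI * Ci)) = chi true n.
Proof.
  assert (P : forall m : nat, Cexp (RtoC (IZR (Z.of_nat m)) * (RtoC PI * Ci)) = chi true (Z.of_nat m)).
  { induction m as [|m IH].
    - replace (RtoC (IZR (Z.of_nat 0)) * (RtoC PI * Ci)) with (RtoC 0) by (simpl; ring). apply Cexp_0.
    - rewrite Nat2Z.inj_succ. unfold Z.succ. rewrite chi_add, plus_IZR, RtoC_plus, <- IH.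
      change (chi true 1) with (- (1)). rewrite <- Cexp_PI_Ci, <- Cexp_plus. f_equal. ring. }
  destruct (Z_le_dec 0 n) as [L|L].
  - replace n with (Z.of_nat (Z.to_nat n)) by lia. apply P.
  - assert (E := P (Z.to_nat (- n))). replace (Z.of_nat (Z.to_nat (- n))) with (- n)%Z in E by lia.
    assert (M : Cexp (RtoC (IZR n) * (RtoC PI * Ci)) * Cexp (RtoC (IZR (- n)) * (RtoC PI * Ci)) = 1).
    { rewrite <- Cexp_plus, <- Cexp_0. f_equal. rewrite opp_IZR, RtoC_opp. ring. }
    rewrite E in M.
    assert (X : chi true (- n) = chi true n) by (simpl; now rewrite Z.even_opp).
    rewrite X in M.
    transitivity (Cexp (RtoC (IZR n) * (RtoC PI * Ci)) * (chi true n * chi true n)); [rewrite chi_sqr; ring|].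
    rewrite Cmult_assoc, M. ring.
Qed.

Lemma theta_00 (tau : C) : theta 0 0 tau = gth 0 false tau.
Proof.
  apply CSeriesZ_ext. intros n. unfold gterm, qexp, chi. cbv zeta. rewrite Cmult_1_l. f_equal.
  simpl INR. rewrite RtoC_mult.
  replace (RtoC (0 / 2)) with (RtoC 0) by (f_equal; field). simpl. ring.
Qed.

Lemma theta_10 (tau : C) : theta 1 0 tau = gth 1 false tau.
Proof.
  apply CSeriesZ_ext. intros n. unfold gterm, qexp, chi. cbv zeta. rewrite Cmult_1_l. f_equal.
  simpl INR. rewrite RtoC_mult.
  replace (RtoC (0 / 2)) with (RtoC 0) by (f_equal; field). simpl. ring.
Qed.

Lemma theta_01 (tau : C) : theta 0 1 tau = gth 0 true tau.
Proof.
  apply CSeriesZ_ext. intros n. unfold gterm, qexp. cbv zeta. rewrite <- Cexp_chi, <- Cexp_plus. f_equal.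
  simpl INR. rewrite RtoC_mult.
  replace (RtoC (1 / 2)) with (RtoC 1 / RtoC 2) by (rewrite RtoC_div; auto; lra).
  replace (IZR n + 0 / 2)%R with (IZR n) by field. simpl. field.
Qed.

(** * Doubling formulas and Jacobi's identity *)

Section ThetaDoubling.

Variable tau : C.
Hypothesis H : upper_half_plane tau.

Lemma theta_00_sqr : theta 0 0 tau ^ 2 = theta 0 0 (2 * tau) ^ 2 + theta 1 0 (2 * tau) ^ 2.
Proof.
  rewrite !theta_00, theta_10. assert (E := gth_mult 0 false false tau H). simpl in E.
  simpl. rewrite !Cmult_1_r, E. ring.
Qed.

Lemma theta_01_sqr : theta 0 1 tau ^ 2 = theta 0 0 (2 * tau) ^ 2 - theta 1 0 (2 * tau) ^ 2.
Proof.
  rewrite theta_01, theta_00, theta_10. assert (E := gth_mult 0 true true tau H). simpl in E.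
  simpl. rewrite !Cmult_1_r, E. ring.
Qed.

(** The two sign characters multiply to the nontrivial one, and the odd part of the product formula
    vanishes by [gth_1_true]. *)
Lemma theta_00_01 : theta 0 0 tau * theta 0 1 tau = theta 0 1 (2 * tau) ^ 2.
Proof.
  rewrite !theta_01, theta_00. assert (E := gth_mult 0 false true tau H). simpl in E.
  rewrite (gth_1_true _ (uhp_double tau H)) in E. simpl. rewrite !Cmult_1_r, E. ring.
Qed.

(** The even and odd parts of the product formula contribute equally, since raising the first
    characteristic from $0$ to $2$ changes nothing. Hence the factor $2$. *)
Lemma theta_10_sqr : theta 1 0 tau ^ 2 = 2 * theta 0 0 (2 * tau) * theta 1 0 (2 * tau).
Proof.
  rewrite !theta_10, theta_00. assert (E := gth_mult 1 false false tau H). simpl in E.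
  assert (E2 := gth_add2 0 false (2 * tau) (uhp_double tau H)). simpl in E2. rewrite E2 in E.
  simpl. rewrite !Cmult_1_r, E. ring.
Qed.

(** The identity $(u^2+v^2)^2=(u^2-v^2)^2+(2uv)^2$ for $u=\vartheta_{00}(2\tau)$ and
    $v=\vartheta_{10}(2\tau)$. *)
Lemma jacobi_identity : theta 0 0 tau ^ 4 = theta 0 1 tau ^ 4 + theta 1 0 tau ^ 4.
Proof.
  replace (theta 0 0 tau ^ 4) with ((theta 0 0 tau ^ 2) ^ 2) by (simpl; ring).
  replace (theta 0 1 tau ^ 4) with ((theta 0 1 tau ^ 2) ^ 2) by (simpl; ring).
  replace (theta 1 0 tau ^ 4) with ((theta 1 0 tau ^ 2) ^ 2) by (simpl; ring).
  rewrite theta_00_sqr, theta_01_sqr, theta_10_sqr. simpl. ring.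
Qed.

End ThetaDoubling.

(** * The lambda function *)

Definition nome (tau : C) : C := Cexp (RtoC PI * Ci * tau).

Lemma Cmod_nome (tau : C) : Cmod (nome tau) = exp (- (PI * Im tau)).
Proof. unfold nome. rewrite Cmod_Cexp. f_equal. destruct tau; simpl; ring. Qed.

Lemma nome_lt_1 (tau : C) : upper_half_plane tau -> (Cmod (nome tau) < 1)%R.
Proof.
  intros H. rewrite Cmod_nome, <- exp_0. apply exp_increasing.
  assert (0 < PI * Im tau)%R by (apply Rmult_lt_0_compat; [apply PI_RGT_0 | apply H]). lra.
Qed.

Lemma qexp_INR (tau : C) (k : nat) : qexp tau (INR k) = nome tau ^ k.
Proof.
  induction k as [|k IH].
  - unfold qexp. simpl. replace (RtoC PI * Ci * 0 * tau) with (RtoC 0) by ring. apply Cexp_0.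
  - rewrite S_INR, qexp_plus, IH. simpl. rewrite Cmult_comm. f_equal.
    unfold qexp, nome. f_equal. ring.
Qed.

Lemma gap_summable_1 (e : nat -> nat) : (forall n, (n <= e n)%nat) -> gap_summable (fun _ => 1) e 1.
Proof.
  intros He rho Hr. apply ex_series_le_R with (fun n => rho ^ n)%R.
  - intros n. rewrite Cmod_1, Rmult_1_l. split; [apply pow_le; lra|].
    replace (e n) with (n + (e n - n))%nat by (specialize (He n); lia). rewrite pow_add.
    rewrite <- (Rmult_1_r (rho ^ n)) at 2. apply Rmult_le_compat_l; [apply pow_le; lra|].
    rewrite <- (pow1 (e n - n)). apply pow_incr. lra.
  - apply ex_series_geom. rewrite Rabs_pos_eq; lra.
Qed.

(* [theta_00], [theta_01] and [theta_10] as functions of the nome [q]: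
   [A(q)], [A(-q)] and [2 q^(1/4) B(q)]. *)
Definition qA (q : C) : C :=
  CSeries (fun n => 1 * q ^ (n * n)) + CSeries (fun n => 1 * q ^ (S n * S n)).

Definition qB (q : C) : C := CSeries (fun n => 1 * q ^ (n * n + n)).

Lemma qA_gap1 : gap_summable (fun _ => 1) (fun n => n * n)%nat 1.
Proof. apply gap_summable_1. intros n; nia. Qed.

Lemma qA_gap2 : gap_summable (fun _ => 1) (fun n => S n * S n)%nat 1.
Proof. apply gap_summable_1. intros n; nia. Qed.

Lemma qB_gap : gap_summable (fun _ => 1) (fun n => n * n + n)%nat 1.
Proof. apply gap_summable_1. intros n; nia. Qed.

Lemma holo_qA (q : C) : (Cmod q < 1)%R -> holo qA q.
Proof.
  intros H. apply holo_plus.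
  - apply (gap_series_holo (fun _ => 1) (fun n => n * n)%nat 1 q qA_gap1 H).
  - apply (gap_series_holo (fun _ => 1) (fun n => S n * S n)%nat 1 q qA_gap2 H).
Qed.

Lemma holo_qB (q : C) : (Cmod q < 1)%R -> holo qB q.
Proof. apply (gap_series_holo (fun _ => 1) (fun n => n * n + n)%nat 1 q qB_gap). Qed.

Lemma CSeries_head (u : nat -> C) : (forall n, u (S n) = 0) -> CSeries u = u O.
Proof.
  intros H. apply CSeries_unique. intros eps He. exists 1%nat. intros n Hn.
  replace (csum u n) with (u O).
  - replace (u O - u O) with (RtoC 0) by ring. now rewrite Cmod_0.
  - induction n as [|n IH]; [lia|]. destruct n; [simpl; ring|]. rewrite csum_S, <- IH, H by lia. ring.
Qed.

Lemma qA_0 : qA 0 = 1.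
Proof.
  unfold qA. rewrite !CSeries_head; try (intros; simpl; ring).
Qed.

Lemma qB_0 : qB 0 = 1.
Proof. unfold qB. rewrite CSeries_head; [simpl; ring|]. intros; simpl; ring. Qed.

Section ThetaNome.

Variable tau : C.
Hypothesis H : upper_half_plane tau.

Lemma theta_00_nome : theta 0 0 tau = qA (nome tau).
Proof.
  rewrite theta_00. unfold gth, CSeriesZ, qA. f_equal; apply CSeries_ext; intros n; unfold gterm, chi.
  - rewrite <- qexp_INR. do 2 f_equal. rewrite mult_INR, <- INR_IZR_INZ. simpl. field.
  - rewrite <- qexp_INR. do 2 f_equal. rewrite mult_INR, opp_IZR, <- INR_IZR_INZ. simpl. field.
Qed.

Lemma chi_true_pow (n : nat) : chi true (Z.of_nat n) = (- (1)) ^ n.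
Proof.
  induction n as [|n IH]; [reflexivity|]. rewrite Nat2Z.inj_succ. unfold Z.succ. rewrite chi_add, IH.
  change (chi true 1) with (- (1)). simpl. ring.
Qed.

Lemma neg1_pow_sqr (n : nat) : (- (1)) ^ (n * n) = (- (1)) ^ n.
Proof.
  rewrite <- !chi_true_pow. unfold chi. rewrite Nat2Z.inj_mul, Z.even_mul. now destruct (Z.even (Z.of_nat n)).
Qed.

Lemma theta_01_nome : theta 0 1 tau = qA (- nome tau).
Proof.
  rewrite theta_01. unfold gth, CSeriesZ, qA. f_equal; apply CSeries_ext; intros n; unfold gterm.
  - rewrite chi_true_pow, <- neg1_pow_sqr. replace (- nome tau) with ((- (1)) * nome tau) by ring.
    rewrite Cpow_mult_l, <- qexp_INR. rewrite Cmult_1_l. do 2 f_equal. rewrite mult_INR, <- INR_IZR_INZ. simpl. field.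
  - replace (chi true (- Z.of_nat (S n))) with (chi true (Z.of_nat (S n))) by (unfold chi; now rewrite Z.even_opp).
    rewrite chi_true_pow, <- neg1_pow_sqr. replace (- nome tau) with ((- (1)) * nome tau) by ring.
    rewrite Cpow_mult_l, <- qexp_INR. rewrite Cmult_1_l. do 2 f_equal. rewrite mult_INR, opp_IZR, <- INR_IZR_INZ. simpl. field.
Qed.

Lemma theta_10_nome : theta 1 0 tau = 2 * qexp tau (1 / 4) * qB (nome tau).
Proof.
  assert (S : cseries (fun n => 1 * nome tau ^ (n * n + n)) (qB (nome tau))).
  { apply csummable_cseries. apply (gap_csummable _ _ 1 _ qB_gap). now apply nome_lt_1. }
  assert (E : forall n, qexp tau ((INR n + 1 / 2) * (INR n + 1 / 2)) = qexp tau (1 / 4) * (1 * nome tau ^ (n * n + n))).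
  { intros n. rewrite <- qexp_INR, Cmult_1_l, <- qexp_plus. f_equal. rewrite plus_INR, mult_INR. field. }
  apply (cseries_scal (qexp tau (1 / 4))) in S.
  rewrite theta_10. unfold gth, CSeriesZ.
  transitivity (qexp tau (1 / 4) * qB (nome tau) + qexp tau (1 / 4) * qB (nome tau)); [|ring].
  f_equal; apply CSeries_unique; (apply cseries_ext with (2 := S)); intros n; rewrite <- E; unfold gterm, chi; rewrite Cmult_1_l; f_equal.
  - rewrite <- INR_IZR_INZ. simpl. field.
  - rewrite opp_IZR, <- INR_IZR_INZ, S_INR. simpl. field.
Qed.

Lemma qexp_quarter_pow : qexp tau (1 / 4) ^ 4 = nome tau.
Proof.
  simpl. rewrite Cmult_1_r, <- !qexp_plus.
  replace (1 / 4 + (1 / 4 + (1 / 4 + 1 / 4)))%R with (INR 1) by (simpl; field).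
  rewrite qexp_INR. simpl. ring.
Qed.

Lemma nome_double : nome (2 * tau) = nome tau ^ 2.
Proof. unfold nome. simpl. rewrite Cmult_1_r, <- Cexp_plus. f_equal. ring. Qed.

Lemma nome_plus1 : nome (tau + 1) = - nome tau.
Proof.
  unfold nome. replace (RtoC PI * Ci * (tau + 1)) with (RtoC PI * Ci + RtoC PI * Ci * tau) by ring.
  rewrite Cexp_plus, Cexp_PI_Ci. ring.
Qed.

End ThetaNome.

(** Doubling [tau] squares the nome, which therefore enters any disc about $0$ after finitely many
    doublings; the property then descends step by step. *)
Lemma doubling_induction (P : C -> Prop) (r : R) : (0 < r)%R ->
  (forall tau, upper_half_plane tau -> (Cmod (nome tau) < r)%R -> P tau) ->
  (forall tau, upper_half_plane tau -> P (2 * tau) -> P tau) ->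
  forall tau, upper_half_plane tau -> P tau.
Proof.
  intros Hr H0 Hs.
  assert (G : forall n tau, upper_half_plane tau -> (Cmod (nome tau) ^ (2 ^ n) < r)%R -> P tau).
  { induction n as [|n IH]; intros tau H Hn.
    - apply H0; auto. simpl in Hn. lra.
    - apply Hs; auto. apply IH; [now apply uhp_double|].
      rewrite nome_double, Cmod_pow, <- pow_mult. exact Hn. }
  intros tau H. assert (H1 := nome_lt_1 tau H).
  destruct (Cpow_le_1_limit (Cmod (nome tau)) (conj (Cmod_ge_0 _) H1) r Hr) as [N HN].
  apply (G N tau H), HN. apply Nat.lt_le_incl, Nat.pow_gt_lin_r. lia.
Qed.

(** Near the cusp both functions are close to $1$. The descent uses
    $\vartheta_{00}(\tau)\vartheta_{01}(\tau)=\vartheta_{01}(2\tau)^2$, which is why the two are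
    treated together. *)
Lemma theta_00_01_neq0 (tau : C) : upper_half_plane tau -> theta 0 0 tau <> 0 /\ theta 0 1 tau <> 0.
Proof.
  destruct (ccont_neq0 qA 0 0) as (r & Hr & K).
  { apply holo_ccont, holo_qA. rewrite Cmod_0. lra. }
  { rewrite qA_0. apply C1_nz. }
  apply (doubling_induction (fun tau => theta 0 0 tau <> 0 /\ theta 0 1 tau <> 0) r Hr).
  - intros t H Ht. rewrite theta_00_nome, theta_01_nome by auto. split; apply K.
    + now replace (nome t - 0) with (nome t) by ring.
    + replace (- nome t - 0) with (- nome t) by ring. now rewrite Cmod_opp.
  - intros t H [_ H1]. assert (E := theta_00_01 t H).
    split; intro X; rewrite X in E; apply (Cpow_nz _ 2 H1); rewrite <- E; ring.
Qed.

Lemma theta_00_neq0 (tau : C) : upper_half_plane tau -> theta 0 0 tau <> 0.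
Proof. intros H. exact (proj1 (theta_00_01_neq0 tau H)). Qed.

Lemma theta_01_neq0 (tau : C) : upper_half_plane tau -> theta 0 1 tau <> 0.
Proof. intros H. exact (proj2 (theta_00_01_neq0 tau H)). Qed.

(** Near the cusp the factor [qB] is close to $1$; the descent uses
    $\vartheta_{10}(\tau)^2=2\vartheta_{00}(2\tau)\vartheta_{10}(2\tau)$. *)
Lemma theta_10_neq0 (tau : C) : upper_half_plane tau -> theta 1 0 tau <> 0.
Proof.
  destruct (ccont_neq0 qB 0 0) as (r & Hr & K).
  { apply holo_ccont, holo_qB. rewrite Cmod_0. lra. }
  { rewrite qB_0. apply C1_nz. }
  assert (N2 : RtoC 2 <> 0) by (intro X; apply RtoC_inj in X; lra).
  apply (doubling_induction (fun tau => theta 1 0 tau <> 0) r Hr).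
  - intros t H Ht. rewrite theta_10_nome by auto. apply Cmult_neq_0; [apply Cmult_neq_0; auto; apply Cexp_neq0|].
    apply K. now replace (nome t - 0) with (nome t) by ring.
  - intros t H H1. assert (E := theta_10_sqr t H). intro X. rewrite X in E.
    assert (Z : 2 * theta 0 0 (2 * t) * theta 1 0 (2 * t) = 0) by (rewrite <- E; simpl; ring).
    revert Z. apply Cmult_neq_0; auto. apply Cmult_neq_0; auto. apply theta_00_neq0. now apply uhp_double.
Qed.

Lemma near_uhp (tau : C) : upper_half_plane tau -> near tau upper_half_plane.
Proof.
  intros H. exists (Im tau); split; auto. intros w Hw. unfold upper_half_plane in *.
  assert (A := im_le_Cmod (w - tau)). change (Im (w - tau)) with (Im w - Im tau)%R in A.
  destruct (Rabs_def2 _ _ (Rle_lt_trans _ _ _ A Hw)). lra.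
Qed.

Lemma convex_uhp : convex upper_half_plane.
Proof.
  intros a b t Ha Hb Ht. unfold upper_half_plane in *. destruct a, b; simpl in *.
  destruct (Req_dec t 1) as [->|]; nra.
Qed.

Lemma holo_Cexp_lin (c z : C) : holo (fun z => Cexp (c * z)) z.
Proof.
  apply (holo_comp (fun z => c * z) Cexp); [|apply holo_Cexp].
  apply (holo_mult (fun _ => c) (fun z => z)); [apply holo_const | apply holo_id].
Qed.

Section LambdaProps.

Variable tau : C.
Hypothesis H : upper_half_plane tau.

Lemma holo_theta_00 : holo (theta 0 0) tau.
Proof.
  apply (holo_ext (fun t => qA (nome t))).
  - generalize (near_uhp tau H). apply near_imp. intros t Ht. symmetry. now apply theta_00_nome.
  - apply (holo_comp nome qA); [apply holo_Cexp_lin | apply holo_qA, nome_lt_1, H].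
Qed.

Lemma holo_theta_10 : holo (theta 1 0) tau.
Proof.
  apply (holo_ext (fun t => 2 * qexp t (1 / 4) * qB (nome t))).
  - generalize (near_uhp tau H). apply near_imp. intros t Ht. symmetry. now apply theta_10_nome.
  - apply holo_mult.
    + apply (holo_mult (fun _ => RtoC 2)); [apply holo_const | apply holo_Cexp_lin].
    + apply (holo_comp nome qB); [apply holo_Cexp_lin | apply holo_qB, nome_lt_1, H].
Qed.

Lemma theta_00_pow4_neq0 : theta 0 0 tau ^ 4 <> 0.
Proof. apply Cpow_nz. now apply theta_00_neq0. Qed.

Lemma holo_lambda : holo lambda tau.
Proof.
  apply holo_div.
  - apply (holo_pow (theta 1 0)), holo_theta_10.
  - apply (holo_pow (theta 0 0)), holo_theta_00.
  - apply theta_00_pow4_neq0.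
Qed.

Lemma lambda_compl : 1 - lambda tau = theta 0 1 tau ^ 4 / theta 0 0 tau ^ 4.
Proof.
  unfold lambda. assert (J := jacobi_identity tau H). assert (N := theta_00_neq0 tau H).
  transitivity ((theta 0 0 tau ^ 4 - theta 1 0 tau ^ 4) / theta 0 0 tau ^ 4); [field; auto|].
  rewrite J at 1. f_equal. ring.
Qed.

Lemma lambda_neq0 : lambda tau <> 0.
Proof.
  unfold lambda. intro X. apply (Cpow_nz _ 4 (theta_10_neq0 tau H)).
  transitivity (theta 1 0 tau ^ 4 / theta 0 0 tau ^ 4 * theta 0 0 tau ^ 4); [field; now apply theta_00_neq0|].
  rewrite X. ring.
Qed.

Lemma lambda_neq1 : lambda tau <> 1.
Proof.
  intro X. assert (E := lambda_compl). rewrite X in E.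
  apply (Cpow_nz _ 4 (theta_01_neq0 tau H)).
  transitivity (theta 0 1 tau ^ 4 / theta 0 0 tau ^ 4 * theta 0 0 tau ^ 4); [field; now apply theta_00_neq0|].
  rewrite <- E. ring.
Qed.

Lemma uhp_plus1 : upper_half_plane (tau + 1).
Proof. unfold upper_half_plane in *. destruct tau; simpl in *. lra. Qed.

(** Translation by $1$ replaces $q$ by $-q$. This turns $\vartheta_{00}$ into $\vartheta_{01}$ and
    changes the sign of $\vartheta_{10}^4=16q\,B(q)^4$, because $B$ is even: all exponents $n^2+n$
    are even. *)
Lemma lambda_T : lambda (tau + 1) = lambda tau / (lambda tau - 1).
Proof.
  assert (E0 : theta 0 0 (tau + 1) = theta 0 1 tau).
  { rewrite theta_00_nome, theta_01_nome by (auto; apply uhp_plus1). now rewrite nome_plus1. }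
  assert (E1 : theta 1 0 (tau + 1) ^ 4 = - theta 1 0 tau ^ 4).
  { rewrite !theta_10_nome by (auto; apply uhp_plus1). rewrite nome_plus1.
    assert (EB : qB (- nome tau) = qB (nome tau)).
    { apply CSeries_ext. intros n. replace (- nome tau) with ((- (1)) * nome tau) by ring.
      rewrite Cpow_mult_l. rewrite Cpow_add_r, neg1_pow_sqr, <- Cpow_mult_l.
      replace (- (1) * - (1)) with (RtoC 1) by ring. rewrite Cpow_1_l. ring. }
    rewrite EB, !Cpow_mult_l, !qexp_quarter_pow, nome_plus1. ring. }
  assert (N0 := theta_00_neq0 tau H).
  assert (N1 := theta_01_neq0 tau H).
  assert (E : lambda tau - 1 = - (theta 0 1 tau ^ 4 / theta 0 0 tau ^ 4)) by (rewrite <- lambda_compl; ring).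
  rewrite E. unfold lambda at 1. rewrite E0, E1. unfold lambda. field. auto.
Qed.

(** Here [k] is the complementary modulus, a square root of $1-\lambda$. The formulas are Landen's
    transformation on the side of the theta constants, with the matching change of
    $\vartheta_{00}^2$. *)
Lemma lambda_double (k : C) : k = theta 0 1 tau ^ 2 / theta 0 0 tau ^ 2 ->
  1 + k <> 0 /\ lambda (2 * tau) = ((1 - k) / (1 + k)) ^ 2 /\
  theta 0 0 tau ^ 2 * (1 + k) = 2 * theta 0 0 (2 * tau) ^ 2.
Proof.
  intros ->. assert (H2 := uhp_double tau H).
  assert (N0' := theta_00_neq0 tau H). assert (N0 := Cpow_nz _ 2 N0').
  assert (N2 : theta 0 0 (2 * tau) <> 0) by now apply theta_00_neq0.
  assert (NR : RtoC 2 <> 0) by (intro X; apply RtoC_inj in X; lra).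
  set (k := theta 0 1 tau ^ 2 / theta 0 0 tau ^ 2).
  assert (Ep : 1 + k = 2 * theta 0 0 (2 * tau) ^ 2 / theta 0 0 tau ^ 2).
  { transitivity ((theta 0 0 tau ^ 2 + theta 0 1 tau ^ 2) / theta 0 0 tau ^ 2); [unfold k; field; auto|].
    f_equal. rewrite theta_00_sqr, theta_01_sqr by auto. ring. }
  assert (Em : 1 - k = 2 * theta 1 0 (2 * tau) ^ 2 / theta 0 0 tau ^ 2).
  { transitivity ((theta 0 0 tau ^ 2 - theta 0 1 tau ^ 2) / theta 0 0 tau ^ 2); [unfold k; field; auto|].
    f_equal. rewrite theta_00_sqr, theta_01_sqr by auto. ring. }
  rewrite Ep, Em. repeat split.
  - unfold Cdiv. apply Cmult_neq_0; [apply Cmult_neq_0; auto; now apply Cpow_nz|].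
    intro X. apply N0. rewrite <- (Cmult_1_r (theta 0 0 tau ^ 2)).
    assert (Y : theta 0 0 tau ^ 2 * / theta 0 0 tau ^ 2 = 1) by (apply Cinv_r; auto). rewrite X in Y.
    exfalso. apply C1_nz. rewrite <- Y. ring.
  - unfold lambda. set (a := theta 0 0 (2 * tau)) in *. set (b := theta 1 0 (2 * tau)).
    set (c := theta 0 0 tau ^ 2) in *. clearbody a b c. simpl. field. auto.
  - field. auto.
Qed.

End LambdaProps.

Definition qlambda (q : C) : C := 16 * q * (qB q ^ 4 / qA q ^ 4).

Lemma lambda_qlambda (tau : C) : upper_half_plane tau -> lambda tau = qlambda (nome tau).
Proof.
  intros H. assert (N := theta_00_neq0 tau H). rewrite theta_00_nome in N by auto.
  unfold lambda, qlambda. rewrite theta_10_nome, theta_00_nome by auto.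
  rewrite !Cpow_mult_l, qexp_quarter_pow. replace (RtoC 2 ^ 4) with (RtoC 16) by (simpl; ring). field. auto.
Qed.

Lemma holo_qlambda_0 : holo (fun q => qB q ^ 4 / qA q ^ 4) 0.
Proof.
  assert (Z : (Cmod 0 < 1)%R) by (rewrite Cmod_0; lra).
  apply (holo_div (fun q => qB q ^ 4) (fun q => qA q ^ 4)).
  - now apply holo_pow, holo_qB.
  - now apply holo_pow, holo_qA.
  - rewrite qA_0, Cpow_1_l. apply C1_nz.
Qed.

(** The nonzero value $16$ makes $\lambda$ a local coordinate in the nome at the cusp. *)
Lemma cder_qlambda_0 : holo qlambda 0 /\ cder qlambda 0 16.
Proof.
  split.
  - apply (holo_mult (fun q => 16 * q)); [apply (holo_mult (fun _ => RtoC 16)); [apply holo_const | apply holo_id] | apply holo_qlambda_0].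
  - destruct (holo_cder _ _ holo_qlambda_0) as [l Hl].
    eapply cder_eq; [apply (cder_mult (fun q => 16 * q)); [apply (cder_mult (fun _ => RtoC 16) (fun q => q)); [apply cder_const | apply cder_id] | apply Hl]|].
    cbv beta. rewrite qA_0, qB_0, !Cpow_1_l. field.
Qed.

Lemma nome_inj_of_lambda : exists r : R, (0 < r)%R /\
  forall tau1 tau2, upper_half_plane tau1 -> upper_half_plane tau2 ->
  (Cmod (nome tau1) < r)%R -> (Cmod (nome tau2) < r)%R -> lambda tau1 = lambda tau2 ->
  nome tau1 = nome tau2.
Proof.
  destruct cder_qlambda_0 as [H1 H2].
  destruct (local_inverse qlambda 0 16 1 Rlt_0_1 H1 H2) as (eta & d & G & [He _] & _ & Hinj & _).
  { intro X; apply RtoC_inj in X; lra. }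
  exists eta; split; auto. intros t1 t2 U1 U2 K1 K2 E. rewrite !lambda_qlambda in E by auto.
  apply Hinj; auto.
  - now replace (nome t1 - 0) with (nome t1) by ring.
  - now replace (nome t2 - 0) with (nome t2) by ring.
Qed.

Lemma lambda_cusp (eps : R) : (0 < eps)%R -> exists r : R, (0 < r)%R /\
  forall tau, upper_half_plane tau -> (Cmod (nome tau) < r)%R -> (Cmod (lambda tau) < eps)%R.
Proof.
  intros He. destruct cder_qlambda_0 as [H1 _].
  destruct (holo_ccont _ _ H1 eps He) as (r & Hr & K). exists r; split; auto.
  intros t U Ht. rewrite lambda_qlambda by auto.
  assert (E0 : qlambda 0 = 0) by (unfold qlambda; ring).
  replace (qlambda (nome t)) with (qlambda (nome t) - qlambda 0) by (rewrite E0; ring).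
  apply K. now replace (nome t - 0) with (nome t) by ring.
Qed.

(** From $e^{\pi i(\tau_1-\tau_2)}=1$, the modulus forces a real difference, the sine an integral
    one and the sign an even one. *)
Lemma nome_eq (tau1 tau2 : C) : nome tau1 = nome tau2 -> exists k : Z, tau1 = tau2 + RtoC (2 * IZR k).
Proof.
  intros E.
  assert (E1 : Cexp (RtoC PI * Ci * (tau1 - tau2)) = 1).
  { assert (X : Cexp (RtoC PI * Ci * (tau1 - tau2)) * nome tau2 = 1 * nome tau2).
    { unfold nome. rewrite <- Cexp_plus. rewrite Cmult_1_l. change (Cexp (RtoC PI * Ci * tau2)) with (nome tau2). rewrite <- E. unfold nome. f_equal. ring. }
    assert (N := Cexp_neq0 (RtoC PI * Ci * tau2)). fold (nome tau2) in N.
    transitivity (Cexp (RtoC PI * Ci * (tau1 - tau2)) * nome tau2 / nome tau2); [field; auto|].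
    rewrite X. field; auto. }
  assert (Him : Im (tau1 - tau2) = 0%R).
  { assert (M := f_equal Cmod E1). rewrite Cmod_Cexp, Cmod_1 in M.
    rewrite <- exp_0 in M. apply exp_inv in M.
    assert (M2 : (PI * Im (tau1 - tau2) = 0)%R) by (destruct (tau1 - tau2); simpl in *; lra).
    apply Rmult_integral in M2. destruct M2; auto. generalize PI_RGT_0; lra. }
  set (x := Re (tau1 - tau2)).
  assert (Ex : tau1 - tau2 = RtoC x) by (unfold x; revert Him; destruct (tau1 - tau2); simpl; intros ->; auto).
  rewrite Ex in E1. replace (RtoC PI * Ci * RtoC x) with (RtoC (x * PI) * Ci) in E1 by (rewrite RtoC_mult; ring).
  assert (Hs : sin (x * PI) = 0%R).
  { apply (f_equal Im) in E1. unfold Cexp in E1. simpl in E1.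
    replace (x * PI * 1 + 0 * 0)%R with (x * PI)%R in E1 by ring.
    apply Rmult_integral in E1. destruct E1 as [Y|]; auto.
    match type of Y with exp ?a = _ => generalize (exp_pos a) end. lra. }
  destruct (sin_eq_0_0 _ Hs) as [m Hm].
  assert (Hx : x = IZR m) by (apply Rmult_eq_reg_r with PI; auto; generalize PI_RGT_0; lra).
  assert (Ec := Cexp_chi m).
  replace (RtoC (IZR m) * (RtoC PI * Ci)) with (RtoC (x * PI) * Ci) in Ec by (rewrite Hx, RtoC_mult; ring).
  rewrite E1 in Ec. simpl in Ec. destruct (Z.even m) eqn:Em.
  - apply Z.even_spec in Em. destruct Em as [k Hk]. exists k.
    rewrite <- mult_IZR, <- Hk, <- Hx, <- Ex. ring.
  - exfalso. rewrite <- RtoC_opp in Ec. apply RtoC_inj in Ec. lra.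
Qed.

Open Scope R_scope.

(** * The real hypergeometric equation *)

Definition hcoef (a b c : R) (n : nat) : R :=
  pochhammer a n * pochhammer b n / (pochhammer c n * pochhammer 1 n).

Definition hypR (a b c x : R) : R := PSeries (hcoef a b c) x.
Definition hypR1 (a b c x : R) : R := PSeries (PS_derive (hcoef a b c)) x.
Definition hypR2 (a b c x : R) : R := PSeries (PS_derive (PS_derive (hcoef a b c))) x.

Lemma pochhammer_pos (a : R) (n : nat) : 0 < a -> 0 < pochhammer a n.
Proof.
  intros Ha. induction n as [|n IH]; simpl; [lra|]. apply Rmult_lt_0_compat; auto.
  generalize (pos_INR n); lra.
Qed.

Section Hypergeometric.

Variables a b c : R.
Hypothesis (Ha : 0 < a) (Hb : 0 < b) (Hc : 0 < c) (Hab : a * b <= c) (Habc : a + b <= c + 1).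

Lemma hcoef_pos (n : nat) : 0 < hcoef a b c n.
Proof.
  apply Rdiv_lt_0_compat; apply Rmult_lt_0_compat; apply pochhammer_pos; lra.
Qed.

Lemma hcoef_S (n : nat) :
  (c + INR n) * (1 + INR n) * hcoef a b c (S n) = (a + INR n) * (b + INR n) * hcoef a b c n.
Proof.
  unfold hcoef. simpl. generalize (pos_INR n); intros.
  assert (0 < pochhammer c n) by now apply pochhammer_pos.
  assert (0 < pochhammer 1 n) by (apply pochhammer_pos; lra).
  field. repeat split; lra.
Qed.

(** The two inequalities on the parameters give $(a+n)(b+n)\le(c+n)(1+n)$. The coefficients
    therefore stay in $(0,1]$, and the radius of convergence is at least $1$. *)
Lemma hcoef_decr (n : nat) : hcoef a b c (S n) <= hcoef a b c n.
Proof.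
  assert (P := pos_INR n). assert (Q := hcoef_pos n).
  assert (D : 0 < (c + INR n) * (1 + INR n)) by (apply Rmult_lt_0_compat; lra).
  apply Rmult_le_reg_l with ((c + INR n) * (1 + INR n)); auto. rewrite hcoef_S.
  apply Rmult_le_compat_r; [lra|].
  assert (INR n * (a + b) <= INR n * (c + 1)) by (apply Rmult_le_compat_l; lra). lra.
Qed.

Lemma hcoef_le_1 (n : nat) : hcoef a b c n <= 1.
Proof.
  induction n as [|n IH]; [unfold hcoef; simpl; right; field|].
  eapply Rle_trans; [apply hcoef_decr | auto].
Qed.

Lemma hcoef_radius (x : R) : Rabs x < 1 -> Rbar_lt (Rabs x) (CV_radius (hcoef a b c)).
Proof.
  intros Hx. apply Rbar_lt_le_trans with (Finite 1); auto.
  apply CV_radius_bounded. exists 1. intros n. rewrite pow1, Rmult_1_r, Rabs_pos_eq.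
  - apply hcoef_le_1.
  - left; apply hcoef_pos.
Qed.

Lemma hypR_derive (x : R) : Rabs x < 1 -> is_derive (hypR a b c) x (hypR1 a b c x).
Proof. intros Hx. apply is_derive_PSeries. now apply hcoef_radius. Qed.

Lemma hypR1_derive (x : R) : Rabs x < 1 -> is_derive (hypR1 a b c) x (hypR2 a b c x).
Proof.
  intros Hx. apply is_derive_PSeries. rewrite CV_radius_derive. now apply hcoef_radius.
Qed.

Lemma hypR_0 : hypR a b c 0 = 1.
Proof. unfold hypR. rewrite PSeries_0. unfold hcoef. simpl. field. Qed.

(** Comparison of the coefficients of $x^n$ in the combined series reduces the equation to the
    recursion [hcoef_S]. *)
Lemma hyp_ode (x : R) : Rabs x < 1 ->
  x * (1 - x) * hypR2 a b c x + (c - (a + b + 1) * x) * hypR1 a b c x - a * b * hypR a b c x = 0.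
Proof.
  intros Hx. assert (Hr := hcoef_radius x Hx). set (u := hcoef a b c) in *.
  assert (P0 : is_pseries u x (hypR a b c x)) by (apply PSeries_correct, CV_radius_inside; auto).
  assert (P1 : is_pseries (PS_derive u) x (hypR1 a b c x))
    by (apply PSeries_correct, CV_radius_inside; rewrite CV_radius_derive; auto).
  assert (P2 : is_pseries (PS_derive (PS_derive u)) x (hypR2 a b c x))
    by (apply PSeries_correct, CV_radius_inside; rewrite !CV_radius_derive; auto).
  assert (Q2 := is_pseries_incr_1 (K := R_AbsRing) (V := R_NormedModule) _ _ _ P2).
  assert (Q3 := is_pseries_incr_1 (K := R_AbsRing) (V := R_NormedModule) _ _ _ Q2).
  assert (Q1 := is_pseries_incr_1 (K := R_AbsRing) (V := R_NormedModule) _ _ _ P1).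
  assert (S3 := is_pseries_scal (K := R_AbsRing) (V := R_NormedModule) (-1) _ _ _ (Rmult_comm _ _) Q3).
  assert (S1 := is_pseries_scal (K := R_AbsRing) (V := R_NormedModule) c _ _ _ (Rmult_comm _ _) P1).
  assert (S1' := is_pseries_scal (K := R_AbsRing) (V := R_NormedModule) (- (a + b + 1)) _ _ _ (Rmult_comm _ _) Q1).
  assert (S0 := is_pseries_scal (K := R_AbsRing) (V := R_NormedModule) (- (a * b)) _ _ _ (Rmult_comm _ _) P0).
  assert (T := is_pseries_plus (K := R_AbsRing) (V := R_NormedModule) _ _ _ _ _
    (is_pseries_plus (K := R_AbsRing) (V := R_NormedModule) _ _ _ _ _ Q2 S3)
    (is_pseries_plus (K := R_AbsRing) (V := R_NormedModule) _ _ _ _ _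
      (is_pseries_plus (K := R_AbsRing) (V := R_NormedModule) _ _ _ _ _ S1 S1') S0)).
  apply is_pseries_unique in T.
  unfold scal, plus in T; simpl in T; unfold mult in T; simpl in T.
  transitivity (x * hypR2 a b c x + -1 * (x * (x * hypR2 a b c x)) +
    (c * hypR1 a b c x + - (a + b + 1) * (x * hypR1 a b c x) + - (a * b) * hypR a b c x)); [ring|].
  etransitivity; [symmetry; exact T|].
  transitivity (PSeries (fun _ => 0) x); [|apply PSeries_const_0].
  apply PSeries_ext. intros n.
  unfold PS_plus, PS_scal, PS_incr_1, plus, scal, zero; simpl; unfold mult; simpl.
  destruct n as [|n].
  - assert (E := hcoef_S 0). simpl in E. unfold PS_derive. simpl. fold u in E. lra.
  - assert (E := hcoef_S (S n)). fold u in E.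
    destruct n as [|n]; unfold PS_derive; rewrite ?S_INR in *; simpl INR in *; simpl; lra.
Qed.

Lemma hypR_ge_1 (x : R) : 0 <= x < 1 -> 1 <= hypR a b c x.
Proof.
  intros Hx. assert (Hr := hcoef_radius x ltac:(rewrite Rabs_pos_eq; lra)).
  assert (S : ex_series (fun n => hcoef a b c n * x ^ n)).
  { apply CV_radius_inside in Hr. apply ex_pseries_R in Hr. exact Hr. }
  change (1 <= Series (fun n => hcoef a b c n * x ^ n)).
  eapply Rle_trans; [|apply (rsum_le_Series _ 1); auto].
  - simpl. unfold hcoef. simpl. right; field.
  - intros k. apply Rmult_le_pos; [left; apply hcoef_pos | apply pow_le; lra].
Qed.

Lemma hypR_incr (x y : R) : 0 <= x <= y -> y < 1 -> hypR a b c x <= hypR a b c y.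
Proof.
  intros Hx Hy. apply Series_le.
  - intros n. assert (P := hcoef_pos n). assert (0 <= x ^ n) by (apply pow_le; lra).
    assert (x ^ n <= y ^ n) by (apply pow_incr; lra). split.
    + apply Rmult_le_pos; lra.
    + apply Rmult_le_compat_l; lra.
  - apply ex_pseries_R, CV_radius_inside, hcoef_radius. rewrite Rabs_pos_eq; lra.
Qed.

Lemma hypR_cont (x : R) : Rabs x < 1 -> continuous (hypR a b c) x.
Proof.
  intros Hx. apply (ex_derive_continuous (K := R_AbsRing) (V := R_NormedModule)).
  eexists; now apply hypR_derive.
Qed.

Lemma hypergeom_real (x : R) : hypergeom a b c (RtoC x) = RtoC (hypR a b c x).
Proof.
  unfold hypergeom, CSeries, hypR, PSeries, RtoC. f_equal.
  - apply Series_ext. intros n. fold (hcoef a b c n).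
    change ((x, 0) ^ n)%C with (RtoC x ^ n)%C. rewrite <- RtoC_pow. simpl. ring.
  - transitivity (Series (fun _ => 0)).
    + apply Series_ext. intros n. change ((x, 0) ^ n)%C with (RtoC x ^ n)%C. rewrite <- RtoC_pow. simpl. ring.
    + apply is_series_unique. apply is_series_eps. intros e He; exists O; intros n _.
      replace (sum_n (fun _ : nat => 0) n) with 0; [now rewrite Rminus_diag, Rabs_R0|].
      induction n; [now rewrite sum_O | rewrite sum_Sn, <- IHn; symmetry; apply Rplus_0_l].
Qed.

End Hypergeometric.

(** * Comparison of solutions and Landen's transformation *)

Lemma constant_of_derive_0 (f : R -> R) (l r : R) : l < r ->
  (forall x, l < x < r -> is_derive f x 0) -> (forall x, l <= x <= r -> continuous f x) -> f l = f r.
Proof.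
  intros Hlr Hd Hc. destruct (MVT_gen f l r (fun _ => 0)) as (x & _ & E).
  - intros x Hx. rewrite Rmin_left, Rmax_right in Hx by lra. auto.
  - intros x Hx. rewrite Rmin_left, Rmax_right in Hx by lra. now apply continuity_pt_filterlim, Hc.
  - lra.
Qed.

(** Both functions solve $(py')'=qy$, so $p$ times their Wronskian is constant; it vanishes at one
    end, and the quotient $y/w$ is then constant. At the ends only continuity of $py'$ and $pw'$ is
    assumed, so that a singular point with $p=0$ may be an end. *)
Lemma wronskian_proportional (y dy w dw p q : R -> R) (l r : R) : l < r ->
  (forall x, l <= x <= r -> continuous y x) -> (forall x, l <= x <= r -> continuous w x) ->
  (forall x, l <= x <= r -> continuous (fun x => p x * dy x) x) ->
  (forall x, l <= x <= r -> continuous (fun x => p x * dw x) x) ->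
  (forall x, l < x < r -> is_derive y x (dy x)) -> (forall x, l < x < r -> is_derive w x (dw x)) ->
  (forall x, l < x < r -> is_derive (fun x => p x * dy x) x (q x * y x)) ->
  (forall x, l < x < r -> is_derive (fun x => p x * dw x) x (q x * w x)) ->
  (forall x, l < x < r -> p x <> 0) -> (forall x, l <= x <= r -> w x <> 0) ->
  (p l * dy l * w l - y l * (p l * dw l) = 0 \/ p r * dy r * w r - y r * (p r * dw r) = 0) ->
  y l * w r = y r * w l.
Proof.
  intros Hlr Cy Cw Cpy Cpw Dy Dw Dpy Dpw Hp Hw H0.
  set (W := fun x => (p x * dy x) * w x - y x * (p x * dw x)).
  assert (CW : forall x, l <= x <= r -> continuous W x).
  { intros x Hx. apply (continuous_minus (V := R_NormedModule)); apply (continuous_mult (K := R_AbsRing)); auto. }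
  assert (DW : forall x, l < x < r -> is_derive W x 0).
  { intros x Hx.
    replace 0 with ((q x * y x * w x + p x * dy x * dw x) - (dy x * (p x * dw x) + y x * (q x * w x))) by ring.
    apply (is_derive_minus (K := R_AbsRing) (V := R_NormedModule) (fun x => p x * dy x * w x) (fun x => y x * (p x * dw x))).
    - apply (is_derive_mult (K := R_AbsRing) (fun x => p x * dy x) w); auto. intros; apply Rmult_comm.
    - apply (is_derive_mult (K := R_AbsRing) y (fun x => p x * dw x)); auto. intros; apply Rmult_comm. }
  assert (WC : forall x, l <= x <= r -> W x = 0).
  { intros x Hx. destruct H0 as [H0|H0].
    - destruct (Req_dec x l) as [->|N]; auto. rewrite <- H0. symmetry.
      apply (constant_of_derive_0 W l x); [lra| |]; intros; [apply DW | apply CW]; lra.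
    - destruct (Req_dec x r) as [->|N]; auto. rewrite <- H0.
      apply (constant_of_derive_0 W x r); [lra| |]; intros; [apply DW | apply CW]; lra. }
  assert (E : y l / w l = y r / w r).
  { apply (constant_of_derive_0 (fun x => y x / w x)); auto.
    - intros x Hx. assert (Hwx := Hw x ltac:(lra)).
      replace 0 with ((dy x * w x - y x * dw x) / (w x) ^ 2).
      + apply is_derive_div; auto.
      + assert (X := WC x ltac:(lra)). unfold W in X.
        replace (dy x * w x - y x * dw x) with 0; [field; auto|].
        apply Rmult_eq_reg_l with (p x); [|apply Hp; lra]. lra.
    - intros x Hx. apply (continuous_mult (K := R_AbsRing) y (fun x => / w x)); auto.
      apply continuous_comp; auto. apply continuity_pt_filterlim.
      apply (continuity_pt_inv id); [apply continuity_pt_id | now apply Hw]. }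
  assert (w l <> 0) by (apply Hw; lra). assert (w r <> 0) by (apply Hw; lra).
  apply (f_equal (fun t => t * (w l * w r))) in E. field_simplify in E; auto. lra.
Qed.

(** The complete elliptic integral in the parameter $x=k^2$, normalised to the value $1$ at $0$; it
    is $\frac2\pi K$ in the usual notation. *)
Definition ellK (x : R) : R := hypR (1 / 2) (1 / 2) 1 x.
Definition ellK1 (x : R) : R := hypR1 (1 / 2) (1 / 2) 1 x.
Definition ellK2 (x : R) : R := hypR2 (1 / 2) (1 / 2) 1 x.

Lemma ellK_derive (x : R) : Rabs x < 1 -> is_derive ellK x (ellK1 x).
Proof. apply hypR_derive; lra. Qed.

Lemma ellK1_derive (x : R) : Rabs x < 1 -> is_derive ellK1 x (ellK2 x).
Proof. apply hypR1_derive; lra. Qed.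

Lemma ellK_ode (x : R) : Rabs x < 1 -> x * (1 - x) * ellK2 x + (1 - 2 * x) * ellK1 x - / 4 * ellK x = 0.
Proof.
  intros Hx. assert (E := hyp_ode (1 / 2) (1 / 2) 1 ltac:(lra) ltac:(lra) ltac:(lra) ltac:(lra) ltac:(lra) x Hx).
  fold (ellK x) (ellK1 x) (ellK2 x) in E. lra.
Qed.

Lemma ellK_ge_1 (x : R) : 0 <= x < 1 -> 1 <= ellK x.
Proof. apply hypR_ge_1; lra. Qed.

Lemma ellK_0 : ellK 0 = 1.
Proof. apply hypR_0; lra. Qed.

Lemma ellK_incr (x y : R) : 0 <= x <= y -> y < 1 -> ellK x <= ellK y.
Proof. apply hypR_incr; lra. Qed.

Lemma ellK_cont (x : R) : Rabs x < 1 -> continuous ellK x.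
Proof. apply hypR_cont; lra. Qed.

Lemma ex_derive_ellK (x : R) : Rabs x < 1 -> ex_derive ellK x.
Proof. intros; eexists; now apply ellK_derive. Qed.

Lemma ex_derive_ellK1 (x : R) : Rabs x < 1 -> ex_derive ellK1 x.
Proof. intros; eexists; now apply ellK1_derive. Qed.

Ltac derive_ellK A :=
  change (Derive (fun x => ellK x)) with (Derive ellK);
  change (Derive (fun x => ellK1 x)) with (Derive ellK1);
  rewrite ?(is_derive_unique _ _ _ (ellK_derive _ A)), ?(is_derive_unique _ _ _ (ellK1_derive _ A)).

Lemma landen_arg (x : R) : 0 <= x < 1 -> 0 <= 4 * x / (1 + x) ^ 2 < 1.
Proof.
  intros Hx. assert (0 < (1 + x) ^ 2) by (apply pow_lt; lra). split.
  - apply Rmult_le_pos; [lra|]. left; now apply Rinv_0_lt_compat.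
  - apply Rmult_lt_reg_r with ((1 + x) ^ 2); auto. unfold Rdiv; rewrite Rmult_assoc, Rinv_l by lra. nra.
Qed.

(** Both $K(4x/(1+x)^2)/(1+x)$ and $K(x^2)$ solve $(x(1-x^2)y')'=xy$ and equal $1$ at $0$, where the
    leading coefficient vanishes and with it the Wronskian term. *)
Lemma landen (x : R) : 0 <= x < 1 -> ellK (4 * x / (1 + x) ^ 2) = (1 + x) * ellK (x ^ 2).
Proof.
  intros Hx. destruct (Req_dec x 0) as [->|N].
  { replace (4 * 0 / (1 + 0) ^ 2) with 0 by field. replace (0 ^ 2) with 0 by ring. rewrite ellK_0. ring. }
  set (s := fun x => 4 * x / (1 + x) ^ 2).
  set (y := fun x => ellK (s x) / (1 + x)).
  set (dy := fun x => ellK1 (s x) * (4 * (1 - x) / (1 + x) ^ 3) / (1 + x) - ellK (s x) / (1 + x) ^ 2).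
  set (w := fun x => ellK (x ^ 2)).
  set (dw := fun x => 2 * x * ellK1 (x ^ 2)).
  assert (Hs : forall t, 0 <= t < 1 -> Rabs (s t) < 1).
  { intros t Ht. destruct (landen_arg t Ht). unfold s. rewrite Rabs_pos_eq; lra. }
  assert (Hq : forall t, 0 <= t < 1 -> Rabs (t ^ 2) < 1) by (intros t Ht; rewrite Rabs_pos_eq; nra).
  assert (Dy : forall t, 0 <= t < 1 -> is_derive y t (dy t)).
  { intros t Ht. unfold y, dy, s. assert (A := Hs t Ht). unfold s in A. auto_derive.
    - repeat split; try nra. now apply ex_derive_ellK.
    - change (4 * t * / ((1 + t) * ((1 + t) * 1))) with (4 * t / (1 + t) ^ 2).
      derive_ellK A. field. lra. }
  assert (Dw : forall t, 0 <= t < 1 -> is_derive w t (dw t)).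
  { intros t Ht. unfold w, dw. assert (A := Hq t Ht). auto_derive.
    - now apply ex_derive_ellK.
    - change (t * (t * 1)) with (t ^ 2). derive_ellK A. ring. }
  assert (Cdy : forall t, 0 <= t < 1 -> ex_derive dy t).
  { intros t Ht. unfold dy, s. assert (A := Hs t Ht). unfold s in A. auto_derive.
    repeat split; first [now apply ex_derive_ellK | now apply ex_derive_ellK1 | repeat apply Rmult_integral_contrapositive_currified; lra]. }
  assert (Cdw : forall t, 0 <= t < 1 -> ex_derive dw t).
  { intros t Ht. unfold dw. assert (A := Hq t Ht). auto_derive. now apply ex_derive_ellK1. }
  assert (E : y 0 * w x = y x * w 0).
  { apply (wronskian_proportional y dy w dw (fun x => x * (1 - x * x)) (fun x => x)); try lra.
    - intros t Ht. apply (ex_derive_continuous (K := R_AbsRing) (V := R_NormedModule)). eexists; apply Dy; lra.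
    - intros t Ht. apply (ex_derive_continuous (K := R_AbsRing) (V := R_NormedModule)). eexists; apply Dw; lra.
    - intros t Ht. apply (ex_derive_continuous (K := R_AbsRing) (V := R_NormedModule)).
      apply (ex_derive_mult (fun x => x * (1 - x * x)) dy); [auto_derive; auto | apply Cdy; lra].
    - intros t Ht. apply (ex_derive_continuous (K := R_AbsRing) (V := R_NormedModule)).
      apply (ex_derive_mult (fun x => x * (1 - x * x)) dw); [auto_derive; auto | apply Cdw; lra].
    - intros t Ht. apply Dy; lra.
    - intros t Ht. apply Dw; lra.
    - intros t Ht. unfold dy, y, s. assert (A := Hs t ltac:(lra)). unfold s in A. auto_derive.
      + repeat split; first [now apply ex_derive_ellK | now apply ex_derive_ellK1 | repeat apply Rmult_integral_contrapositive_currified; lra].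
      + change (4 * t * / ((1 + t) * ((1 + t) * 1))) with (4 * t / (1 + t) ^ 2).
        derive_ellK A.
        assert (O := ellK_ode _ A). set (S := 4 * t / (1 + t) ^ 2) in *.
        assert (NS : S * (1 - S) <> 0).
        { replace (1 - S) with ((1 - t) ^ 2 / (1 + t) ^ 2) by (unfold S; field; lra).
          apply Rmult_integral_contrapositive_currified; unfold S; apply Rmult_integral_contrapositive_currified;
          try apply Rinv_neq_0_compat; try apply pow_nonzero; lra. }
        (* Once the equation is solved for the second derivative, the claim is a rational identity
           in [t], linear in [ellK S] and [ellK1 S]. *)
        assert (E2 : ellK2 S = (/ 4 * ellK S - (1 - 2 * S) * ellK1 S) / (S * (1 - S))) by (apply Rmult_eq_reg_l with (S * (1 - S)); auto; field_simplify; [lra|split; intro; apply NS; nra]).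
        rewrite E2. unfold S. field. repeat split; try lra; nra.
    - intros t Ht. unfold dw, w. assert (A := Hq t ltac:(lra)). auto_derive.
      + repeat split. now apply ex_derive_ellK1.
      + change (t * (t * 1)) with (t ^ 2). derive_ellK A.
        assert (O := ellK_ode _ A).
        transitivity (4 * t * (t ^ 2 * (1 - t ^ 2) * ellK2 (t ^ 2) + (1 - 2 * t ^ 2) * ellK1 (t ^ 2))); [ring|].
        replace (t ^ 2 * (1 - t ^ 2) * ellK2 (t ^ 2) + (1 - 2 * t ^ 2) * ellK1 (t ^ 2)) with (/ 4 * ellK (t ^ 2)) by lra. field.
    - intros t Ht. apply Rmult_integral_contrapositive_currified; nra.
    - intros t Ht. assert (1 <= w t); [|lra]. apply ellK_ge_1. nra. }
  unfold y, w, s in E. replace (4 * 0 / (1 + 0) ^ 2) with 0 in E by field. replace (0 ^ 2) with 0 in E by ring.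
  rewrite ellK_0 in E.
  apply (f_equal (fun t => t * (1 + x))) in E. field_simplify in E; [|lra]. lra.
Qed.

(** * The pull-back of the hypergeometric equation along 1/j *)

Definition quadP (x : R) : R := 1 - x + x * x.

Lemma quadP_pos (x : R) : 0 < quadP x.
Proof. unfold quadP. generalize (Rle_0_sqr (x - / 2)). unfold Rsqr. lra. Qed.

(* [1/j] as a function of [x = lambda]. *)
Definition zof (x : R) : R := 27 / 4 * (x * (1 - x) * (x * (1 - x))) / (quadP x * quadP x * quadP x).

Definition zof' (x : R) : R :=
  27 / 4 * (x * (1 - x) * (1 - 2 * x) * (2 - x) * (1 + x)) / (quadP x * quadP x * quadP x * quadP x).

(** This rests on $4(1-x+x^2)^3-27x^2(1-x)^2=((1-2x)(2-x)(1+x))^2$; the square reflects the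
    ramification over the value $1$. *)
Lemma zof_compl (x : R) :
  1 - zof x = ((1 - 2 * x) * (2 - x) * (1 + x)) ^ 2 / (4 * (quadP x * quadP x * quadP x)).
Proof. assert (P := quadP_pos x). unfold zof. unfold quadP in *. field. lra. Qed.

Lemma zof_derive (x : R) : is_derive zof x (zof' x).
Proof.
  assert (P := quadP_pos x). unfold zof, zof', quadP in *. auto_derive.
  - repeat apply Rmult_integral_contrapositive_currified; lra.
  - field. lra.
Qed.

(** The chain rule produces $z'^2Y''$, and the hypergeometric equation controls $z(1-z)Y''$; this
    identity converts one into the other. *)
Lemma zof'_sqr (x : R) : zof' x * zof' x = 27 / (quadP x * quadP x) * (zof x * (1 - zof x)).
Proof. rewrite zof_compl. assert (P := quadP_pos x). unfold zof, zof', quadP in *. field. lra. Qed.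

Lemma zof_range (x : R) : 0 < x < / 2 -> 0 < zof x < 1.
Proof.
  intros Hx. assert (P := quadP_pos x). split.
  - unfold zof. apply Rdiv_lt_0_compat; [|repeat apply Rmult_lt_0_compat; auto].
    assert (0 < x * (1 - x)) by (apply Rmult_lt_0_compat; lra). nra.
  - assert (0 < 1 - zof x); [|lra]. rewrite zof_compl. apply Rdiv_lt_0_compat.
    + apply pow_lt. repeat apply Rmult_lt_0_compat; lra.
    + repeat apply Rmult_lt_0_compat; lra.
Qed.

(** The weight $(1-x+x^2)^{-1/4}$ turns the pulled-back equation into that of $K$. Classically
    $F(\frac1{12},\frac5{12},1;1/j)^4=E_4=\vartheta_{00}^8(1-\lambda+\lambda^2)$ near the cusp,
    while $\vartheta_{00}^2=K(\lambda)$ in the present normalisation. *)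
Definition weightE (x : R) : R := exp (- (1 / 4) * ln (quadP x)).

Definition logderE (x : R) : R := - (1 / 4) * (2 * x - 1) / quadP x.

Lemma weightE_derive (x : R) : is_derive weightE x (weightE x * logderE x).
Proof.
  assert (P := quadP_pos x). unfold weightE, logderE, quadP in *. auto_derive; auto. change (1 + - x + x * x) with (1 - x + x * x). field. lra.
Qed.

Lemma weightE_pos (x : R) : 0 < weightE x.
Proof. apply exp_pos. Qed.

Section Pullback.

Variables (D : R -> Prop) (Y Y1 Y2 : R -> R).
Hypothesis HY : forall z, D z -> is_derive Y z (Y1 z).
Hypothesis HY1 : forall z, D z -> is_derive Y1 z (Y2 z).
Hypothesis Hode : forall z, D z -> z * (1 - z) * Y2 z + (1 - 3 / 2 * z) * Y1 z - 5 / 144 * Y z = 0.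

(** [Y] is any solution of the hypergeometric equation for $(\frac1{12},\frac5{12},1)$ on [D]. Both
    $F(\frac1{12},\frac5{12},1;z)$ and $F(\frac1{12},\frac5{12},\frac12;1-z)$ are such solutions. *)
Definition pullY (x : R) : R := weightE x * Y (zof x).
Definition pullY1 (x : R) : R := weightE x * (logderE x * Y (zof x) + zof' x * Y1 (zof x)).

Lemma is_derive_Rcomp (f g : R -> R) (x df dg : R) :
  is_derive f (g x) df -> is_derive g x dg -> is_derive (fun x => f (g x)) x (dg * df).
Proof. intros Hf Hg. apply (is_derive_comp f g); auto. Qed.

Lemma is_derive_Rmult (f g : R -> R) (x df dg : R) :
  is_derive f x df -> is_derive g x dg -> is_derive (fun x => f x * g x) x (df * g x + f x * dg).
Proof. intros Hf Hg. apply (is_derive_mult (K := R_AbsRing)); auto. intros; apply Rmult_comm. Qed.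

Lemma is_derive_Rplus (f g : R -> R) (x df dg : R) :
  is_derive f x df -> is_derive g x dg -> is_derive (fun x => f x + g x) x (df + dg).
Proof. intros Hf Hg. now apply (is_derive_plus (K := R_AbsRing) (V := R_NormedModule)). Qed.

Lemma is_derive_Rext (f g : R -> R) (x l : R) : (forall t, f t = g t) -> is_derive f x l -> is_derive g x l.
Proof. intros E. now apply is_derive_ext. Qed.

Lemma is_derive_value (f : R -> R) (x l m : R) : is_derive f x l -> l = m -> is_derive f x m.
Proof. now intros H <-. Qed.

Lemma pullY_derive (x : R) : D (zof x) -> is_derive pullY x (pullY1 x).
Proof.
  intros Hx. eapply is_derive_value.
  - apply is_derive_Rmult; [apply weightE_derive|]. apply is_derive_Rcomp; [now apply HY | apply zof_derive].
  - unfold pullY1. ring.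
Qed.

(** The result is the self-adjoint equation $(x(1-x)y')'=\frac14y$ of the elliptic integral, so
    pulled-back solutions can be compared with it by their Wronskian. *)
Lemma pullY1_derive (x : R) : D (zof x) ->
  is_derive (fun x => x * (1 - x) * pullY1 x) x (1 / 4 * pullY x).
Proof.
  intros Hx. assert (P := quadP_pos x).
  assert (Da : is_derive logderE x (- (1 / 4) * (2 * quadP x - (2 * x - 1) * (2 * x - 1)) / (quadP x * quadP x))).
  { unfold logderE, quadP in *. auto_derive; [lra|]. field. lra. }
  set (b' := 27 / 4 * ((-1 + 6 * x - 6 * x * x) * - (1) * ((2 - x) * (1 + x)) + x * (1 - x) * (1 - 2 * x) * (1 - 2 * x)) / (quadP x * quadP x * quadP x * quadP x)
    - 4 * (2 * x - 1) * zof' x / quadP x).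
  assert (Db : is_derive zof' x b').
  { unfold b', zof', quadP in *. auto_derive; [repeat apply Rmult_integral_contrapositive_currified; lra|]. field. lra. }
  assert (DU : is_derive (fun x => Y (zof x)) x (zof' x * Y1 (zof x))) by (apply is_derive_Rcomp; [now apply HY | apply zof_derive]).
  assert (DV : is_derive (fun x => Y1 (zof x)) x (zof' x * Y2 (zof x))) by (apply is_derive_Rcomp; [now apply HY1 | apply zof_derive]).
  assert (Dp : is_derive (fun x => x * (1 - x)) x (1 - 2 * x)) by (auto_derive; auto; ring).
  eapply is_derive_value.
  - apply is_derive_Rmult; [apply Dp|]. apply is_derive_Rmult; [apply weightE_derive|].
    apply is_derive_Rplus; apply is_derive_Rmult; eassumption.
  - cbv beta. unfold pullY1, pullY.
    assert (Q : zof' x * (zof' x * Y2 (zof x)) = 27 / (quadP x * quadP x) * (5 / 144 * Y (zof x) - (1 - 3 / 2 * zof x) * Y1 (zof x))).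
    { rewrite <- Rmult_assoc, zof'_sqr, Rmult_assoc. f_equal. generalize (Hode _ Hx). lra. }
    set (U := Y (zof x)) in *. set (V := Y1 (zof x)) in *. set (T := Y2 (zof x)) in *.
    (* After elimination of $Y''$, the coefficient of $Y$ must be $\frac14$ and that of $Y'$ must
       vanish; [CU] and [CV] are these two rational identities. *)
    assert (CU : (1 - 2 * x) * logderE x + x * (1 - x) * (logderE x * logderE x + (- (1 / 4) * (2 * quadP x - (2 * x - 1) * (2 * x - 1)) / (quadP x * quadP x)) + 27 / (quadP x * quadP x) * (5 / 144)) = 1 / 4).
    { unfold logderE, quadP in *. field. lra. }
    assert (CV : (1 - 2 * x) * zof' x + x * (1 - x) * (2 * logderE x * zof' x + b' - 27 / (quadP x * quadP x) * (1 - 3 / 2 * zof x)) = 0).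
    { unfold b', logderE, zof', zof, quadP in *. field. lra. }
    transitivity (weightE x * (((1 - 2 * x) * logderE x + x * (1 - x) * (logderE x * logderE x + (- (1 / 4) * (2 * quadP x - (2 * x - 1) * (2 * x - 1)) / (quadP x * quadP x)))) * U
      + ((1 - 2 * x) * zof' x + x * (1 - x) * (2 * logderE x * zof' x + b')) * V + x * (1 - x) * (zof' x * (zof' x * T)))); [ring|].
    rewrite Q.
    transitivity (weightE x * (((1 - 2 * x) * logderE x + x * (1 - x) * (logderE x * logderE x + (- (1 / 4) * (2 * quadP x - (2 * x - 1) * (2 * x - 1)) / (quadP x * quadP x)) + 27 / (quadP x * quadP x) * (5 / 144))) * U
      + ((1 - 2 * x) * zof' x + x * (1 - x) * (2 * logderE x * zof' x + b' - 27 / (quadP x * quadP x) * (1 - 3 / 2 * zof x))) * V)); [ring|].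
    rewrite CU, CV. ring.
Qed.

End Pullback.

Lemma ellK_selfadj (x : R) : Rabs x < 1 -> is_derive (fun x => x * (1 - x) * ellK1 x) x (1 / 4 * ellK x).
Proof.
  intros Hx. eapply is_derive_value.
  - apply is_derive_Rmult; [|now apply ellK1_derive].
    instantiate (1 := 1 - 2 * x). auto_derive; auto; ring.
  - generalize (ellK_ode x Hx). lra.
Qed.

Lemma is_derive_compl (f : R -> R) (x l : R) : is_derive f (1 - x) l -> is_derive (fun x => f (1 - x)) x (- l).
Proof.
  intros H. eapply is_derive_value; [apply (is_derive_Rcomp f (fun x => 1 - x)); [apply H|]|].
  - instantiate (1 := -1). auto_derive; auto; ring.
  - ring.
Qed.

Lemma ellK_compl_selfadj (x : R) : Rabs (1 - x) < 1 ->
  is_derive (fun x => x * (1 - x) * - ellK1 (1 - x)) x (1 / 4 * ellK (1 - x)).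
Proof.
  intros Hx. apply (is_derive_Rext (fun x => - ((1 - x) * (1 - (1 - x)) * ellK1 (1 - x)))).
  - intros t. ring.
  - replace (1 / 4 * ellK (1 - x)) with (- - (1 / 4 * ellK (1 - x))) by ring.
    apply (is_derive_opp (K := R_AbsRing) (V := R_NormedModule) (fun x => (1 - x) * (1 - (1 - x)) * ellK1 (1 - x))).
    apply (is_derive_compl (fun x => x * (1 - x) * ellK1 x)). now apply ellK_selfadj.
Qed.

Lemma derive_continuous (f : R -> R) (x l : R) : is_derive f x l -> continuous f x.
Proof. intros H. apply (ex_derive_continuous (K := R_AbsRing) (V := R_NormedModule)). now exists l. Qed.

Definition F1 (z : R) : R := hypR (1 / 12) (5 / 12) 1 z.
Definition F2 (z : R) : R := hypR (1 / 12) (5 / 12) (1 / 2) z.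

(** Comparison from $x=0$: there $x(1-x)$ vanishes and both solutions have the value $1$. *)
Lemma F1_pullback (x : R) : 0 <= x < / 2 -> weightE x * F1 (zof x) = ellK x.
Proof.
  intros Hx.
  assert (Z0 : zof 0 = 0) by (unfold zof; unfold quadP; field).
  assert (E0 : weightE 0 = 1).
  { unfold weightE, quadP. replace (1 - 0 + 0 * 0) with 1 by ring. rewrite ln_1, Rmult_0_r. apply exp_0. }
  assert (B0 : F1 0 = 1) by (apply hypR_0).
  destruct (Req_dec x 0) as [->|N]; [rewrite Z0, E0, B0, ellK_0; ring|].
  set (D := fun z => Rabs z < 1).
  assert (HD : forall t, 0 <= t <= x -> D (zof t)).
  { intros t Ht. unfold D. destruct (Req_dec t 0) as [->|]; [rewrite Z0, Rabs_R0; lra|].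
    destruct (zof_range t ltac:(lra)). rewrite Rabs_pos_eq; lra. }
  assert (A1 : forall z, D z -> is_derive F1 z (hypR1 (1 / 12) (5 / 12) 1 z)) by (intros; apply hypR_derive; auto; lra).
  assert (A2 : forall z, D z -> is_derive (hypR1 (1 / 12) (5 / 12) 1) z (hypR2 (1 / 12) (5 / 12) 1 z)) by (intros; apply hypR1_derive; auto; lra).
  assert (A3 : forall z, D z -> z * (1 - z) * hypR2 (1 / 12) (5 / 12) 1 z + (1 - 3 / 2 * z) * hypR1 (1 / 12) (5 / 12) 1 z - 5 / 144 * F1 z = 0).
  { intros z Hz. assert (O := hyp_ode (1 / 12) (5 / 12) 1 ltac:(lra) ltac:(lra) ltac:(lra) ltac:(lra) ltac:(lra) z Hz).
    unfold F1. lra. }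
  set (y := pullY F1). set (dy := pullY1 F1 (hypR1 (1 / 12) (5 / 12) 1)).
  assert (E : y 0 * ellK x = y x * ellK 0).
  { apply (wronskian_proportional y dy ellK ellK1 (fun x => x * (1 - x)) (fun _ => 1 / 4)); try lra.
    - intros t Ht. eapply derive_continuous, (pullY_derive D F1 _ A1), HD, Ht.
    - intros t Ht. eapply derive_continuous, ellK_derive. rewrite Rabs_pos_eq; lra.
    - intros t Ht. eapply derive_continuous, (pullY1_derive D F1 _ _ A1 A2 A3), HD, Ht.
    - intros t Ht. eapply derive_continuous, ellK_selfadj. rewrite Rabs_pos_eq; lra.
    - intros t Ht. apply (pullY_derive D F1 _ A1), HD; lra.
    - intros t Ht. apply ellK_derive. rewrite Rabs_pos_eq; lra.
    - intros t Ht. apply (pullY1_derive D F1 _ _ A1 A2 A3), HD; lra.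
    - intros t Ht. apply ellK_selfadj. rewrite Rabs_pos_eq; lra.
    - intros t Ht. apply Rmult_integral_contrapositive_currified; lra.
    - intros t Ht. generalize (ellK_ge_1 t); lra. }
  unfold y, pullY in E. rewrite Z0, E0, B0, ellK_0 in E. lra.
Qed.

(** Comparison from $x=1/2$, where $1-z=0$ and the series is regular. The constant is left open
    here; it is identified through the growth at the cusp in [hyp_ratio_imag]. *)
Lemma F2_pullback : exists c : R, forall x, 0 < x < / 2 ->
  weightE x * F2 (1 - zof x) = c * (ellK x + ellK (1 - x)).
Proof.
  assert (Z0 : zof (/ 2) = 1) by (unfold zof; unfold quadP; field).
  set (Y := fun z => F2 (1 - z)).
  set (Y1 := fun z => - hypR1 (1 / 12) (5 / 12) (1 / 2) (1 - z)).
  set (Y2 := fun z => hypR2 (1 / 12) (5 / 12) (1 / 2) (1 - z)).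
  set (D := fun z => Rabs (1 - z) < 1).
  assert (HD : forall t, 0 < t <= / 2 -> D (zof t)).
  { intros t Ht. unfold D. destruct (Req_dec t (/ 2)) as [->|].
    - rewrite Z0, Rminus_diag, Rabs_R0; lra.
    - destruct (zof_range t ltac:(lra)). rewrite Rabs_pos_eq; lra. }
  assert (A1 : forall z, D z -> is_derive Y z (Y1 z)).
  { intros z Hz. apply (is_derive_compl F2). apply hypR_derive; auto; lra. }
  assert (A2 : forall z, D z -> is_derive Y1 z (Y2 z)).
  { intros z Hz. unfold Y1, Y2. replace (hypR2 (1 / 12) (5 / 12) (1 / 2) (1 - z)) with (- - hypR2 (1 / 12) (5 / 12) (1 / 2) (1 - z)) by ring.
    apply (is_derive_opp (K := R_AbsRing) (V := R_NormedModule) (fun z => hypR1 (1 / 12) (5 / 12) (1 / 2) (1 - z))).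
    apply (is_derive_compl (hypR1 (1 / 12) (5 / 12) (1 / 2))). apply hypR1_derive; auto; lra. }
  assert (A3 : forall z, D z -> z * (1 - z) * Y2 z + (1 - 3 / 2 * z) * Y1 z - 5 / 144 * Y z = 0).
  { intros z Hz. assert (O := hyp_ode (1 / 12) (5 / 12) (1 / 2) ltac:(lra) ltac:(lra) ltac:(lra) ltac:(lra) ltac:(lra) (1 - z) Hz).
    unfold Y, Y1, Y2, F2. lra. }
  set (y := pullY Y). set (dy := pullY1 Y Y1).
  set (w := fun x => ellK x + ellK (1 - x)). set (dw := fun x => ellK1 x + - ellK1 (1 - x)).
  assert (Pw : forall t, 0 < t < 1 -> 2 <= w t).
  { intros t Ht. unfold w. generalize (ellK_ge_1 t ltac:(lra)) (ellK_ge_1 (1 - t) ltac:(lra)). lra. }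
  assert (Dw : forall t, 0 < t < 1 -> is_derive w t (dw t)).
  { intros t Ht. apply is_derive_Rplus; [apply ellK_derive | apply is_derive_compl, ellK_derive]; rewrite Rabs_pos_eq; lra. }
  assert (Dpw : forall t, 0 < t < 1 -> is_derive (fun x => x * (1 - x) * dw x) t (1 / 4 * w t)).
  { intros t Ht. apply (is_derive_Rext (fun x => x * (1 - x) * ellK1 x + x * (1 - x) * - ellK1 (1 - x))).
    - intros u. unfold dw. ring.
    - unfold w. replace (1 / 4 * (ellK t + ellK (1 - t))) with (1 / 4 * ellK t + 1 / 4 * ellK (1 - t)) by ring.
      apply is_derive_Rplus; [apply ellK_selfadj | apply ellK_compl_selfadj]; rewrite Rabs_pos_eq; lra. }
  exists (y (/ 2) / w (/ 2)). intros x Hx.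
  assert (E : y x * w (/ 2) = y (/ 2) * w x).
  { apply (wronskian_proportional y dy w dw (fun x => x * (1 - x)) (fun _ => 1 / 4)); try lra.
    - intros t Ht. eapply derive_continuous, (pullY_derive D Y _ A1), HD; lra.
    - intros t Ht. eapply derive_continuous, Dw; lra.
    - intros t Ht. eapply derive_continuous, (pullY1_derive D Y _ _ A1 A2 A3), HD; lra.
    - intros t Ht. eapply derive_continuous, Dpw; lra.
    - intros t Ht. apply (pullY_derive D Y _ A1), HD; lra.
    - intros t Ht. apply Dw; lra.
    - intros t Ht. apply (pullY1_derive D Y _ _ A1 A2 A3), HD; lra.
    - intros t Ht. apply Dpw; lra.
    - intros t Ht. apply Rmult_integral_contrapositive_currified; lra.
    - intros t Ht. generalize (Pw t); lra.
    (* Both derivatives vanish at $1/2$: the logarithmic derivative of the weight and the derivative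
       of [zof] are zero there, and $K(x)+K(1-x)$ is symmetric. *)
    - right. unfold dy, dw, pullY1.
      assert (L0 : logderE (/ 2) = 0) by (unfold logderE, quadP; field).
      assert (Z1 : zof' (/ 2) = 0) by (unfold zof', quadP; field).
      rewrite L0, Z1. replace (1 - / 2) with (/ 2) by field. ring. }
  change (y x = y (/ 2) / w (/ 2) * w x). assert (W2 := Pw (/ 2) ltac:(lra)).
  apply Rmult_eq_reg_r with (w (/ 2)); [|lra]. rewrite E. field. lra.
Qed.

(** * The beta function and logarithmic growth *)

Lemma filterlim_at_left1 (f : R -> R) (l : R) :
  (forall eps, 0 < eps -> exists d, 0 < d /\ forall x, 1 - d < x < 1 -> Rabs (f x - l) < eps) ->
  filterlim f (at_left 1) (locally l).
Proof.
  intros H. apply filterlim_locally. intros eps.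
  destruct (H eps (cond_pos eps)) as (d & Hd & K). exists (mkposreal d Hd). intros x Hx Hx1.
  apply K. destruct (Rabs_def2 _ _ Hx). unfold minus, plus, opp in *; simpl in *. lra.
Qed.

Lemma filterlim_at_right0 (f : R -> R) (l : R) :
  (forall eps, 0 < eps -> exists d, 0 < d /\ forall x, 0 < x < d -> Rabs (f x - l) < eps) ->
  filterlim f (at_right 0) (locally l).
Proof.
  intros H. apply filterlim_locally. intros eps.
  destruct (H eps (cond_pos eps)) as (d & Hd & K). exists (mkposreal d Hd). intros x Hx Hx1.
  apply K. destruct (Rabs_def2 _ _ Hx). unfold minus, plus, opp in *; simpl in *. lra.
Qed.

Lemma unit_interval_ends :
  filter_prod (at_right 0) (at_left 1) (fun ab : R * R => 0 < fst ab < / 2 /\ / 2 < snd ab < 1).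
Proof.
  apply Filter_prod with (fun a => 0 < a < / 2) (fun b => / 2 < b < 1).
  - exists (mkposreal (/ 2) ltac:(lra)). intros x Hx Hx1.
    destruct (Rabs_def2 _ _ Hx). unfold minus, plus, opp in *; simpl in *. lra.
  - exists (mkposreal (/ 2) ltac:(lra)). intros x Hx Hx1.
    destruct (Rabs_def2 _ _ Hx). unfold minus, plus, opp in *; simpl in *. lra.
  - intros x y Hx Hy. simpl. auto.
Qed.

Lemma ends_forall (P : R -> Prop) : (forall x, 0 < x < 1 -> P x) ->
  filter_prod (at_right 0) (at_left 1) (fun ab : R * R =>
    forall x, Rmin (fst ab) (snd ab) <= x <= Rmax (fst ab) (snd ab) -> P x).
Proof.
  intros H. generalize unit_interval_ends. apply filter_imp. intros [a b] [Ha Hb] x Hx. simpl in *.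
  rewrite Rmin_left, Rmax_right in Hx by lra. apply H; lra.
Qed.

Definition bint (h : R -> R) (v : R) : Prop := is_RInt_gen h (at_right 0) (at_left 1) v.

Lemma bint_ext (h k : R -> R) (v : R) : (forall x, 0 < x < 1 -> h x = k x) -> bint h v -> bint k v.
Proof.
  intros E. apply is_RInt_gen_ext.
  generalize (ends_forall _ E). apply filter_imp. intros ab K x Hx. apply K; lra.
Qed.

Lemma bint_primitive (P h : R -> R) (l0 l1 : R) :
  (forall x, 0 < x < 1 -> is_derive P x (h x)) -> (forall x, 0 < x < 1 -> continuous h x) ->
  filterlim P (at_right 0) (locally l0) -> filterlim P (at_left 1) (locally l1) -> bint h (l1 - l0).
Proof.
  intros HP Hc H0 H1. apply bint_ext with (Derive P).
  - intros x Hx. now apply is_derive_unique, HP.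
  - apply (is_RInt_gen_Derive P l0 l1); auto.
    + apply ends_forall. intros x Hx. eexists; now apply HP.
    + apply ends_forall. intros x Hx. apply continuous_ext_loc with h; [|auto].
      exists (mkposreal (Rmin x (1 - x)) ltac:(apply Rmin_pos; lra)). intros t Ht. symmetry.
      apply is_derive_unique, HP. destruct (Rabs_def2 _ _ Ht). unfold minus, plus, opp in *; simpl in *.
      generalize (Rmin_l x (1 - x)) (Rmin_r x (1 - x)). lra.
Qed.

Lemma bint_unique (h : R -> R) (v : R) : bint h v -> RInt_gen h (at_right 0) (at_left 1) = v.
Proof. apply (is_RInt_gen_unique (V := R_CompleteNormedModule)). Qed.

Lemma bint_le (h k : R -> R) (v w : R) : (forall x, 0 < x < 1 -> 0 <= h x <= k x) ->
  bint h v -> bint k w -> v <= w.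
Proof.
  intros H Hh Hk. eapply Rle_trans; [apply Rle_abs|].
  apply (RInt_gen_norm (V := R_CompleteNormedModule) (Fa := at_right 0) (Fb := at_left 1) h k v w); auto.
  - generalize unit_interval_ends. apply filter_imp. intros ab Hab. lra.
  - generalize unit_interval_ends. apply filter_imp. intros ab Hab x Hx.
    change (Rabs (h x) <= k x). rewrite Rabs_pos_eq; apply H; lra.
Qed.

Lemma bint_lin (h k : R -> R) (c d v w : R) : bint h v -> bint k w ->
  bint (fun x => c * h x + d * k x) (c * v + d * w).
Proof.
  intros Hh Hk. apply (is_RInt_gen_plus (V := R_NormedModule) (fun x => c * h x) (fun x => d * k x));
  now apply (is_RInt_gen_scal (V := R_NormedModule)).
Qed.

Definition bdens (a b t : R) : R := Rpower t (a - 1) * Rpower (1 - t) (b - 1).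

Lemma beta_bint (a b v : R) : bint (bdens a b) v -> beta a b = v.
Proof. apply bint_unique. Qed.

Lemma bdens_pos (a b t : R) : 0 < bdens a b t.
Proof. apply Rmult_lt_0_compat; apply exp_pos. Qed.

Lemma bdens_cont (a b t : R) : 0 < t < 1 -> continuous (bdens a b) t.
Proof.
  intros Ht. apply (ex_derive_continuous (K := R_AbsRing) (V := R_NormedModule)).
  unfold bdens, Rpower. auto_derive. lra.
Qed.

Lemma Rpower_small (a : R) (eps : R) : 0 < a -> 0 < eps -> exists d, 0 < d /\ forall x, 0 < x < d -> Rpower x a < eps.
Proof.
  intros Ha He. exists (Rpower eps (/ a)). split; [apply exp_pos|]. intros x Hx.
  replace eps with (Rpower (Rpower eps (/ a)) a).
  - unfold Rpower at 1 2. apply exp_increasing. apply Rmult_lt_compat_l; auto. apply ln_increasing; lra.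
  - rewrite Rpower_mult, Rinv_l, Rpower_1; lra.
Qed.

Lemma Rpower_le_1 (x b : R) : 0 < x <= 1 -> 0 <= b -> Rpower x b <= 1.
Proof.
  intros Hx Hb. unfold Rpower. rewrite <- exp_0. apply exp_le_compat.
  assert (ln x <= 0) by (rewrite <- ln_1; destruct (Req_dec x 1) as [->|]; [lra | left; apply ln_increasing; lra]). nra.
Qed.

Lemma bprim_derive (a b t : R) : 0 < t < 1 ->
  is_derive (fun t => Rpower t a * Rpower (1 - t) b) t ((a + b) * bdens a (b + 1) t + - b * bdens a b t).
Proof.
  intros Ht. unfold bdens.
  assert (E1 : Rpower t (a - 1) = Rpower t a / t).
  { unfold Rminus. rewrite Rpower_plus, Rpower_Ropp, Rpower_1 by lra. reflexivity. }
  assert (E2 : Rpower (1 - t) (b - 1) = Rpower (1 - t) b / (1 - t)).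
  { unfold Rminus. rewrite Rpower_plus, Rpower_Ropp, Rpower_1 by lra. reflexivity. }
  replace (b + 1 - 1) with b by ring. rewrite E1, E2.
  unfold Rpower. auto_derive; [lra|]. change (1 + - t) with (1 - t). field. lra.
Qed.

Lemma bprim_lim0 (a b : R) : 0 < a -> 0 <= b ->
  filterlim (fun t => Rpower t a * Rpower (1 - t) b) (at_right 0) (locally 0).
Proof.
  intros Ha Hb. apply filterlim_at_right0. intros eps He. destruct (Rpower_small a eps Ha He) as (d & Hd & K).
  exists (Rmin d 1). split; [apply Rmin_pos; lra|]. intros x Hx.
  assert (x < d) by (generalize (Rmin_l d 1); lra). assert (x < 1) by (generalize (Rmin_r d 1); lra).
  assert (P1 : 0 < Rpower x a) by apply exp_pos. assert (P2 : 0 < Rpower (1 - x) b) by apply exp_pos.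
  rewrite Rminus_0_r, Rabs_pos_eq by nra.
  assert (Rpower (1 - x) b <= 1) by (apply Rpower_le_1; lra). specialize (K x ltac:(lra)). nra.
Qed.

Lemma bprim_lim1 (a b : R) : 0 <= a -> 0 < b ->
  filterlim (fun t => Rpower t a * Rpower (1 - t) b) (at_left 1) (locally 0).
Proof.
  intros Ha Hb. apply filterlim_at_left1. intros eps He. destruct (Rpower_small b eps Hb He) as (d & Hd & K).
  exists (Rmin d 1). split; [apply Rmin_pos; lra|]. intros x Hx.
  assert (1 - x < d) by (generalize (Rmin_l d 1); lra). assert (0 < x) by (generalize (Rmin_r d 1); lra).
  assert (P1 : 0 < Rpower x a) by apply exp_pos. assert (P2 : 0 < Rpower (1 - x) b) by apply exp_pos.
  rewrite Rminus_0_r, Rabs_pos_eq by nra.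
  assert (Rpower x a <= 1) by (apply Rpower_le_1; lra). specialize (K (1 - x) ltac:(lra)). nra.
Qed.

(** The derivative of $t^a(1-t)^b$, which tends to $0$ at both ends, integrates to
    $(a+b)B(a,b+1)-bB(a,b)=0$. *)
Lemma bint_succ (a b v : R) : 0 < a -> 0 < b -> bint (bdens a b) v ->
  bint (bdens a (b + 1)) (b / (a + b) * v).
Proof.
  intros Ha Hb Hv.
  assert (H := bint_primitive _ (fun t => (a + b) * bdens a (b + 1) t + - b * bdens a b t) _ _
    (fun t => bprim_derive a b t)
    ltac:(intros t Ht; apply (continuous_plus (V := R_NormedModule)); apply (continuous_scal_r (K := R_AbsRing) (V := R_NormedModule)); now apply bdens_cont)
    (bprim_lim0 a b Ha ltac:(lra)) (bprim_lim1 a b ltac:(lra) Hb)).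
  assert (L := bint_lin _ _ (/ (a + b)) (b / (a + b)) _ _ H Hv).
  replace (b / (a + b) * v) with (/ (a + b) * (0 - 0) + b / (a + b) * v) by ring.
  revert L. apply bint_ext. intros x Hx. field. lra.
Qed.

Lemma bint_1 (a : R) : 0 < a -> bint (bdens a 1) (/ a).
Proof.
  intros Ha. replace (/ a) with (/ a - 0) by ring.
  apply (bint_primitive (fun t => Rpower t a * / a)).
  - intros t Ht. unfold bdens. replace (1 - 1) with 0 by ring. rewrite Rpower_O by lra.
    assert (E1 : Rpower t (a - 1) = Rpower t a / t).
    { unfold Rminus. rewrite Rpower_plus, Rpower_Ropp, Rpower_1 by lra. reflexivity. }
    rewrite E1. unfold Rpower. auto_derive; [lra|]. field. lra.
  - intros t Ht. now apply bdens_cont.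
  - apply filterlim_at_right0. intros eps He. destruct (Rpower_small a (eps * a) Ha) as (d & Hd & K); [nra|].
    exists d; split; auto. intros x Hx. specialize (K x Hx).
    assert (P : 0 < Rpower x a) by apply exp_pos. assert (Q : 0 < / a) by now apply Rinv_0_lt_compat.
    rewrite Rminus_0_r, Rabs_pos_eq by nra. apply Rmult_lt_reg_r with a; auto. rewrite Rmult_assoc, Rinv_l; lra.
  - apply filterlim_at_left1. intros eps He.
    assert (C : continuous (fun t => Rpower t a * / a) 1).
    { apply (ex_derive_continuous (K := R_AbsRing) (V := R_NormedModule)). unfold Rpower. auto_derive. lra. }
    destruct (continuous_R_eps_inv _ _ C eps He) as (d & Hd & K). exists d; split; auto. intros x Hx.
    specialize (K x ltac:(apply Rabs_def1; lra)). cbv beta in K.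
    replace (Rpower 1 a) with 1 in K by (unfold Rpower; rewrite ln_1, Rmult_0_r, exp_0; auto). now rewrite Rmult_1_l in K.
Qed.

Lemma bint_antitone (a b b' v v' : R) : b <= b' -> bint (bdens a b) v -> bint (bdens a b') v' -> v' <= v.
Proof.
  intros Hb Hv Hv'. apply (bint_le (bdens a b') (bdens a b)); auto.
  intros x Hx. split; [left; apply bdens_pos|]. unfold bdens. apply Rmult_le_compat_l; [left; apply exp_pos|].
  unfold Rpower. apply exp_le_compat.
  assert (ln (1 - x) <= 0) by (rewrite <- ln_1; left; apply ln_increasing; lra). nra.
Qed.

Section BetaCoefficients.

Variables a b v : R.
Hypothesis (Ha : 0 < a) (Hb : 0 < b <= 1) (Hv : bint (bdens a b) v).

Lemma bint_pos : 0 < v.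
Proof.
  apply Rlt_le_trans with (/ a); [now apply Rinv_0_lt_compat|].
  apply (bint_antitone a b 1 v (/ a)); auto; [lra | now apply bint_1].
Qed.

Lemma bint_shift (n : nat) : bint (bdens a (b + INR n)) (v * (pochhammer b n / pochhammer (a + b) n)).
Proof.
  induction n as [|n IH].
  - simpl. replace (b + 0) with b by ring. now replace (v * (1 / 1)) with v by field.
  - rewrite S_INR. replace (b + (INR n + 1)) with (b + INR n + 1) by ring.
    assert (P := pos_INR n). assert (Q : 0 < pochhammer (a + b) n) by (apply pochhammer_pos; lra).
    apply bint_succ in IH; try lra. simpl.
    replace (v * (pochhammer b n * (b + INR n) / (pochhammer (a + b) n * (a + b + INR n))))
      with ((b + INR n) / (a + (b + INR n)) * (v * (pochhammer b n / pochhammer (a + b) n))); auto.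
    field. split; lra.
Qed.

Lemma bint_nat (n : nat) : bint (bdens a (1 + INR n)) (pochhammer 1 n / (pochhammer a n * (a + INR n))).
Proof.
  induction n as [|n IH].
  - simpl. replace (1 + 0) with 1 by ring. replace (1 / (1 * (a + 0))) with (/ a) by (field; lra). now apply bint_1.
  - rewrite S_INR. replace (1 + (INR n + 1)) with (1 + INR n + 1) by ring.
    assert (P := pos_INR n). assert (Q : 0 < pochhammer a n) by (apply pochhammer_pos; lra).
    apply bint_succ in IH; try lra. simpl.
    replace (pochhammer 1 n * (1 + INR n) / (pochhammer a n * (a + INR n) * (a + (INR n + 1))))
      with ((1 + INR n) / (a + (1 + INR n)) * (pochhammer 1 n / (pochhammer a n * (a + INR n)))); auto.
    field. repeat split; lra.
Qed.

(** With $N=n+1$, $v$ times the coefficient is $B(a,b+N)\,(a,N)/(1,N)$. As $N\le b+N\le1+N$,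
    monotonicity in the second argument places it between the explicit values from $B(a,1+N)$ and
    $B(a,N)$. *)
Lemma beta_coef_bounds (n : nat) :
  / (a + INR (S n)) <= v * hcoef a b (a + b) (S n) <= / INR (S n).
Proof.
  set (N := S n). assert (HN : 0 < INR N) by (apply lt_0_INR; unfold N; lia).
  assert (B1 := bint_shift N). assert (B2 := bint_nat N). assert (B3 := bint_nat n).
  assert (L1 := bint_antitone a (b + INR N) (1 + INR N) _ _ ltac:(lra) B1 B2).
  assert (L2 := bint_antitone a (1 + INR n) (b + INR N) _ _ ltac:(unfold N; rewrite S_INR; lra) B3 B1).
  assert (Pa : 0 < pochhammer a N) by (apply pochhammer_pos; lra).
  assert (Pa' : 0 < pochhammer a n) by (apply pochhammer_pos; lra).
  assert (P1 : 0 < pochhammer 1 N) by (apply pochhammer_pos; lra).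
  assert (P1' : 0 < pochhammer 1 n) by (apply pochhammer_pos; lra).
  assert (Pc : 0 < pochhammer (a + b) N) by (apply pochhammer_pos; lra).
  set (V := v * (pochhammer b N / pochhammer (a + b) N)) in *.
  assert (E : v * hcoef a b (a + b) N = V * (pochhammer a N / pochhammer 1 N)).
  { unfold V, hcoef. field. split; lra. }
  rewrite E. assert (R : 0 < pochhammer a N / pochhammer 1 N) by now apply Rdiv_lt_0_compat.
  split.
  - replace (/ (a + INR N)) with (pochhammer 1 N / (pochhammer a N * (a + INR N)) * (pochhammer a N / pochhammer 1 N)) by (field; lra).
    apply Rmult_le_compat_r; lra.
  - replace (/ INR N) with (pochhammer 1 n / (pochhammer a n * (a + INR n)) * (pochhammer a N / pochhammer 1 N)).
    + apply Rmult_le_compat_r; lra.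
    + unfold N. simpl pochhammer. assert (Q := pos_INR n). rewrite S_INR. field. repeat split; lra.
Qed.

End BetaCoefficients.

Definition lncoef (n : nat) : R := match n with O => 0 | S _ => / INR n end.

Lemma lncoef_bounds (n : nat) : 0 <= lncoef n <= 1.
Proof.
  destruct n as [|n]; unfold lncoef; [lra|]. assert (1 <= INR (S n)) by (rewrite S_INR; generalize (pos_INR n); lra).
  split; [left; apply Rinv_0_lt_compat; lra|]. rewrite <- Rinv_1. apply Rinv_le_contravar; lra.
Qed.

Lemma lncoef_radius (x : R) : Rabs x < 1 -> Rbar_lt (Rabs x) (CV_radius lncoef).
Proof.
  intros Hx. apply Rbar_lt_le_trans with (Finite 1); auto.
  apply CV_radius_bounded. exists 1. intros n. rewrite pow1, Rmult_1_r, Rabs_pos_eq; apply lncoef_bounds.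
Qed.

Lemma ln_series (x : R) : 0 <= x < 1 -> PSeries lncoef x = - ln (1 - x).
Proof.
  intros Hx. assert (D : forall t, 0 <= t <= x -> is_derive (fun t => PSeries lncoef t + ln (1 - t)) t 0).
  { intros t Ht. assert (At : Rabs t < 1) by (rewrite Rabs_pos_eq; lra).
    replace 0 with (PSeries (PS_derive lncoef) t + - / (1 - t)).
    - apply is_derive_Rplus; [now apply is_derive_PSeries, lncoef_radius|]. auto_derive; [lra|]. change (1 + - t) with (1 - t). field; lra.
    - assert (G := Series_geom t At).
      replace (PSeries (PS_derive lncoef) t) with (/ (1 - t)); [ring|]. rewrite <- G.
      apply Series_ext. intros n. unfold PS_derive, lncoef. field. rewrite S_INR. generalize (pos_INR n); lra. }
  destruct (Req_dec x 0) as [->|N]; [rewrite PSeries_0; simpl; rewrite Rminus_0_r, ln_1; ring|].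
  assert (E := constant_of_derive_0 (fun t => PSeries lncoef t + ln (1 - t)) 0 x ltac:(lra)
    ltac:(intros; apply D; lra) ltac:(intros t Ht; eapply derive_continuous, D, Ht)).
  cbv beta in E. rewrite PSeries_0, Rminus_0_r, ln_1 in E. simpl in E. lra.
Qed.

Lemma ex_series_radius (u : nat -> R) (x : R) : Rbar_lt (Rabs x) (CV_radius u) -> ex_series (fun n => u n * x ^ n).
Proof. intros H. now apply ex_pseries_R, CV_radius_inside. Qed.

(** Comparison with $-\ln(1-x)=\sum x^n/n$ coefficient by coefficient. The lower bound shifts the
    index by one, which is allowed by $a\le1$ and costs the first term $x\le1$. *)
Lemma hyp_log_bounds (a b v x : R) : 0 < a <= 1 -> 0 < b <= 1 -> bint (bdens a b) v -> 0 <= x < 1 ->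
  - ln (1 - x) - 1 <= v * (hypR a b (a + b) x - 1) <= - ln (1 - x).
Proof.
  intros Ha Hb Hv Hx. rewrite <- ln_series by auto.
  assert (Ax : Rabs x < 1) by (rewrite Rabs_pos_eq; lra).
  assert (Pv : 0 < v) by (apply (bint_pos a b); auto; lra).
  assert (S1 : ex_series (fun n => hcoef a b (a + b) n * x ^ n)) by (apply ex_series_radius, hcoef_radius; auto; nra).
  assert (S2 : ex_series (fun n => lncoef n * x ^ n)) by now apply ex_series_radius, lncoef_radius.
  assert (H0 : hcoef a b (a + b) 0 = 1) by (unfold hcoef; simpl; field).
  assert (S1' := proj1 (ex_series_incr_1 _) S1). assert (S2' := proj1 (ex_series_incr_1 _) S2).
  assert (E1 : hypR a b (a + b) x - 1 = Series (fun n => hcoef a b (a + b) (S n) * x ^ S n)).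
  { unfold hypR, PSeries. rewrite Series_incr_1 by auto. rewrite H0. simpl. ring. }
  assert (E2 : PSeries lncoef x = Series (fun n => lncoef (S n) * x ^ S n)).
  { unfold PSeries. rewrite Series_incr_1 by auto. simpl. ring. }
  assert (Xp : forall n, 0 <= x ^ n) by (intros; apply pow_le; lra).
  rewrite E1, <- Series_scal_l. split.
  - assert (E3 : PSeries lncoef x - x = Series (fun n => lncoef (S (S n)) * x ^ S (S n))).
    { rewrite E2, Series_incr_1 by auto. simpl. field. }
    apply Rle_trans with (PSeries lncoef x - x); [lra|]. rewrite E3.
    apply Series_le.
    + intros n. assert (P := pos_INR n). split.
      * apply Rmult_le_pos; auto. apply lncoef_bounds.
      * rewrite <- Rmult_assoc. apply Rmult_le_compat; auto.
        -- apply lncoef_bounds.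
        -- destruct (beta_coef_bounds a b v ltac:(lra) Hb Hv n) as [B _]. unfold lncoef.
           eapply Rle_trans; [|apply B]. apply Rinv_le_contravar; rewrite !S_INR; lra.
        -- simpl. assert (Q := Xp n). assert (0 <= x * x ^ n) by (apply Rmult_le_pos; lra). nra.
    + apply (ex_series_scal (K := R_AbsRing) (V := R_NormedModule)), S1'.
  - rewrite E2. apply Series_le; auto. intros n. split.
    + assert (0 < hcoef a b (a + b) (S n)) by (apply hcoef_pos; lra). apply Rmult_le_pos; [lra|]. apply Rmult_le_pos; [lra | apply Xp].
    + rewrite <- Rmult_assoc. apply Rmult_le_compat_r; auto. unfold lncoef. apply (beta_coef_bounds a b v ltac:(lra) Hb Hv n).
Qed.

Lemma asin_derive (x : R) : -1 < x < 1 -> is_derive asin x (/ sqrt (1 - x * x)).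
Proof.
  intros Hx. apply is_derive_Reals. rewrite <- Rsqr_def.
  replace (/ sqrt (1 - x²)) with (derive_pt asin x (derivable_pt_asin x Hx)) by (rewrite derive_pt_asin; field; apply Rgt_not_eq, sqrt_lt_R0; unfold Rsqr; nra).
  apply (derive_pt_eq_1 asin x _ (derivable_pt_asin x Hx)). reflexivity.
Qed.

Lemma asin_lim1 (eps : R) : 0 < eps -> exists d, 0 < d /\ forall x, 1 - d < x < 1 -> PI / 2 - eps < asin x < PI / 2.
Proof.
  intros He. assert (Pp := PI_RGT_0). set (e := Rmin eps 1). assert (He1 : 0 < e) by (apply Rmin_pos; lra).
  assert (P1 : 2 < PI) by (generalize PI2_1; lra).
  assert (He2 : e <= 1) by apply Rmin_r.
  assert (Hs : sin (PI / 2 - e) < 1).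
  { rewrite <- sin_PI2. apply sin_increasing_1; lra. }
  assert (Hs0 : 0 <= sin (PI / 2 - e)) by (apply sin_ge_0; lra).
  exists (1 - sin (PI / 2 - e)). split; [lra|]. intros x Hx.
  assert (Bx := asin_bound_lt x ltac:(lra)). split; [|lra].
  apply Rle_lt_trans with (PI / 2 - e); [generalize (Rmin_l eps 1); unfold e; lra|].
  apply sin_increasing_0; try lra. rewrite sin_asin; lra.
Qed.

(** The primitive is $\arcsin(2t-1)$. The value $\pi$ fixes the logarithmic growth of the elliptic
    integral. *)
Lemma bint_half : bint (bdens (1 / 2) (1 / 2)) PI.
Proof.
  replace PI with (PI / 2 - - (PI / 2)) by field.
  assert (G : forall t, 0 < t < 1 -> bdens (1 / 2) (1 / 2) t = 2 * / sqrt (1 - (2 * t - 1) * (2 * t - 1))).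
  { intros t Ht. unfold bdens.
    replace (1 - (2 * t - 1) * (2 * t - 1)) with (2 * 2 * (t * (1 - t))) by ring.
    rewrite sqrt_mult, sqrt_square, sqrt_mult by nra.
    replace (1 / 2 - 1) with (- / 2) by field. rewrite !Rpower_Ropp, !Rpower_sqrt by lra.
    field. split; apply Rgt_not_eq, sqrt_lt_R0; lra. }
  apply (bint_primitive (fun t => asin (2 * t - 1))).
  - intros t Ht. rewrite G by auto. apply (is_derive_Rcomp asin (fun t => 2 * t - 1)).
    + apply asin_derive; lra.
    + auto_derive; auto; ring.
  - intros t Ht. now apply bdens_cont.
  - apply filterlim_at_right0. intros eps He. destruct (asin_lim1 eps He) as (d & Hd & K).
    exists (Rmin (d / 2) (/ 2)). split; [apply Rmin_pos; lra|]. intros x Hx.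
    assert (x < d / 2) by (generalize (Rmin_l (d / 2) (/ 2)); lra). assert (x < / 2) by (generalize (Rmin_r (d / 2) (/ 2)); lra).
    specialize (K (- (2 * x - 1)) ltac:(lra)). rewrite asin_opp in K. apply Rabs_def1; lra.
  - apply filterlim_at_left1. intros eps He. destruct (asin_lim1 eps He) as (d & Hd & K).
    exists (d / 2). split; [lra|]. intros x Hx. specialize (K (2 * x - 1) ltac:(lra)). apply Rabs_def1; lra.
Qed.

Lemma incr_bounded_limit (f : R -> R) (M : R) :
  (forall x y, / 2 <= x <= y -> y < 1 -> f x <= f y) -> (forall x, / 2 <= x < 1 -> f x <= M) ->
  exists l, filterlim f (at_left 1) (locally l).
Proof.
  intros Hi HM. destruct (completeness (fun y => exists x, / 2 <= x < 1 /\ y = f x)) as [l [U L]].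
  - exists M. intros y (x & Hx & ->). auto.
  - exists (f (/ 2)), (/ 2). split; lra.
  - exists l. apply filterlim_at_left1. intros eps He.
    assert (E : exists x, / 2 <= x < 1 /\ l - eps < f x).
    { apply Classical_Prop.NNPP. intros N. assert (l <= l - eps); [|lra]. apply L. intros y (x & Hx & ->).
      destruct (Rle_lt_dec (f x) (l - eps)); auto. exfalso. apply N. now exists x. }
    destruct E as (x & Hx & Hl). exists (1 - x). split; [lra|]. intros y Hy.
    assert (f y <= l) by (apply U; exists y; split; auto; lra).
    assert (f x <= f y) by (apply Hi; lra). apply Rabs_def1; lra.
Qed.

Lemma incr_of_derive (f f' : R -> R) (x y : R) : x <= y ->
  (forall t, x <= t <= y -> is_derive f t (f' t)) -> (forall t, x <= t <= y -> 0 <= f' t) -> f x <= f y.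
Proof.
  intros Hxy Hd Hp. destruct (MVT_gen f x y f') as (c & Hc & E).
  - intros t Ht. rewrite Rmin_left, Rmax_right in Ht by lra. apply Hd; lra.
  - intros t Ht. rewrite Rmin_left, Rmax_right in Ht by lra. apply continuity_pt_filterlim. eapply derive_continuous, Hd, Ht.
  - rewrite Rmin_left, Rmax_right in Hc by lra. assert (0 <= f' c) by now apply Hp. nra.
Qed.

Definition bhalf (a b x : R) : R := RInt (bdens a b) (/ 2) x.

Lemma bhalf_half (a b : R) : bhalf a b (/ 2) = 0.
Proof. unfold bhalf. now rewrite RInt_point. Qed.

Lemma bhalf_derive (a b x : R) : 0 < x < 1 -> is_derive (bhalf a b) x (bdens a b x).
Proof.
  intros Hx. apply (is_derive_RInt (V := R_CompleteNormedModule) (bdens a b) _ (/ 2)).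
  - exists (mkposreal (Rmin x (1 - x)) ltac:(apply Rmin_pos; lra)). intros t Ht.
    destruct (Rabs_def2 _ _ Ht). unfold minus, plus, opp in *; simpl in *.
    apply RInt_correct. apply (ex_RInt_continuous (V := R_CompleteNormedModule)). intros z Hz. apply bdens_cont.
    generalize (Rmin_l x (1 - x)) (Rmin_r x (1 - x)). intros.
    destruct (Rle_dec (/ 2) t); [rewrite Rmin_left, Rmax_right in Hz by lra | rewrite Rmin_right, Rmax_left in Hz by lra]; lra.
  - now apply bdens_cont.
Qed.

(** On $[\frac12,1)$ the integrand is at most a constant times $(1-t)^{b-1}$, whose primitive is
    bounded, so the increasing integral has a limit. *)
Lemma bhalf_lim (a b : R) : 0 < a <= 1 -> 0 < b <= 1 -> exists l, filterlim (bhalf a b) (at_left 1) (locally l).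
Proof.
  intros Ha Hb. set (C := Rpower (/ 2) (a - 1)). assert (PC : 0 < C) by apply exp_pos.
  apply incr_bounded_limit with (C / b * Rpower (/ 2) b).
  - intros x y Hxy Hy. apply (incr_of_derive _ (bdens a b)); [lra| |]; intros t Ht; [apply bhalf_derive; lra | left; apply bdens_pos].
  - intros x Hx. set (g := fun t => - (bhalf a b t + C / b * Rpower (1 - t) b)).
    assert (G : g (/ 2) <= g x).
    { apply (incr_of_derive g (fun t => - (bdens a b t - C * Rpower (1 - t) (b - 1)))); [lra| |].
      - intros t Ht. apply (is_derive_opp (K := R_AbsRing) (V := R_NormedModule) (fun t => bhalf a b t + C / b * Rpower (1 - t) b)).
        replace (bdens a b t - C * Rpower (1 - t) (b - 1)) with (bdens a b t + - C * Rpower (1 - t) (b - 1)) by ring.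
        apply is_derive_Rplus; [apply bhalf_derive; lra|].
        assert (E2 : Rpower (1 - t) (b - 1) = Rpower (1 - t) b / (1 - t)).
        { unfold Rminus. rewrite Rpower_plus, Rpower_Ropp, Rpower_1 by lra. reflexivity. }
        rewrite E2. unfold Rpower. auto_derive; [lra|]. change (1 + - t) with (1 - t). field. lra.
      - intros t Ht. unfold bdens, C. assert (P : 0 < Rpower (1 - t) (b - 1)) by apply exp_pos.
        assert (Rpower t (a - 1) <= Rpower (/ 2) (a - 1)).
        { unfold Rpower. apply exp_le_compat. assert (ln (/ 2) <= ln t) by (destruct (Req_dec t (/ 2)) as [->|]; [lra | left; apply ln_increasing; lra]). nra. }
        nra. }
    unfold g in G. assert (Z : bhalf a b (/ 2) = 0) by apply bhalf_half. rewrite Z in G.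
    replace (1 - / 2) with (/ 2) in G by field.
    assert (0 < C / b * Rpower (1 - x) b) by (apply Rmult_lt_0_compat; [now apply Rdiv_lt_0_compat | apply exp_pos]). lra.
Qed.

(** The substitution $t\mapsto1-t$ reduces the end $0$ to the end $1$ with the exponents exchanged.
    No closed form of the value appears; it enters through [hyp_log_bounds]. *)
Lemma bint_exists (a b : R) : 0 < a <= 1 -> 0 < b <= 1 -> exists v, bint (bdens a b) v.
Proof.
  intros Ha Hb. destruct (bhalf_lim a b Ha Hb) as [l1 H1]. destruct (bhalf_lim b a Hb Ha) as [l0 H0].
  exists (l1 - - l0). apply (bint_primitive (bhalf a b)); auto.
  - intros x Hx. now apply bhalf_derive.
  - intros x Hx. now apply bdens_cont.
  - assert (Dd : forall x, 0 < x < 1 -> is_derive (fun x => bhalf a b x + bhalf b a (1 - x)) x 0).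
    { intros x Hx. replace 0 with (bdens a b x + - bdens b a (1 - x)).
      - apply is_derive_Rplus; [now apply bhalf_derive|]. apply is_derive_compl. apply bhalf_derive. lra.
      - unfold bdens. replace (1 - (1 - x)) with x by ring. ring. }
    assert (E : forall x, 0 < x < / 2 -> bhalf a b x = - bhalf b a (1 - x)).
    { intros x Hx. assert (X := constant_of_derive_0 _ x (/ 2) ltac:(lra) ltac:(intros; apply Dd; lra) ltac:(intros t Ht; eapply derive_continuous, Dd; lra)).
      cbv beta in X. replace (1 - / 2) with (/ 2) in X by field.
      assert (Z1 : bhalf a b (/ 2) = 0) by apply bhalf_half. assert (Z2 : bhalf b a (/ 2) = 0) by apply bhalf_half. lra. }
    apply filterlim_at_right0. intros eps He.
    destruct (proj1 (filterlim_locally _ _) H0 (mkposreal eps He)) as [d Hd].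
    exists (Rmin d (/ 2)). split; [apply Rmin_pos; [apply cond_pos | lra]|]. intros x Hx.
    assert (x < d) by (generalize (Rmin_l d (/ 2)); lra). assert (x < / 2) by (generalize (Rmin_r d (/ 2)); lra).
    rewrite E by lra. assert (K := Hd (1 - x)).
    assert (K1 : ball 1 d (1 - x)) by (apply Rabs_def1; unfold minus, plus, opp; simpl; lra).
    specialize (K K1 ltac:(lra)). change (Rabs (bhalf b a (1 - x) - l0) < eps) in K.
    replace (- bhalf b a (1 - x) - - l0) with (- (bhalf b a (1 - x) - l0)) by ring. now rewrite Rabs_Ropp.
Qed.

(** * The imaginary axis *)

Definition imag (t : R) : C := (0, t).

Lemma uhp_imag (t : R) : 0 < t -> upper_half_plane (imag t).
Proof. auto. Qed.

Lemma imag_double (t : R) : (2 * imag t)%C = imag (2 * t).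
Proof. unfold imag, Cmult, RtoC; simpl. f_equal; ring. Qed.

Definition rnome (t : R) : R := exp (- (PI * t)).

Lemma nome_imag (t : R) : nome (imag t) = RtoC (rnome t).
Proof.
  unfold nome, imag, rnome, Cexp, RtoC, Ci; simpl.
  replace ((PI * 0 - 0 * 1) * 0 - (PI * 1 + 0 * 0) * t) with (- (PI * t)) by ring.
  replace ((PI * 0 - 0 * 1) * t + (PI * 1 + 0 * 0) * 0) with 0 by ring.
  rewrite cos_0, sin_0. f_equal; ring.
Qed.

Lemma Im_CSeries_0 (u : nat -> C) : (forall n, Im (u n) = 0) -> Im (CSeries u) = 0.
Proof.
  intros H. unfold CSeries; simpl. rewrite (Series_ext _ (fun _ => 0)) by auto.
  apply is_series_unique. apply is_series_eps. intros e He; exists O; intros n _.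
  replace (sum_n (fun _ : nat => 0) n) with 0; [now rewrite Rminus_diag, Rabs_R0|].
  induction n; [now rewrite sum_O | rewrite sum_Sn, <- IHn; symmetry; apply Rplus_0_l].
Qed.

Lemma Im_pow_real (x : R) (n : nat) : Im (1 * RtoC x ^ n)%C = 0.
Proof. rewrite <- RtoC_pow. simpl. ring. Qed.

Lemma Im_qA_real (x : R) : Im (qA (RtoC x)) = 0.
Proof.
  unfold qA. change (Im (CSeries (fun n => 1 * RtoC x ^ (n * n))%C) + Im (CSeries (fun n => 1 * RtoC x ^ (S n * S n))%C) = 0).
  rewrite !Im_CSeries_0; [ring| |]; intros; apply Im_pow_real.
Qed.

Lemma Im_qB_real (x : R) : Im (qB (RtoC x)) = 0.
Proof. apply Im_CSeries_0. intros; apply Im_pow_real. Qed.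

Lemma real_of_Im (z : C) : Im z = 0 -> z = RtoC (Re z).
Proof. destruct z as [x y]; simpl. now intros ->. Qed.

Lemma thetas_imag (t : R) : 0 < t -> exists A B D : R, A <> 0 /\ B <> 0 /\ D <> 0 /\
  theta 0 0 (imag t) = RtoC A /\ theta 0 1 (imag t) = RtoC B /\ theta 1 0 (imag t) = RtoC D.
Proof.
  intros Ht. assert (U := uhp_imag t Ht).
  assert (E0 : theta 0 0 (imag t) = RtoC (Re (qA (RtoC (rnome t))))).
  { rewrite theta_00_nome, nome_imag by auto. apply real_of_Im, Im_qA_real. }
  assert (E1 : theta 0 1 (imag t) = RtoC (Re (qA (RtoC (- rnome t))))).
  { rewrite theta_01_nome, nome_imag, <- RtoC_opp by auto. apply real_of_Im, Im_qA_real. }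
  assert (E2 : theta 1 0 (imag t) = RtoC (2 * exp (- (PI * t / 4)) * Re (qB (RtoC (rnome t))))).
  { rewrite theta_10_nome, nome_imag by auto. rewrite (real_of_Im _ (Im_qB_real (rnome t))) at 1.
    rewrite !RtoC_mult. f_equal. f_equal. unfold qexp, imag, Cexp, RtoC, Ci; simpl.
    replace (((PI * 0 - 0 * 1) * (1 / 4) - (PI * 1 + 0 * 0) * 0) * 0 - ((PI * 0 - 0 * 1) * 0 + (PI * 1 + 0 * 0) * (1 / 4)) * t) with (- (PI * t / 4)) by field.
    replace (((PI * 0 - 0 * 1) * (1 / 4) - (PI * 1 + 0 * 0) * 0) * t + ((PI * 0 - 0 * 1) * 0 + (PI * 1 + 0 * 0) * (1 / 4)) * 0) with 0 by ring.
    rewrite cos_0, sin_0. f_equal; ring. }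
  assert (N : forall x z, z = RtoC x -> z <> RtoC 0 -> x <> 0) by (intros x z -> H ->; auto).
  do 3 eexists. repeat split; [| | | exact E0 | exact E1 | exact E2].
  - apply (N _ _ E0). now apply theta_00_neq0.
  - apply (N _ _ E1). now apply theta_01_neq0.
  - apply (N _ _ E2). now apply theta_10_neq0.
Qed.

Definition lam (t : R) : R := Re (lambda (imag t)).

Lemma RtoC_neq0 (x : R) : x <> 0 -> RtoC x <> RtoC 0.
Proof. intros H E. apply H. now apply RtoC_inj. Qed.

(** The witness $k=\vartheta_{01}^2/\vartheta_{00}^2$ is the positive square root of $1-\lambda$.
    The theta constants are real on the imaginary axis, so positivity selects the root that Landen's
    formula requires. *)
Lemma lam_spec (t : R) : 0 < t ->
  lambda (imag t) = RtoC (lam t) /\ 0 < lam t < 1 /\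
  exists A k, A <> 0 /\ 0 < k < 1 /\ k * k = 1 - lam t /\ theta 0 0 (imag t) = RtoC A /\
    lam (2 * t) = ((1 - k) / (1 + k)) ^ 2 /\
    forall A2, theta 0 0 (imag (2 * t)) = RtoC A2 -> A ^ 2 * (1 + k) = 2 * A2 ^ 2.
Proof.
  intros Ht. assert (U := uhp_imag t Ht).
  destruct (thetas_imag t Ht) as (A & B & D & NA & NB & ND & EA & EB & ED).
  assert (NA' := RtoC_neq0 _ NA).
  assert (NA4 := pow_nonzero A 4 NA). assert (NA2 := pow_nonzero A 2 NA).
  assert (El : lambda (imag t) = RtoC (D ^ 4 / A ^ 4)).
  { unfold lambda. rewrite EA, ED, RtoC_div, !RtoC_pow; auto. }
  assert (Elam : lam t = D ^ 4 / A ^ 4) by (unfold lam; now rewrite El).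
  assert (Ec : 1 - lam t = B ^ 4 / A ^ 4).
  { apply RtoC_inj. rewrite RtoC_minus, Elam, <- El, (lambda_compl _ U), EA, EB.
    rewrite RtoC_div, !RtoC_pow; auto. }
  assert (P4 : forall x, x <> 0 -> 0 < x ^ 4).
  { intros x Nx. replace (x ^ 4) with ((x * x) * (x * x)) by ring. assert (0 < x * x) by nra. nra. }
  assert (PA := P4 A NA). assert (PB := P4 B NB). assert (PD := P4 D ND).
  assert (L0 : 0 < lam t) by (rewrite Elam; now apply Rdiv_lt_0_compat).
  assert (L1 : 0 < 1 - lam t) by (rewrite Ec; now apply Rdiv_lt_0_compat).
  split; [now rewrite El, Elam|]. split; [lra|].
  set (k := B ^ 2 / A ^ 2). exists A, k.
  assert (Pk : 0 < k) by (apply Rdiv_lt_0_compat; apply pow2_gt_0; auto).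
  assert (Ek : k * k = 1 - lam t) by (rewrite Ec; unfold k; field; auto).
  assert (EkC : RtoC k = (theta 0 1 (imag t) ^ 2 / theta 0 0 (imag t) ^ 2)%C).
  { unfold k. rewrite EA, EB, RtoC_div, !RtoC_pow; auto. }
  destruct (lambda_double _ U _ EkC) as (D1 & D2 & D3). rewrite imag_double in D2, D3.
  repeat split; auto; try nra.
  - unfold lam. rewrite D2.
    replace (((1 - RtoC k) / (1 + RtoC k)) ^ 2)%C with (RtoC (((1 - k) / (1 + k)) ^ 2)); auto.
    rewrite RtoC_pow, RtoC_div, RtoC_minus, RtoC_plus by lra. reflexivity.
  - intros A2 E2. rewrite EA, E2 in D3. apply RtoC_inj.
    rewrite !RtoC_mult, RtoC_plus, !RtoC_pow. exact D3.
Qed.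

(** Landen's formula twice: at $(1-k)/(1+k)$, whose square is $\lambda(2it)$, for the first
    relation, and at $k$, whose square is $1-\lambda(it)$, for the second. *)
Lemma landen_lam (t : R) : 0 < t -> exists A A2 k, A <> 0 /\ A2 <> 0 /\ 0 < k < 1 /\
  theta 0 0 (imag t) = RtoC A /\ theta 0 0 (imag (2 * t)) = RtoC A2 /\ A ^ 2 * (1 + k) = 2 * A2 ^ 2 /\
  ellK (lam t) * (1 + k) = 2 * ellK (lam (2 * t)) /\
  ellK (1 - lam (2 * t)) = (1 + k) * ellK (1 - lam t).
Proof.
  intros Ht. destruct (lam_spec t Ht) as (_ & L & A & k & NA & Hk & Ek & EA & E2 & HA).
  destruct (thetas_imag (2 * t) ltac:(lra)) as (A2 & _ & _ & NA2 & _ & _ & EA2 & _).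
  exists A, A2, k. repeat split; auto; try lra.
  - set (x := (1 - k) / (1 + k)) in *.
    assert (Hx : 0 <= x < 1).
    { unfold x. split; [apply Rmult_le_pos; [lra|]; left; apply Rinv_0_lt_compat; lra|].
      apply Rmult_lt_reg_r with (1 + k); [lra|]. unfold Rdiv; rewrite Rmult_assoc, Rinv_l; lra. }
    assert (La := landen x Hx). rewrite <- E2 in La.
    replace (4 * x / (1 + x) ^ 2) with (lam t) in La.
    + rewrite La. unfold x. field. lra.
    + replace (lam t) with (1 - k * k) by lra. unfold x. field. lra.
  - assert (La := landen k ltac:(lra)). replace (k ^ 2) with (1 - lam t) in La by (rewrite <- Ek; ring).
    rewrite <- La. f_equal. rewrite E2. field. lra.
Qed.

(** The quotient $\lambda/(16q)$ tends to $1$ at the cusp; between $\frac12$ and $\frac32$ it yields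
    the constants $8$ and $24$. *)
Lemma lam_asymptotic : exists T, 0 < T /\ forall t, T <= t -> 8 * rnome t <= lam t <= 24 * rnome t.
Proof.
  assert (H := holo_ccont _ _ holo_qlambda_0 (/ 2) ltac:(lra)). destruct H as (d & Hd & K).
  cbv beta in K. rewrite qA_0, qB_0, !Cpow_1_l in K.
  replace (1 / 1)%C with (RtoC 1) in K by field.
  set (T := Rmax 1 (- ln d / PI + 1)). assert (Pp := PI_RGT_0).
  exists T. assert (HT : 1 <= T) by apply Rmax_l. split; [lra|]. intros t Ht.
  assert (U := uhp_imag t ltac:(lra)). destruct (lam_spec t ltac:(lra)) as (El & _).
  rewrite (lambda_qlambda _ U), nome_imag in El. unfold qlambda in El.
  assert (Pq : 0 < rnome t) by apply exp_pos.
  assert (Hq : (Cmod (RtoC (rnome t) - 0) < d)%R).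
  { replace (RtoC (rnome t) - 0)%C with (RtoC (rnome t)) by ring. rewrite Cmod_R, Rabs_pos_eq by lra.
    rewrite <- (exp_ln d Hd). unfold rnome. apply exp_increasing.
    assert (- ln d / PI < t) by (generalize (Rmax_r 1 (- ln d / PI + 1)); unfold T in Ht; lra).
    assert (- ln d / PI * PI < t * PI) by (apply Rmult_lt_compat_r; lra).
    replace (- ln d / PI * PI) with (- ln d) in H0 by (field; lra). lra. }
  specialize (K _ Hq). set (g := (qB (RtoC (rnome t)) ^ 4 / qA (RtoC (rnome t)) ^ 4)%C) in *.
  assert (Eg : g = RtoC (lam t / (16 * rnome t))).
  { rewrite RtoC_div by lra. rewrite <- El, RtoC_mult. field. repeat split; apply RtoC_neq0; lra. }
  rewrite Eg, <- RtoC_minus, Cmod_R in K. apply Rabs_def2 in K.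
  assert (E : lam t = lam t / (16 * rnome t) * (16 * rnome t)) by (field; lra).
  split; rewrite E.
  - assert (/ 2 * (16 * rnome t) <= lam t / (16 * rnome t) * (16 * rnome t)) by (apply Rmult_le_compat_r; lra). lra.
  - assert (lam t / (16 * rnome t) * (16 * rnome t) <= 3 / 2 * (16 * rnome t)) by (apply Rmult_le_compat_r; lra). lra.
Qed.

Lemma ln_lam_bounds : exists T, 0 < T /\ forall t, T <= t -> lam t < / 2 /\ PI * t - 24 <= - ln (lam t) <= PI * t.
Proof.
  destruct lam_asymptotic as (T & HT & K). assert (Pp := PI_RGT_0).
  exists (Rmax T 2). split; [generalize (Rmax_l T 2); lra|]. intros t Ht.
  assert (T <= t) by (generalize (Rmax_l T 2); lra). assert (2 <= t) by (generalize (Rmax_r T 2); lra).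
  destruct (K t ltac:(lra)) as [K1 K2]. assert (Pq : 0 < rnome t) by apply exp_pos.
  assert (P4 : 3 < PI) by (generalize PI2_3_2; lra).
  (* For $t\ge2$ the nome is at most $e^{-6}\le2^{-6}$, and $24/64<\frac12$. *)
  assert (Q : rnome t <= / 64).
  { unfold rnome. rewrite exp_Ropp. apply Rinv_le_contravar; [lra|].
    apply Rle_trans with (exp 6); [|apply exp_le_compat; nra].
    replace 6 with (INR 6 * 1) by (simpl; ring). rewrite exp_INR_mult.
    apply Rle_trans with (2 ^ 6); [simpl; lra|]. apply pow_incr. generalize (exp_ineq1 1 ltac:(lra)); lra. }
  assert (Pl : 0 < lam t) by lra.
  split; [lra|]. split.
  - assert (ln (lam t) <= ln (24 * rnome t)) by (apply ln_le; lra).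
    rewrite ln_mult in H1 by lra. unfold rnome in H1. rewrite ln_exp in H1.
    assert (ln 24 < 24) by (rewrite <- (ln_exp 24) at 2; apply ln_increasing; [lra | generalize (exp_ineq1 24 ltac:(lra)); lra]). lra.
  - assert (ln (8 * rnome t) <= ln (lam t)) by (apply ln_le; lra).
    rewrite ln_mult in H1 by lra. unfold rnome in H1. rewrite ln_exp in H1.
    assert (0 < ln 8) by (rewrite <- ln_1; apply ln_increasing; lra). lra.
Qed.

(** Along $t,2t,4t,\dots$ the function is constant and also converges to [l]. This turns doubling
    formulas and behaviour at the cusp into exact identities. *)
Lemma dyadic_limit (f : R -> R) (t l : R) : 0 < t ->
  (forall s, 0 < s -> f (2 * s) = f s) ->
  (forall eps, 0 < eps -> exists T, forall s, T <= s -> Rabs (f s - l) <= eps) -> f t = l.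
Proof.
  intros Ht Hd Hl. apply Rminus_diag_uniq. apply NNPP. intros N.
  assert (P : 0 < Rabs (f t - l)) by now apply Rabs_pos_lt.
  destruct (Hl (Rabs (f t - l) / 2) ltac:(lra)) as [T K].
  assert (E : forall n, f (2 ^ n * t) = f t).
  { induction n as [|n IH]; [simpl; now rewrite Rmult_1_l|].
    simpl. rewrite Rmult_assoc, Hd; auto. apply Rmult_lt_0_compat; auto. apply pow_lt; lra. }
  destruct (Pow_x_infinity 2 ltac:(rewrite Rabs_pos_eq; lra) (Rmax T 0 / t)) as [M HM].
  specialize (HM M (le_n M)). rewrite Rabs_pos_eq in HM by (apply pow_le; lra).
  assert (T <= 2 ^ M * t).
  { apply Rle_trans with (Rmax T 0); [apply Rmax_l|].
    replace (Rmax T 0) with (Rmax T 0 / t * t) by (field; lra). apply Rmult_le_compat_r; lra. }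
  specialize (K _ H). rewrite E in K. lra.
Qed.

Lemma ellK_lam_near_1 (eps : R) : 0 < eps -> exists T, 0 < T /\ forall t, T <= t -> 1 <= ellK (lam t) <= 1 + eps.
Proof.
  intros He. destruct (continuous_R_eps_inv ellK 0 (ellK_cont 0 ltac:(rewrite Rabs_R0; lra)) eps He) as (d & Hd & K).
  destruct lam_asymptotic as (T & HT & L). assert (Pp := PI_RGT_0).
  set (T' := Rmax T (- ln (d / 24) / PI + 1)). exists T'.
  assert (T <= T') by apply Rmax_l. split; [lra|]. intros t Ht.
  destruct (L t ltac:(lra)) as [_ L2]. destruct (lam_spec t ltac:(lra)) as (_ & L3 & _).
  assert (Hq : rnome t < d / 24).
  { rewrite <- (exp_ln (d / 24)) by lra. unfold rnome. apply exp_increasing.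
    assert (- ln (d / 24) / PI < t) by (generalize (Rmax_r T (- ln (d / 24) / PI + 1)); unfold T' in Ht; lra).
    assert (- ln (d / 24) / PI * PI < t * PI) by (apply Rmult_lt_compat_r; lra).
    replace (- ln (d / 24) / PI * PI) with (- ln (d / 24)) in H1 by (field; lra). lra. }
  specialize (K (lam t) ltac:(rewrite Rminus_0_r, Rabs_pos_eq; lra)).
  rewrite ellK_0 in K. apply Rabs_def2 in K. split; [apply ellK_ge_1|]; lra.
Qed.

(** The growth is $-\frac1\pi\ln\lambda$ with $\lambda$ of the order of $e^{-\pi t}$; the two
    factors $\pi$ cancel, so the slope in $t$ is exactly $1$. *)
Lemma ellK_compl_asymptotic : exists C T, 0 < C /\ 0 < T /\ forall t, T <= t -> Rabs (ellK (1 - lam t) - t) <= C.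
Proof.
  destruct ln_lam_bounds as (T & HT & K). assert (Pp := PI_RGT_0).
  exists (26 / PI + 1), T. split; [assert (0 < 26 / PI) by (apply Rdiv_lt_0_compat; lra); lra|]. split; auto. intros t Ht.
  destruct (K t Ht) as [L1 L2]. destruct (lam_spec t ltac:(lra)) as (_ & L3 & _).
  assert (B := hyp_log_bounds (1 / 2) (1 / 2) PI (1 - lam t) ltac:(lra) ltac:(lra) bint_half ltac:(lra)).
  replace (1 / 2 + 1 / 2) with 1 in B by field. fold (ellK (1 - lam t)) in B.
  replace (1 - (1 - lam t)) with (lam t) in B by ring.
  set (y := ellK (1 - lam t)) in *.
  assert (D : 26 / PI * PI = 26) by (field; lra).
  apply Rabs_le. split; apply Rmult_le_reg_r with PI; auto; nra.
Qed.

(** The quotient of the two sides is invariant under doubling by [landen_lam] and tends to $1$. *)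
Theorem period_ratio (t : R) : 0 < t -> ellK (1 - lam t) = t * ellK (lam t).
Proof.
  intros Ht.
  assert (E : ellK (1 - lam t) / (t * ellK (lam t)) = 1).
  { apply (dyadic_limit (fun t => ellK (1 - lam t) / (t * ellK (lam t)))); auto.
    - intros s Hs. destruct (landen_lam s Hs) as (A & A2 & k & _ & _ & Hk & _ & _ & _ & L1 & L2).
      destruct (lam_spec s Hs) as (_ & Hl & _). assert (1 <= ellK (lam s)) by (apply ellK_ge_1; lra).
      rewrite L2. replace (ellK (lam (2 * s))) with (ellK (lam s) * (1 + k) / 2) by lra. field. repeat split; lra.
    - intros eps He. destruct ellK_compl_asymptotic as (M & T1 & HM & HT1 & K1).
      destruct (ellK_lam_near_1 (Rmin (eps / 2) 1) ltac:(apply Rmin_pos; lra)) as (T2 & HT2 & K2).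
      set (T := Rmax (Rmax T1 T2) (2 * M / eps)).
      exists T. intros s Hs.
      assert (T1 <= s) by (unfold T in Hs; generalize (Rmax_l (Rmax T1 T2) (2 * M / eps)) (Rmax_l T1 T2); lra).
      assert (T2 <= s) by (unfold T in Hs; generalize (Rmax_l (Rmax T1 T2) (2 * M / eps)) (Rmax_r T1 T2); lra).
      assert (2 * M / eps <= s) by (unfold T in Hs; generalize (Rmax_r (Rmax T1 T2) (2 * M / eps)); lra).
      specialize (K1 s H). specialize (K2 s H0).
      assert (2 * M <= eps * s).
      { replace (2 * M) with (eps * (2 * M / eps)) by (field; lra). apply Rmult_le_compat_l; lra. }
      set (y := ellK (1 - lam s)) in *. set (x := ellK (lam s)) in *.
      assert (Hx : x <= 1 + eps / 2) by (generalize (Rmin_l (eps / 2) 1); lra).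
      apply Rabs_le_between in K1.
      assert (Psx : 0 < s * x) by (apply Rmult_lt_0_compat; lra).
      assert (s * x <= s * (1 + eps / 2)) by (apply Rmult_le_compat_l; lra).
      assert (s * 1 <= s * x) by (apply Rmult_le_compat_l; lra).
      apply Rabs_le. split; apply Rmult_le_reg_r with (s * x); auto;
        replace ((y / (s * x) - 1) * (s * x)) with (y - s * x) by (field; split; lra).
      + assert (eps * s <= eps * (s * x)) by (apply Rmult_le_compat_l; lra). lra.
      + assert (eps * s <= eps * (s * x)) by (apply Rmult_le_compat_l; lra). lra. }
  destruct (lam_spec t Ht) as (_ & Hl & _). assert (1 <= ellK (lam t)) by (apply ellK_ge_1; lra).
  apply (f_equal (fun x => x * (t * ellK (lam t)))) in E. rewrite Rmult_1_l in E. rewrite <- E. field. split; lra.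
Qed.

(** Under doubling both sides acquire the same factor $(1+k)/2$, and both tend to $1$ at the
    cusp. *)
Theorem theta_00_sqr_ellK (t : R) : 0 < t -> (theta 0 0 (imag t) ^ 2)%C = RtoC (ellK (lam t)).
Proof.
  intros Ht.
  assert (R2 : forall s, 0 < s -> exists A, A <> 0 /\ theta 0 0 (imag s) = RtoC A).
  { intros s Hs. destruct (thetas_imag s Hs) as (A & _ & _ & N & _ & _ & E & _). eauto. }
  assert (E : ellK (lam t) / (Re (theta 0 0 (imag t))) ^ 2 = 1).
  { apply (dyadic_limit (fun t => ellK (lam t) / (Re (theta 0 0 (imag t))) ^ 2)); auto.
    - intros s Hs. destruct (landen_lam s Hs) as (A & A2 & k & NA & NA2 & Hk & EA & EA2 & H1 & H2 & _).
      rewrite EA, EA2. simpl Re.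
      replace (ellK (lam (2 * s))) with (ellK (lam s) * (1 + k) / 2) by lra.
      assert (E2 : A2 ^ 2 = A ^ 2 * (1 + k) / 2) by lra.
      rewrite E2. field. repeat split; auto; lra.
    - intros eps He.
      assert (Hc : forall e, 0 < e -> exists T, 0 < T /\ forall s, T <= s -> Rabs (Re (theta 0 0 (imag s)) ^ 2 - 1) < e).
      { intros e Hep.
        assert (C0 : ccont (fun q => qA q ^ 2)%C 0) by (apply holo_ccont; apply (holo_pow qA); apply holo_qA; rewrite Cmod_0; lra).
        destruct (C0 e Hep) as (d & Hd & K). cbv beta in K. rewrite qA_0, Cpow_1_l in K. assert (Pp := PI_RGT_0).
        exists (Rmax 1 (- ln d / PI + 1)). split; [generalize (Rmax_l 1 (- ln d / PI + 1)); lra|]. intros s Hs.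
        assert (1 <= s) by (generalize (Rmax_l 1 (- ln d / PI + 1)); lra).
        assert (- ln d / PI < s) by (generalize (Rmax_r 1 (- ln d / PI + 1)); lra).
        destruct (R2 s ltac:(lra)) as (A & _ & EA). rewrite EA. simpl Re.
        rewrite theta_00_nome, nome_imag in EA by (apply uhp_imag; lra).
        assert (Hq : (Cmod (RtoC (rnome s) - 0) < d)%R).
        { replace (RtoC (rnome s) - 0)%C with (RtoC (rnome s)) by ring. rewrite Cmod_R, Rabs_pos_eq by (left; apply exp_pos).
          rewrite <- (exp_ln d Hd). unfold rnome. apply exp_increasing.
          assert (- ln d / PI * PI < s * PI) by (apply Rmult_lt_compat_r; lra).
          replace (- ln d / PI * PI) with (- ln d) in H1 by (field; lra). lra. }
        specialize (K _ Hq). rewrite EA, <- RtoC_pow, <- RtoC_minus, Cmod_R in K. exact K. }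
      destruct (Hc (Rmin (/ 2) (eps / 4)) ltac:(apply Rmin_pos; lra)) as (T1 & HT1 & K1).
      destruct (ellK_lam_near_1 (eps / 4) ltac:(lra)) as (T2 & HT2 & K2).
      exists (Rmax T1 T2). intros s Hs.
      assert (T1 <= s) by (generalize (Rmax_l T1 T2); lra). assert (T2 <= s) by (generalize (Rmax_r T1 T2); lra).
      specialize (K1 s H). specialize (K2 s H0). set (x := ellK (lam s)) in *. set (y := Re (theta 0 0 (imag s)) ^ 2) in *.
      apply Rabs_def2 in K1. assert (M1 := Rmin_l (/ 2) (eps / 4)). assert (M2 := Rmin_r (/ 2) (eps / 4)).
      assert (Py : / 2 < y) by lra.
      apply Rabs_le. split; apply Rmult_le_reg_r with y; try lra; replace ((x / y - 1) * y) with (x - y) by (field; lra); nra. }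
  destruct (R2 t Ht) as (A & NA & EA). rewrite EA in *. simpl Re in E.
  rewrite <- RtoC_pow. f_equal. apply (f_equal (fun x => x * A ^ 2)) in E. rewrite Rmult_1_l in E. rewrite <- E. field. auto.
Qed.

Lemma wronskian_const : exists c0 : R, forall x, 0 < x < 1 ->
  is_derive (fun x => ellK (1 - x) / ellK x) x (c0 / (x * (1 - x) * (ellK x) ^ 2)).
Proof.
  set (W := fun x => (x * (1 - x) * - ellK1 (1 - x)) * ellK x - ellK (1 - x) * (x * (1 - x) * ellK1 x)).
  assert (A1 : forall x, 0 < x < 1 -> Rabs x < 1) by (intros; rewrite Rabs_pos_eq; lra).
  assert (A2 : forall x, 0 < x < 1 -> Rabs (1 - x) < 1) by (intros; rewrite Rabs_pos_eq; lra).
  assert (Dc : forall x, 0 < x < 1 -> is_derive (fun x => ellK (1 - x)) x (- ellK1 (1 - x))).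
  { intros x Hx. apply is_derive_compl, ellK_derive, A2, Hx. }
  assert (DW : forall x, 0 < x < 1 -> is_derive W x 0).
  { intros x Hx. eapply is_derive_value.
    - apply (is_derive_minus (K := R_AbsRing) (V := R_NormedModule) (fun x => (x * (1 - x) * - ellK1 (1 - x)) * ellK x) (fun x => ellK (1 - x) * (x * (1 - x) * ellK1 x))).
      + apply (is_derive_Rmult (fun x => x * (1 - x) * - ellK1 (1 - x)) ellK); [apply ellK_compl_selfadj; auto | apply ellK_derive; auto].
      + apply (is_derive_Rmult (fun x => ellK (1 - x)) (fun x => x * (1 - x) * ellK1 x)); [apply Dc; auto | apply ellK_selfadj; auto].
    - unfold minus, plus, opp; simpl. ring. }
  exists (W (/ 2)). intros x Hx.
  assert (E : W x = W (/ 2)).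
  { destruct (Rtotal_order x (/ 2)) as [L|[->|L]]; auto.
    - apply constant_of_derive_0; auto; intros; [apply DW; lra | eapply derive_continuous, DW; lra].
    - symmetry. apply constant_of_derive_0; auto; intros; [apply DW; lra | eapply derive_continuous, DW; lra]. }
  rewrite <- E. assert (P := ellK_ge_1 x ltac:(lra)).
  replace (W x / (x * (1 - x) * ellK x ^ 2)) with ((- ellK1 (1 - x) * ellK x - ellK (1 - x) * ellK1 x) / (ellK x) ^ 2).
  - apply (is_derive_div (fun x => ellK (1 - x)) ellK); [apply Dc; auto | apply ellK_derive; auto | lra].
  - unfold W. field. repeat split; lra.
Qed.

Definition modratio (x : R) : R := ellK (1 - x) / ellK x.

Lemma modratio_lam (t : R) : 0 < t -> modratio (lam t) = t.
Proof.
  intros Ht. unfold modratio. destruct (lam_spec t Ht) as (_ & L & _).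
  rewrite period_ratio by auto. field. generalize (ellK_ge_1 (lam t)); lra.
Qed.

(** If the Wronskian constant were zero, [modratio] would be constant, but it takes the values $1$
    and $2$ at [lam 1] and [lam 2]. *)
Lemma modratio_derive : exists c0 : R, c0 <> 0 /\ forall x, 0 < x < 1 ->
  is_derive modratio x (c0 / (x * (1 - x) * (ellK x) ^ 2)).
Proof.
  destruct wronskian_const as [c0 H]. exists c0. split; auto. intros ->.
  destruct (lam_spec 1 ltac:(lra)) as (_ & L1 & _). destruct (lam_spec 2 ltac:(lra)) as (_ & L2 & _).
  assert (D : forall x, 0 < x < 1 -> is_derive modratio x 0).
  { intros x Hx. replace 0 with (0 / (x * (1 - x) * ellK x ^ 2)) by (unfold Rdiv; ring). now apply H. }
  assert (C : forall x y, 0 < x < 1 -> 0 < y < 1 -> x < y -> modratio x = modratio y).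
  { intros x y Hx Hy Hxy. apply constant_of_derive_0; auto; intros; [apply D; lra | eapply derive_continuous, D; lra]. }
  assert (E1 := modratio_lam 1 ltac:(lra)). assert (E2 := modratio_lam 2 ltac:(lra)).
  destruct (Rtotal_order (lam 1) (lam 2)) as [X|[X|X]].
  - rewrite (C _ _ L1 L2 X) in E1. lra.
  - rewrite X in E1. lra.
  - rewrite (C _ _ L2 L1 X) in E2. lra.
Qed.

Lemma modratio_inj (x y : R) : 0 < x < 1 -> 0 < y < 1 -> modratio x = modratio y -> x = y.
Proof.
  destruct modratio_derive as (c0 & Hc & D).
  assert (C : forall x y, 0 < x < 1 -> 0 < y < 1 -> x < y -> modratio x <> modratio y).
  { clear x y. intros x y Hx Hy Hxy E.
    destruct (MVT_gen modratio x y (fun x => c0 / (x * (1 - x) * (ellK x) ^ 2))) as (z & Hz & M).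
    - intros t Ht. rewrite Rmin_left, Rmax_right in Ht by lra. apply D; lra.
    - intros t Ht. rewrite Rmin_left, Rmax_right in Ht by lra. apply continuity_pt_filterlim. eapply derive_continuous, D; lra.
    - rewrite Rmin_left, Rmax_right in Hz by lra. rewrite E, Rminus_diag in M. symmetry in M.
      apply Rmult_integral in M. destruct M as [M|M]; [|lra].
      assert (P := ellK_ge_1 z ltac:(lra)). revert M. apply Rmult_integral_contrapositive_currified; auto.
      apply Rinv_neq_0_compat, Rgt_not_eq. repeat apply Rmult_lt_0_compat; try lra. }
  intros Hx Hy E. destruct (Rtotal_order x y) as [X|[X|X]]; auto; exfalso.
  - now apply (C x y).
  - now apply (C y x).
Qed.

(** Both sides have the same image $1/t$ under the injective function [modratio]. This is the source
    of the inversion formula for $\lambda$. *)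
Lemma lam_inv (t : R) : 0 < t -> lam (/ t) = 1 - lam t.
Proof.
  intros Ht. assert (Hi := Rinv_0_lt_compat t Ht).
  destruct (lam_spec t Ht) as (_ & L1 & _). destruct (lam_spec (/ t) Hi) as (_ & L2 & _).
  apply modratio_inj; try lra. rewrite modratio_lam by auto.
  unfold modratio. replace (1 - (1 - lam t)) with (lam t) by ring. rewrite period_ratio by auto.
  assert (1 <= ellK (lam t)) by (apply ellK_ge_1; lra). field. split; lra.
Qed.

(** If $\lambda\ge\frac12$, monotonicity gives $K(1-\lambda)\le K(\lambda)$, against the ratio
    $t>1$. *)
Lemma lam_lt_half (t : R) : 1 < t -> lam t < / 2.
Proof.
  intros Ht. destruct (lam_spec t ltac:(lra)) as (_ & L & _).
  destruct (Rlt_le_dec (lam t) (/ 2)) as [|G]; auto. exfalso.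
  assert (P := period_ratio t ltac:(lra)).
  assert (ellK (1 - lam t) <= ellK (lam t)) by (apply ellK_incr; lra).
  assert (1 <= ellK (lam t)) by (apply ellK_ge_1; lra). nra.
Qed.

(** One has $z=x^2r$ with $1\le r\le16$: on the interval $1-x+x^2$ lies in $[\frac34,1]$, and
    $\frac{27}4/(\frac34)^3=16$. *)
Lemma zof_ln_bounds (x : R) : 0 < x < / 2 -> - 2 * ln x - 16 <= - ln (zof x) <= - 2 * ln x.
Proof.
  intros Hx. assert (P := quadP_pos x). assert (P1 : quadP x <= 1) by (unfold quadP; assert (0 <= x * (1 - x)) by (apply Rmult_le_pos; lra); lra).
  assert (P2 : 3 / 4 <= quadP x) by (unfold quadP; generalize (Rle_0_sqr (x - / 2)); unfold Rsqr; lra).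
  set (r := 27 / 4 * ((1 - x) * (1 - x)) / (quadP x * quadP x * quadP x)).
  assert (Pp : 0 < quadP x * quadP x * quadP x) by (repeat apply Rmult_lt_0_compat; auto).
  assert (E : zof x = x * x * r) by (unfold zof, r; field; lra).
  assert (Pc : quadP x * quadP x * quadP x <= 1).
  { assert (quadP x * quadP x <= 1) by nra. nra. }
  assert (Pd : 27 / 64 <= quadP x * quadP x * quadP x).
  { assert (9 / 16 <= quadP x * quadP x) by nra. nra. }
  assert (Q1 : / 4 <= (1 - x) * (1 - x) <= 1) by nra.
  assert (R1 : 1 <= r).
  { unfold r. apply Rmult_le_reg_r with (quadP x * quadP x * quadP x); auto.
    replace (27 / 4 * ((1 - x) * (1 - x)) / (quadP x * quadP x * quadP x) * (quadP x * quadP x * quadP x)) with (27 / 4 * ((1 - x) * (1 - x))) by (field; lra). lra. }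
  assert (R2 : r <= 16).
  { unfold r. apply Rmult_le_reg_r with (quadP x * quadP x * quadP x); auto.
    replace (27 / 4 * ((1 - x) * (1 - x)) / (quadP x * quadP x * quadP x) * (quadP x * quadP x * quadP x)) with (27 / 4 * ((1 - x) * (1 - x))) by (field; lra). lra. }
  assert (Px : 0 < x * x) by nra.
  rewrite E, ln_mult, ln_mult by lra.
  assert (0 <= ln r) by (rewrite <- ln_1; apply ln_le; lra).
  assert (ln r <= 16).
  { rewrite <- (ln_exp 16). apply ln_le; [lra|]. generalize (exp_ineq1 16 ltac:(lra)); lra. }
  lra.
Qed.

(** Division of the two pull-backs and [period_ratio] give $F_2=c(1+t)F_1$. The beta value $B$
    satisfies $Bc=2\pi$, because $B F_2(1-z)$ grows like $-\ln z$, hence like $-2\ln\lambda$, hence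
    like $2\pi t$. *)
Theorem hyp_ratio_imag (t : R) : 1 < t ->
  beta (1 / 12) (5 / 12) * F2 (1 - zof (lam t)) = 2 * PI * (1 + t) * F1 (zof (lam t)).
Proof.
  destruct F2_pullback as [c Hc].
  destruct (bint_exists (1 / 12) (5 / 12) ltac:(lra) ltac:(lra)) as [B HB].
  rewrite (beta_bint _ _ _ HB). assert (PB := bint_pos (1 / 12) (5 / 12) B ltac:(lra) ltac:(lra) HB).
  assert (Pp := PI_RGT_0).
  assert (Ht : forall t, 1 < t -> F2 (1 - zof (lam t)) = c * (1 + t) * F1 (zof (lam t))).
  { clear t. intros t Ht. assert (L1 := lam_lt_half t Ht). destruct (lam_spec t ltac:(lra)) as (_ & L & _).
    assert (E1 := F1_pullback (lam t) ltac:(lra)). assert (E2 := Hc (lam t) ltac:(lra)).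
    rewrite period_ratio in E2 by lra. rewrite <- E1 in E2. assert (Pw := weightE_pos (lam t)).
    apply Rmult_eq_reg_l with (weightE (lam t)); [|lra]. rewrite E2. ring. }
  intros Ht1. rewrite Ht by auto.
  assert (Ec : B * c = 2 * PI).
  { (* both sides are the growth rate of [B F2(1 - z)] along the imaginary axis *)
    apply NNPP. intros N.
    destruct ln_lam_bounds as (T & HT & KT).
    (* The constant is $65=1+16+2\cdot24$, from [hyp_log_bounds], [zof_ln_bounds] and
       [ln_lam_bounds]. *)
    assert (Hb : forall t, 1 < t -> T <= t -> Rabs (B * F2 (1 - zof (lam t)) - 2 * PI * t) <= B + 65).
    { clear t Ht1. intros t Ht1 Ht2. destruct (KT t Ht2) as (G1 & G2). destruct (lam_spec t ltac:(lra)) as (_ & L & _).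
      destruct (zof_range (lam t) ltac:(lra)) as [Z1 Z2].
      assert (Lg := hyp_log_bounds (1 / 12) (5 / 12) B (1 - zof (lam t)) ltac:(lra) ltac:(lra) HB ltac:(lra)).
      replace (1 / 12 + 5 / 12) with (1 / 2) in Lg by field. fold (F2 (1 - zof (lam t))) in Lg.
      replace (1 - (1 - zof (lam t))) with (zof (lam t)) in Lg by ring.
      assert (Zb := zof_ln_bounds (lam t) ltac:(lra)).
      set (y := F2 (1 - zof (lam t))) in *. apply Rabs_le. split; lra. }
    assert (Hk : forall eps, 0 < eps -> exists T', 0 < T' /\ forall t, T' <= t -> Rabs (F1 (zof (lam t)) - 1) <= eps).
    { intros eps He.
      assert (C1 : continuous (fun x => F1 (zof x)) 0).
      { apply continuous_comp; [eapply derive_continuous, zof_derive|].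
        replace (zof 0) with 0 by (unfold zof, quadP; field). apply hypR_cont; try lra. rewrite Rabs_R0; lra. }
      destruct (continuous_R_eps_inv _ _ C1 eps He) as (d & Hd & Kd).
      assert (Z0 : F1 (zof 0) = 1) by (replace (zof 0) with 0 by (unfold zof, quadP; field); apply hypR_0).
      cbv beta in Kd. rewrite Z0 in Kd.
      exists (Rmax T (- ln d / PI + 26)). split; [generalize (Rmax_l T (- ln d / PI + 26)); lra|]. intros s Hs.
      assert (S1 : T <= s) by (generalize (Rmax_l T (- ln d / PI + 26)); lra).
      assert (S2 : - ln d / PI + 26 <= s) by (generalize (Rmax_r T (- ln d / PI + 26)); lra).
      destruct (KT s S1) as (G1 & G2). destruct (lam_spec s ltac:(lra)) as (_ & L & _).
      left. apply Kd. rewrite Rminus_0_r, Rabs_pos_eq by lra.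
      apply ln_lt_inv; try lra.
      assert (PI * (- ln d / PI + 26) <= PI * s) by (apply Rmult_le_compat_l; lra).
      replace (PI * (- ln d / PI + 26)) with (- ln d + PI * 26) in H by (field; lra).
      assert (3 < PI) by (generalize PI2_3_2; lra). lra. }
    set (D := B * c - 2 * PI). assert (ND : D <> 0) by (unfold D; lra).
    assert (PD : 0 < Rabs D) by now apply Rabs_pos_lt.
    assert (Pbc := Rabs_pos (B * c)).
    destruct (Hk (Rabs D / (4 * (Rabs (B * c) + 1)))) as (T' & HT' & KT'); [apply Rdiv_lt_0_compat; lra|].
    set (M := 65 + B + Rabs (B * c) * 2).
    (* At this [s] the fixed errors, and both parts of $(1+s)|D|/4$, are each at most a quarter of
       $|D|s$, which leads to $|D|s\le\frac34|D|s$. *)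
    set (s := Rmax (Rmax (T + T' + 2) (Rabs D)) (4 * M / Rabs D)).
    assert (S1 : T + T' + 2 <= s) by (unfold s; eapply Rle_trans; [apply Rmax_l|apply Rmax_l]).
    assert (S2 : 4 * M / Rabs D <= s) by (unfold s; apply Rmax_r).
    specialize (Hb s ltac:(lra) ltac:(lra)). specialize (KT' s ltac:(lra)). rewrite Ht in Hb by lra.
    set (F := F1 (zof (lam s))) in *.
    (* D s = (B c (1+s) F - 2 PI s) - B c - B c (1+s) (F - 1) *)
    assert (Id : D * s = (B * (c * (1 + s) * F) - 2 * PI * s) + (- (B * c) + - ((B * c) * (1 + s) * (F - 1)))) by (unfold D; ring).
    assert (Ab : Rabs D * s <= (B + 65) + (Rabs (B * c) + Rabs (B * c) * (1 + s) * (Rabs D / (4 * (Rabs (B * c) + 1))))).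
    { rewrite <- (Rabs_pos_eq s) at 1 by lra. rewrite <- Rabs_mult, Id.
      eapply Rle_trans; [apply Rabs_triang|]. apply Rplus_le_compat; auto.
      eapply Rle_trans; [apply Rabs_triang|]. rewrite !Rabs_Ropp. apply Rplus_le_compat_l.
      rewrite Rabs_mult, (Rabs_mult (B * c) (1 + s)), (Rabs_pos_eq (1 + s)) by lra. apply Rmult_le_compat_l; auto.
      apply Rmult_le_pos; lra. }
    assert (Fr : Rabs (B * c) * (Rabs D / (4 * (Rabs (B * c) + 1))) <= Rabs D / 4).
    { apply Rle_trans with ((Rabs (B * c) + 1) * (Rabs D / (4 * (Rabs (B * c) + 1)))).
      - apply Rmult_le_compat_r; [|lra]. left; apply Rdiv_lt_0_compat; lra.
      - right. field. lra. }
    assert (Fr2 : Rabs (B * c) * (1 + s) * (Rabs D / (4 * (Rabs (B * c) + 1))) <= (1 + s) * (Rabs D / 4)).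
    { replace (Rabs (B * c) * (1 + s) * (Rabs D / (4 * (Rabs (B * c) + 1)))) with ((1 + s) * (Rabs (B * c) * (Rabs D / (4 * (Rabs (B * c) + 1))))) by ring.
      apply Rmult_le_compat_l; lra. }
    assert (Ms : 4 * M <= Rabs D * s).
    { replace (4 * M) with (Rabs D * (4 * M / Rabs D)) by (field; lra). apply Rmult_le_compat_l; lra. }
    assert (Rabs D * 1 <= Rabs D * s) by (apply Rmult_le_compat_l; lra).
    unfold M in Ms. lra. }
  transitivity (B * c * (1 + t) * F1 (zof (lam t))); [ring|]. rewrite Ec. ring.
Qed.

Lemma schwarz_imag (t : R) : 1 < t -> schwarz2_init (RtoC (zof (lam t))) = imag t.
Proof.
  intros Ht. assert (L1 := lam_lt_half t Ht). destruct (lam_spec t ltac:(lra)) as (_ & L & _).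
  destruct (zof_range (lam t) ltac:(lra)) as [Z1 Z2]. assert (R := hyp_ratio_imag t Ht).
  assert (PF : 1 <= F1 (zof (lam t))) by (apply hypR_ge_1; lra). assert (Pp := PI_RGT_0).
  unfold schwarz2_init. rewrite <- RtoC_minus, !hypergeom_real. fold (F1 (zof (lam t))) (F2 (1 - zof (lam t))).
  rewrite <- RtoC_div by lra.
  set (f1 := F1 (zof (lam t))) in *. set (f2 := F2 (1 - zof (lam t))) in *.
  transitivity (Ci * RtoC (beta (1 / 12) (5 / 12) / (2 * PI) * (f2 / f1)) - Ci)%C; [rewrite RtoC_mult; ring|].
  replace (beta (1 / 12) (5 / 12) / (2 * PI) * (f2 / f1)) with (1 + t).
  - unfold imag, Ci, Cminus, Cplus, Copp, Cmult, RtoC; simpl. f_equal; ring.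
  - replace (beta (1 / 12) (5 / 12) / (2 * PI) * (f2 / f1)) with ((beta (1 / 12) (5 / 12) * f2) / (2 * PI * f1)) by (field; lra).
    rewrite R. field. lra.
Qed.

(** * The derivative of lambda and its behaviour under inversion *)

Lemma rder_imag (t : R) : rder imag t Ci.
Proof. split; unfold imag; simpl; auto_derive; auto. Qed.

Lemma ball_pos (t : R) (Ht : 0 < t) (u : R) : ball t (mkposreal t Ht) u -> 0 < u.
Proof. intros Hu. destruct (Rabs_def2 _ _ Hu). unfold minus, plus, opp in *; simpl in *. lra. Qed.

(* [modratio (lam t) = t] determines the logarithmic derivative of [lambda] on the imaginary axis. *)
Lemma lambda_deriv_imag : exists c0 : R, c0 <> 0 /\ forall t, 0 < t ->
  (RtoC c0 * Ci * Cderiv lambda (imag t) = lambda (imag t) * (1 - lambda (imag t)) * theta 0 0 (imag t) ^ 4)%C.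
Proof.
  destruct modratio_derive as (c0 & Hc & D). exists c0. split; auto. intros t Ht.
  assert (U := uhp_imag t Ht). destruct (lam_spec t Ht) as (El & L & _).
  assert (Hd := cder_curve lambda imag t _ _ (Cderiv_correct _ _ (holo_lambda _ U)) (rder_imag t)).
  destruct Hd as [Hr Hi]. set (X := (Cderiv lambda (imag t) * Ci)%C) in *.
  assert (Xi : Im X = 0).
  { assert (Z : is_derive (fun u => Im (lambda (imag u))) t 0).
    { apply (is_derive_ext_loc (fun _ => 0)); [|apply @is_derive_const].
      exists (mkposreal t Ht). intros u Hu. apply ball_pos in Hu.
      destruct (lam_spec u Hu) as (-> & _). reflexivity. }
    rewrite <- (is_derive_unique _ _ _ Hi). now apply is_derive_unique. }
  assert (Xr : c0 * Re X = lam t * (1 - lam t) * ellK (lam t) ^ 2).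
  { assert (Z : is_derive (fun u => modratio (lam u)) t (Re X * (c0 / (lam t * (1 - lam t) * ellK (lam t) ^ 2)))).
    { apply is_derive_Rcomp; [now apply D | exact Hr]. }
    assert (Z1 : is_derive (fun u => modratio (lam u)) t 1).
    { apply (is_derive_ext_loc (fun u => u)); [|apply @is_derive_id].
      exists (mkposreal t Ht). intros u Hu. symmetry. apply modratio_lam. now apply ball_pos in Hu. }
    assert (E := is_derive_unique _ _ _ Z). rewrite (is_derive_unique _ _ _ Z1) in E.
    assert (P := ellK_ge_1 (lam t) ltac:(lra)).
    apply (f_equal (fun y => y * (lam t * (1 - lam t) * ellK (lam t) ^ 2))) in E. rewrite Rmult_1_l in E. rewrite E.
    field. repeat split; lra. }
  transitivity (RtoC c0 * X)%C; [unfold X; ring|].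
  rewrite (real_of_Im X Xi), <- RtoC_mult, Xr, El.
  replace (theta 0 0 (imag t) ^ 4)%C with ((theta 0 0 (imag t) ^ 2) ^ 2)%C by (simpl; ring).
  rewrite theta_00_sqr_ellK by auto. rewrite !RtoC_mult, RtoC_minus, RtoC_pow. reflexivity.
Qed.

Lemma uhp_neq0 (tau : C) : upper_half_plane tau -> tau <> RtoC 0.
Proof. intros H E. rewrite E in H. unfold upper_half_plane in H. simpl in H. lra. Qed.

Lemma uhp_S (tau : C) : upper_half_plane tau -> upper_half_plane (- / tau)%C.
Proof.
  destruct tau as [x y]. unfold upper_half_plane, Cinv, Copp; simpl. intros H.
  assert (0 < x * (x * 1) + y * (y * 1)) by nra.
  replace (- (- y / (x * (x * 1) + y * (y * 1)))) with (y / (x * (x * 1) + y * (y * 1))) by (field; lra).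
  now apply Rdiv_lt_0_compat.
Qed.

(** The zeros of [f - g] accumulate at $i$ along the imaginary axis. *)
Lemma identity_imag (f g : C -> C) : (forall z, upper_half_plane z -> holo f z) -> (forall z, upper_half_plane z -> holo g z) ->
  (forall t, 0 < t -> f (imag t) = g (imag t)) -> forall z, upper_half_plane z -> f z = g z.
Proof.
  intros Hf Hg E z Hz.
  assert (U1 := uhp_imag 1 ltac:(lra)).
  apply (near_self z (fun z => f z = g z)).
  apply (identity_theorem_eq upper_half_plane f g (imag 1) z convex_uhp Hf Hg U1 Hz).
  apply (near_imp _ (fun w => f w - g w = 0)%C); [intros w Hw; now apply Ceq_minus|].
  apply holo_zeros; [apply holo_minus; auto|]. intros d Hd. exists (imag (1 + d / 2)).
  assert (Ed : (imag (1 + d / 2) - imag 1)%C = imag (d / 2)) by (unfold imag, Cminus, Cplus, Copp; simpl; f_equal; ring).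
  repeat split.
  - intro X. injection X. lra.
  - rewrite Ed. replace (imag (d / 2)) with (Ci * RtoC (d / 2))%C by (unfold imag, Ci, RtoC, Cmult; simpl; f_equal; ring).
    rewrite Cmod_mult, Cmod_R, Rabs_pos_eq by lra. replace (Cmod Ci) with 1; [lra|].
    unfold Cmod, Ci; simpl. replace (0 * (0 * 1) + 1 * (1 * 1)) with 1 by ring. now rewrite sqrt_1.
  - rewrite E by lra. ring.
Qed.

Lemma lambda_S (tau : C) : upper_half_plane tau -> lambda (- / tau)%C = (1 - lambda tau)%C.
Proof.
  apply (identity_imag (fun tau => lambda (- / tau)%C) (fun tau => (1 - lambda tau)%C)).
  - intros z Hz. apply (holo_comp (fun z => (- / z)%C) lambda); [|now apply holo_lambda, uhp_S].
    apply holo_opp. apply (holo_inv (fun z => z)); [apply holo_id | now apply uhp_neq0].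
  - intros z Hz. apply holo_minus; [apply holo_const | now apply holo_lambda].
  - intros t Ht. replace (- / imag t)%C with (imag (/ t)).
    + destruct (lam_spec t Ht) as (-> & _). destruct (lam_spec (/ t) (Rinv_0_lt_compat _ Ht)) as (-> & _).
      rewrite lam_inv by auto. apply RtoC_minus.
    + unfold imag, Cinv, Copp; simpl. f_equal; field; lra.
Qed.

(** The formula of [lambda_deriv_imag] extends to the half-plane, where its right-hand side
    $\lambda(1-\lambda)\vartheta_{00}^4$ has no zeros. *)
Lemma lambda_deriv_neq0 (tau : C) : upper_half_plane tau -> Cderiv lambda tau <> RtoC 0.
Proof.
  intros H X. destruct lambda_deriv_imag as (c0 & Hc & K).
  assert (E := identity_imag (fun z => RtoC c0 * Ci * Cderiv lambda z)%C
    (fun z => lambda z * (1 - lambda z) * theta 0 0 z ^ 4)%C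
    ltac:(intros z Hz; apply holo_mult; [apply holo_const | now apply holo_Cderiv, holo_lambda])
    ltac:(intros z Hz; apply holo_mult; [apply holo_mult; [now apply holo_lambda | apply holo_minus; [apply holo_const | now apply holo_lambda]] | now apply holo_pow, holo_theta_00])
    K tau H).
  cbv beta in E. rewrite X, Cmult_0_r in E. symmetry in E. revert E.
  apply Cmult_neq_0; [apply Cmult_neq_0; [now apply lambda_neq0|] | now apply theta_00_pow4_neq0].
  intro Y. apply (lambda_neq1 tau H). symmetry. now apply Ceq_minus.
Qed.

Open Scope C_scope.

(** * The modular group and the j-invariant *)

Definition jpoly (x : C) : C := 4 / 27 * ((x ^ 2 - x + 1) ^ 3 / (x ^ 2 * (1 - x) ^ 2)).

Lemma j_inv_jpoly (tau : C) : j_inv tau = jpoly (lambda tau).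
Proof. reflexivity. Qed.

Lemma RtoC_IZR_neq0 (n : Z) : n <> 0%Z -> RtoC (IZR n) <> 0.
Proof. intros H E. apply RtoC_inj in E. now apply eq_IZR in E. Qed.

Lemma minus_neq0 (x y : C) : x <> y -> x - y <> 0.
Proof. intros H E. apply H. now apply Ceq_minus. Qed.

Lemma jpoly_minus_1 (x : C) : x <> 0 -> x <> 1 ->
  jpoly x - 1 = ((2 * x - 1) * (x - 2) * (x + 1)) ^ 2 / (27 * (x ^ 2 * (1 - x) ^ 2)).
Proof.
  intros H0 H1. unfold jpoly. assert (H2 := minus_neq0 1 x (not_eq_sym H1)).
  assert (H27 := RtoC_IZR_neq0 27 ltac:(lia)). simpl. field. repeat split; auto.
Qed.

Lemma cder_jpoly (x : C) : x <> 0 -> x <> 1 ->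
  cder jpoly x (4 / 27 * ((x ^ 2 - x + 1) ^ 2 * ((2 * x - 1) * (2 - x) * (1 + x)) / (x ^ 3 * (1 - x) ^ 3))).
Proof.
  intros H0 H1. assert (H2 := minus_neq0 1 x (not_eq_sym H1)).
  assert (H27 := RtoC_IZR_neq0 27 ltac:(lia)).
  eapply cder_eq.
  - apply (cder_mult (fun _ => 4 / 27)); [apply cder_const|].
    apply (cder_div (fun x => (x ^ 2 - x + 1) ^ 3) (fun x => x ^ 2 * (1 - x) ^ 2)).
    + apply (cder_pow (fun x => x ^ 2 - x + 1)). apply cder_plus; [|apply cder_const].
      apply cder_minus; [apply (cder_pow (fun x => x)); apply cder_id | apply cder_id].
    + apply (cder_mult (fun x => x ^ 2) (fun x => (1 - x) ^ 2)).
      * apply (cder_pow (fun x => x)); apply cder_id.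
      * apply (cder_pow (fun x => 1 - x)). apply cder_minus; [apply cder_const | apply cder_id].
    + apply Cmult_neq_0; now apply Cpow_nz.
  - cbv beta. simpl pred. replace (RtoC (INR 3)) with (RtoC 3) by (simpl; f_equal; ring).
    replace (RtoC (INR 2)) with (RtoC 2) by (simpl; f_equal; ring). simpl. field. repeat split; auto.
Qed.

Lemma holo_jpoly (x : C) : x <> 0 -> x <> 1 -> holo jpoly x.
Proof.
  intros H0 H1. assert (H2 := minus_neq0 1 x (not_eq_sym H1)).
  apply (holo_mult (fun _ => 4 / 27)); [apply holo_const|].
  apply (holo_div (fun x => (x ^ 2 - x + 1) ^ 3) (fun x => x ^ 2 * (1 - x) ^ 2)).
  - apply (holo_pow (fun x => x ^ 2 - x + 1)). apply holo_plus; [|apply holo_const].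
    apply holo_minus; [apply (holo_pow (fun x => x)); apply holo_id | apply holo_id].
  - apply (holo_mult (fun x => x ^ 2) (fun x => (1 - x) ^ 2)).
    + apply (holo_pow (fun x => x)); apply holo_id.
    + apply (holo_pow (fun x => 1 - x)). apply holo_minus; [apply holo_const | apply holo_id].
  - apply Cmult_neq_0; now apply Cpow_nz.
Qed.

Lemma holo_j (tau : C) : upper_half_plane tau -> holo j_inv tau.
Proof.
  intros H. apply (holo_comp lambda jpoly); [now apply holo_lambda|].
  apply holo_jpoly; [now apply lambda_neq0 | now apply lambda_neq1].
Qed.

(** The critical points of [jpoly] other than $0$ and $1$ are the zeros of $x^2-x+1$, lying over
    $0$, and of $(2x-1)(x-2)(x+1)$, lying over $1$; $\lambda$ contributes no others. *)
Lemma j_deriv_neq0 (tau : C) : upper_half_plane tau -> j_inv tau <> 0 -> j_inv tau <> 1 ->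
  Cderiv j_inv tau <> 0.
Proof.
  intros H J0 J1. set (x := lambda tau).
  assert (X0 : x <> 0) by now apply lambda_neq0. assert (X1 : x <> 1) by now apply lambda_neq1.
  assert (X2 := minus_neq0 1 x (not_eq_sym X1)).
  assert (N : forall n, n <> 0%Z -> RtoC (IZR n) <> 0) by exact RtoC_IZR_neq0.
  assert (P : x ^ 2 - x + 1 <> 0).
  { intro E. apply J0. rewrite j_inv_jpoly. unfold jpoly. fold x. rewrite E. simpl. field. repeat split; auto. }
  assert (Q : (2 * x - 1) * (x - 2) * (x + 1) <> 0).
  { intro E. apply J1. apply Ceq_minus. rewrite j_inv_jpoly, jpoly_minus_1 by auto. fold x. rewrite E. simpl.
    field. repeat split; auto. }
  assert (D := cder_comp lambda jpoly tau _ _ (Cderiv_correct _ _ (holo_lambda tau H)) (cder_jpoly x X0 X1)).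
  rewrite (cder_unique _ _ _ _ (Cderiv_correct _ _ (holo_j tau H)) D).
  apply Cmult_neq_0; [|now apply lambda_deriv_neq0].
  apply Cmult_neq_0.
  - intro E. apply C1_nz. apply (f_equal (fun z => z * (27 / 4))) in E. rewrite Cmult_0_l in E. rewrite <- E. field.
  - intro E. apply (f_equal (fun z => z * (x ^ 3 * (1 - x) ^ 3))) in E. rewrite Cmult_0_l in E.
    revert E. unfold Cdiv. rewrite <- Cmult_assoc, Cinv_l, Cmult_1_r by (apply Cmult_neq_0; now apply Cpow_nz).
    apply Cmult_neq_0; [now apply Cpow_nz|]. intro E. apply Q. transitivity (- ((2 * x - 1) * (2 - x) * (1 + x))); [ring|].
    rewrite E. ring.
Qed.

Lemma j_imag (t : R) : (0 < t)%R -> j_inv (imag t) = / RtoC (zof (lam t)) .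
Proof.
  intros Ht. destruct (lam_spec t Ht) as (El & L & _). rewrite j_inv_jpoly, El. set (x := lam t) in *.
  assert (P := quadP_pos x).
  assert (Z : zof x <> 0%R).
  { unfold zof. apply Rmult_integral_contrapositive_currified; [|apply Rinv_neq_0_compat, Rgt_not_eq; repeat apply Rmult_lt_0_compat; auto].
    assert (0 < x * (1 - x))%R by (apply Rmult_lt_0_compat; lra). nra. }
  assert (E : (4 / 27 * ((quadP x) ^ 3 / (x ^ 2 * (1 - x) ^ 2)) = / zof x)%R).
  { unfold zof. field. repeat split; lra. }
  rewrite <- RtoC_inv, <- E by auto. unfold jpoly.
  assert (Nd : (x ^ 2 * (1 - x) ^ 2 <> 0)%R) by (apply Rmult_integral_contrapositive_currified; apply pow_nonzero; lra).
  rewrite RtoC_mult, !RtoC_div, RtoC_mult, !RtoC_pow, RtoC_minus by (auto; lra).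
  replace (RtoC (quadP x)) with (RtoC x ^ 2 - RtoC x + 1).
  - reflexivity.
  - unfold quadP. rewrite RtoC_plus, RtoC_minus, RtoC_mult. simpl. ring.
Qed.

(** For the fourth powers $a,b,c$ of $\vartheta_{00},\vartheta_{10},\vartheta_{01}$, Jacobi's
    identity $c=a-b$ gives $a^2+b^2+c^2=2(a^2-ab+b^2)$; the cube accounts for
    $\frac8{54}=\frac4{27}$. *)
Lemma j_inv_j_theta (tau : C) : upper_half_plane tau -> j_inv tau = j_theta tau.
Proof.
  intros H. unfold j_inv, j_theta, lambda.
  assert (J := jacobi_identity tau H).
  assert (A0 := theta_00_neq0 tau H). assert (B0 := theta_10_neq0 tau H). assert (C0 := theta_01_neq0 tau H).
  set (a := theta 0 0 tau ^ 4) in *. set (b := theta 1 0 tau ^ 4) in *. set (c := theta 0 1 tau ^ 4) in *.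
  assert (A8 : theta 0 0 tau ^ 8 = a ^ 2) by (unfold a; simpl; ring).
  assert (B8 : theta 1 0 tau ^ 8 = b ^ 2) by (unfold b; simpl; ring).
  assert (C8 : theta 0 1 tau ^ 8 = c ^ 2) by (unfold c; simpl; ring).
  rewrite A8, B8, C8.
  assert (Na : a <> 0) by now apply Cpow_nz. assert (Nb : b <> 0) by now apply Cpow_nz. assert (Nc : c <> 0) by now apply Cpow_nz.
  assert (Ec : c = a - b) by (rewrite J; ring). rewrite Ec in Nc |- *. clearbody a b. clear - Na Nb Nc.
  assert (N27 := RtoC_IZR_neq0 27 ltac:(lia)). assert (N54 := RtoC_IZR_neq0 54 ltac:(lia)).
  simpl. field. repeat split; auto.
Qed.

Section Moebius.

Variables a b c d : Z.
Hypothesis det : (a * d - b * c = 1)%Z.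

Lemma det_R : (IZR a * IZR d - IZR b * IZR c = 1)%R.
Proof. rewrite <- !mult_IZR, <- minus_IZR, det. reflexivity. Qed.

Lemma moebius_den_neq0 (tau : C) : upper_half_plane tau -> RtoC (IZR c) * tau + RtoC (IZR d) <> 0.
Proof.
  intros H E. destruct tau as [x y]. unfold upper_half_plane in H; simpl in H.
  injection E. intros E2 E1. simpl in *. assert (D := det_R).
  assert (IZR c * y = 0)%R by lra. apply Rmult_integral in H0. destruct H0 as [C0|]; [|lra].
  rewrite C0 in *. assert (IZR d = 0)%R by lra. rewrite H0 in D. lra.
Qed.

Lemma Im_moebius (tau : C) : upper_half_plane tau ->
  Im (moebius a b c d tau) = (Im tau / Cmod (RtoC (IZR c) * tau + RtoC (IZR d)) ^ 2)%R.
Proof.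
  intros H. assert (N := moebius_den_neq0 tau H).
  assert (Q : (0 < Re (RtoC (IZR c) * tau + RtoC (IZR d)) ^ 2 + Im (RtoC (IZR c) * tau + RtoC (IZR d)) ^ 2)%R).
  { rewrite <- Cmod2_alt. now apply pow_lt, Cmod_gt_0. }
  rewrite Cmod2_alt.
  transitivity ((IZR a * IZR d - IZR b * IZR c) * Im tau / (Re (RtoC (IZR c) * tau + RtoC (IZR d)) ^ 2 + Im (RtoC (IZR c) * tau + RtoC (IZR d)) ^ 2))%R.
  - unfold moebius. destruct tau as [x y]; simpl in *. field. lra.
  - rewrite det_R, Rmult_1_l. reflexivity.
Qed.

Lemma uhp_moebius (tau : C) : upper_half_plane tau -> upper_half_plane (moebius a b c d tau).
Proof.
  intros H. unfold upper_half_plane. rewrite Im_moebius by auto.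
  apply Rdiv_lt_0_compat; auto. apply pow_lt. now apply Cmod_gt_0, moebius_den_neq0.
Qed.

Lemma holo_moebius (tau : C) : upper_half_plane tau -> holo (moebius a b c d) tau.
Proof.
  intros H. apply (holo_div (fun t => RtoC (IZR a) * t + RtoC (IZR b)) (fun t => RtoC (IZR c) * t + RtoC (IZR d))).
  - apply holo_plus; [apply (holo_mult (fun _ => _) (fun t => t)); [apply holo_const | apply holo_id] | apply holo_const].
  - apply holo_plus; [apply (holo_mult (fun _ => _) (fun t => t)); [apply holo_const | apply holo_id] | apply holo_const].
  - now apply moebius_den_neq0.
Qed.

End Moebius.

Lemma moebius_comp (a b c d a' b' c' d' : Z) (tau : C) :
  (a * d - b * c = 1)%Z -> (a' * d' - b' * c' = 1)%Z -> upper_half_plane tau ->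
  moebius a b c d (moebius a' b' c' d' tau) =
  moebius (a * a' + b * c') (a * b' + b * d') (c * a' + d * c') (c * b' + d * d') tau.
Proof.
  intros D1 D2 H. assert (N1 := moebius_den_neq0 a' b' c' d' D2 tau H).
  assert (N2 := moebius_den_neq0 a b c d D1 _ (uhp_moebius a' b' c' d' D2 tau H)).
  assert (D3 : ((a * a' + b * c') * (c * b' + d * d') - (a * b' + b * d') * (c * a' + d * c') = 1)%Z).
  { transitivity ((a * d - b * c) * (a' * d' - b' * c'))%Z; [ring|]. now rewrite D1, D2. }
  assert (N3 := moebius_den_neq0 _ _ _ _ D3 tau H).
  unfold moebius in *. rewrite !plus_IZR, !mult_IZR, !RtoC_plus, !RtoC_mult in *.
  field. repeat split; auto.
Qed.

(** Equality is demanded on the half-plane only, so that compositions, translations and $-1/\tau$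
    belong to the class whatever happens at poles. *)
Definition modular (g : C -> C) : Prop :=
  exists a b c d : Z, (a * d - b * c = 1)%Z /\ forall tau, upper_half_plane tau -> g tau = moebius a b c d tau.

Lemma modular_uhp (g : C -> C) (tau : C) : modular g -> upper_half_plane tau -> upper_half_plane (g tau).
Proof. intros (a & b & c & d & D & E) H. rewrite E by auto. now apply uhp_moebius. Qed.

Lemma modular_holo (g : C -> C) (tau : C) : modular g -> upper_half_plane tau -> holo g tau.
Proof.
  intros (a & b & c & d & D & E) H. apply (holo_ext (moebius a b c d)); [|now apply holo_moebius].
  generalize (near_uhp tau H). apply near_imp. intros w Hw. symmetry. auto.
Qed.

Lemma modular_comp (g h : C -> C) : modular g -> modular h -> modular (fun t => g (h t)).
Proof.
  intros (a & b & c & d & D & E) (a' & b' & c' & d' & D' & E').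
  exists (a * a' + b * c')%Z, (a * b' + b * d')%Z, (c * a' + d * c')%Z, (c * b' + d * d')%Z. split.
  - transitivity ((a * d - b * c) * (a' * d' - b' * c'))%Z; [ring|]. now rewrite D, D'.
  - intros tau H. rewrite E' by auto. rewrite E by now apply uhp_moebius. now apply moebius_comp.
Qed.

Lemma modular_id : modular (fun t => t).
Proof.
  exists 1%Z, 0%Z, 0%Z, 1%Z. split; auto. intros tau _. unfold moebius. field.
Qed.

Lemma modular_inv (g : C -> C) : modular g -> exists h, modular h /\
  forall tau, upper_half_plane tau -> h (g tau) = tau /\ g (h tau) = tau.
Proof.
  intros (a & b & c & d & D & E).
  assert (D' : (d * a - - b * - c = 1)%Z) by (rewrite <- D; ring).
  exists (moebius d (- b) (- c) a). split; [exists d, (- b)%Z, (- c)%Z, a; auto|].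
  assert (I : forall p q r s tau, p = 1%Z -> q = 0%Z -> r = 0%Z -> s = 1%Z -> moebius p q r s tau = tau).
  { intros p q r s tau -> -> -> ->. unfold moebius. field. }
  intros tau H. split.
  - rewrite E by auto. rewrite moebius_comp by auto. apply I; lia.
  - rewrite E by now apply uhp_moebius. rewrite moebius_comp by auto. apply I; lia.
Qed.

Lemma modular_T (n : Z) : modular (fun t => t + RtoC (IZR n)).
Proof.
  exists 1%Z, n, 0%Z, 1%Z. split; [lia|]. intros tau _. unfold moebius. field.
Qed.

Lemma RtoC_m1 : RtoC (-1) = - (1).
Proof. unfold RtoC, Copp; simpl. f_equal; ring. Qed.

Lemma modular_S : modular (fun t => - / t).
Proof.
  exists 0%Z, (-1)%Z, 1%Z, 0%Z. split; [lia|]. intros tau H. unfold moebius.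
  rewrite RtoC_m1. field. now apply uhp_neq0.
Qed.

(* Euclid's algorithm on the first column. *)
Lemma modular_ind (Q : (C -> C) -> Prop) :
  (forall g h, (forall tau, upper_half_plane tau -> g tau = h tau) -> Q g -> Q h) ->
  Q (fun t => t) ->
  (forall g, modular g -> Q g -> Q (fun t => g t + 1)) ->
  (forall g, modular g -> Q g -> Q (fun t => g t - 1)) ->
  (forall g, modular g -> Q g -> Q (fun t => - / g t)) ->
  forall g, modular g -> Q g.
Proof.
  intros Hext Hid HT HT' HS.
  assert (HTn : forall n g, modular g -> Q g -> Q (fun t => g t + RtoC (IZR n))).
  { assert (P : forall m : nat, forall g, modular g -> Q g ->
       Q (fun t => g t + RtoC (IZR (Z.of_nat m))) /\ Q (fun t => g t + RtoC (IZR (- Z.of_nat m)))).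
    { induction m as [|m IH]; intros g Mg Hg.
      - split; apply (Hext g); auto; intros; simpl; ring.
      - destruct (IH g Mg Hg) as [I1 I2].
        assert (Mp : forall k, modular (fun t => g t + RtoC (IZR k))) by (intros k; apply (modular_comp (fun t => t + RtoC (IZR k)) g); auto; apply modular_T).
        split.
        + apply (Hext (fun t => g t + RtoC (IZR (Z.of_nat m)) + 1)); [|now apply (HT _ (Mp _))].
          intros tau _. rewrite Nat2Z.inj_succ. unfold Z.succ. rewrite plus_IZR, RtoC_plus. ring.
        + apply (Hext (fun t => g t + RtoC (IZR (- Z.of_nat m)) - 1)); [|now apply (HT' _ (Mp _))].
          intros tau _. replace (- Z.of_nat (S m))%Z with (- Z.of_nat m - 1)%Z by lia. rewrite minus_IZR, RtoC_minus. ring. }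
    intros n g Mg Hg. destruct (Z_le_dec 0 n) as [L|L].
    - replace n with (Z.of_nat (Z.to_nat n)) by lia. now apply P.
    - replace n with (- Z.of_nat (Z.to_nat (- n)))%Z by lia. now apply P. }
  assert (Main : forall k : nat, forall a b c d : Z, (Z.abs_nat c <= k)%nat -> (a * d - b * c = 1)%Z -> Q (moebius a b c d)).
  { induction k as [|k IH]; intros a b c d Hk D.
    - assert (c = 0%Z) by lia. subst c.
      assert (E : (a = 1 /\ d = 1)%Z \/ (a = -1 /\ d = -1)%Z).
      { assert (X : (a * d = 1)%Z) by lia. apply Z.eq_mul_1 in X. destruct X as [-> | ->]; lia. }
      destruct E as [[-> ->]|[-> ->]].
      + apply (Hext (fun t => t + RtoC (IZR b))); [|apply HTn; auto using modular_id].
        intros tau _. unfold moebius. field.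
      + apply (Hext (fun t => t + RtoC (IZR (- b)))); [|apply HTn; auto using modular_id].
        intros tau _. unfold moebius. rewrite opp_IZR, RtoC_m1, RtoC_opp. field.
    - destruct (Z.eq_dec c 0) as [->|Nc]; [apply IH; auto; lia|].
      set (q := (a / c)%Z). assert (Hm := Z_div_mod_eq_full a c). fold q in Hm.
      assert (Hr : (Z.abs (a mod c) < Z.abs c)%Z).
      { destruct (Z_lt_le_dec 0 c) as [L|L].
        - generalize (Z.mod_pos_bound a c L). lia.
        - generalize (Z.mod_neg_bound a c ltac:(lia)). lia. }
      assert (D' : (- c * (b - q * d) - - d * (a - q * c) = 1)%Z) by lia.
      assert (M' : modular (moebius (- c) (- d) (a - q * c) (b - q * d))) by (do 4 eexists; split; [exact D'|auto]).
      (* Division step: $\frac{at+b}{ct+d}=q-1/M'(t)$, where $M'$ has lower left entry $a-qc$, the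
         remainder of $a$ modulo $c$. *)
      apply (Hext (fun t => - / moebius (- c) (- d) (a - q * c) (b - q * d) t + RtoC (IZR q))).
      + intros tau H. assert (N1 := moebius_den_neq0 _ _ _ _ D tau H). assert (N2 := moebius_den_neq0 _ _ _ _ D' tau H).
        unfold moebius. rewrite !opp_IZR, !minus_IZR, !mult_IZR in *. rewrite !RtoC_opp, !RtoC_minus, !RtoC_mult in *.
        field. repeat split; auto.
        intro X. apply N1. match type of X with ?e = _ => transitivity (- e); [ring | rewrite X; ring] end.
      + apply (HTn q (fun t => - / moebius (- c) (- d) (a - q * c) (b - q * d) t)).
        * apply (modular_comp (fun t => - / t)); auto. apply modular_S.
        * apply HS; auto. apply IH; auto. replace (a - q * c)%Z with (a mod c)%Z by lia. lia. }
  intros g (a & b & c & d & D & E). apply (Hext (moebius a b c d)); [intros; symmetry; auto|].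
  now apply (Main (Z.abs_nat c)).
Qed.

(* The six values of [lambda] on an orbit of the modular group. *)
Definition anharm (i : nat) (x : C) : C :=
  match i with
  | 0%nat => x
  | 1%nat => 1 - x
  | 2%nat => / x
  | 3%nat => 1 - / x
  | 4%nat => / (1 - x)
  | _ => x / (x - 1)
  end.

Ltac neq_from H X :=
  apply H; match type of X with ?e = _ =>
    first [transitivity e; [ring | exact X] | transitivity (- e); [ring | rewrite X; ring]] end.

Lemma anharm_T (i : nat) : exists k, forall x : C, x <> 0 -> x <> 1 ->
  anharm i x / (anharm i x - 1) = anharm k x.
Proof.
  destruct i as [|[|[|[|[|i]]]]]; [exists 5%nat | exists 3%nat | exists 4%nat | exists 1%nat | exists 2%nat | exists 0%nat];
  intros x H0 H1; assert (H2 := minus_neq0 1 x (not_eq_sym H1)); assert (H3 := minus_neq0 x 1 H1); simpl; field;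
  repeat split; auto; intro X; first [neq_from C1_nz X | neq_from H0 X | neq_from H2 X | neq_from H3 X].
Qed.

Lemma anharm_S (i : nat) : exists k, forall x : C, x <> 0 -> x <> 1 -> 1 - anharm i x = anharm k x.
Proof.
  destruct i as [|[|[|[|[|i]]]]]; [exists 1%nat | exists 0%nat | exists 3%nat | exists 2%nat | exists 5%nat | exists 4%nat];
  intros x H0 H1; assert (H2 := minus_neq0 1 x (not_eq_sym H1)); assert (H3 := minus_neq0 x 1 H1); simpl; field;
  repeat split; auto; intro X; first [neq_from C1_nz X | neq_from H0 X | neq_from H2 X | neq_from H3 X].
Qed.

Lemma jpoly_anharm (i : nat) (x : C) : x <> 0 -> x <> 1 -> jpoly (anharm i x) = jpoly x.
Proof.
  intros H0 H1. assert (H2 := minus_neq0 1 x (not_eq_sym H1)). assert (H3 := minus_neq0 x 1 H1).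
  assert (H27 := RtoC_IZR_neq0 27 ltac:(lia)).
  destruct i as [|[|[|[|[|i]]]]]; unfold jpoly; simpl anharm; simpl; auto; field;
  repeat split; auto; intro X; first [neq_from C1_nz X | neq_from H0 X | neq_from H2 X | neq_from H3 X].
Qed.

Lemma lambda_Tinv (tau : C) : upper_half_plane tau -> lambda (tau - 1) = lambda tau / (lambda tau - 1).
Proof.
  intros H. assert (U : upper_half_plane (tau - 1)) by (unfold upper_half_plane in *; destruct tau; simpl in *; lra).
  assert (E := lambda_T (tau - 1) U). replace (tau - 1 + 1) with tau in E by ring.
  assert (N0 := lambda_neq0 _ U). assert (N1 := minus_neq0 _ _ (lambda_neq1 _ U)). rewrite E. field.
  repeat split; auto; intro X; first [neq_from C1_nz X | neq_from N1 X].
Qed.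

(** The generators act on values of $\lambda$ by $x/(x-1)$ and $1-x$, which permute the six
    functions. The index depends on [g] alone, so one relation holds at all points of the
    half-plane. *)
Lemma lambda_modular (g : C -> C) : modular g ->
  exists i, forall tau, upper_half_plane tau -> lambda (g tau) = anharm i (lambda tau).
Proof.
  revert g. apply modular_ind.
  - intros g h E [i Hi]. exists i. intros tau H. rewrite <- E by auto. auto.
  - exists 0%nat. auto.
  - intros g Mg [i Hi]. destruct (anharm_T i) as [k Hk]. exists k. intros tau H.
    rewrite lambda_T by now apply modular_uhp. rewrite Hi by auto. apply Hk; [now apply lambda_neq0 | now apply lambda_neq1].
  - intros g Mg [i Hi]. destruct (anharm_T i) as [k Hk]. exists k. intros tau H.
    rewrite lambda_Tinv by now apply modular_uhp. rewrite Hi by auto. apply Hk; [now apply lambda_neq0 | now apply lambda_neq1].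
  - intros g Mg [i Hi]. destruct (anharm_S i) as [k Hk]. exists k. intros tau H.
    rewrite lambda_S by now apply modular_uhp. rewrite Hi by auto. apply Hk; [now apply lambda_neq0 | now apply lambda_neq1].
Qed.

Lemma j_modular (g : C -> C) (tau : C) : modular g -> upper_half_plane tau -> j_inv (g tau) = j_inv tau.
Proof.
  intros Mg H. destruct (lambda_modular g Mg) as [i Hi]. rewrite !j_inv_jpoly, Hi by auto.
  apply jpoly_anharm; [now apply lambda_neq0 | now apply lambda_neq1].
Qed.

(* Every [anharm i] is induced by a modular transformation, which moves
   compact boxes of the half-plane into compact boxes. *)
Definition in_box (N : R) (tau : C) : Prop := (Rabs (Re tau) <= N /\ / N <= Im tau <= N)%R.

Definition boxed (g : C -> C) : Prop :=
  forall N, (1 <= N)%R -> exists N', (1 <= N')%R /\ forall tau, in_box N tau -> in_box N' (g tau).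

Lemma boxed_S : boxed (fun t => - / t).
Proof.
  (* On the box $|\tau|^2$ lies between $N^{-2}$ and $2N^2$; the worst case is the lower bound
     $N^{-1}/(2N^2)$ of the imaginary part. *)
  intros N HN. exists (2 * N * N * N)%R.
  assert (N2 : (1 <= N * N)%R) by nra. split; [nra|]. intros [x y] [Hx [Hy1 Hy2]]. simpl in *.
  assert (Pi : (0 < / N)%R) by (apply Rinv_0_lt_compat; lra).
  set (n := (x * (x * 1) + y * (y * 1))%R).
  assert (Hxx : (0 <= x * x <= N * N)%R).
  { split; [nra|]. replace (x * x)%R with (Rabs x * Rabs x)%R by (rewrite <- Rabs_mult; apply Rabs_pos_eq; nra).
    generalize (Rabs_pos x); nra. }
  assert (Hyy : (/ N * / N <= y * y <= N * N)%R) by nra.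
  assert (Hn1 : (/ N * / N <= n)%R) by (unfold n; lra).
  assert (Hn2 : (n <= 2 * (N * N))%R) by (unfold n; lra).
  assert (Hn0 : (0 < n)%R) by (assert (0 < / N * / N)%R by nra; lra).
  assert (Hin : (/ n <= N * N)%R).
  { rewrite <- (Rinv_inv (N * N)), Rinv_mult. apply Rinv_le_contravar; auto. nra. }
  assert (Hin2 : (/ (2 * (N * N)) <= / n)%R) by (apply Rinv_le_contravar; auto).
  assert (Pin : (0 < / n)%R) by now apply Rinv_0_lt_compat.
  split; [|split].
  - simpl. fold n. rewrite Rabs_Ropp. unfold Rdiv. rewrite Rabs_mult, (Rabs_pos_eq (/ n)) by lra.
    assert (Rabs x * / n <= N * (N * N))%R by (apply Rmult_le_compat; auto using Rabs_pos; lra). nra.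
  - simpl. fold n. replace (- (- y / n))%R with (y * / n)%R by (field; lra).
    replace (/ (2 * N * N * N))%R with (/ N * / (2 * (N * N)))%R by (field; lra).
    apply Rmult_le_compat; try lra. left. apply Rinv_0_lt_compat. nra.
  - simpl. fold n. replace (- (- y / n))%R with (y * / n)%R by (field; lra).
    assert (y * / n <= N * (N * N))%R by (apply Rmult_le_compat; lra). nra.
Qed.

Lemma boxed_T : boxed (fun t => t + RtoC (IZR 1)).
Proof.
  intros N HN. exists (N + 1)%R. split; [lra|]. intros [x y] [Hx [Hy1 Hy2]]. simpl in *.
  split; [|split]; simpl.
  - eapply Rle_trans; [apply Rabs_triang|]. rewrite (Rabs_pos_eq 1) by lra. lra.
  - rewrite Rplus_0_r. eapply Rle_trans; [|apply Hy1]. apply Rinv_le_contravar; lra.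
  - lra.
Qed.

Lemma boxed_comp (g h : C -> C) : boxed g -> boxed h -> boxed (fun t => g (h t)).
Proof.
  intros Hg Hh N HN. destruct (Hh N HN) as (N1 & HN1 & K1). destruct (Hg N1 HN1) as (N2 & HN2 & K2).
  exists N2. split; auto.
Qed.

Lemma boxed_id : boxed (fun t => t).
Proof. intros N HN. exists N. auto. Qed.

(** Each of the six functions is undone by a word in $\tau+1$ and $-1/\tau$. Boxes are tracked
    because in [lambda_cover] the corrected point must still lie in a fixed compact set. *)
Lemma anharm_inverse (i : nat) : exists g, modular g /\ boxed g /\
  forall (x : C) tau, upper_half_plane tau -> x <> 0 -> x <> RtoC 1 -> lambda tau = anharm i x -> lambda (g tau) = x.
Proof.
  assert (MT := modular_T 1). assert (MS := modular_S). assert (BT := boxed_T). assert (BS := boxed_S).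
  set (T := fun t => t + RtoC (IZR 1)) in *. set (S := fun t : C => - / t) in *.
  assert (LT : forall tau, upper_half_plane tau -> lambda (T tau) = lambda tau / (lambda tau - 1)) by exact lambda_T.
  assert (LS : forall tau, upper_half_plane tau -> lambda (S tau) = 1 - lambda tau) by exact lambda_S.
  assert (MTS := modular_comp T S MT MS). assert (BTS := boxed_comp T S BT BS).
  assert (MST := modular_comp S T MS MT). assert (BST := boxed_comp S T BS BT).
  assert (MSTS := modular_comp S _ MS MTS). assert (BSTS := boxed_comp S _ BS BTS).
  assert (US : forall tau, upper_half_plane tau -> upper_half_plane (S tau)) by (intros; now apply modular_uhp).
  assert (UT : forall tau, upper_half_plane tau -> upper_half_plane (T tau)) by (intros; now apply modular_uhp).
  destruct i as [|[|[|[|[|i]]]]];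
    [exists (fun t => t) | exists S | exists (fun t => S (T (S t))) | exists (fun t => S (T t)) | exists (fun t => T (S t)) | exists T];
    (split; [auto using modular_id | split; [auto using boxed_id|]]);
    intros x tau H H0 H1 E; assert (H2 := minus_neq0 1 x (not_eq_sym H1)); assert (H3 := minus_neq0 x 1 H1);
    rewrite ?LS, ?LT, ?LS, ?E by auto; simpl; auto; field;
    repeat split; auto; intro X; first [neq_from C1_nz X | neq_from H0 X | neq_from H2 X | neq_from H3 X].
Qed.

Lemma nearest_integer (x : R) : exists n : Z, (Rabs (x + IZR n) <= / 2)%R.
Proof.
  exists (- Int_part (x + / 2))%Z. destruct (base_Int_part (x + / 2)) as [H1 H2]. rewrite opp_IZR.
  apply Rabs_le. lra.
Qed.

(* While [Im tau < 1/2] and [|Re tau| <= 1/2], inversion doubles the imaginary part. *)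
Lemma modular_reduction (tau : C) : upper_half_plane tau ->
  exists g, modular g /\ (Rabs (Re (g tau)) <= / 2)%R /\ (/ 2 <= Im (g tau))%R.
Proof.
  assert (P : forall n tau, upper_half_plane tau -> (/ 2 <= Im tau * 2 ^ n)%R ->
    exists g, modular g /\ (Rabs (Re (g tau)) <= / 2)%R /\ (/ 2 <= Im (g tau))%R).
  { clear tau. induction n as [|n IH]; intros tau H Hn; destruct (nearest_integer (Re tau)) as [m Hm];
    assert (Mm := modular_T m); assert (Um := modular_uhp _ tau Mm H); cbv beta in Um;
    assert (ER : Re (tau + RtoC (IZR m)) = (Re tau + IZR m)%R) by reflexivity;
    assert (EI : Im (tau + RtoC (IZR m)) = Im tau) by (destruct tau; simpl; ring).
    - exists (fun t => t + RtoC (IZR m)). rewrite ER, EI. repeat split; auto. simpl in Hn. lra.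
    - destruct (Rle_lt_dec (/ 2) (Im tau)) as [L|L].
      + exists (fun t => t + RtoC (IZR m)). rewrite ER, EI. repeat split; auto.
      + set (t1 := tau + RtoC (IZR m)) in *.
        assert (U1 := uhp_S t1 Um).
        assert (I1 : (2 * Im tau <= Im (- / t1))%R).
        { rewrite <- EI. rewrite <- EI in L. rewrite <- ER in Hm. destruct t1 as [x y]. simpl in *. unfold upper_half_plane in *; simpl in *.
          set (d := (x * (x * 1) + y * (y * 1))%R).
          assert (Hxx : (x * x <= / 4)%R).
          { replace (x * x)%R with (Rabs x * Rabs x)%R by (rewrite <- Rabs_mult; apply Rabs_pos_eq; nra).
            generalize (Rabs_pos x); nra. }
          assert (D0 : (0 < d)%R) by (unfold d; nra).
          assert (D1 : (d <= / 2)%R) by (unfold d; nra).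
          replace (- (- y / d))%R with (y * / d)%R by (field; lra).
          assert (2 <= / d)%R by (rewrite <- (Rinv_inv 2); apply Rinv_le_contravar; lra). nra. }
        destruct (IH (- / t1) U1) as (g & Mg & G1 & G2).
        { simpl in Hn. assert (0 < 2 ^ n)%R by (apply pow_lt; lra). nra. }
        exists (fun t => g (- / (t + RtoC (IZR m)))). repeat split; auto.
        apply (modular_comp g (fun t => - / (t + RtoC (IZR m)))); auto.
        apply (modular_comp (fun t => - / t) (fun t => t + RtoC (IZR m))); auto. apply modular_S. }
  intros H. destruct (Pow_x_infinity 2 ltac:(rewrite Rabs_pos_eq; lra) (/ (2 * Im tau))) as [M HM].
  specialize (HM M (le_n M)). rewrite Rabs_pos_eq in HM by (apply pow_le; lra).
  apply (P M tau H). unfold upper_half_plane in H.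
  replace (/ 2)%R with (Im tau * / (2 * Im tau))%R by (field; lra). apply Rmult_le_compat_l; lra.
Qed.

(** * Behaviour at the cusp and even coverings *)

Lemma nome_small (r : R) : (0 < r)%R -> exists M, (1 <= M)%R /\ forall tau, (M <= Im tau)%R -> (Cmod (nome tau) < r)%R.
Proof.
  intros Hr. assert (Pp := PI_RGT_0). exists (Rmax 1 (- ln r / PI + 1)). split; [apply Rmax_l|]. intros tau Ht.
  rewrite Cmod_nome. rewrite <- (exp_ln r Hr). apply exp_increasing.
  assert (- ln r / PI < Im tau)%R by (generalize (Rmax_r 1 (- ln r / PI + 1)); lra).
  assert (- ln r / PI * PI < Im tau * PI)%R by (apply Rmult_lt_compat_r; lra).
  replace (- ln r / PI * PI)%R with (- ln r)%R in H0 by (field; lra). lra.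
Qed.

(** The reciprocal of [jpoly] extends holomorphically to $0$ and vanishes there. *)
Lemma j_large_of_lambda (B : R) : (0 < B)%R -> exists r, (0 < r)%R /\
  forall x : C, x <> RtoC 0 -> x <> RtoC 1 -> (Cmod x < r)%R -> (B < Cmod (jpoly x))%R.
Proof.
  intros HB.
  set (k := fun x : C => 27 / 4 * (x ^ 2 * (1 - x) ^ 2 / (x ^ 2 - x + 1) ^ 3)).
  assert (Hk : holo k 0).
  { apply (holo_mult (fun _ => 27 / 4)); [apply holo_const|].
    apply (holo_div (fun x => x ^ 2 * (1 - x) ^ 2) (fun x => (x ^ 2 - x + 1) ^ 3)).
    - apply (holo_mult (fun x => x ^ 2) (fun x => (1 - x) ^ 2)).
      + apply (holo_pow (fun x => x)); apply holo_id.
      + apply (holo_pow (fun x => 1 - x)). apply holo_minus; [apply holo_const | apply holo_id].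
    - apply (holo_pow (fun x => x ^ 2 - x + 1)). apply holo_plus; [|apply holo_const].
      apply holo_minus; [apply (holo_pow (fun x => x)); apply holo_id | apply holo_id].
    - apply Cpow_nz. intro X. apply C1_nz. rewrite <- X. simpl. ring. }
  assert (K0 : k 0 = 0) by (unfold k; simpl; field).
  assert (NP : near 0 (fun x : C => x ^ 2 - x + 1 <> 0)).
  { apply (ccont_neq0 (fun x => x ^ 2 - x + 1)).
    - apply holo_ccont. apply holo_plus; [|apply holo_const].
      apply holo_minus; [apply (holo_pow (fun x => x)); apply holo_id | apply holo_id].
    - intro X. apply C1_nz. rewrite <- X. simpl. ring. }
  destruct (near_and _ _ _ NP (holo_ccont _ _ Hk (/ B)%R ltac:(now apply Rinv_0_lt_compat))) as (r & Hr & K).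
  exists r. split; auto. intros x H0 H1 Hx. destruct (K x) as [P Q].
  { now replace (x - 0) with x by ring. }
  rewrite K0 in Q. replace (k x - 0) with (k x) in Q by ring.
  assert (H2 := minus_neq0 1 x (not_eq_sym H1)). assert (H27 := RtoC_IZR_neq0 27 ltac:(lia)). assert (H4 := RtoC_IZR_neq0 4 ltac:(lia)).
  assert (E : k x * jpoly x = 1) by (unfold k, jpoly; field; repeat split; auto).
  assert (M : (Cmod (k x) * Cmod (jpoly x) = 1)%R) by (rewrite <- Cmod_mult, E; apply Cmod_1).
  assert (Pk := Cmod_ge_0 (k x)). assert (Pj := Cmod_ge_0 (jpoly x)).
  destruct (Rlt_le_dec B (Cmod (jpoly x))) as [|L]; auto. exfalso.
  assert (Cmod (k x) * Cmod (jpoly x) <= Cmod (k x) * B)%R by (apply Rmult_le_compat_l; auto).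
  assert (Cmod (k x) * B < / B * B)%R by (apply Rmult_lt_compat_r; auto).
  rewrite Rinv_l in H3 by lra. lra.
Qed.

Lemma j_cusp (B : R) : (0 < B)%R -> exists M, (1 <= M)%R /\
  forall tau, upper_half_plane tau -> (M <= Im tau)%R -> (B < Cmod (j_inv tau))%R.
Proof.
  intros HB. destruct (j_large_of_lambda B HB) as (r & Hr & K).
  destruct (lambda_cusp r Hr) as (r' & Hr' & K'). destruct (nome_small r' Hr') as (M & HM & K'').
  exists M. split; auto. intros tau H HMt. rewrite j_inv_jpoly.
  apply K; [now apply lambda_neq0 | now apply lambda_neq1 | auto].
Qed.

(** A Lebesgue number for the cover of a compact box by squares of half-side [delta]. The bound on
    [Im sigma] keeps the centres in the half-plane. *)
Lemma box_lebesgue (N : R) (delta : C -> R) : (forall tau, (0 < delta tau)%R) ->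
  exists d, (0 < d)%R /\ forall tau, in_box N tau -> exists sigma,
    (/ N <= Im sigma)%R /\ (Rabs (Re tau - Re sigma) < delta sigma)%R /\ (Rabs (Im tau - Im sigma) < delta sigma)%R /\ (d <= delta sigma)%R.
Proof.
  intros Hd. destruct (compactness_value_2d (- N) N (/ N) N (fun u v => mkposreal (delta (u, v)) (Hd (u, v)))) as [d K].
  exists d. split; [apply cond_pos|]. intros [x y] [Hx Hy]. simpl in *.
  apply Rabs_le_between in Hx. specialize (K x y Hx Hy). apply NNPP in K.
  destruct K as (u & v & Hu & Hv & K1 & K2 & K3). exists (u, v). simpl in *. repeat split; auto. lra.
Qed.

Lemma near_box (tau : C) (P : C -> Prop) : near tau P -> exists d, (0 < d)%R /\ forall w,
  (Rabs (Re w - Re tau) < d)%R -> (Rabs (Im w - Im tau) < d)%R -> P w.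
Proof.
  intros (d & Hd & K). exists (d / 2)%R. split; [lra|]. intros w H1 H2. apply K.
  eapply Rle_lt_trans; [apply Cmod_le_comp|].
  change (Re (w - tau)) with (Re w - Re tau)%R. change (Im (w - tau)) with (Im w - Im tau)%R. lra.
Qed.

(** One radius serves every sheet over the disc; the values of [G] outside of the disc are
    arbitrary. *)
Definition covers (phi : C -> C) (w0 : C) (rho : R) : Prop :=
  forall tau1, upper_half_plane tau1 -> (Cmod (phi tau1 - w0) < rho)%R ->
  exists G : C -> C, G (phi tau1) = tau1 /\
    forall w, (Cmod (w - w0) < rho)%R -> upper_half_plane (G w) /\ phi (G w) = w /\ holo G w.

(** Transformations preserving [phi] bring every preimage near [w0] into one compact box. There each
    point has a square with a local inverse of [phi], or a square on which [phi] avoids a disc about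
    [w0]; a Lebesgue number gives a common radius, and the inverse transformation carries the
    section back. *)
Lemma uniform_cover (phi : C -> C) (w0 : C) (N eta : R) :
  (forall tau, upper_half_plane tau -> holo phi tau) ->
  (forall tau, upper_half_plane tau -> phi tau = w0 -> Cderiv phi tau <> 0) ->
  (1 <= N)%R -> (0 < eta)%R ->
  (forall tau, upper_half_plane tau -> (Cmod (phi tau - w0) < eta)%R ->
     exists g, modular g /\ (forall t, upper_half_plane t -> phi (g t) = phi t) /\ in_box N (g tau)) ->
  exists rho, (0 < rho)%R /\ covers phi w0 rho.
Proof.
  intros Hphi Hcrit HN Heta Hred.
  (* A single number [d] is at once the size of the square, the allowed distance of [phi tau] from
     [w0] and the radius of the section, so that choosing it pointwise gives a gauge for
     [box_lebesgue]. *)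
  set (good := fun (s : C) (d : R) => (0 < d)%R /\ (upper_half_plane s -> forall tau, upper_half_plane tau ->
     (Rabs (Re tau - Re s) < d)%R -> (Rabs (Im tau - Im s) < d)%R -> (Cmod (phi tau - w0) < d)%R ->
     exists G : C -> C, G (phi tau) = tau /\
       forall w, (Cmod (w - w0) < d)%R -> upper_half_plane (G w) /\ phi (G w) = w /\ holo G w)).
  assert (Hgood : forall s, exists d, good s d).
  { intros s. destruct (classic (upper_half_plane s)) as [Us|Ns].
    2:{ exists 1%R. split; [lra | tauto]. }
    destruct (Ceq_dec (phi s) w0) as [E|Ne].
    - destruct (near_uhp s Us) as (e & He & Ke).
      destruct (local_inverse phi s (Cderiv phi s) e He (Hphi s Us) (Cderiv_correct _ _ (Hphi s Us)) (Hcrit s Us E))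
        as (et & de & G & [Het Hee] & Hde & Hinj & HG).
      rewrite E in HG.
      assert (Nb : near s (fun w => Cmod (w - s) < et)%R) by (exists et; auto).
      destruct (near_box s _ Nb) as (d1 & Hd1 & K1).
      exists (Rmin d1 de). split; [now apply Rmin_pos|]. intros _ tau Ut R1 R2 R3.
      exists G. split.
      + destruct (HG (phi tau)) as (G1 & G2 & _); [eapply Rlt_le_trans; [apply R3 | apply Rmin_r]|].
        apply Hinj; auto. apply K1; (eapply Rlt_le_trans; [eassumption | apply Rmin_l]).
      + intros w Hw. destruct (HG w) as (G1 & G2 & G3); [eapply Rlt_le_trans; [apply Hw | apply Rmin_r]|].
        repeat split; auto. apply Ke. lra.
    - assert (Hm : (0 < Cmod (phi s - w0))%R) by now apply Cmod_gt_0, minus_neq0.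
      destruct (near_box s _ (holo_ccont _ _ (Hphi s Us) (Cmod (phi s - w0) / 2)%R ltac:(lra))) as (d1 & Hd1 & K1).
      exists (Rmin d1 (Cmod (phi s - w0) / 2)). split; [apply Rmin_pos; lra|]. intros _ tau Ut R1 R2 R3. exfalso.
      specialize (K1 tau (Rlt_le_trans _ _ _ R1 (Rmin_l _ _)) (Rlt_le_trans _ _ _ R2 (Rmin_l _ _))).
      assert (R4 := Rlt_le_trans _ _ _ R3 (Rmin_r _ _)).
      assert (T : (Cmod (phi s - w0) <= Cmod (phi tau - w0) + Cmod (phi tau - phi s))%R).
      { replace (phi s - w0) with ((phi tau - w0) + - (phi tau - phi s)) at 1 by ring.
        eapply Rle_trans; [apply Cmod_triangle|]. rewrite Cmod_opp. lra. }
      lra. }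
  set (delta := fun s => epsilon (inhabits 1%R) (good s)).
  assert (Hdelta : forall s, good s (delta s)) by (intros s; unfold delta; apply epsilon_spec, Hgood).
  destruct (box_lebesgue N delta (fun s => proj1 (Hdelta s))) as (d & Hd & K).
  exists (Rmin d eta). split; [now apply Rmin_pos|]. intros tau1 U1 H1.
  assert (Hd1 := Rlt_le_trans _ _ _ H1 (Rmin_l _ _)). assert (He1 := Rlt_le_trans _ _ _ H1 (Rmin_r _ _)).
  destruct (Hred tau1 U1 He1) as (g & Mg & Pg & Bg).
  destruct (K _ Bg) as (s & Us & K1 & K2 & K3).
  assert (Us' : upper_half_plane s) by (unfold upper_half_plane; assert (0 < / N)%R by (apply Rinv_0_lt_compat; lra); lra).
  destruct (Hdelta s) as [_ Hs].
  destruct (Hs Us' (g tau1) (modular_uhp g tau1 Mg U1) K1 K2) as (G & G1 & G2).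
  { rewrite Pg by auto. lra. }
  destruct (modular_inv g Mg) as (h & Mh & Hh).
  exists (fun w => h (G w)). rewrite Pg in G1 by auto. split.
  - rewrite G1. now apply Hh.
  - intros w Hw. assert (Hw' := Rlt_le_trans _ _ _ Hw (Rmin_l _ _)). destruct (G2 w ltac:(lra)) as (A1 & A2 & A3).
    assert (Uh := modular_uhp h (G w) Mh A1). repeat split; auto.
    + rewrite <- (Pg (h (G w))) by auto. rewrite (proj2 (Hh (G w) A1)). auto.
    + apply (holo_comp G h); auto. now apply modular_holo.
Qed.

(** A reduced point high in the half-plane has a large value of $j$, so reduced preimages of values
    near [w0] stay in a box. *)
Theorem j_cover (w0 : C) : w0 <> 0 -> w0 <> 1 -> exists rho, (0 < rho)%R /\ covers j_inv w0 rho.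
Proof.
  intros H0 H1. destruct (j_cusp (Cmod w0 + 1)) as (M & HM & K); [generalize (Cmod_ge_0 w0); lra|].
  apply (uniform_cover j_inv w0 (M + 1) 1); try lra.
  - intros; now apply holo_j.
  - intros tau H E. apply j_deriv_neq0; auto; now rewrite E.
  - intros tau H Hj. destruct (modular_reduction tau H) as (g & Mg & G1 & G2). exists g. split; auto. split.
    + intros t Ht. now apply j_modular.
    + split; [lra|]. split.
      * apply Rle_trans with (/ 2)%R; auto. apply Rinv_le_contravar; lra.
      * destruct (Rle_lt_dec (Im (g tau)) M) as [|L]; [lra|]. exfalso.
        assert (B := K (g tau) (modular_uhp g tau Mg H) ltac:(lra)). rewrite j_modular in B by auto.
        assert (Cmod (j_inv tau) <= Cmod (j_inv tau - w0) + Cmod w0)%R; [|lra].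
        replace (j_inv tau) with ((j_inv tau - w0) + w0) at 1 by ring. apply Cmod_triangle.
Qed.

(** Reduction changes $\lambda$ by one of the six functions; a fixed transformation undoes this, and
    six of them have a common box. *)
Theorem lambda_cover (w0 : C) : w0 <> 0 -> w0 <> 1 -> exists rho, (0 < rho)%R /\ covers lambda w0 rho.
Proof.
  intros H0 H1. destruct (j_cusp (Cmod (jpoly w0) + 1)) as (M & HM & K); [generalize (Cmod_ge_0 (jpoly w0)); lra|].
  destruct (holo_ccont _ _ (holo_jpoly w0 H0 H1) 1%R ltac:(lra)) as (eta & Heta & Kj).
  set (hs := fun i => epsilon (inhabits (fun t : C => t)) (fun g => modular g /\ boxed g /\
    forall (x : C) tau, upper_half_plane tau -> x <> 0 -> x <> RtoC 1 -> lambda tau = anharm i x -> lambda (g tau) = x)).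
  assert (Hhs : forall i, modular (hs i) /\ boxed (hs i) /\
    forall (x : C) tau, upper_half_plane tau -> x <> 0 -> x <> RtoC 1 -> lambda tau = anharm i x -> lambda (hs i tau) = x).
  { intros i. unfold hs. apply epsilon_spec, anharm_inverse. }
  assert (HB : forall k, exists N', (1 <= N')%R /\ forall i, (i < k)%nat -> forall tau, in_box (M + 1) tau -> in_box N' (hs i tau)).
  { induction k as [|k (N1 & HN1 & IH)]; [exists 1%R; split; [lra | intros; lia]|].
    destruct (Hhs k) as (_ & Bk & _). destruct (Bk (M + 1)%R ltac:(lra)) as (N2 & HN2 & K2).
    exists (Rmax N1 N2). split; [eapply Rle_trans; [apply HN1 | apply Rmax_l]|].
    intros i Hi tau Ht.
    assert (W : forall N', (1 <= N')%R -> (N' <= Rmax N1 N2)%R -> in_box N' (hs i tau) -> in_box (Rmax N1 N2) (hs i tau)).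
    { intros N' HN' L (A1 & A2 & A3). split; [lra|]. split; [|lra].
      eapply Rle_trans; [|apply A2]. apply Rinv_le_contravar; lra. }
    destruct (Nat.eq_dec i k) as [->|].
    - apply (W N2); auto. apply Rmax_r.
    - apply (W N1); auto. apply Rmax_l. apply IH; auto. lia. }
  destruct (HB 6%nat) as (N' & HN' & KB).
  apply (uniform_cover lambda w0 N' eta); auto.
  - intros; now apply holo_lambda.
  - intros; now apply lambda_deriv_neq0.
  - intros tau H Hl. destruct (modular_reduction tau H) as (g & Mg & G1 & G2).
    assert (Ug := modular_uhp g tau Mg H).
    assert (Bg : in_box (M + 1) (g tau)).
    { split; [lra|]. split.
      * apply Rle_trans with (/ 2)%R; auto. apply Rinv_le_contravar; lra.
      * destruct (Rle_lt_dec (Im (g tau)) M) as [|L]; [lra|]. exfalso.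
        assert (B := K (g tau) Ug ltac:(lra)). rewrite j_modular, j_inv_jpoly in B by auto.
        specialize (Kj _ Hl).
        assert (Cmod (jpoly (lambda tau)) <= Cmod (jpoly (lambda tau) - jpoly w0) + Cmod (jpoly w0))%R; [|lra].
        replace (jpoly (lambda tau)) with ((jpoly (lambda tau) - jpoly w0) + jpoly w0) at 1 by ring. apply Cmod_triangle. }
    destruct (lambda_modular g Mg) as [i Hi].
    (* All indices from $5$ on denote the same default branch of [anharm], so finitely many
       suffice. *)
    assert (Hi' : exists i, (i < 6)%nat /\ forall t, upper_half_plane t -> lambda (g t) = anharm i (lambda t)).
    { destruct (le_lt_dec 6 i) as [L|L]; [|exists i; auto]. exists 5%nat. split; [lia|]. intros t Ht. rewrite Hi by auto.
      do 6 (destruct i as [|i]; [lia|]). reflexivity. }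
    clear i Hi. destruct Hi' as (i & L6 & Hi).
    destruct (Hhs i) as (Mh & _ & Lh).
    exists (fun t => hs i (g t)). split; [now apply modular_comp|]. split.
    + intros t Ht. apply Lh; auto; [now apply modular_uhp | now apply lambda_neq0 | now apply lambda_neq1].
    + apply (KB i L6), Bg.
Qed.

(* Differentiating [phi (G w) = w]. *)
Lemma section_crit (phi G : C -> C) (w0 : C) :
  holo phi (G w0) -> holo G w0 -> near w0 (fun w => phi (G w) = w) -> Cderiv phi (G w0) <> 0.
Proof.
  intros Hp HG Hn X.
  assert (D := cder_comp G phi w0 _ _ (Cderiv_correct _ _ HG) (Cderiv_correct _ _ Hp)).
  assert (D' := cder_ext _ _ _ _ Hn D). assert (E := cder_unique _ _ _ _ D' (cder_id w0)).
  rewrite X in E. apply C1_nz. rewrite <- E. ring.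
Qed.

(** Two sections with a common value agree near that point by local injectivity, and then on the
    whole disc by the identity theorem. *)
Lemma sections_agree (phi G1 G2 : C -> C) (w0 w1 : C) (rho : R) :
  (forall w, (Cmod (w - w0) < rho)%R -> holo phi (G1 w) /\ phi (G1 w) = w /\ holo G1 w) ->
  (forall w, (Cmod (w - w0) < rho)%R -> phi (G2 w) = w /\ holo G2 w) ->
  (Cmod (w1 - w0) < rho)%R -> G1 w1 = G2 w1 ->
  forall w, (Cmod (w - w0) < rho)%R -> G1 w = G2 w.
Proof.
  intros H1 H2 Hw1 E w Hw. destruct (H1 w1 Hw1) as (A1 & A2 & A3). destruct (H2 w1 Hw1) as (B1 & B2).
  assert (Hn := near_disc w0 w1 rho Hw1).
  assert (N : near w1 (fun w => G1 w = G2 w)).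
  { apply (section_unique phi G1 G2 w1 (Cderiv phi (G1 w1))); auto using holo_ccont, Cderiv_correct.
    - apply section_crit; auto. revert Hn. apply near_imp. intros v Hv. now apply H1.
    - revert Hn. apply near_imp. intros v Hv. destruct (H1 v Hv) as (_ & -> & _). destruct (H2 v Hv) as (-> & _). auto. }
  apply (near_self w (fun w => G1 w = G2 w)).
  apply (identity_theorem_eq (fun w => Cmod (w - w0) < rho)%R G1 G2 w1 w); auto using convex_disc.
  - intros z Hz. now apply H1.
  - intros z Hz. now apply H2.
Qed.

(** * Orbits over small values of lambda *)

Lemma bounded_on_box (f : C -> C) (N : R) : (1 <= N)%R ->
  (forall tau, upper_half_plane tau -> holo f tau) ->
  exists B, (0 < B)%R /\ forall tau, in_box N tau -> (Cmod (f tau) <= B)%R.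
Proof.
  intros HN Hf.
  (* With the bound written as [/ d], one number controls both the square and the size of [f]; a
     Lebesgue number then yields a global bound. *)
  set (good := fun (s : C) (d : R) => (0 < d)%R /\ (upper_half_plane s -> forall w,
    (Rabs (Re w - Re s) < d)%R -> (Rabs (Im w - Im s) < d)%R -> (Cmod (f w) <= / d)%R)).
  assert (Hgood : forall s, exists d, good s d).
  { intros s. destruct (classic (upper_half_plane s)) as [Us|Ns].
    2:{ exists 1%R. split; [lra | tauto]. }
    destruct (near_box s _ (holo_ccont _ _ (Hf s Us) 1%R ltac:(lra))) as (d & Hd & K).
    assert (P := Cmod_ge_0 (f s)).
    exists (Rmin d (/ (Cmod (f s) + 1))). split; [apply Rmin_pos; auto; apply Rinv_0_lt_compat; lra|].
    intros _ w R1 R2. specialize (K w (Rlt_le_trans _ _ _ R1 (Rmin_l _ _)) (Rlt_le_trans _ _ _ R2 (Rmin_l _ _))).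
    apply Rle_trans with (Cmod (f s) + 1)%R.
    - replace (f w) with ((f w - f s) + f s) by ring. eapply Rle_trans; [apply Cmod_triangle | lra].
    - rewrite <- (Rinv_inv (Cmod (f s) + 1)) at 1. apply Rinv_le_contravar; [|apply Rmin_r].
      apply Rmin_pos; auto. apply Rinv_0_lt_compat; lra. }
  set (delta := fun s => epsilon (inhabits 1%R) (good s)).
  assert (Hdelta : forall s, good s (delta s)) by (intros s; unfold delta; apply epsilon_spec, Hgood).
  destruct (box_lebesgue N delta (fun s => proj1 (Hdelta s))) as (d & Hd & K).
  exists (/ d)%R. split; [now apply Rinv_0_lt_compat|]. intros tau Ht.
  destruct (K tau Ht) as (s & Us & K1 & K2 & K3).
  assert (Us' : upper_half_plane s) by (unfold upper_half_plane; assert (0 < / N)%R by (apply Rinv_0_lt_compat; lra); lra).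
  eapply Rle_trans; [apply (proj2 (Hdelta s) Us'); auto|]. now apply Rinv_le_contravar.
Qed.

(** Classically the principal congruence subgroup of level $2$, described here by its effect on
    $\lambda$. *)
Definition lambda_fixing (g : C -> C) : Prop :=
  modular g /\ forall t, upper_half_plane t -> lambda (g t) = lambda t.

Lemma lambda_fixing_comp (g h : C -> C) : lambda_fixing g -> lambda_fixing h -> lambda_fixing (fun t => g (h t)).
Proof.
  intros [M1 L1] [M2 L2]. split; [now apply modular_comp|]. intros t Ht. rewrite L1; auto. now apply modular_uhp.
Qed.

Lemma lambda_fixing_inv (g : C -> C) : lambda_fixing g -> exists h, lambda_fixing h /\
  forall tau, upper_half_plane tau -> h (g tau) = tau /\ g (h tau) = tau.
Proof.
  intros [M L]. destruct (modular_inv g M) as (h & Mh & Hh). exists h. split; auto. split; auto.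
  intros t Ht. rewrite <- (L (h t)) by now apply modular_uhp. now rewrite (proj2 (Hh t Ht)).
Qed.

Lemma lambda_T2k (k : Z) (tau : C) : upper_half_plane tau -> lambda (tau + RtoC (2 * IZR k)) = lambda tau.
Proof.
  intros H.
  assert (S : forall t, upper_half_plane t -> upper_half_plane (t + 2) /\ lambda (t + 2) = lambda t).
  { intros t Ht. assert (U1 := uhp_plus1 t Ht). replace (t + 2) with (t + 1 + 1) by ring. split; [now apply uhp_plus1|].
    rewrite !lambda_T by auto. assert (N0 := lambda_neq0 t Ht). assert (N1 := minus_neq0 _ _ (lambda_neq1 t Ht)).
    field; repeat split; auto; intro X; first [neq_from C1_nz X | neq_from N1 X]. }
  assert (P : forall m : nat, forall t, upper_half_plane t ->
    upper_half_plane (t + RtoC (2 * INR m)) /\ lambda (t + RtoC (2 * INR m)) = lambda t).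
  { induction m as [|m IH]; intros t Ht.
    - simpl. rewrite Rmult_0_r. replace (t + 0) with t by ring. auto.
    - destruct (IH t Ht) as [U E]. destruct (S _ U) as [U2 E2]. rewrite S_INR.
      replace (t + RtoC (2 * (INR m + 1))) with (t + RtoC (2 * INR m) + 2) by (rewrite !RtoC_mult, RtoC_plus; ring).
      split; auto. now rewrite E2. }
  destruct (Z_le_dec 0 k) as [L|L].
  - replace (IZR k) with (INR (Z.to_nat k)) by (rewrite INR_IZR_INZ; f_equal; lia). now apply P.
  - set (m := Z.to_nat (- k)).
    assert (Ek : IZR k = (- INR m)%R) by (unfold m; rewrite INR_IZR_INZ, <- opp_IZR; f_equal; lia).
    assert (U : upper_half_plane (tau + RtoC (2 * IZR k))) by (unfold upper_half_plane in *; destruct tau; simpl in *; lra).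
    destruct (P m _ U) as [_ E]. rewrite <- E. f_equal. rewrite Ek, !RtoC_mult, RtoC_opp. ring.
Qed.

Lemma lambda_fixing_T2k (k : Z) : lambda_fixing (fun t => t + RtoC (2 * IZR k)).
Proof.
  split; [|intros; now apply lambda_T2k]. rewrite <- mult_IZR. apply (modular_T (2 * k)).
Qed.

(** A small $\lambda(\tau)$ makes $j$ large, so the reduced point is high and $\lambda$ is small
    there too. Of the six functions only $x$ and $x/(x-1)$ allow this, and a further translation by
    $1$ corrects the second. *)
Lemma lambda_cusp_reduction (M : R) : (1 <= M)%R -> exists eps, (0 < eps)%R /\
  forall tau, upper_half_plane tau -> (Cmod (lambda tau) < eps)%R ->
  exists g, lambda_fixing g /\ (M <= Im (g tau))%R.
Proof.
  intros HM0. destruct (lambda_cusp (/ 4) ltac:(lra)) as (r & Hr & Kr). destruct (nome_small r Hr) as (M1 & HM1 & Kn).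
  set (M2 := Rmax M M1). assert (L1 : (M <= M2)%R) by apply Rmax_l. assert (L2 : (M1 <= M2)%R) by apply Rmax_r.
  destruct (bounded_on_box j_inv (M2 + 1) ltac:(lra) holo_j) as (B & HB & KB).
  destruct (j_large_of_lambda B HB) as (r2 & Hr2 & Kj).
  exists (Rmin (/ 4) r2). split; [apply Rmin_pos; lra|]. intros tau H Hl.
  assert (Hl1 := Rlt_le_trans _ _ _ Hl (Rmin_l _ _)). assert (Hl2 := Rlt_le_trans _ _ _ Hl (Rmin_r _ _)).
  assert (N0 := lambda_neq0 tau H). assert (N1 := lambda_neq1 tau H).
  destruct (modular_reduction tau H) as (g & Mg & G1 & G2). assert (Ug := modular_uhp g tau Mg H).
  assert (HI : (M2 <= Im (g tau))%R).
  { destruct (Rle_lt_dec M2 (Im (g tau))) as [|L]; auto. exfalso.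
    assert (Bx : in_box (M2 + 1) (g tau)).
    { split; [lra|]. split; [|lra]. apply Rle_trans with (/ 2)%R; auto. apply Rinv_le_contravar; lra. }
    assert (X := KB _ Bx). rewrite j_modular in X by auto. assert (Y := Kj _ N0 N1 Hl2). rewrite <- j_inv_jpoly in Y. lra. }
  assert (Hs := Kr _ Ug (Kn (g tau) ltac:(lra))).
  destruct (lambda_modular g Mg) as [i Hi]. rewrite Hi in Hs by auto.
  set (x := lambda tau) in *.
  assert (Px : (0 < Cmod x)%R) by now apply Cmod_gt_0.
  (* For $|x|<\frac14$ the values $1-x$, $1/x$, $1-1/x$ and $1/(1-x)$ have modulus at least
     $\frac34$, $4$, $3$ and $\frac45$, all excluded by [Hs]. *)
  assert (Q1 : (3 / 4 <= Cmod (1 - x))%R).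
  { assert (T := Cmod_triangle (1 - x) x). replace (1 - x + x) with (RtoC 1) in T by ring. rewrite Cmod_1 in T. lra. }
  assert (Q2 : (Cmod (1 - x) <= 5 / 4)%R).
  { assert (T := Cmod_triangle 1 (- x)). rewrite Cmod_opp, Cmod_1 in T. change (1 + - x) with (1 - x) in T. lra. }
  assert (Nx1 : 1 - x <> 0) by (apply minus_neq0; auto).
  assert (Q3 : (4 <= Cmod (/ x))%R).
  { rewrite Cmod_inv by auto. rewrite <- (Rinv_inv 4). apply Rinv_le_contravar; lra. }
  assert (Q4 : (4 / 5 <= Cmod (/ (1 - x)))%R).
  { rewrite Cmod_inv by auto. replace (4 / 5)%R with (/ (5 / 4))%R by field; apply Rinv_le_contravar; lra. }
  assert (Q5 : (3 <= Cmod (1 - / x))%R).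
  { assert (T := Cmod_triangle (1 - / x) (- (1))). rewrite Cmod_opp, Cmod_1 in T.
    replace (1 - / x + - (1)) with (- / x) in T by ring. rewrite Cmod_opp in T. lra. }
  assert (Cases : i = 0%nat \/ forall y, anharm i y = y / (y - 1)).
  { destruct i as [|[|[|[|[|i]]]]]; simpl in Hs; auto; lra. }
  destruct Cases as [-> | Ci].
  - exists g. split; [|lra]. split; auto.
  - exists (fun t => g t + RtoC (IZR 1)). split.
    + split; [apply (modular_comp (fun t => t + RtoC (IZR 1)) g); auto; apply modular_T|].
      intros t Ht. assert (Ut := modular_uhp g t Mg Ht). change (RtoC (IZR 1)) with (RtoC 1). rewrite lambda_T, Hi, Ci by auto.
      assert (M0 := lambda_neq0 t Ht). assert (M3 := minus_neq0 _ _ (lambda_neq1 t Ht)).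
      field; repeat split; auto; intro X; first [neq_from C1_nz X | neq_from M3 X].
    + destruct (g tau); simpl in *. lra.
Qed.

(** Both points are moved high up without changing $\lambda$. There $\lambda$ determines the nome,
    and equal nomes differ by an even translation. *)
Lemma lambda_cusp_orbit : exists eps, (0 < eps)%R /\ forall tau1 tau2,
  upper_half_plane tau1 -> upper_half_plane tau2 -> lambda tau1 = lambda tau2 -> (Cmod (lambda tau1) < eps)%R ->
  exists g, lambda_fixing g /\ g tau1 = tau2.
Proof.
  destruct nome_inj_of_lambda as (r & Hr & Kr). destruct (nome_small r Hr) as (M & HM & Kn).
  destruct (lambda_cusp_reduction M HM) as (eps & He & K). exists eps. split; auto.
  intros t1 t2 U1 U2 E Hl. destruct (K t1 U1 Hl) as (g1 & F1 & I1). rewrite E in Hl. destruct (K t2 U2 Hl) as (g2 & F2 & I2).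
  assert (V1 := modular_uhp g1 t1 (proj1 F1) U1). assert (V2 := modular_uhp g2 t2 (proj1 F2) U2).
  assert (En := Kr _ _ V2 V1 (Kn _ I2) (Kn _ I1)). rewrite (proj2 F1), (proj2 F2) in En by auto. specialize (En (eq_sym E)).
  destruct (nome_eq _ _ En) as [k Ek]. destruct (lambda_fixing_inv g2 F2) as (h & Fh & Hh).
  exists (fun t => h (g1 t + RtoC (2 * IZR k))). split.
  - apply (lambda_fixing_comp h (fun t => g1 t + RtoC (2 * IZR k))); auto.
    apply (lambda_fixing_comp (fun t => t + RtoC (2 * IZR k)) g1); auto. apply lambda_fixing_T2k.
  - rewrite <- Ek. now apply Hh.
Qed.

(* The property propagates outwards along the ray from [0] to [x] by the covering property of [lambda]. *)
Theorem lambda_orbit (x : C) : x <> 0 -> (forall s : R, (0 < s <= 1)%R -> RtoC s * x <> 1) ->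
  forall tau1 tau2, upper_half_plane tau1 -> upper_half_plane tau2 -> lambda tau1 = x -> lambda tau2 = x ->
  exists g, modular g /\ g tau1 = tau2.
Proof.
  intros H0 Hx. destruct lambda_cusp_orbit as (eps & He & Kc).
  assert (Px : (0 < Cmod x)%R) by now apply Cmod_gt_0.
  (* The start $ex$ of the ray has modulus at most half of the radius where [lambda_cusp_orbit]
     applies; $e\le\frac12$ keeps $1-e$ positive. *)
  set (e := Rmin (/ 2) (eps / (2 * Cmod x))).
  assert (He0 : (0 < e)%R) by (apply Rmin_pos; [lra | apply Rdiv_lt_0_compat; lra]).
  assert (He1 : (e <= / 2)%R) by apply Rmin_l.
  set (p := fun s : R => RtoC (e + s * (1 - e)) * x).
  assert (Hps : forall s, (0 <= s <= 1)%R -> (0 < e + s * (1 - e) <= 1)%R) by (intros; split; nra).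
  assert (Hp0 : forall s, (0 <= s <= 1)%R -> p s <> 0).
  { intros s Hs. apply Cmult_neq_0; auto. apply RtoC_neq0. specialize (Hps s Hs). lra. }
  assert (Hp1 : forall s, (0 <= s <= 1)%R -> p s <> 1) by (intros s Hs; apply Hx, Hps, Hs).
  assert (Main : forall s, (0 <= s <= 1)%R -> forall t1 t2, upper_half_plane t1 -> upper_half_plane t2 ->
    lambda t1 = p s -> lambda t2 = p s -> exists g, lambda_fixing g /\ g t1 = t2).
  { refine (uniform_induction (fun s => forall t1 t2, upper_half_plane t1 -> upper_half_plane t2 ->
    lambda t1 = p s -> lambda t2 = p s -> exists g, lambda_fixing g /\ g t1 = t2) _ _).
    - intros t1 t2 U1 U2 E1 E2. apply Kc; auto; [congruence|]. rewrite E1. unfold p.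
      rewrite Cmod_mult, Cmod_R, Rabs_pos_eq by nra.
      apply Rle_lt_trans with (eps / (2 * Cmod x) * Cmod x)%R.
      + apply Rmult_le_compat_r; [lra|]. replace (e + 0 * (1 - e))%R with e by ring. apply Rmin_r.
      + replace (eps / (2 * Cmod x) * Cmod x)%R with (eps / 2)%R by (field; lra). lra.
    - intros t Ht. destruct (lambda_cover (p t) (Hp0 t Ht) (Hp1 t Ht)) as (rho & Hrho & Cov).
      exists (rho / Cmod x)%R. split; [now apply Rdiv_lt_0_compat|].
      assert (Hclose : forall s, (Rabs (s - t) < rho / Cmod x)%R -> (Cmod (p s - p t) < rho)%R).
      { intros s Hs. replace (p s - p t) with (RtoC ((s - t) * (1 - e)) * x)
          by (unfold p; rewrite !RtoC_plus, !RtoC_mult, !RtoC_minus; ring).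
        rewrite Cmod_mult, Cmod_R, Rabs_mult, (Rabs_pos_eq (1 - e)) by lra.
        apply Rle_lt_trans with (Rabs (s - t) * Cmod x)%R.
        - apply Rmult_le_compat_r; [lra|]. generalize (Rabs_pos (s - t)). nra.
        - apply Rlt_le_trans with (rho / Cmod x * Cmod x)%R; [now apply Rmult_lt_compat_r|]. right; field; lra. }
      intros s s' Hs Hs' D D' IH t1 t2 U1 U2 E1 E2.
      assert (C1 := Hclose s D). assert (C1' := Hclose s' D').
      destruct (Cov t1 U1) as (G1 & A1 & B1); [now rewrite E1|]. destruct (Cov t2 U2) as (G2 & A2 & B2); [now rewrite E2|].
      rewrite E1 in A1. rewrite E2 in A2.
      destruct (B1 (p s) C1) as (V1 & L1 & _). destruct (B2 (p s) C1) as (V2 & L2 & _).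
      destruct (IH (G1 (p s)) (G2 (p s)) V1 V2 L1 L2) as (g & Fg & Eg).
      exists g. split; auto. rewrite <- A1, <- A2.
      apply (sections_agree lambda (fun w => g (G1 w)) G2 (p t) (p s) rho); auto.
      + intros w Hw. destruct (B1 w Hw) as (W1 & W2 & W3). repeat split.
        * apply holo_lambda, modular_uhp; auto. apply Fg.
        * now rewrite (proj2 Fg).
        * apply (holo_comp G1 g); auto. apply modular_holo; auto. apply Fg.
      + intros w Hw. destruct (B2 w Hw) as (W1 & W2 & W3). auto. }
  intros t1 t2 U1 U2 E1 E2. assert (Ep : p 1%R = x) by (unfold p; replace (e + 1 * (1 - e))%R with 1%R by ring; ring).
  destruct (Main 1%R ltac:(lra) t1 t2 U1 U2) as (g & Fg & Eg); [congruence | congruence|].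
  exists g. split; auto. apply Fg.
Qed.

(** * The orbits of i and of the sixth root of unity *)

Definition rho6 : C := - omega ^ 2.

Lemma rho6_spec : upper_half_plane rho6 /\ rho6 ^ 2 - rho6 + 1 = 0.
Proof.
  assert (S3 : (sqrt 3 * sqrt 3 = 3)%R) by (apply sqrt_sqrt; lra). assert (P3 : (0 < sqrt 3)%R) by (apply sqrt_lt_R0; lra).
  assert (E : rho6 = (/ 2, sqrt 3 / 2)%R).
  { unfold rho6, omega. assert (E0 : (-1 + RtoC (sqrt 3) * Ci) / 2 = (- / 2, sqrt 3 / 2)%R).
    { unfold Cdiv, Cinv, Cplus, Cmult, Ci, RtoC; simpl. f_equal; field. }
    rewrite E0. unfold Copp, Cmult, RtoC; simpl. f_equal; [|field].
    replace (- / 2 * (- / 2 * 1 - sqrt 3 / 2 * 0) - sqrt 3 / 2 * (- / 2 * 0 + sqrt 3 / 2 * 1))%R with (/ 4 - sqrt 3 * sqrt 3 / 4)%R by field.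
    rewrite S3. field. }
  rewrite E. split.
  - unfold upper_half_plane. simpl. lra.
  - unfold Cminus, Cplus, Copp, Cmult, RtoC; simpl. f_equal; [|field].
    replace (/ 2 * (/ 2 * 1 - sqrt 3 / 2 * 0) - sqrt 3 / 2 * (/ 2 * 0 + sqrt 3 / 2 * 1) + - / 2 + 1)%R with (3 / 4 - sqrt 3 * sqrt 3 / 4)%R by field.
    rewrite S3. field.
Qed.

Lemma uhp_Ci : upper_half_plane Ci.
Proof. unfold upper_half_plane; simpl; lra. Qed.

Lemma lambda_Ci : lambda Ci = / 2.
Proof.
  assert (E := lambda_S Ci uhp_Ci).
  assert (I : - / Ci = Ci) by (unfold Cinv, Copp, Ci; simpl; f_equal; field).
  rewrite I in E. assert (N2 := RtoC_IZR_neq0 2 ltac:(lia)).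
  transitivity ((lambda Ci + lambda Ci) / 2); [field; auto|]. rewrite E at 1. now field.
Qed.

(** For $\rho=e^{\pi i/3}$ one has $-1/\rho=\rho-1$; the inversion and translation formulas for
    $\lambda$ then give two expressions for one value. *)
Lemma lambda_rho6 : lambda rho6 ^ 2 - lambda rho6 + 1 = 0.
Proof.
  destruct rho6_spec as [U E]. assert (N := uhp_neq0 _ U).
  assert (I : - / rho6 = rho6 - 1).
  { transitivity (- (rho6 ^ 2 - rho6 + 1) / rho6 + (rho6 - 1)); [simpl; field; auto|]. rewrite E. field; auto. }
  assert (L := lambda_S rho6 U). rewrite I in L.
  assert (U1 : upper_half_plane (rho6 - 1)) by (rewrite <- I; now apply uhp_S).
  assert (T := lambda_T _ U1). replace (rho6 - 1 + 1) with rho6 in T by ring. rewrite L in T.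
  assert (N0 := lambda_neq0 _ U). set (x := lambda rho6) in *.
  assert (T2 : x * (- x) = 1 - x).
  { rewrite T at 1. field. intro X. apply N0. match type of X with ?e = _ => transitivity (- e); [ring | rewrite X; ring] end. }
  transitivity (- (x * - x) - x + 1); [simpl; ring|]. rewrite T2. ring.
Qed.

Lemma jpoly_eq_1 (x : C) : x <> 0 -> x <> 1 -> jpoly x = 1 -> x = / 2 \/ x = 2 \/ x = - (1).
Proof.
  intros H0 H1 E. assert (F := jpoly_minus_1 x H0 H1). rewrite E in F.
  assert (H2 := minus_neq0 1 x (not_eq_sym H1)). assert (H27 := RtoC_IZR_neq0 27 ltac:(lia)). assert (N2 := RtoC_IZR_neq0 2 ltac:(lia)).
  assert (Z : (2 * x - 1) * (x - 2) * (x + 1) = 0).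
  { apply NNPP. intro N. assert (X : ((2 * x - 1) * (x - 2) * (x + 1)) ^ 2 = 0).
    { transitivity (((2 * x - 1) * (x - 2) * (x + 1)) ^ 2 / (27 * (x ^ 2 * (1 - x) ^ 2)) * (27 * (x ^ 2 * (1 - x) ^ 2))).
      - simpl. field; auto.
      - rewrite <- F. ring. }
    now apply (Cpow_nz _ 2 N). }
  destruct (Ceq_dec (2 * x - 1) 0) as [A|A].
  - left. transitivity ((2 * x - 1) / 2 + / 2); [field; auto|]. rewrite A. field; auto.
  - destruct (Ceq_dec (x - 2) 0) as [B|B]; [right; left; now apply Ceq_minus|].
    destruct (Ceq_dec (x + 1) 0) as [D|D]; [right; right; transitivity (x + 1 - 1); [ring | rewrite D; ring]|].
    exfalso. revert Z. apply Cmult_neq_0; auto. now apply Cmult_neq_0.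
Qed.

(** The possible values of $\lambda$ are $\frac12$, $2$ and $-1$. Translation and inversion bring
    all of them to $\frac12=\lambda(i)$, for which the segment from $0$ avoids $1$ as [lambda_orbit]
    demands. *)
Lemma j_eq_1_orbit (tau : C) : upper_half_plane tau -> j_inv tau = 1 -> exists g, modular g /\ tau = g Ci.
Proof.
  intros H E. rewrite j_inv_jpoly in E.
  assert (N2 := RtoC_IZR_neq0 2 ltac:(lia)). assert (N3 := RtoC_IZR_neq0 3 ltac:(lia)).
  assert (R : exists h, modular h /\ lambda (h tau) = / 2).
  { assert (Tm : forall t, upper_half_plane t -> lambda t = - (1) -> lambda (t + RtoC (IZR 1)) = / 2).
    { intros t Ht Et. change (RtoC (IZR 1)) with (RtoC 1). rewrite lambda_T, Et by auto. field; repeat split; auto. }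
    destruct (jpoly_eq_1 _ (lambda_neq0 tau H) (lambda_neq1 tau H) E) as [E1|[E1|E1]].
    - exists (fun t => t). split; auto using modular_id.
    - exists (fun t => - / t + RtoC (IZR 1)). split.
      + apply (modular_comp (fun t => t + RtoC (IZR 1)) (fun t => - / t)); [apply modular_T | apply modular_S].
      + apply Tm; [now apply uhp_S|]. rewrite lambda_S, E1 by auto. ring.
    - exists (fun t => t + RtoC (IZR 1)). split; [apply modular_T | now apply Tm]. }
  destruct R as (h & Mh & Eh).
  destruct (lambda_orbit (/ 2)) with (tau1 := Ci) (tau2 := h tau) as (g & Mg & Eg); auto using uhp_Ci, lambda_Ci.
  - intro X. apply C1_nz. transitivity (2 * / 2); [field; auto | rewrite X; ring].
  - intros s Hs X. rewrite <- RtoC_inv, <- RtoC_mult in X by lra. apply RtoC_inj in X. lra.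
  - now apply modular_uhp.
  - destruct (modular_inv h Mh) as (k & Mk & Hk). exists (fun t => k (g t)). split; [now apply modular_comp|].
    rewrite Eg. symmetry. now apply Hk.
Qed.

(** The possible values of $\lambda$ are the two roots of $x^2-x+1$, exchanged by inversion. They
    are not real, so the segment from $0$ avoids $1$. *)
Lemma j_eq_0_orbit (tau : C) : upper_half_plane tau -> j_inv tau = 0 -> exists g, modular g /\ tau = g rho6.
Proof.
  intros H E. rewrite j_inv_jpoly in E. destruct rho6_spec as [U _]. assert (L := lambda_rho6).
  set (r := lambda rho6) in *. assert (N0 := lambda_neq0 tau H). assert (N1 := lambda_neq1 tau H).
  set (x := lambda tau) in *. assert (N2 := minus_neq0 1 x (not_eq_sym N1)).
  assert (Q : x ^ 2 - x + 1 = 0).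
  { apply NNPP. intro N. revert E. unfold jpoly. assert (H27 := RtoC_IZR_neq0 27 ltac:(lia)). assert (H4 := RtoC_IZR_neq0 4 ltac:(lia)).
    apply Cmult_neq_0.
    - intro X. apply H4. transitivity (4 / 27 * 27); [field; auto | rewrite X; ring].
    - intro X. apply (Cpow_nz _ 3 N). transitivity ((x ^ 2 - x + 1) ^ 3 / (x ^ 2 * (1 - x) ^ 2) * (x ^ 2 * (1 - x) ^ 2)).
      + simpl. field; auto.
      + rewrite X. ring. }
  assert (R : exists h, modular h /\ lambda (h tau) = r).
  { assert (Z : (x - r) * (x - (1 - r)) = 0).
    { transitivity ((x ^ 2 - x + 1) - (r ^ 2 - r + 1)); [simpl; ring|]. rewrite Q, L. ring. }
    destruct (Ceq_dec (x - r) 0) as [A|A].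
    - exists (fun t => t). split; [apply modular_id|]. now apply Ceq_minus.
    - destruct (Ceq_dec (x - (1 - r)) 0) as [B|B]; [|exfalso; revert Z; now apply Cmult_neq_0].
      exists (fun t => - / t). split; [apply modular_S|]. rewrite lambda_S by auto. fold x.
      transitivity (r - (x - (1 - r))); [ring|]. rewrite B. ring. }
  destruct R as (h & Mh & Eh).
  destruct (lambda_orbit r) with (tau1 := rho6) (tau2 := h tau) as (g & Mg & Eg); auto.
  - now apply lambda_neq0.
  - intros s Hs X.
    (* then [r = 1/s] would be a real root of [r^2 - r + 1] *)
    assert (Er : r = RtoC (/ s)).
    { rewrite RtoC_inv by lra. transitivity (RtoC s * r / RtoC s); [field; apply RtoC_neq0; lra|]. rewrite X. field; apply RtoC_neq0; lra. }
    rewrite Er in L. rewrite <- RtoC_pow, <- RtoC_minus, <- RtoC_plus in L. apply RtoC_inj in L.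
    generalize (Rle_0_sqr (/ s - / 2)). unfold Rsqr. simpl in L. lra.
  - now apply modular_uhp.
  - destruct (modular_inv h Mh) as (k & Mk & Hk). exists (fun t => k (g t)). split; [now apply modular_comp|].
    rewrite Eg. symmetry. now apply Hk.
Qed.

Lemma j_Ci : j_inv Ci = 1.
Proof.
  rewrite j_inv_jpoly, lambda_Ci. unfold jpoly. assert (N2 := RtoC_IZR_neq0 2 ltac:(lia)).
  rewrite <- RtoC_inv by lra. rewrite <- RtoC_minus, <- !RtoC_pow, <- RtoC_minus, <- RtoC_plus, <- !RtoC_pow, <- RtoC_mult.
  rewrite <- !RtoC_div, <- RtoC_mult by lra. f_equal. field.
Qed.

Lemma j_rho6 : j_inv rho6 = 0.
Proof.
  rewrite j_inv_jpoly. unfold jpoly. rewrite lambda_rho6. destruct rho6_spec as [U _].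
  assert (N0 := lambda_neq0 _ U). assert (N1 := minus_neq0 1 _ (not_eq_sym (lambda_neq1 _ U))). assert (H27 := RtoC_IZR_neq0 27 ltac:(lia)).
  simpl. field; auto.
Qed.

Theorem H2_iff (tau : C) : H2 tau <-> upper_half_plane tau /\ j_inv tau <> 0 /\ j_inv tau <> 1.
Proof.
  split.
  - intros [H K]. split; auto. split; intro E.
    + destruct (j_eq_0_orbit tau H E) as (g & (a & b & c & d & D & Eg) & ->).
      destruct (K a b c d D) as [_ X]. apply X. apply Eg. apply rho6_spec.
    + destruct (j_eq_1_orbit tau H E) as (g & (a & b & c & d & D & Eg) & ->).
      destruct (K a b c d D) as [X _]. apply X. apply Eg. apply uhp_Ci.
  - intros (H & J0 & J1). split; auto. intros a b c d D.
    assert (M : modular (moebius a b c d)) by (exists a, b, c, d; auto).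
    split; intros ->.
    + apply J1. rewrite j_modular by auto using uhp_Ci. apply j_Ci.
    + apply J0. rewrite j_modular; auto; [apply j_rho6 | apply rho6_spec].
Qed.

(** * Analytic continuation of the Schwarz map *)

Lemma holo_hypergeom (a b c : R) (z : C) :
  (0 < a)%R -> (0 < b)%R -> (0 < c)%R -> (a + b <= 1 + c)%R -> (a * b <= c)%R -> (Cmod z < 1)%R ->
  holo (hypergeom a b c) z.
Proof.
  intros Ha Hb Hc H1 H2 Hz. apply (gap_series_holo (fun n => RtoC (hcoef a b c n)) (fun n => n) 1 z); auto.
  intros rho Hr. apply (ex_series_le_R _ (fun n => rho ^ n)%R); [|apply ex_series_geom; rewrite Rabs_pos_eq; lra].
  intros n. assert (P := pow_le rho n (proj1 Hr)). rewrite Cmod_R.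
  assert (Q1 : (0 < hcoef a b c n)%R) by (apply hcoef_pos; lra). assert (Q2 : (hcoef a b c n <= 1)%R) by (apply hcoef_le_1; lra).
  rewrite Rabs_pos_eq by lra. nra.
Qed.

(* [k c_k - (k+1) c_{k+1} >= (67/288) c_k] for [k >= 1], so the coefficients after the first sum to at most
   [(288/67) c_1 = 10/67]. *)
Lemma hcoef_sum_bound (n : nat) :
  (67 / 288 * sum_f_R0 (fun k => hcoef (1 / 12) (5 / 12) 1 (S k)) n
    + INR (S (S n)) * hcoef (1 / 12) (5 / 12) 1 (S (S n)) <= 5 / 144)%R.
Proof.
  assert (K : forall k, (67 / 288 * hcoef (1 / 12) (5 / 12) 1 (S k) + INR (S (S k)) * hcoef (1 / 12) (5 / 12) 1 (S (S k))
    <= INR (S k) * hcoef (1 / 12) (5 / 12) 1 (S k))%R).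
  { intros k. assert (E := hcoef_S (1 / 12) (5 / 12) 1 ltac:(lra) (S k)).
    assert (P : (0 < hcoef (1 / 12) (5 / 12) 1 (S k))%R) by (apply hcoef_pos; lra).
    rewrite (S_INR (S k)). assert (N : (1 <= INR (S k))%R) by (rewrite (S_INR k); generalize (pos_INR k); lra).
    set (x := INR (S k)) in *. set (u := hcoef (1 / 12) (5 / 12) 1 (S k)) in *. set (v := hcoef (1 / 12) (5 / 12) 1 (S (S k))) in *.
    apply Rmult_le_reg_l with (1 + x)%R; [lra|].
    replace ((1 + x) * (67 / 288 * u + (x + 1) * v))%R with ((1 + x) * (67 / 288) * u + (1 + x) * (1 + x) * v)%R by ring.
    rewrite E. assert (0 <= (x - 1) * u)%R by (apply Rmult_le_pos; lra). nra. }
  induction n as [|n IH].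
  - simpl sum_f_R0. generalize (K O). change (INR 1) with 1%R.
    replace (hcoef (1 / 12) (5 / 12) 1 1) with (5 / 144)%R by (unfold hcoef; simpl; field). lra.
  - simpl sum_f_R0. generalize (K (S n)). lra.
Qed.

(** By [hcoef_sum_bound] the partial sums stay within $10/67<\frac12$ of $1$ on the unit disc. This
    is what makes the quotient in the Schwarz map holomorphic on the whole lens. *)
Lemma hypergeom_neq0 (z : C) : (Cmod z < 1)%R -> hypergeom (1 / 12) (5 / 12) 1 z <> 0.
Proof.
  intros Hz. set (u := fun n => RtoC (hcoef (1 / 12) (5 / 12) 1 n) * z ^ n).
  assert (P : forall n, (0 < hcoef (1 / 12) (5 / 12) 1 n)%R) by (intros; apply hcoef_pos; lra).
  assert (Pz := Cmod_ge_0 z).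
  assert (Hu : forall n, (Cmod (u n) <= hcoef (1 / 12) (5 / 12) 1 n * Cmod z ^ n)%R).
  { intros n. unfold u. rewrite Cmod_mult, Cmod_R, Cmod_pow, Rabs_pos_eq by (left; auto). lra. }
  assert (Hc : cseries u (CSeries u)).
  { apply csummable_cseries, (csummable_le u (fun n => Cmod z ^ n)%R).
    - intros n. eapply Rle_trans; [apply Hu|]. assert (Q : (hcoef (1 / 12) (5 / 12) 1 n <= 1)%R) by (apply hcoef_le_1; lra).
      assert (P2 := pow_le _ n Pz). nra.
    - apply ex_series_geom. rewrite Rabs_pos_eq; lra. }
  change (CSeries u <> 0). intros E. rewrite E in Hc. destruct (Hc (/ 2)%R ltac:(lra)) as [N K].
  specialize (K (S (S N)) ltac:(lia)).
  assert (B : forall n, (Cmod (csum u (S (S n)) - 1) <= sum_f_R0 (fun k => hcoef (1 / 12) (5 / 12) 1 (S k)) n)%R).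
  { assert (B1 : forall n, (Cmod (u n) <= hcoef (1 / 12) (5 / 12) 1 n)%R).
    { intros n. eapply Rle_trans; [apply Hu|]. assert (Cmod z ^ n <= 1)%R; [|specialize (P n); nra].
      rewrite <- (pow1 n). apply pow_incr. lra. }
    induction n as [|n IH].
    - rewrite !csum_S. replace (csum u 0 + u 0%nat + u 1%nat - 1) with (u 1%nat); [apply B1|].
      assert (E0 : u 0%nat = 1) by (unfold u, hcoef; simpl; rewrite Cmult_1_r; f_equal; field). rewrite E0. simpl csum. ring.
    - rewrite csum_S. simpl sum_f_R0.
      replace (csum u (S (S n)) + u (S (S n)) - 1) with ((csum u (S (S n)) - 1) + u (S (S n))) by ring.
      eapply Rle_trans; [apply Cmod_triangle|]. apply Rplus_le_compat; auto. }
  specialize (B N). assert (T := hcoef_sum_bound N).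
  assert (0 <= INR (S (S N)) * hcoef (1 / 12) (5 / 12) 1 (S (S N)))%R by (apply Rmult_le_pos; [apply pos_INR | left; apply P]).
  assert (T2 := Cmod_triangle (csum u (S (S N))) (- (csum u (S (S N)) - 1))).
  replace (csum u (S (S N)) + - (csum u (S (S N)) - 1)) with (RtoC 1) in T2 by ring.
  rewrite Cmod_1, Cmod_opp in T2. replace (csum u (S (S N)) - 0) with (csum u (S (S N))) in K by ring. lra.
Qed.

Lemma holo_schwarz2_init (z : C) : lens z -> holo schwarz2_init z.
Proof.
  intros [H1 H2]. apply holo_minus; [|apply holo_const].
  apply (holo_mult (fun _ => Ci * RtoC (beta (1 / 12) (5 / 12) / (2 * PI)))); [apply holo_const|].
  apply (holo_div (fun z => hypergeom (1 / 12) (5 / 12) (1 / 2) (1 - z))).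
  - apply (holo_comp (fun z => 1 - z)).
    + apply holo_minus; [apply holo_const | apply holo_id].
    + apply holo_hypergeom; auto; lra.
  - apply holo_hypergeom; auto; lra.
  - now apply hypergeom_neq0.
Qed.

Definition jrec (tau : C) : C := / j_inv tau.

Definition regular (tau : C) : Prop := upper_half_plane tau /\ j_inv tau <> 0 /\ j_inv tau <> 1.

Lemma holo_jrec (tau : C) : regular tau -> holo jrec tau.
Proof. intros (H & J0 & _). apply holo_inv; auto. now apply holo_j. Qed.

Lemma jrec_deriv_neq0 (tau : C) : regular tau -> Cderiv jrec tau <> 0.
Proof.
  intros H. assert (Hr := holo_jrec tau H). destruct H as (H & J0 & J1). assert (D := j_deriv_neq0 tau H J0 J1).
  assert (E := cder_inv j_inv tau _ (Cderiv_correct _ _ (holo_j tau H)) (ccont_neq0 _ _ 0 (holo_ccont _ _ (holo_j tau H)) J0)).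
  rewrite (cder_unique _ _ _ _ (Cderiv_correct jrec tau Hr) E).
  intro X. apply D.
  transitivity (- (- Cderiv j_inv tau / (j_inv tau * j_inv tau)) * (j_inv tau * j_inv tau)); [field; auto|].
  rewrite X. ring.
Qed.

Lemma regular_jrec (tau : C) : regular tau -> Zdom (jrec tau).
Proof.
  intros (H & J0 & J1). unfold Zdom, jrec. split.
  - intro X. apply C1_nz. transitivity (j_inv tau * / j_inv tau); [field; auto | rewrite X; ring].
  - intro X. apply J1. transitivity (j_inv tau * / j_inv tau); [rewrite X; ring | field; auto].
Qed.

Lemma jrec_eq (tau z : C) : Zdom z -> jrec tau = z -> j_inv tau = / z.
Proof.
  intros [Z0 Z1] E. unfold jrec in E. destruct (Ceq_dec (j_inv tau) 0) as [J|J].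
  (* [Cinv] sends $0$ to $0$, so a pole of [jrec] would give [z = 0]. *)
  - exfalso. apply Z0. rewrite <- E, J. unfold Cinv, RtoC; simpl. f_equal; unfold Rdiv; ring.
  - rewrite <- E. field. auto.
Qed.

Lemma jrec_regular (tau z : C) : Zdom z -> upper_half_plane tau -> jrec tau = z -> regular tau.
Proof.
  intros HZ H E. assert (Ej := jrec_eq tau z HZ E). destruct HZ as [Z0 Z1]. split; auto. rewrite Ej. split.
  - intro X. apply C1_nz. transitivity (z * / z); [field; auto | rewrite X; ring].
  - intro X. apply Z1. transitivity (z * / z); [rewrite X; ring | field; auto].
Qed.

Definition path_cont (gamma : R -> C) : Prop := forall t, (0 <= t <= 1)%R -> forall eps, (0 < eps)%R ->
  exists d, (0 < d)%R /\ forall s, (0 <= s <= 1)%R -> (Rabs (s - t) < d)%R -> (Cmod (gamma s - gamma t) < eps)%R.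

Lemma path_in_iff (D : C -> Prop) (gamma : R -> C) :
  path_in D gamma <-> path_cont gamma /\ forall t, (0 <= t <= 1)%R -> D (gamma t).
Proof.
  split; intros [Hc Hd]; split; auto.
  - intros t Ht eps He. specialize (Hc t Ht (fun w => Cmod (w - gamma t) < eps)%R).
    destruct Hc as [d Kd]; [apply near_locally; exists eps; auto|].
    exists d. split; [apply cond_pos|]. intros s Hs Hst. apply (Kd s); auto.
  - intros t Ht P HP. apply near_locally in HP. destruct HP as (eps & He & KP).
    destruct (Hc t Ht eps He) as (d & Hd0 & K). exists (mkposreal d Hd0). intros s Hst Hs. apply KP, K; auto.
Qed.

Definition lifted (f : C -> C) (w : C) : Prop := upper_half_plane (f w) /\ jrec (f w) = w.

(* Analytic continuation preserves the equation [jrec (f w) = w] because [j_inv] evenly covers a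
   neighbourhood of each value other than [0] and [1]. *)
Lemma continuation_lifts (gamma : R -> C) (F : R -> C -> C) (r : R -> R) :
  path_in Zdom gamma -> continuation_along gamma F r ->
  near (gamma 0%R) (lifted (F 0%R)) -> forall t, (0 <= t <= 1)%R -> near (gamma t) (lifted (F t)).
Proof.
  intros Hp HF H0. apply path_in_iff in Hp. destruct Hp as [Hc Hd].
  apply (uniform_induction (fun t => near (gamma t) (lifted (F t)))); auto.
  intros t Ht. destruct (HF t Ht) as (Hr & Ha & delta & Hdelta & K). destruct (Hd t Ht) as [Z0 Z1].
  set (z0 := gamma t) in *.
  destruct (j_cover (/ z0)) as (rho & Hrho & Cov).
  { intro X. apply C1_nz. transitivity (z0 * / z0); [field; auto | rewrite X; ring]. }
  { intro X. apply Z1. transitivity (z0 * / z0); [rewrite X; ring | field; auto]. }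
  destruct (near_and z0 _ _ (holo_ccont Cinv z0 (holo_Cinv z0 Z0) rho Hrho) (ccont_neq0 _ _ 0 (ccont_id z0) Z0)) as (d1 & Hd1 & K1).
  (* On this disc [F t] is analytic and inversion lands in the disc covered by [j_inv]. *)
  set (R0 := Rmin d1 (r t)). assert (HR0 : (0 < R0)%R) by now apply Rmin_pos.
  destruct (Hc t Ht R0 HR0) as (d2 & Hd2 & K2). fold z0 in K2.
  exists (Rmin delta d2). split; [now apply Rmin_pos|]. intros s s' Hs Hs' D D' Ps.
  assert (Ns := K2 s Hs (Rlt_le_trans _ _ _ D (Rmin_r _ _))). assert (Ns' := K2 s' Hs' (Rlt_le_trans _ _ _ D' (Rmin_r _ _))).
  destruct (K s Hs (Rlt_le_trans _ _ _ D (Rmin_l _ _))) as [_ Es]. destruct (K s' Hs' (Rlt_le_trans _ _ _ D' (Rmin_l _ _))) as [_ Es'].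
  apply near_locally in Es, Es'.
  assert (Hdisc : forall w, (Cmod (w - z0) < R0)%R -> (Cmod (/ w - / z0) < rho)%R /\ w <> 0 /\ holo (F t) w).
  { intros w Hw. destruct (K1 w (Rlt_le_trans _ _ _ Hw (Rmin_l _ _))). repeat split; auto.
    apply analytic_holo, Ha. exact (Rlt_le_trans _ _ _ Hw (Rmin_r _ _)). }
  assert (Ps1 : near (gamma s) (lifted (F t))).
  { generalize (near_and _ _ _ Ps Es). apply near_imp. unfold lifted. intros w [H E]. now rewrite <- E. }
  destruct (near_self _ _ Ps1) as [U1 E1]. assert (Ej := jrec_eq _ _ (Hd s Hs) E1).
  destruct (Cov (F t (gamma s)) U1) as (G & G1 & KG). { rewrite Ej. now apply Hdisc. }
  set (H := fun w => G (/ w)).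
  assert (HH : forall w, (Cmod (w - z0) < R0)%R -> upper_half_plane (H w) /\ jrec (H w) = w /\ holo H w).
  { intros w Hw. destruct (Hdisc w Hw) as (A & B & _). destruct (KG (/ w) A) as (V1 & V2 & V3). split; auto. split.
    - unfold jrec, H. rewrite V2. field. auto.
    - unfold H. apply (holo_comp Cinv G); auto. now apply holo_Cinv. }
  assert (Hreg := jrec_regular _ _ (Hd s Hs) U1 E1).
  (* [F t] and the covering section [H] are both sections of [jrec] near [gamma s] with the same
     value there. *)
  assert (N : near (gamma s) (fun w => F t w = H w)).
  { destruct (HH _ Ns) as (V1 & V2 & V3). destruct (Hdisc _ Ns) as (_ & _ & V4).
    apply (section_unique jrec (F t) H (gamma s) (Cderiv jrec (F t (gamma s)))); auto using holo_ccont, holo_jrec, jrec_deriv_neq0.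
    - now apply Cderiv_correct, holo_jrec.
    - unfold H. now rewrite <- Ej, G1.
    - generalize (near_and _ _ _ Ps1 (near_disc z0 (gamma s) R0 Ns)). apply near_imp. intros w [[_ W1] W2].
      rewrite W1. symmetry. now apply HH. }
  (* Agreement near [gamma s] spreads over the whole disc, which also contains [gamma s']; beyond
     that point [F s'] agrees with [F t] locally. *)
  assert (N' : near (gamma s') (fun w => F t w = H w)).
  { apply (identity_theorem_eq (fun w => Cmod (w - z0) < R0)%R _ _ (gamma s) (gamma s')); auto using convex_disc.
    - intros w Hw. now apply Hdisc.
    - intros w Hw. now apply HH. }
  generalize (near_and _ _ _ (near_and _ _ _ N' Es') (near_disc z0 (gamma s') R0 Ns')). apply near_imp.
  intros w [[A B] W]. unfold lifted. rewrite B, A. destruct (HH w W) as (V1 & V2 & _). auto.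
Qed.

Lemma regular_imag_2 : regular (imag 2).
Proof.
  split; [apply uhp_imag; lra|]. rewrite j_imag by lra.
  destruct (zof_range (lam 2)) as [Z1 Z2]; [split; [apply lam_spec; lra | apply lam_lt_half; lra]|].
  assert (P : (1 < / zof (lam 2))%R) by (rewrite <- Rinv_1; apply Rinv_lt_contravar; lra).
  rewrite <- RtoC_inv by lra. split; intro X; apply RtoC_inj in X; lra.
Qed.

Definition zbase : C := jrec (imag 2).

Lemma jrec_imag (t : R) : (1 < t)%R -> jrec (imag t) = RtoC (zof (lam t)) /\ lens (RtoC (zof (lam t))).
Proof.
  intros Ht. destruct (zof_range (lam t)) as [Z1 Z2]; [split; [apply lam_spec; lra | now apply lam_lt_half]|]. split.
  - unfold jrec. rewrite j_imag by lra. field. apply RtoC_neq0. lra.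
  - unfold lens. rewrite <- RtoC_minus, !Cmod_R, !Rabs_pos_eq; lra.
Qed.

(** The values [schwarz_imag] on the imaginary axis accumulate at $2i$, so [schwarz2_init] inverts
    $1/j$ near that point. The base point lies above $i$, since the computation requires $t>1$ and
    $1/j$ is ramified at $i$. *)
Lemma schwarz2_init_base : near zbase (lifted schwarz2_init).
Proof.
  destruct (jrec_imag 2 ltac:(lra)) as [Eb Lb]. fold zbase in Eb. rewrite <- Eb in Lb.
  assert (HR := regular_imag_2). assert (Hj := holo_jrec _ HR).
  assert (Hs : holo (fun tau => schwarz2_init (jrec tau)) (imag 2)).
  { apply (holo_comp jrec); auto. now apply holo_schwarz2_init. }
  assert (N : near (imag 2) (fun tau => schwarz2_init (jrec tau) - tau = 0)).
  { apply holo_zeros; [apply holo_minus; auto; apply holo_id|].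
    intros d Hd. exists (imag (2 + d / 2)). replace (imag (2 + d / 2) - imag 2) with (RtoC (d / 2) * Ci).
    2:{ unfold imag, Cminus, Cplus, Copp, Cmult, RtoC, Ci; simpl. f_equal; field. }
    split; [|split].
    - intro X. unfold imag in X. injection X. lra.
    - rewrite Cmod_mult, Cmod_R, Rabs_pos_eq by lra. replace (Cmod Ci) with 1%R; [lra|].
      unfold Cmod, Ci; simpl. rewrite Rmult_0_l, Rplus_0_l, !Rmult_1_l. symmetry. apply sqrt_1.
    - rewrite (proj1 (jrec_imag (2 + d / 2) ltac:(lra))), (schwarz_imag (2 + d / 2)) by lra. apply Cplus_opp_r. }
  destruct N as (e1 & He1 & K1). destruct (near_uhp _ (proj1 HR)) as (e2 & He2 & K2).
  destruct (local_inverse jrec (imag 2) (Cderiv jrec (imag 2)) (Rmin e1 e2)) as (eta & delta & G & Heta & Hdelta & _ & KG);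
    auto using jrec_deriv_neq0; [now apply Rmin_pos | now apply Cderiv_correct|].
  fold zbase in KG. exists delta. split; auto. intros w Hw. destruct (KG w Hw) as (A & B & _).
  assert (L : (eta <= Rmin e1 e2)%R) by apply Heta. assert (L1 := Rmin_l e1 e2). assert (L2 := Rmin_r e1 e2).
  assert (E : schwarz2_init w = G w).
  { rewrite <- B at 1. apply Ceq_minus. apply K1. lra. }
  unfold lifted. rewrite E. split; auto. apply K2. lra.
Qed.

Lemma lens_Zdom (z : C) : lens z -> Zdom z.
Proof.
  intros [H1 H2]. split; intros ->.
  - replace (1 - 0) with (RtoC 1) in H2 by ring. rewrite Cmod_1 in H2. lra.
  - rewrite Cmod_1 in H1. lra.
Qed.

Lemma convex_lens : convex lens.
Proof.
  intros a b t [A1 A2] [B1 B2] Ht. split.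
  - assert (X := convex_disc 0 1 a b t). cbv beta in X. replace (a - 0) with a in X by ring. replace (b - 0) with b in X by ring.
    specialize (X A1 B1 Ht). now replace (a + RtoC t * (b - a) - 0) with (a + RtoC t * (b - a)) in X by ring.
  - assert (X := convex_disc 1 1 a b t). cbv beta in X.
    rewrite <- (Cmod_opp (1 - _)). rewrite <- (Cmod_opp (1 - a)) in A2. rewrite <- (Cmod_opp (1 - b)) in B2.
    replace (- (1 - a)) with (a - 1) in A2 by ring. replace (- (1 - b)) with (b - 1) in B2 by ring.
    specialize (X A2 B2 Ht). now replace (- (1 - (a + RtoC t * (b - a)))) with (a + RtoC t * (b - a) - 1) by ring.
Qed.

Lemma lipschitz_path_cont (gamma : R -> C) (L : R) : (forall s t, (0 <= s <= 1)%R -> (0 <= t <= 1)%R -> (Cmod (gamma s - gamma t) <= L * Rabs (s - t))%R) ->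
  path_cont gamma.
Proof.
  intros H t Ht eps He. assert (P : (0 < Rabs L + 1)%R) by (generalize (Rabs_pos L); lra).
  exists (eps / (Rabs L + 1))%R. split; [now apply Rdiv_lt_0_compat|].
  intros s Hs0 Hs. eapply Rle_lt_trans; [apply H; auto|].
  apply Rle_lt_trans with ((Rabs L + 1) * Rabs (s - t))%R.
  - apply Rmult_le_compat_r; [apply Rabs_pos|]. generalize (Rle_abs L); lra.
  - apply Rlt_le_trans with ((Rabs L + 1) * (eps / (Rabs L + 1)))%R; [now apply Rmult_lt_compat_l|]. right; field; lra.
Qed.

Lemma lens_zbase : lens zbase.
Proof. unfold zbase. destruct (jrec_imag 2 ltac:(lra)) as [-> L]. exact L. Qed.

(** In the convex lens the function itself, taken as a constant family, is a continuation along the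
    segment from the base point, and [continuation_lifts] applies. *)
Lemma schwarz2_init_lifted (z : C) : lens z -> near z (lifted schwarz2_init).
Proof.
  intros Hz. set (gamma := fun t : R => zbase + RtoC t * (z - zbase)).
  assert (Hl : forall t, (0 <= t <= 1)%R -> lens (gamma t)) by (intros t Ht; apply convex_lens; auto using lens_zbase).
  assert (Hc : path_cont gamma).
  { apply (lipschitz_path_cont _ (Cmod (z - zbase))). intros s t _ _. unfold gamma.
    replace (zbase + RtoC s * (z - zbase) - (zbase + RtoC t * (z - zbase))) with (RtoC (s - t) * (z - zbase)) by (rewrite RtoC_minus; ring).
    rewrite Cmod_mult, Cmod_R. lra. }
  assert (E1 : gamma 1%R = z) by (unfold gamma; ring). rewrite <- E1.
  set (r := fun t => Rmin (1 - Cmod (gamma t)) (1 - Cmod (1 - gamma t))).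
  apply (continuation_lifts gamma (fun _ => schwarz2_init) r); [| | |lra].
  - apply path_in_iff. split; auto. intros t Ht. now apply lens_Zdom, Hl.
  - intros t Ht. destruct (Hl t Ht) as [L1 L2]. assert (Hr : (0 < r t)%R) by (apply Rmin_pos; lra). split; auto. split.
    + intros w Hw. apply holo_analytic, holo_schwarz2_init.
      assert (A := Rlt_le_trans _ _ _ Hw (Rmin_l _ _)). assert (B := Rlt_le_trans _ _ _ Hw (Rmin_r _ _)). split.
      * replace w with ((w - gamma t) + gamma t) by ring. eapply Rle_lt_trans; [apply Cmod_triangle | lra].
      * replace (1 - w) with (- (w - gamma t) + (1 - gamma t)) by ring. eapply Rle_lt_trans; [apply Cmod_triangle|].
        rewrite Cmod_opp. lra.
    + destruct (Hc t Ht (r t) Hr) as (d & Hd & K). exists d. split; auto. intros s Hs Hst. split; [now apply K|].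
      apply near_locally, near_all. auto.
  - replace (gamma 0%R) with zbase by (unfold gamma; ring). apply schwarz2_init_base.
Qed.

Theorem schwarz2_value (z tau : C) : schwarz2 z tau -> regular tau /\ jrec tau = z.
Proof.
  intros (gamma & F & r & Hp & HU & E1 & HF & E0 & Ew).
  assert (Hl : near (gamma 0%R) (lifted (F 0%R))).
  { apply near_locally in E0. generalize (near_and _ _ _ E0 (schwarz2_init_lifted _ HU)). apply near_imp.
    unfold lifted. now intros w [-> H]. }
  assert (K := near_self _ _ (continuation_lifts gamma F r Hp HF Hl 1%R ltac:(lra))).
  destruct K as [U E]. rewrite E1, Ew in *. split; auto. apply (jrec_regular tau z); auto.
  rewrite <- E1. apply Hp. unfold unit_interval. lra.
Qed.

(** * Arcs avoiding countably many points *)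

Open Scope R_scope.

(** Cantor's nested intervals: each step keeps the outer third on the side of the midpoint away from
    the next term of the sequence. *)
Fixpoint nested (u : nat -> R) (n : nat) : R * R :=
  match n with
  | O => (0, 1)
  | S m => let (a, b) := nested u m in
           if Rle_lt_dec (u m) ((a + b) / 2) then (b - (b - a) / 3, b) else (a, a + (b - a) / 3)
  end.

Lemma real_avoiding (u : nat -> R) : exists s, forall n, u n <> s.
Proof.
  assert (Hlt : forall n, fst (nested u n) < snd (nested u n)).
  { induction n as [|n IH]; simpl; [lra|]. destruct (nested u n) as [a b]. simpl in IH.
    destruct Rle_lt_dec; simpl; lra. }
  assert (Hstep : forall n, fst (nested u n) <= fst (nested u (S n)) /\ snd (nested u (S n)) <= snd (nested u n)).
  { intros n. generalize (Hlt n). simpl. destruct (nested u n) as [a b]. simpl. intros L. destruct Rle_lt_dec; simpl; lra. }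
  assert (Hmono : forall k n, fst (nested u n) <= fst (nested u (k + n)) /\ snd (nested u (k + n)) <= snd (nested u n)).
  { induction k as [|k IH]; intros n; [simpl; lra|]. specialize (IH n). generalize (Hstep (k + n)%nat). change (S k + n)%nat with (S (k + n)). lra. }
  destruct (completeness (fun x => exists n, x = fst (nested u n))) as [s [Hs1 Hs2]].
  { exists 1. intros x [n ->]. generalize (Hlt n) (proj2 (Hmono n O)). rewrite Nat.add_0_r. simpl. lra. }
  { exists 0. exists O. reflexivity. }
  exists s. intros n E.
  assert (Hb : fst (nested u (S n)) <= s <= snd (nested u (S n))).
  { split; [apply Hs1; eauto|]. apply Hs2. intros x [m ->].
    generalize (Hmono m (S n)) (Hmono (S n) m) (Hlt (m + S n)%nat). rewrite (Nat.add_comm (S n) m). lra. }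
  generalize (Hlt n) Hb. simpl. destruct (nested u n) as [a b]. simpl. intros L.
  destruct Rle_lt_dec; simpl; lra.
Qed.

Definition cross (z w : C) : R := Re z * Im w - Im z * Re w.

Lemma cross_scal_r (x : R) (z w : C) : cross z (RtoC x * w)%C = x * cross z w.
Proof. destruct z, w; unfold cross; simpl; ring. Qed.

Lemma cross_plus_r (z w1 w2 : C) : cross z (w1 + w2)%C = cross z w1 + cross z w2.
Proof. destruct z, w1, w2; unfold cross; simpl; ring. Qed.

Lemma cross_anti (z w : C) : cross z w = - cross w z.
Proof. unfold cross; ring. Qed.

Definition arc (a b w : C) (s t : R) : C := (a + RtoC t * (b - a) + RtoC (t * (1 - t) * s) * w)%C.

(* The arcs with different [s > 0] only meet in their endpoints. *)
Lemma arc_avoiding (a b w : C) (beta : nat -> C) : cross w (b - a)%C <> 0 ->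
  exists s, 0 < s /\ forall t n, 0 < t < 1 -> arc a b w s t <> beta n.
Proof.
  intros Hx. set (X := cross w (b - a)%C) in *.
  (* If [beta n] lies on an arc, the product with [w] recovers [t] and the product with [b - a]
     recovers the height, so each [n] excludes one height only. The logarithm lets the avoided
     parameter range over all reals while the height stays positive. *)
  set (tn := fun n => cross w (beta n - a)%C / X).
  destruct (real_avoiding (fun n => ln (cross (b - a)%C (beta n - a)%C / (tn n * (1 - tn n) * - X)))) as [s Hs].
  exists (exp s). split; [apply exp_pos|]. intros t n Ht E. apply (Hs n). rewrite <- (ln_exp s). f_equal.
  assert (Eb : (beta n - a = RtoC t * (b - a) + RtoC (t * (1 - t) * exp s) * w)%C) by (rewrite <- E; unfold arc; ring).
  assert (Et : tn n = t).
  { unfold tn. rewrite Eb, cross_plus_r, !cross_scal_r. fold X. replace (cross w w) with 0 by (unfold cross; ring). field. auto. }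
  rewrite Et, Eb, cross_plus_r, !cross_scal_r. rewrite (cross_anti (b - a)%C w). fold X.
  replace (cross (b - a)%C (b - a)%C) with 0 by (unfold cross; ring). field. split; auto; lra.
Qed.

Lemma arc_uhp (a b w : C) (s t : R) : upper_half_plane a -> upper_half_plane b -> 0 <= Im w -> 0 < s -> 0 <= t <= 1 ->
  upper_half_plane (arc a b w s t).
Proof.
  intros Ha Hb Hw Hs Ht. assert (U := convex_uhp a b t Ha Hb Ht). unfold upper_half_plane, arc in *.
  assert (E : forall z r, Im (z + RtoC r * w)%C = Im z + r * Im w) by (intros z r; destruct z, w; simpl; ring).
  rewrite E. assert (0 <= t * (1 - t) * s * Im w); [|lra]. repeat apply Rmult_le_pos; lra.
Qed.

Lemma arc_cont (a b w : C) (s : R) : path_cont (arc a b w s).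
Proof.
  apply (lipschitz_path_cont _ (Cmod (b - a) + Rabs s * Cmod w)). intros t t' Ht Ht'. unfold arc.
  match goal with |- Cmod ?x <= _ => replace x with (RtoC (t - t') * (b - a) + RtoC ((t - t') * ((1 - t - t') * s)) * w)%C end.
  2:{ repeat rewrite ?RtoC_mult, ?RtoC_minus. ring. }
  eapply Rle_trans; [apply Cmod_triangle|]. rewrite !Cmod_mult, !Cmod_R, !Rabs_mult.
  assert (P1 := Rabs_pos (t - t')). assert (P2 := Rabs_pos s). assert (P3 := Cmod_ge_0 w).
  assert (B : Rabs (1 - t - t') <= 1) by (apply Rabs_le; lra). assert (P4 := Rabs_pos (1 - t - t')).
  assert (Rabs (t - t') * (Rabs (1 - t - t') * Rabs s) * Cmod w <= Rabs (t - t') * (1 * Rabs s) * Cmod w); [|lra].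
  apply Rmult_le_compat_r; auto. apply Rmult_le_compat_l; auto. now apply Rmult_le_compat_r.
Qed.

Definition Z_of_code (n : nat) : Z := let (a, b) := Cantor.of_nat n in (Z.of_nat a - Z.of_nat b)%Z.

Lemma Z_of_code_surj (k : Z) : exists n, Z_of_code n = k.
Proof.
  exists (Cantor.to_nat (Z.to_nat k, Z.to_nat (- k))). unfold Z_of_code. rewrite Cantor.cancel_of_to. lia.
Qed.

(** The enumeration runs through all integer quadruples, whatever their determinant; a larger
    countable set is harmless. *)
Lemma irregular_countable : exists beta : nat -> C, forall tau, upper_half_plane tau -> ~ regular tau -> exists n, beta n = tau.
Proof.
  set (orb := fun (tau0 : C) (n : nat) => let (m1, m2) := Cantor.of_nat n in
    let (a, b) := Cantor.of_nat m1 in let (c, d) := Cantor.of_nat m2 in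
    moebius (Z_of_code a) (Z_of_code b) (Z_of_code c) (Z_of_code d) tau0).
  assert (Horb : forall tau0 g, upper_half_plane tau0 -> modular g -> exists n, orb tau0 n = g tau0).
  { intros tau0 g H (a & b & c & d & _ & E). rewrite E by auto.
    destruct (Z_of_code_surj a) as [na <-]. destruct (Z_of_code_surj b) as [nb <-].
    destruct (Z_of_code_surj c) as [nc <-]. destruct (Z_of_code_surj d) as [nd <-].
    exists (Cantor.to_nat (Cantor.to_nat (na, nb), Cantor.to_nat (nc, nd))).
    unfold orb. now rewrite !Cantor.cancel_of_to. }
  exists (fun n => let (i, m) := Cantor.of_nat n in match i with O => orb Ci m | S _ => orb rho6 m end).
  intros tau H N.
  destruct (classic (j_inv tau = RtoC 0)) as [J0|J0]; [|destruct (classic (j_inv tau = RtoC 1)) as [J1|J1]].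
  - destruct (j_eq_0_orbit tau H J0) as (g & Mg & ->). destruct (Horb rho6 g) as [m <-]; auto; [apply rho6_spec|].
    exists (Cantor.to_nat (1%nat, m)). now rewrite Cantor.cancel_of_to.
  - destruct (j_eq_1_orbit tau H J1) as (g & Mg & ->). destruct (Horb Ci g) as [m <-]; auto using uhp_Ci.
    exists (Cantor.to_nat (0%nat, m)). now rewrite Cantor.cancel_of_to.
  - exfalso. apply N. split; auto.
Qed.

Lemma regular_path (a b : C) : regular a -> regular b ->
  exists p : R -> C, path_cont p /\ p 0 = a /\ p 1 = b /\ forall t, 0 <= t <= 1 -> regular (p t).
Proof.
  intros Ha Hb. destruct (classic (a = b)) as [<-|Nab].
  { exists (fun _ => a). repeat split; auto; try apply Ha. apply (lipschitz_path_cont _ 0). intros s t _ _.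
    replace (a - a)%C with (RtoC 0) by ring. rewrite Cmod_0. lra. }
  (* The direction must not be parallel to [b - a] and must not point downwards, so that the arcs
     stay in the half-plane: $i$ serves unless the chord is vertical, and then $1$ does. *)
  assert (Hw : exists w, 0 <= Im w /\ cross w (b - a)%C <> 0).
  { destruct (Req_dec (Re (b - a)%C) 0) as [E|E].
    - exists (RtoC 1). split; [simpl; lra|]. intro X. apply Nab. destruct a as [a1 a2], b as [b1 b2].
      unfold cross in X. simpl in E, X. f_equal; lra.
    - exists Ci. split; [simpl; lra|]. unfold cross. change (Re Ci) with 0. change (Im Ci) with 1. lra. }
  destruct Hw as (w & W1 & W2). destruct irregular_countable as [beta Hbeta].
  destruct (arc_avoiding a b w beta W2) as (s & Hs & K). exists (arc a b w s). split; [apply arc_cont|].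
  assert (E0 : arc a b w s 0 = a) by (unfold arc; replace (0 * (1 - 0) * s) with 0 by ring; ring).
  assert (E1 : arc a b w s 1 = b) by (unfold arc; replace (1 * (1 - 1) * s) with 0 by ring; ring).
  split; auto. split; auto. intros t Ht. apply NNPP. intro N.
  assert (U : upper_half_plane (arc a b w s t)) by (apply arc_uhp; auto; [apply Ha | apply Hb]).
  destruct (Hbeta _ U N) as [n En]. apply (K t n); auto.
  split; apply Rnot_le_lt; intro L; apply N; [replace t with 0 by lra; now rewrite E0 | replace t with 1 by lra; now rewrite E1].
Qed.

Open Scope C_scope.

(** A local inverse of [phi] is chosen at each parameter; neighbouring choices agree because both
    are sections of [phi] through the same point of the path. *)
Lemma inverse_along (phi : C -> C) (p : R -> C) : path_cont p ->
  (forall t, (0 <= t <= 1)%R -> holo phi (p t) /\ Cderiv phi (p t) <> 0) ->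
  exists (F : R -> C -> C) (r : R -> R), continuation_along (fun t => phi (p t)) F r /\
    forall t, (0 <= t <= 1)%R -> F t (phi (p t)) = p t /\ holo (F t) (phi (p t)) /\ near (phi (p t)) (fun w => phi (F t w) = w).
Proof.
  intros Hp Hphi.
  set (good := fun (t : R) (x : (C -> C) * R * R) => let '(G, delta, eta) := x in
    (0 < eta)%R /\ (0 < delta)%R /\
    (forall z z', (Cmod (z - p t) < eta)%R -> (Cmod (z' - p t) < eta)%R -> phi z = phi z' -> z = z') /\
    (forall w, (Cmod (w - phi (p t)) < delta)%R -> (Cmod (G w - p t) < eta)%R /\ phi (G w) = w /\ holo G w)).
  assert (Hex : forall t, (0 <= t <= 1)%R -> exists x, good t x).
  { intros t Ht. destruct (Hphi t Ht) as [H1 H2].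
    destruct (local_inverse phi (p t) (Cderiv phi (p t)) 1) as (eta & delta & G & He & Hd & Hi & KG); auto using Cderiv_correct; [lra|].
    exists (G, delta, eta). simpl. repeat split; try apply He; auto; now apply KG. }
  set (ch := fun t => epsilon (inhabits ((fun z : C => z), 1%R, 1%R)) (good t)).
  assert (Hch : forall t, (0 <= t <= 1)%R -> good t (ch t)) by (intros t Ht; unfold ch; now apply epsilon_spec, Hex).
  clearbody ch.
  set (F := fun t => fst (fst (ch t))). set (r := fun t => snd (fst (ch t))). set (e := fun t => snd (ch t)).
  assert (HF : forall t, (0 <= t <= 1)%R -> (0 < e t)%R /\ (0 < r t)%R /\
    (forall z z', (Cmod (z - p t) < e t)%R -> (Cmod (z' - p t) < e t)%R -> phi z = phi z' -> z = z') /\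
    (forall w, (Cmod (w - phi (p t)) < r t)%R -> (Cmod (F t w - p t) < e t)%R /\ phi (F t w) = w /\ holo (F t) w)).
  { intros t Ht. specialize (Hch t Ht). unfold F, r, e. destruct (ch t) as [[G d] h]. exact Hch. }
  clearbody F r e. clear Hch Hex good ch.
  assert (Z : forall x : C, Cmod (x - x) = 0%R) by (intros x; replace (x - x) with (RtoC 0) by ring; apply Cmod_0).
  assert (Hval : forall t, (0 <= t <= 1)%R -> forall z, (Cmod (z - p t) < e t)%R -> (Cmod (phi z - phi (p t)) < r t)%R -> F t (phi z) = z).
  { intros t Ht z H1 H2. destruct (HF t Ht) as (_ & _ & Hi & KG). destruct (KG _ H2) as (A & B & _). now apply Hi. }
  assert (Hsec : forall t, (0 <= t <= 1)%R ->
     F t (phi (p t)) = p t /\ holo (F t) (phi (p t)) /\ near (phi (p t)) (fun w => phi (F t w) = w)).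
  { intros t Ht. destruct (HF t Ht) as (He & Hr & _ & KG). split; [apply Hval; auto; rewrite Z; auto|]. split.
    - apply KG. now rewrite Z.
    - exists (r t). split; auto. intros w Hw. now apply KG. }
  exists F, r. split; auto. intros t Ht. destruct (HF t Ht) as (He & Hr & _ & KG). split; auto. split.
  { intros w Hw. apply holo_analytic, KG, Hw. }
  assert (Hc : near (p t) (fun z => Cmod (phi z - phi (p t)) < r t)%R) by (apply holo_ccont; auto; now apply Hphi).
  destruct Hc as (d & Hd & Kd). destruct (Hp t Ht (Rmin d (e t))) as (delta & Hdelta & K); [now apply Rmin_pos|].
  exists delta. split; auto. intros s Hs Hst. specialize (K s Hs Hst).
  assert (A := Kd _ (Rlt_le_trans _ _ _ K (Rmin_l _ _))). assert (B := Rlt_le_trans _ _ _ K (Rmin_r _ _)).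
  split; auto. apply near_locally. destruct (Hsec s Hs) as (S1 & S2 & S3). destruct (Hphi s Hs) as [P1 P2].
  destruct (KG _ A) as (_ & _ & S4).
  (* At [phi (p s)] both elements take the value [p s]: for [F t] because [p s] lies in its disc of
     injectivity, by [Hval]. *)
  apply (section_unique phi (F s) (F t) (phi (p s)) (Cderiv phi (p s))); rewrite ?S1; auto using holo_ccont, Cderiv_correct.
  - symmetry. now apply Hval.
  - generalize (near_and _ _ _ S3 (near_disc (phi (p t)) (phi (p s)) (r t) A)). apply near_imp. intros w [-> W].
    symmetry. now apply KG.
Qed.

Lemma schwarz2_jrec (tau : C) : regular tau -> schwarz2 (jrec tau) tau.
Proof.
  intros H. destruct (regular_path (imag 2) tau regular_imag_2 H) as (p & Hp & E0 & E1 & Hreg).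
  assert (Hphi : forall t, (0 <= t <= 1)%R -> holo jrec (p t) /\ Cderiv jrec (p t) <> 0)
    by (intros t Ht; split; [now apply holo_jrec, Hreg | now apply jrec_deriv_neq0, Hreg]).
  destruct (inverse_along jrec p Hp Hphi) as (F & r & HF & K).
  exists (fun t => jrec (p t)), F, r. rewrite E0, E1. fold zbase.
  destruct (K 0%R ltac:(lra)) as (A0 & B0 & D0). destruct (K 1%R ltac:(lra)) as (A1 & _). rewrite E0 in A0, B0, D0. rewrite E1 in A1. fold zbase in A0, B0, D0.
  split; [|split; [apply lens_zbase|split; [auto|split; [auto|split; auto]]]].
  - apply path_in_iff. split.
    + intros t Ht eps He. destruct (holo_ccont _ _ (proj1 (Hphi t Ht)) eps He) as (d & Hd & Kd).
      destruct (Hp t Ht d Hd) as (delta & Hdelta & Kp). exists delta. auto.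
    + intros t Ht. now apply regular_jrec, Hreg.
  - apply near_locally. assert (R2 := regular_imag_2).
    assert (Hs : schwarz2_init zbase = imag 2) by (unfold zbase; rewrite (proj1 (jrec_imag 2 ltac:(lra))); apply schwarz_imag; lra).
    (* Near the base point both functions are sections of [jrec] through $2i$, so the continuation
       starts from the prescribed branch. *)
    apply (section_unique jrec (F 0%R) schwarz2_init zbase (Cderiv jrec (imag 2))); rewrite ?A0;
      auto using holo_jrec, holo_ccont, Cderiv_correct, jrec_deriv_neq0, holo_schwarz2_init, lens_zbase.
    generalize (near_and _ _ _ D0 schwarz2_init_base). apply near_imp. unfold lifted. intros w [-> [_ ->]]. auto.
Qed.

Theorem theorem6p5 :
  (forall tau : C, (exists z : C, Zdom z /\ schwarz2 z tau) <-> H2 tau) /\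
  (forall tau : C, upper_half_plane tau -> j_inv tau = j_theta tau) /\
  (forall tau : C, H2 tau ->
     j_inv tau <> RtoC 0 /\ Zdom (Cdiv (RtoC 1) (j_inv tau))) /\
  (forall z tau : C, Zdom z -> H2 tau ->
     (schwarz2 z tau <-> z = Cdiv (RtoC 1) (j_inv tau))).
Proof.
  assert (Hreg : forall tau, H2 tau <-> regular tau) by exact H2_iff.
  assert (E : forall tau, Cdiv (RtoC 1) (j_inv tau) = jrec tau) by (intros; unfold Cdiv; apply Cmult_1_l).
  repeat apply conj.
  - intros tau. rewrite Hreg. split.
    + intros (z & _ & Hz). now apply schwarz2_value in Hz.
    + intros H. exists (jrec tau). split; [now apply regular_jrec | now apply schwarz2_jrec].
  - apply j_inv_j_theta.
  - intros tau H. apply Hreg in H. split; [apply H|]. rewrite E. now apply regular_jrec.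
  - intros z tau _ H. apply Hreg in H. rewrite E. split.
    + intros Hz. symmetry. now apply schwarz2_value in Hz.
    + intros ->. now apply schwarz2_jrec.
Qed.
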